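(* Let $B$ be a Banach space with norm $\|\cdot\|$, let $2\le q<\infty$, $1<p<\infty$ and $\alpha>0$, and let $\{W_t\}_{t>0}$ be the classical heat semigroup on $\mathbb R^n$. The following assertions are equivalent. (a) There exists a norm $|||\cdot|||$ on $B$ that is equivalent to $\|\cdot\|$ and such that $(B,|||\cdot|||)$ is $q$-uniformly convex. (b) There exists $C>0$ such that $$\|\mathcal A^\alpha_{q,W_t;B}(f)\|_{L^p(\mathbb R^n)}\le C\|f\|_{L^p(\mathbb R^n,B)},\qquad f\in L^p(\mathbb R^n,B).$$
   Context: **Uniform convexity.** For a Banach space $B$ the modulus of convexity is $\delta_B(\varepsilon)=\inf\{1-\|\frac{a+b}{2}\| : a,b\in B,\ \|a\|=\|b\|=1,\ \|a-b\|=\varepsilon\}$, $0<\varepsilon<2$. For $q>1$, $B$ is $q$-uniformly convex if there is $C>0$ with $\delta_B(\varepsilon)\ge C\varepsilon^q$ for all $0<\varepsilon<2$. **Classical heat semigroup.** $W_t(f)(x)=\frac{1}{(4\pi t)^{n/2}}\int_{\mathbb R^n}e^{-|x-y|^2/4t}f(y)\,dy$, $x\in\mathbb R^n$, $t>0$, for $f$ in the Bochner space $L^p(\mathbb R^n,B)$. **Fractional derivative.** For $\alpha>0$ let $m\in\mathbb N$ with $m-1\le\alpha<m$ and set $$\partial_t^\alpha W_t(f)(x)=\frac{1}{\Gamma(m-\alpha)}\int_t^\infty \partial_u^mW_u(f)(x)\,(u-t)^{m-\alpha-1}\,du,\quad t>0.$$ **Area integral.** For $1<q<\infty$, $$\mathcal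 A^\alpha_{q,W_t;B}(f)(x)=\Big(\int_{\Gamma(x)}\big\|\big(s^\alpha\partial_s^\alpha W_s(f)(y)\big)_{|s=t^2}\big\|^q\frac{dy\,dt}{t^{n+1}}\Big)^{1/q},\quad x\in\mathbb R^n,$$ where $\Gamma(x)=\{(y,t)\in\mathbb R^n\times(0,\infty): |x-y|<t\}$. *)

(* Defs.v *)
From HB Require Import structures.
From mathcomp Require Import all_boot all_order all_algebra.
From mathcomp Require Import all_classical all_reals all_analysis.

Set Implicit Arguments.
Unset Strict Implicit.
Unset Printing Implicit Defensive.

Import Order.TTheory GRing.Theory Num.Theory.
Import numFieldNormedType.Exports.

Local Open Scope classical_set_scope.
Local Open Scope ring_scope.

(* Tuples carry the product of the Borel sigma-algebras of the factors. *)
Notation Rn R n := (n.-tuple (measurableTypeR R)).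

Definition eucl_dist (R : realType) (n : nat) (x y : Rn R n) : R :=
  Num.sqrt (\sum_(i < n) ((tnth x i : R) - (tnth y i : R)) ^+ 2).

Section cons_measure.
Context {R : realType} (n : nat).

Definition rn_cons (z : measurableTypeR R * Rn R n) : Rn R n.+1 :=
  [the n.+1.-tuple (measurableTypeR R) of z.1 :: z.2].

Lemma measurable_rn_cons : measurable_fun [set: _] rn_cons.
Proof.
exact: (measurable_cons (f := fst) (g := snd) measurable_fst measurable_snd).
Qed.

Let uncons (x : Rn R n.+1) : measurableTypeR R * Rn R n :=
  (tnth x ord0, [tuple of behead x]).

Let measurable_uncons : measurable_fun [set: _] uncons.
Proof.
apply: measurable_fun_pair; first exact: measurable_tnth.
exact: measurable_behead.
Qed.

Let consK : cancel rn_cons uncons.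
Proof. by case=> a v; congr (_, _); exact/val_inj. Qed.

Variable m : {sigma_finite_measure set (Rn R n) -> \bar R}.

Definition cons_measure (A : set (Rn R n.+1)) : \bar R :=
  pushforward (lebesgue_measure \x m)%E rn_cons A.

Let cm : {measure set (Rn R n.+1) -> \bar R} :=
  measure_function_pushforward__canonical__measure_function_Measure
    (lebesgue_measure \x m)%E measurable_rn_cons.

Let cons_measure0 : cons_measure set0 = 0%E.
Proof. exact: (measure0 cm). Qed.

Let cons_measure_ge0 A : (0 <= cons_measure A)%E.
Proof. exact: (measure_ge0 cm A). Qed.

Let cons_measure_sigma_additive : semi_sigma_additive cons_measure.
Proof. exact: (@measure_semi_sigma_additive _ _ _ cm). Qed.

HB.instance Definition _ := isMeasure.Build _ _ _ cons_measure
  cons_measure0 cons_measure_ge0 cons_measure_sigma_additive.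

Let cons_measure_sigma_finite : sigma_finite [set: Rn R n.+1] cons_measure.
Proof.
have /sigma_finiteP[F [FT F_nd Foo]] := sigma_finiteT (@lebesgue_measure R).
have /sigma_finiteP[G [GT G_nd Goo]] := sigma_finiteT m.
exists (fun k => uncons @^-1` (F k `*` G k)).
  rewrite -preimage_bigcup (_ : \bigcup_k (F k `*` G k) = setT) ?preimage_setT//.
  rewrite -subTset => -[a v] _.
  have [i _ Fia] : (\bigcup_k F k) a by rewrite -FT.
  have [j _ Gjv] : (\bigcup_k G k) v by rewrite -GT.
  exists (maxn i j) => //; split => /=.
    exact: subsetPset (F_nd _ _ (leq_maxl i j)) _ Fia.
  exact: subsetPset (G_nd _ _ (leq_maxr i j)) _ Gjv.
move=> k; have [[mF Fk] [mG Gk]] := (Foo k, Goo k); split.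
  by rewrite -[X in measurable X]setTI; apply: measurable_uncons => //;
    exact: measurableX.
rewrite /cons_measure /pushforward -comp_preimage.
rewrite (_ : uncons \o rn_cons = id); last first.
  by apply/funext => z /=; rewrite consK.
rewrite preimage_id product_measure1E// lte_mul_pinfty// ge0_fin_numE//.
Qed.

HB.instance Definition _ :=
  @Measure_isSigmaFinite.Build _ _ _ cons_measure cons_measure_sigma_finite.

End cons_measure.

(* One coordinate at a time: the image of the product measure on R * R^k. *)
Fixpoint lebesgue_Rn (R : realType) (n : nat) :
    {sigma_finite_measure set (Rn R n) -> \bar R} :=
  match n with
  | 0 => [the {sigma_finite_measure set (Rn R 0) -> \bar R} of
            dirac ([tuple] : Rn R 0)]
  | k.+1 => [the {sigma_finite_measure set (Rn R k.+1) -> \bar R} of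
               cons_measure (lebesgue_Rn R k)]
  end.

Section bochner.
Context d (T : measurableType d) (R : realType) (B : normedModType R).
Variables (mu : {measure set T -> \bar R}) (D : set T).

Definition simple_function (s : T -> B) : Prop :=
  finite_set (range s) /\ forall b, measurable (s @^-1` [set b]).

(* The exceptional null set makes this the usual class of Bochner measurable
   functions even though the sigma-algebra of [Rn R n] is not completed. *)
Definition strongly_measurable (f : T -> B) : Prop :=
  exists s : nat -> T -> B, (forall k, simple_function (s k)) /\
    {ae mu, forall x, D x -> s k x @[k --> \oo] --> f x}.

Definition simple_integrable (s : T -> B) : Prop :=
  simple_function s /\
  forall b, b != 0 -> (mu (D `&` s @^-1` [set b]) < +oo)%E.

(* The value [b = 0], whose fibre may have infinite measure, contributes 0. *)
Definition simple_integral (s : T -> B) : B :=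
  \sum_(b \in range s) fine (mu (D `&` s @^-1` [set b])) *: b.

Definition is_bochner_integral (f : T -> B) (v : B) : Prop :=
  strongly_measurable f /\
  exists s : nat -> T -> B,
    [/\ forall k, simple_integrable (s k),
        (\int[mu]_(x in D) (`|f x - s k x|)%:E)%E @[k --> \oo] --> 0%E &
        simple_integral (s k) @[k --> \oo] --> v].

(* Equal to 0 if [f] is not Bochner integrable on [D]. *)
Definition bochner_integral (f : T -> B) : B :=
  xget 0 [set v | is_bochner_integral f v].

End bochner.

Definition bochner_norm (R : realType) (n : nat) (B : normedModType R)
    (p : R) (f : Rn R n -> B) : \bar R :=
  ('N[lebesgue_Rn R n]_p%:E [(fun x => (`|f x|%R)%:E)])%E.

Definition bochner_Lp (R : realType) (n : nat) (B : normedModType R)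
    (p : R) (f : Rn R n -> B) : Prop :=
  strongly_measurable (lebesgue_Rn R n) setT f /\ (bochner_norm p f < +oo)%E.

Definition heat_kernel (R : realType) (n : nat) (t : R) (x y : Rn R n) : R :=
  ((4 * pi * t) `^ (n%:R / 2))^-1 * expR (- (eucl_dist x y ^+ 2 / (4 * t))).

Definition heat (R : realType) (n : nat) (B : normedModType R)
    (t : R) (f : Rn R n -> B) (x : Rn R n) : B :=
  bochner_integral (lebesgue_Rn R n) setT (fun y => heat_kernel t x y *: f y).

Definition Gamma (R : realType) (s : R) : R :=
  \int[lebesgue_measure]_(x in `]0, +oo[) (x `^ (s - 1) * expR (- x)).

(* The order [m] is the natural number with [m - 1 <= alpha < m]. *)
Definition frac_deriv (R : realType) (B : normedModType R)
    (alpha : R) (F : R -> B) (t : R) : B :=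
  let m := (Num.truncn alpha).+1 in
  (Gamma (m%:R - alpha))^-1 *:
    bochner_integral lebesgue_measure `]t, +oo[
      (fun u : R => (u - t) `^ (m%:R - alpha - 1) *: derive1n m F u).

Definition cone (R : realType) (n : nat) (x : Rn R n) :
    set (Rn R n * measurableTypeR R) :=
  [set yt | 0 < (yt.2 : R) /\ eucl_dist x yt.1 < (yt.2 : R)].

Definition area_integral (R : realType) (n : nat) (B : normedModType R)
    (q alpha : R) (f : Rn R n -> B) (x : Rn R n) : \bar R :=
  ((\int[lebesgue_Rn R n \x lebesgue_measure]_(yt in cone x)
      (let t : R := yt.2 in
       let s := t ^+ 2 in
       `|s `^ alpha *: frac_deriv alpha (fun u => heat u f yt.1) s| `^ q
         / t ^+ n.+1)%:E) `^ q^-1)%E.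

Section uniform_convexity.
Context (R : realType) (B : lmodType R).
Implicit Types N : B -> R.

Definition is_norm N : Prop :=
  [/\ forall x y, N (x + y) <= N x + N y,
      forall (a : R) x, N (a *: x) = `|a| * N x &
      forall x, N x = 0 -> x = 0].

Definition equivalent_norms N1 N2 : Prop :=
  exists c C : R, [/\ 0 < c, 0 < C & forall x, c * N1 x <= N2 x <= C * N1 x].

(* Extended-real valued: the infimum is +oo if no pair [a], [b] qualifies, as
   happens when [B] has dimension at most 1. *)
Definition modulus_of_convexity N (e : R) : \bar R :=
  ereal_inf [set (1 - N (2^-1 *: (ab.1 + ab.2)))%:E | ab in
    [set ab : B * B | [/\ N ab.1 = 1, N ab.2 = 1 & N (ab.1 - ab.2) = e]]].

Definition uniformly_convex (q : R) N : Prop :=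
  exists2 C : R, 0 < C &
    forall e : R, 0 < e < 2 -> ((C * e `^ q)%:E <= modulus_of_convexity N e)%E.

End uniform_convexity.

(* Main.v *)
(* (a) => (b): for a q-uniformly convex norm N the midpoint inequality gains a multiple of
   N (a - b) ^ q. Applied to the heat semigroup it bounds sums over dyadic times of averaged
   differences of heat flows, for all p by the maximal theorem and duality; the fractional
   derivatives are integrals of these differences against kernel derivatives.
   (b) => (a): (b) is tested on trigonometric polynomials x + f in the unit ball. Gluing such
   polynomials for x + y and x - y, at much smaller scales, along a smooth square wave times y
   adds c |y| ^ q to the square function, so the concave-type function V(x) of optimal gains
   is bounded and V(x) >= c |y| ^ q + (V(x + y) + V(x - y)) / 2. The gauge of a sublevel set
   of 4 K |x| - V(x) is then the norm sought. *)

Require Import Defs.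
From mathcomp Require Import all_boot all_order all_algebra.
From mathcomp Require Import all_classical all_reals all_analysis.
From mathcomp Require Import measurable_realfun ring lra zify.

Set Implicit Arguments.
Unset Strict Implicit.
Unset Printing Implicit Defensive.

Import Order.TTheory GRing.Theory Num.Theory.
Import numFieldNormedType.Exports.

Local Open Scope classical_set_scope.
Local Open Scope ring_scope.
Import HBSimple HBNNSimple.

(** In the direct half every estimate is a pointwise comparison of Gaussians: moving the base point
    of a kernel, or multiplying it by a Gaussian weight, costs a dilation of time. Heat flows are
    compared at times of ratio [256 = 4 ^ 4], large enough to contain the dilations that occur (to
    [42 * t], then [84 * t]); the price is four interleaved telescoping sums. The maximal function
    supplies the missing power of the norm when [p <= q], and dominates the dual weight when
    [p > q]. The obstacle in the converse is that (b) controls only an [L^p] norm, with [p]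
    unrelated to [q], while the renorming needs a bound on averaged gains. Gains are therefore
    followed in distribution: above a suitable threshold the square sum lives on a set of measure at
    most 1/4, and stopping the gluings at that threshold bounds the average gain by a constant plus
    a quarter of itself. Trigonometric polynomials are not in [L^p], so they are truncated to large
    cubes, with a vanishing error in the fractional derivatives. Measurability of the area integral
    is never established: upper bounds use monotonicity of the lower integral, lower bounds use
    disjoint boxes in the cone. *)

Lemma meas_powR d (T : measurableType d) (R : realType) (r : R) (h : T -> R) :
 measurable_fun setT h -> measurable_fun setT (fun x => h x `^ r).
by move=> mh; exact: (measurableT_comp (measurable_powR r) mh). Qed.

Create HintDb side.

(* [side] proves positivity and measurability by following the structure of the expression. *)
Ltac pos_leaf :=
 first [ assumption | solve [trivial] | apply: (lt_trans ltr01); assumption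
 | apply: (lt_le_trans ltr01); assumption | apply: (le_trans ler01); assumption ].

Ltac pos :=
 first
 [ lazymatch goal with
  | |- is_true (@Order.le _ _ _ ?e) =>
   lazymatch e with
   | @GRing.mul _ _ _ => apply: mulr_ge0; pos
   | @GRing.add _ _ (@GRing.opp _ _) => rewrite subr_ge0; pos_leaf
   | @GRing.add _ _ _ => apply: addr_ge0; pos
   | @GRing.exp _ _ _ => apply: exprn_ge0; pos
   | @GRing.inv _ _ => rewrite invr_ge0; pos
   | @powR _ _ _ => exact: powR_ge0
   | @expR _ _ => exact: expR_ge0
   | @pi _ => exact: pi_ge0
   | @GRing.natmul _ _ _ => exact: ler0n
   | @Num.norm _ _ _ => exact: normr_ge0
   | @EFin _ _ => rewrite lee_fin; pos
   | @adde _ _ _ => apply: adde_ge0; pos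
   | @mule _ _ _ => apply: mule_ge0; pos
   | @poweR _ _ _ => exact: poweR_ge0
   | bigop _ _ _ => first [apply: sumr_ge0 => *; pos | apply: sume_ge0 => *; pos]
   | @integral _ _ _ _ _ _ => apply: integral_ge0 => *; pos
   end
  | |- is_true (@Order.lt _ _ _ ?e) =>
   lazymatch e with
   | @GRing.mul _ _ _ => apply: mulr_gt0; pos
   | @GRing.add _ _ (@GRing.opp _ _) => rewrite subr_gt0; pos_leaf
   | @GRing.add _ _ _ => first [apply: ltr_wpDl; pos | apply: ltr_wpDr; pos]
   | @GRing.exp _ _ _ => apply: exprn_gt0; pos
   | @GRing.inv _ _ => rewrite invr_gt0; pos
   | @GRing.natmul _ _ _ => exact: ltr0Sn
   | @powR _ _ _ => apply: powR_gt0; pos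
   | @expR _ _ => exact: expR_gt0
   | @pi _ => exact: pi_gt0
   end
  end
 | solve [auto 1 with side nocore] | pos_leaf | apply: ltW; pos_leaf ].

Ltac meas :=
 first
 [ lazymatch goal with
  | |- measurable_fun _ (EFin \o _) => apply/measurable_EFinP; meas
  | |- measurable_fun _ (fun x => @?e x) =>
   lazymatch e with
   | fun _ => EFin _ => apply/measurable_EFinP; meas
   | fun _ => @GRing.mul _ _ _ => apply: measurable_funM; meas
   | fun _ => @GRing.add _ _ (@GRing.opp _ _) => apply: measurable_funB; meas
   | fun _ => @GRing.add _ _ _ => apply: measurable_funD; meas
   | fun _ => @mule _ (EFin _) (EFin _) => apply/measurable_EFinP; apply: measurable_funM; meas
   | fun _ => @powR _ _ _ => apply: meas_powR; meas
   | fun _ => bigop _ _ _ => apply: measurable_sum => *; meas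
   end
  end
 | solve [auto 1 with side nocore] | assumption | exact: measurable_cst | solve [trivial] | by [] ].

Ltac side :=
 lazymatch goal with
 | |- forall _, _ => move=> ?; side
 | |- measurable_fun _ _ => meas
 | |- is_true (@Order.le _ _ _ _) => pos
 | |- is_true (@Order.lt _ _ _ _) => pos
 | |- is_true (_ && _) => apply/andP; split; side
 | |- is_true (~~ (_ == _)) => apply: lt0r_neq0; pos
 | |- _ => by []
 end.

(** * Lower integrals of nonnegative functions *)

Section lower_integral.
Context d (T : measurableType d) (R : realType).
Variable mu : {measure set T -> \bar R}.
Implicit Types (D : set T) (f g : T -> \bar R).
Local Open Scope ereal_scope.

(* The integral of a nonnegative function is a supremum over simple functions
  below it, so monotonicity needs no measurability. *)
Lemma ge0_le_integral_ae D f g : measurable D ->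
 (forall x, D x -> 0 <= f x) -> (forall x, D x -> 0 <= g x) ->
 {ae mu, forall x, D x -> f x <= g x} ->
 \int[mu]_(x in D) f x <= \int[mu]_(x in D) g x.
move=> mD f0 g0 [N [mN N0 subN]].
rewrite !ge0_integralE//; apply: ge_ereal_sup => _ [h /= hf <-].
have mNC : measurable (~` N) by exact: measurableC.
pose h' := mul_nnsfun h (indic_nnsfun R mNC).
have hh' : sintegral mu h <= sintegral mu h'.
 rewrite -!integralT_nnsfun; apply: ae_ge0_le_integral => //.
 - side.
 - side.
 - side.
 - side.
 - exists N; split => // x /=; rewrite /not; apply: contra_notP => Nx _.
  by rewrite lee_fin /h' /= /mindic /= indicE mem_set// mulr1.
apply: (le_trans hh'); apply: ereal_sup_ubound; exists h' => // x.
rewrite /h' /= /mindic /= indicE; have [xN|xN] := pselect (N x).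
 rewrite (_ : x \in ~` N = false) ?mulr0; last by apply/memNset => /(_ xN).
 by rewrite patchE; case: ifPn => // /set_mem/g0.
rewrite mem_set// mulr1; apply: (le_trans (hf x)).
rewrite !patchE; case: ifPn => // /set_mem Dx.
by apply: contrapT => fg; apply: xN; apply: subN => /(_ Dx).
Qed.

Lemma le_integralW D f g : measurable D ->
 (forall x, D x -> 0 <= f x) -> (forall x, D x -> f x <= g x) ->
 \int[mu]_(x in D) f x <= \int[mu]_(x in D) g x.
move=> mD f0 fg; apply: ge0_le_integral_ae => //.
 by move=> x Dx; exact: le_trans (f0 _ Dx) (fg _ Dx).
exact: aeW.
Qed.

Lemma ge0_ae_eq_integralW D f g : measurable D ->
 (forall x, D x -> 0 <= f x) -> (forall x, D x -> 0 <= g x) ->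
 {ae mu, forall x, D x -> f x = g x} ->
 \int[mu]_(x in D) f x = \int[mu]_(x in D) g x.
move=> mD f0 g0 fg; apply/eqP; rewrite eq_le; apply/andP; split;
 apply: ge0_le_integral_ae => //; apply: filterS fg => x xfg Dx;
 by rewrite xfg.
Qed.

End lower_integral.

(** * Simple functions and strong measurability *)

Section finite_valued.
Context d (T : measurableType d).

(** For [C = B] this is [simple_function]. An arbitrary codomain admits pairs and Boolean tests,
    through which sums and truncations of simple functions become compositions. *)
Definition fsimple (C : Type) (s : T -> C) :=
 finite_set (range s) /\ forall c, measurable (s @^-1` [set c]).

Lemma fsimple_pre (C : Type) (s : T -> C) (Y : set C) :
 fsimple s -> measurable (s @^-1` Y).
move=> [fs ms].
rewrite (_ : _ @^-1` _ = \bigcup_(c in range s `&` Y) (s @^-1` [set c])).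
 by apply: fin_bigcup_measurable => //; exact: finite_setIl.
apply/seteqP; split => x /=.
 by move=> Yx; exists (s x) => //=; split => //; exists x.
by move=> [c [_ Yc]] ->.
Qed.

Lemma fsimple_pair (C1 C2 : Type) (s1 : T -> C1) (s2 : T -> C2) :
 fsimple s1 -> fsimple s2 -> fsimple (fun x => (s1 x, s2 x)).
move=> fs1 fs2; split.
 apply: (@sub_finite_set _ _ (range s1 `*` range s2)).
  by move=> _ [x _ <-]; split => /=; exists x.
 by apply: finite_setX; [case: fs1|case: fs2].
move=> [c1 c2].
rewrite (_ : _ @^-1` _ = s1 @^-1` [set c1] `&` s2 @^-1` [set c2]).
 by apply: measurableI; exact: fsimple_pre.
by apply/seteqP; split => x /= => [[<- <-]|[<- <-]].
Qed.

Lemma fsimple_comp (C1 C2 : Type) (s : T -> C1) (g : C1 -> C2) :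
 fsimple s -> fsimple (g \o s).
move=> fs; split.
 apply: (sub_finite_set _ (finite_image g (proj1 fs))) => _ [x _ <-].
 by exists (s x) => //; exists x.
by move=> c; rewrite comp_preimage; exact: fsimple_pre.
Qed.

Lemma fsimple_comp2 (C1 C2 C3 : Type) (s1 : T -> C1) (s2 : T -> C2)
  (g : C1 -> C2 -> C3) :
 fsimple s1 -> fsimple s2 -> fsimple (fun x => g (s1 x) (s2 x)).
move=> f1 f2.
exact: (fsimple_comp (fun c => g c.1 c.2) (fsimple_pair f1 f2)).
Qed.

Lemma fsimple_cst (C : Type) (c : C) : fsimple (cst c : T -> C).
split; first side.
move=> c'; rewrite preimage_cst; case: ifPn => //.
Qed.

Lemma fsimple_bool (A : set T) : measurable A -> fsimple (fun x => `[< A x >]).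
move=> mA; split; first side.
case.
 rewrite (_ : _ @^-1` _ = A)//; apply/seteqP; split => x /= => [/asboolP//|].
 by move/asboolT.
rewrite (_ : _ @^-1` _ = ~` A); first exact: measurableC.
apply/seteqP; split => x /= => [/asboolPn//|]; exact: asboolF.
Qed.

End finite_valued.

Section strongly_measurable_everywhere.
Context (R : realType).

(** Convergence is required at every point, so the notion involves no measure and is stable under
    composition with measurable maps. A [strongly_measurable] function agrees almost everywhere with
    such a function ([strongly_measurable_smeas]). *)
Definition smeas d (T : measurableType d) (B : normedModType R) (f : T -> B) :=
 exists s : nat -> T -> B, (forall k, fsimple (s k)) /\
  forall x, s k x @[k --> \oo] --> f x.

Lemma fsimple_smeas d (T : measurableType d) (B : normedModType R)
 (f : T -> B) : fsimple f -> smeas f.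
by move=> sf; exists (fun=> f); split => // x; exact: cvg_cst. Qed.

Lemma smeas_op d (T : measurableType d) (B1 B2 B3 : normedModType R)
  (g : B1 -> B2 -> B3) (f1 : T -> B1) (f2 : T -> B2) :
 (forall (u : nat -> B1) (v : nat -> B2) a b, u k @[k --> \oo] --> a ->
   v k @[k --> \oo] --> b -> g (u k) (v k) @[k --> \oo] --> g a b) ->
 smeas f1 -> smeas f2 -> smeas (fun x => g (f1 x) (f2 x)).
move=> gc [s1 [fs1 c1]] [s2 [fs2 c2]].
exists (fun k x => g (s1 k x) (s2 k x)); split.
 by move=> k; exact: fsimple_comp2.
by move=> x; apply: gc; [exact: c1|exact: c2].
Qed.

Lemma smeasD d (T : measurableType d) (B : normedModType R) (f g : T -> B) :
 smeas f -> smeas g -> smeas (fun x => f x + g x).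
by apply: smeas_op => u v a b; exact: cvgD. Qed.

Lemma smeasB d (T : measurableType d) (B : normedModType R) (f g : T -> B) :
 smeas f -> smeas g -> smeas (fun x => f x - g x).
by apply: (smeas_op (g := fun a b => a - b)) => u v a b; exact: cvgB. Qed.

Lemma smeasZ d (T : measurableType d) (B : normedModType R) (c : T -> R^o)
 (f : T -> B) : smeas c -> smeas f -> smeas (fun x => (c x : R) *: f x).
by apply: smeas_op => u v a b; exact: cvgZ. Qed.

Lemma smeas_comp d d' (T : measurableType d) (T' : measurableType d')
  (B : normedModType R) (f : T -> B) (phi : T' -> T) :
 measurable_fun setT phi -> smeas f -> smeas (f \o phi).
move=> mphi [s [fs cs]]; exists (fun k => s k \o phi); split; last first.
 by move=> x /=; exact: cs.
move=> k; have [fk mk] := fs k; split.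
 by apply: sub_finite_set fk => _ [x _ <-]; exists (phi x).
by move=> c; rewrite comp_preimage -[X in measurable X]setTI; exact: mphi.
Qed.

Lemma smeas_cst d (T : measurableType d) (B : normedModType R) (b : B) :
 smeas (fun _ : T => b).
by apply: fsimple_smeas; exact: fsimple_cst. Qed.

Lemma meas_fsimple d (T : measurableType d) (s : T -> R) :
 fsimple s -> measurable_fun setT s.
by move=> fs _ Y mY; rewrite setTI; exact: fsimple_pre. Qed.

Lemma smeas_measurable d (T : measurableType d) (B : normedModType R)
  (N : B -> R) (f : T -> B) :
 (forall (u : nat -> B) a, u k @[k --> \oo] --> a ->
   N (u k) @[k --> \oo] --> N a) ->
 smeas f -> measurable_fun setT (fun x => N (f x)).
move=> Nc [s [fs cs]].
apply: (measurable_fun_cvg (h := fun k x => N (s k x))).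
 by move=> k; apply: meas_fsimple; exact: (fsimple_comp N (fs k)).
by move=> x _; exact: Nc.
Qed.

Lemma smeas_norm d (T : measurableType d) (B : normedModType R) (f : T -> B) :
 smeas f -> measurable_fun setT (fun x => `|f x|).
by apply: smeas_measurable => u a; exact: cvg_norm. Qed.

Lemma meas_smeas d (T : measurableType d) (c : T -> R) :
 measurable_fun setT c -> smeas (c : T -> R^o).
have nn (h : T -> R) : measurable_fun setT h -> (forall x, 0 <= h x) ->
  smeas (h : T -> R^o).
 move=> mh h0; have mEh : measurable_fun setT (EFin \o h).
  side.
 exists (nnsfun_approx measurableT mEh); split.
  side.
 move=> x.
 have /= := @cvg_nnsfun_approx _ _ _ _ measurableT _ mEh (fun x _ => h0 x) x I.
 exact: fine_cvg.
move=> mc.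
rewrite (_ : c = (fun x => (c^\+ x : R^o) - c^\- x)%R).
 apply: smeasB; apply: nn => //.
 - exact: measurable_funrpos.
 - exact: measurable_funrneg.
by apply/funext => x; rewrite -[in LHS](funrposBneg c).
Qed.

End strongly_measurable_everywhere.

Section dominated_approximation.
Context d (T : measurableType d) (R : realType) (B : normedModType R).
Variable mu : {measure set T -> \bar R}.

(** An approximant is kept only where it is at most [2 * |f|]. This holds eventually where [f] is
    nonzero, and where [f] vanishes the truncated values are all 0. The domination is what dominated
    convergence needs for approximation in [L^r]. *)
Lemma smeas_dominated_approx (f : T -> B) : smeas f ->
 exists s : nat -> T -> B, [/\ forall k, fsimple (s k),
  forall k x, `|s k x| <= 2 * `|f x| &
  forall x, s k x @[k --> \oo] --> f x].
move=> sf; have [s [fs cs]] := sf.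
pose A k := [set x | `|s k x| <= 2 * `|f x|].
have mA k : measurable (A k).
 rewrite -[A k]setTI; apply: measurable_fun_ler => //.
  by apply: smeas_norm; exact: fsimple_smeas.
 by apply: measurable_funM => //; exact: smeas_norm.
exists (fun k x => if `[< A k x >] then s k x else 0); split.
- move=> k; exact: (fsimple_comp2 (fun (b : bool) c => if b then c else 0)
  (fsimple_bool (mA k)) (fs k)).
- by move=> k x; case: asboolP => // _; rewrite normr0 mulr_ge0.
move=> x; have [fx0|fx0] := eqVneq (f x) 0.
 apply: (@cvg_trans _ (cst 0 @ \oo)); last by rewrite fx0; exact: cvg_cst.
 apply: near_eq_cvg; near=> k; case: asboolP => //.
 by rewrite /A /= fx0 normr0 mulr0 normr_le0 => /eqP.
apply: (@cvg_trans _ (s k x @[k --> \oo])); last exact: cs.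
apply: near_eq_cvg; near=> k; case: asboolP => //; rewrite /A /= => /negP.
rewrite -ltNge => h; exfalso; suff: `|s k x| <= 2 * `|f x| by rewrite leNgt h.
apply: ltW; near: k; apply: (cvgr_lt `|f x|); first exact: cvg_norm (cs x).
by rewrite ltr_pMl ?ltr1n ?normr_gt0.
Unshelve. all: by end_near. Qed.

(** Chebyshev's inequality: [g] is at least [|b|] on the fibre over [b]. *)
Lemma fsimple_fibre_fin (D : set T) (s : T -> B) (g : T -> R) (r : R) (b : B) :
 measurable D -> fsimple s -> (forall x, D x -> `|s x| <= g x) -> 0 < r ->
 (\int[mu]_(x in D) (g x `^ r)%:E < +oo)%E -> b != 0 ->
 (mu (D `&` s @^-1` [set b]) < +oo)%E.
move=> mD fs sg r0 ig b0.
have mDb : measurable (D `&` s @^-1` [set b]).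
 by apply: measurableI => //; exact: fsimple_pre.
have b'0 : 0 < `|b| `^ r by rewrite powR_gt0 ?normr_gt0.
have : ((`|b| `^ r)%:E * mu (D `&` s @^-1` [set b]) < +oo)%E.
 apply: le_lt_trans ig; rewrite -integral_cst//.
 rewrite [leLHS]integral_mkcond [leRHS]integral_mkcond.
 apply: le_integralW => //.
  by move=> x _; rewrite patchE; case: ifP => // _; rewrite lee_fin powR_ge0.
 move=> x _; rewrite !patchE; case: ifPn => [/set_mem[Dx <-]|_].
  rewrite mem_set// lee_fin; apply: ge0_ler_powR; rewrite ?nnegrE ?(ltW r0)//.
   exact: le_trans (sg _ Dx).
  exact: sg.
 by case: ifP => // _; rewrite lee_fin powR_ge0.
move=> h; rewrite ltNge leye_eq; apply/negP => /eqP E.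
by move: h; rewrite E gt0_muley ?lte_fin// ltxx.
Qed.

End dominated_approximation.

Section ereal_cvg0.
Context (R : realType).
Implicit Types u : nat -> \bar R.

Lemma cvge0_le u (e : R) : 0 < e -> u k @[k --> \oo] --> 0%E ->
 \forall k \near \oo, (u k <= e%:E)%E.
move=> e0 /fine_cvgP[ufin] /cvgr0_norm_le => /(_ _ e0).
apply: filterS2 ufin => k ufin h.
by rewrite -(fineK ufin) lee_fin (le_trans (ler_norm _)).
Qed.

Lemma cvge0I u : (forall k, (0 <= u k)%E) ->
 (forall e : R, 0 < e -> \forall k \near \oo, (u k <= e%:E)%E) ->
 u k @[k --> \oo] --> 0%E.
move=> u0 ue; apply/fine_cvgP; split.
 have := ue _ ltr01; apply: filterS => k uk.
 by rewrite ge0_fin_numE// (le_lt_trans uk)// ltry.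
apply/cvgr0Pnorm_le => e e0; have := ue _ e0; apply: filterS => k uk /=.
rewrite ger0_norm ?fine_ge0//.
by rewrite -lee_fin fineK// ge0_fin_numE// (le_lt_trans uk)// ltry.
Qed.

Lemma cvg0_powR (v : nat -> R) (r : R) : 0 < r -> (forall k, 0 <= v k) ->
 v k @[k --> \oo] --> 0 -> v k `^ r @[k --> \oo] --> 0.
move=> r0 v0 /cvgr0_norm_le vc; apply/cvgr0Pnorm_le => e e0.
have := vc (e `^ r^-1) (powR_gt0 _ e0); apply: filterS => k.
rewrite !ger0_norm ?powR_ge0// => h.
rewrite [leRHS](_ : _ = (e `^ r^-1) `^ r).
 by apply: ge0_ler_powR; rewrite ?nnegrE ?(ltW r0)// powR_ge0.
by rewrite -powRrM mulVf ?gt_eqF// powRr1// ltW.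
Qed.

End ereal_cvg0.

(** * Bochner integral: uniqueness, existence and seminorm bounds *)

Section simple_integral.
Context d (T : measurableType d) (R : realType) (B : normedModType R).
Variables (mu : {measure set T -> \bar R}) (D : set T).
Hypothesis mD : measurable D.

(** The fibres of [g \o h] are unions of fibres of [h], so the sum may run over the values of [h].
    With [h] a pair of simple functions, two integrals are computed on a common partition, whence
    additivity. *)
Lemma simple_integral_comp (C : choiceType) (h : T -> C) (g : C -> B) :
 fsimple h ->
 (forall c, g c != 0 -> (mu (D `&` h @^-1` [set c]) < +oo)%E) ->
 simple_integral mu D (g \o h) =
 \sum_(c \in range h) fine (mu (D `&` h @^-1` [set c])) *: g c.
move=> fh fin; have [frh _] := fh.
have frg : finite_set (range (g \o h)) by have [] := fsimple_comp g fh.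
have mh c : measurable (D `&` h @^-1` [set c]).
 by apply: measurableI => //; exact: fsimple_pre.
pose m c := fine (mu (D `&` h @^-1` [set c])).
transitivity (\sum_(b \in range (g \o h)) \sum_(c \in range h)
  (if g c == b then m c *: b else 0)).
 apply: eq_fsbigr => b _.
 have [->|b0] := eqVneq b 0.
  by rewrite scaler0 fsbig1// => c _; case: ifP => // _; rewrite scaler0.
 pose A := range h `&` [set c | g c = b].
 have fA : finite_set A by exact: finite_setIl.
 have -> : D `&` (g \o h) @^-1` [set b] =
   \bigcup_(c in A) (D `&` h @^-1` [set c]).
  apply/seteqP; split => x /=.
   move=> [Dx gx]; exists (h x); last by split.
   side.
  by move=> [c [_ gc] [Dx hx]]; split => //; rewrite hx.
 rewrite measure_fin_bigcup//; last first.
  by move=> c c' _ _ [x [[_ /= <-] [_ /= <-]]].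
 rewrite (_ : \sum_(c \in range h) _ = \sum_(c \in A) m c *: b); last first.
  rewrite fsbig_mkcondr; apply: eq_fsbigr => c _.
  by case: ifPn => [/eqP gc|/eqP gc]; [rewrite mem_set|rewrite memNset].
 rewrite !fsbig_finite//= -scaler_suml; congr (_ *: _).
 rewrite [in LHS]big_seq [in RHS]big_seq sum_fine//.
 move=> c; rewrite in_fset_set// => /set_mem[_ gc].
 by rewrite ge0_fin_numE// fin// gc.
rewrite exchange_fsbig//; apply: eq_fsbigr => c /set_mem[x _ hx].
rewrite (fsbigD1 (g c))//=; last by exists x => //=; rewrite hx.
by rewrite eqxx fsbig1 ?addr0// => b /= [_ /eqP]; rewrite eq_sym => /negbTE ->.
Qed.

Lemma simple_integrable_pair (s1 s2 : T -> B) :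
 simple_integrable mu D s1 -> simple_integrable mu D s2 ->
 forall c, c != (0, 0) ->
 (mu (D `&` (fun x => (s1 x, s2 x)) @^-1` [set c]) < +oo)%E.
move=> [fs1 i1] [fs2 i2] [c1 c2]; rewrite xpair_eqE negb_and.
have m12 : measurable (D `&` (fun x => (s1 x, s2 x)) @^-1` [set (c1, c2)]).
 by apply: measurableI => //; apply: fsimple_pre; exact: fsimple_pair.
case/orP => [/i1|/i2]; apply: le_lt_trans; apply: le_measure;
 rewrite ?inE//.
- by apply: measurableI => //; exact: fsimple_pre.
- by move=> x [Dx [? ?]].
- by apply: measurableI => //; exact: fsimple_pre.
- by move=> x [Dx [? ?]].
Qed.

Lemma simple_integral_lin (a : R) (s1 s2 : T -> B) :
 simple_integrable mu D s1 -> simple_integrable mu D s2 ->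
 simple_integrable mu D (fun x => a *: s1 x + s2 x) /\
 simple_integral mu D (fun x => a *: s1 x + s2 x) =
 a *: simple_integral mu D s1 + simple_integral mu D s2.
move=> i1 i2; have [fs1 _] := i1; have [fs2 _] := i2.
have fp := fsimple_pair fs1 fs2.
have fin := simple_integrable_pair i1 i2.
have fsum : fsimple (fun x => a *: s1 x + s2 x).
 exact: (fsimple_comp (fun c : B * B => a *: c.1 + c.2) fp).
have key (g : B * B -> B) : g (0, 0) = 0 ->
  simple_integral mu D (g \o (fun x => (s1 x, s2 x))) =
  \sum_(c \in range (fun x => (s1 x, s2 x)))
   fine (mu (D `&` (fun x => (s1 x, s2 x)) @^-1` [set c])) *: g c.
 move=> g0; apply: simple_integral_comp => // c gc; apply: fin.
 by apply: contra_neq gc => ->.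
split.
 split=> // b b0; pose A := range (fun x => (s1 x, s2 x)) `&`
  [set c | a *: c.1 + c.2 = b].
 have fA : finite_set A by apply: finite_setIl; case: fp.
 have -> : D `&` (fun x => a *: s1 x + s2 x) @^-1` [set b] =
   \bigcup_(c in A) (D `&` (fun x => (s1 x, s2 x)) @^-1` [set c]).
  apply/seteqP; split => x /=.
   move=> [Dx gx]; exists (s1 x, s2 x); last by split.
   side.
  by move=> [c [_ gc] [Dx sc]]; split => //; rewrite -gc -sc.
 rewrite measure_fin_bigcup//; last first.
 - by move=> c _; apply: measurableI => //; exact: fsimple_pre.
 - by move=> c c' _ _ [x [[_ /= <-] [_ /= <-]]].
 rewrite fsbig_finite//= big_seq; apply: lte_sum_pinfty => c.
 rewrite in_fset_set// => /set_mem[_ gc]; apply: fin.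
 by apply: contra_neq b0 => c0; rewrite -gc c0 /= scaler0 addr0.
have := key (fun c => a *: c.1 + c.2); rewrite /= scaler0 addr0 => /(_ erefl).
rewrite /comp /= => ->.
have := key fst erefl; rewrite /comp /= => ->.
have := key snd erefl; rewrite /comp /= => ->.
have fr : finite_set (range (fun x => (s1 x, s2 x))) by case: fp.
rewrite !fsbig_finite//= scaler_sumr -big_split/=; apply: eq_bigr => c _.
by rewrite scalerDr !scalerA mulrC.
Qed.

(** Stated for seminorms because the bound on norms of averages is needed for the uniformly convex
    norm [N] as well as for the norm of [B]. *)
Lemma simple_integral_semi_norm_le (N : B -> R) (s : T -> B) :
 (forall x y, N (x + y) <= N x + N y) ->
 (forall (a : R) x, N (a *: x) = `|a| * N x) ->
 simple_integrable mu D s ->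
 ((N (simple_integral mu D s))%:E <= \int[mu]_(x in D) (N (s x))%:E)%E.
move=> ND NZ [fs fin].
have N0 : N 0 = 0 by rewrite -(scale0r 0) NZ normr0 mul0r.
have Nge0 x : 0 <= N x.
 have := ND x (- x); rewrite subrr N0 -scaleN1r NZ normrN1 mul1r -mulr2n.
 by rewrite pmulrn_lge0.
have [fr _] := fs.
have Nsum (I : Type) (r : seq I) (F : I -> B) :
  N (\sum_(i <- r) F i) <= \sum_(i <- r) N (F i).
 elim/big_ind2 : _ => //; first by rewrite N0.
 by move=> x1 x2 y1 y2 h1 h2; apply: le_trans (ND _ _) _; exact: lerD.
have mfib b : measurable (D `&` s @^-1` [set b]).
 by apply: measurableI => //; exact: fsimple_pre.
apply: (@le_trans _ _ (\sum_(b \in range s)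
  (fine (mu (D `&` s @^-1` [set b])) * N b)%:E)%E).
 rewrite /simple_integral fsumEFin// lee_fin !fsbig_finite//=.
 apply: le_trans (Nsum _ _ _) _; apply: ler_sum => b _.
 by rewrite NZ ger0_norm// fine_ge0.
rewrite (_ : (fun x => (N (s x))%:E) = (fun x => \sum_(b \in range s)
  ((N b)%:E * (\1_(s @^-1` [set b]) x)%:E))%E); last first.
 apply/funext => x; rewrite (fsbigD1 (s x))//=; last by exists x.
 rewrite indicE mem_set// mule1 fsbig1 ?adde0// => b [_ /= bs].
 by rewrite indicE memNset ?mule0// => /= sb; exact: bs.
rewrite ge0_integral_fsum//; last 2 first.
- move=> b; apply/measurable_EFinP; apply: measurable_funM => //.
 by apply: measurable_indic; exact: fsimple_pre.
- side.
rewrite !fsbig_finite//=; apply: lee_sum => b _.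
rewrite ge0_integralZl//; last 2 first.
- by apply/measurable_EFinP/measurable_indic; exact: fsimple_pre.
- side.
rewrite integral_indic//; last exact: fsimple_pre.
have [->|b0] := eqVneq b 0.
 by rewrite N0 mulr0 mule_ge0.
rewrite mulrC EFinM setIC; apply: lee_pmul => //.
- side.
by rewrite fineK// ge0_fin_numE// setIC fin.
Qed.

End simple_integral.

Section bochner_theory.
Context d (T : measurableType d) (R : realType) (B : completeNormedModType R).
Variables (mu : {measure set T -> \bar R}) (D : set T).
Hypothesis mD : measurable D.
Local Notation is_bochner := (is_bochner_integral mu D).

Lemma strongly_measurable_smeas (f : T -> B) : strongly_measurable mu D f ->
 exists2 f' : T -> B, smeas f' & {ae mu, forall x, D x -> f x = f' x}.
move=> [s [fs [N [mN N0 subN]]]].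
have mA : measurable (D `\` N) by exact: measurableD.
exists (fun x => if `[< (D `\` N) x >] then f x else 0).
 exists (fun k x => if `[< (D `\` N) x >] then s k x else 0); split.
  move=> k; exact: (fsimple_comp2 (fun (b : bool) c => if b then c else 0)
   (fsimple_bool mA) (fs k)).
 move=> x; case: asboolP => [[Dx Nx]|_]; last exact: cvg_cst.
 by apply: contrapT => h; apply: Nx; apply: subN => /(_ Dx).
exists N; split => // x /=; apply: contra_notP => Nx Dx.
by case: asboolP => // -[]; split.
Qed.

Lemma smeas_strongly_measurable (f : T -> B) :
 smeas f -> strongly_measurable mu D f.
by move=> [s [fs cs]]; exists s; split => //; apply: aeW => x _; exact: cs.
Qed.

Lemma is_bochner_ae (f g : T -> B) (v : B) :
 {ae mu, forall x, D x -> f x = g x} -> is_bochner f v -> is_bochner g v.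
move=> fg [[s [fs cs]] [u [su iu cu]]]; split.
 exists s; split => //; apply: filterS2 fg cs => x fgx csx Dx.
 by rewrite -fgx//; exact: csx.
exists u; split => //; move: iu; apply: cvg_trans; apply: near_eq_cvg.
near=> k; apply: ge0_ae_eq_integralW => //.
by apply: filterS fg => x fgx Dx; rewrite fgx.
Unshelve. all: by end_near. Qed.

Lemma bochner_integral_ae (f g : T -> B) :
 {ae mu, forall x, D x -> f x = g x} ->
 bochner_integral mu D f = bochner_integral mu D g.
move=> fg; rewrite /bochner_integral; congr (xget 0 _).
apply/seteqP; split => v /=; apply: is_bochner_ae => //.
by apply: filterS fg => x fgx Dx; rewrite fgx.
Qed.

(** Domination by the norm makes [N] Lipschitz, so the inequality passes from approximating simple
    functions to the limit. The integral of [N \o f] is first moved to an everywhere strongly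
    measurable representative of [f]. *)
Lemma is_bochner_semi_norm_le (N : B -> R) (C : R) (f : T -> B) (v : B) :
 (forall x y, N (x + y) <= N x + N y) ->
 (forall (a : R) x, N (a *: x) = `|a| * N x) ->
 (forall x, N x <= C * `|x|) ->
 is_bochner f v -> ((N v)%:E <= \int[mu]_(x in D) (N (f x))%:E)%E.
move=> ND NZ NC [sf [s [si cs cv]]].
have N0 : N 0 = 0 by rewrite -(scale0r 0) NZ normr0 mul0r.
have Nge0 x : 0 <= N x.
 have := ND x (- x); rewrite subrr N0 -scaleN1r NZ normrN1 mul1r -mulr2n.
 by rewrite pmulrn_lge0.
have NB x y : N x - N y <= N (x - y).
 by rewrite lerBlDr; have := ND (x - y) y; rewrite subrK.
have NN x : N (- x) = N x by rewrite -scaleN1r NZ normrN1 mul1r.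
have Nlip x y : `|N x - N y| <= C * `|x - y|.
 rewrite ler_norml; apply/andP; split; last exact: le_trans (NB _ _) (NC _).
 rewrite lerNl opprB; apply: le_trans (NB _ _) _.
 by rewrite -NN opprB; exact: NC.
have C0 : 0 <= `|C| by [].
have NC' x : N x <= `|C| * `|x|.
 by apply: le_trans (NC _) _; rewrite ler_wpM2r// ler_norm.
have Nc (u : nat -> B) a : u k @[k --> \oo] --> a ->
  N (u k) @[k --> \oo] --> N a.
 move=> ua; apply/cvgrPdist_le => /= e e0.
 have e1 : 0 < e / (`|C| + 1) by side.
 move/cvgrPdist_le : ua => /(_ _ e1); apply: filterS => k h.
 apply: le_trans (Nlip _ _) _.
 apply: (@le_trans _ _ ((`|C| + 1) * `|a - u k|)).
  by rewrite ler_wpM2r// (le_trans (ler_norm _))// lerDl.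
 by rewrite mulrC -ler_pdivlMr// ltr_wpDl.
have [f' sf' ff'] := strongly_measurable_smeas sf.
have mNf' : measurable_fun D (fun x => (N (f' x))%:E).
 apply/measurable_EFinP; apply: measurable_funTS; exact: smeas_measurable sf'.
have -> : (\int[mu]_(x in D) (N (f x))%:E = \int[mu]_(x in D) (N (f' x))%:E)%E.
 apply: ge0_ae_eq_integralW => //.
 - side.
 - side.
 - by apply: filterS ff' => x ffx Dx; rewrite ffx.
have key k : ((N (simple_integral mu D (s k)))%:E <=
  \int[mu]_(x in D) (N (f' x))%:E +
  `|C|%:E * \int[mu]_(x in D) (`|f x - s k x|)%:E)%E.
 apply: le_trans (simple_integral_semi_norm_le mD ND NZ (si k)) _.
 have -> : (\int[mu]_(x in D) (`|f x - s k x|)%:E =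
   \int[mu]_(x in D) (`|f' x - s k x|)%:E)%E.
  apply: ge0_ae_eq_integralW => //.
  by apply: filterS ff' => x ffx Dx; rewrite ffx.
 have mfs : measurable_fun D (fun x => (`|f' x - s k x|)%:E).
  apply/measurable_EFinP; apply: measurable_funTS.
  apply: smeas_norm; apply: smeasB => //; apply: fsimple_smeas.
  by case: (si k).
 rewrite -ge0_integralZl// -ge0_integralD//.
 - apply: le_integralW => //; first side.
  move=> x _; rewrite -EFinM -EFinD lee_fin -lerBlDl.
  apply: le_trans (NB _ _) _; rewrite -NN opprB; exact: NC'.
 - side.
 - by apply/measurable_EFinP; apply: measurable_funM => //; exact/measurable_EFinP.
apply/lee_addgt0Pr => e e0.
have e2 : 0 < e / 2 by side.
have e3 : 0 < e / 2 / (`|C| + 1) by side.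
near \oo => k.
apply: (@le_trans _ _ ((N (simple_integral mu D (s k)))%:E + (e / 2)%:E)%E).
 rewrite -EFinD lee_fin -lerBlDl; apply: le_trans (ler_norm _) _.
 by near: k; move/cvgrPdist_le : (Nc _ _ cv); exact.
rewrite [in leRHS](splitr e) EFinD addeA leeD2r//.
apply: le_trans (key k) _; rewrite leeD2l//.
apply: (@le_trans _ _ ((`|C| + 1)%:E * (e / 2 / (`|C| + 1))%:E)%E).
 apply: lee_pmul => //; rewrite ?lee_fin ?lerDl//.
  side.
 by near: k; exact: cvge0_le cs.
by rewrite -EFinM lee_fin mulrC divfK// gt_eqF// ltr_wpDl.
Unshelve. all: by end_near. Qed.

Lemma is_bochner_lin (a : R) (f g : T -> B) (v w : B) :
 is_bochner f v -> is_bochner g w ->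
 is_bochner (fun x => a *: f x + g x) (a *: v + w).
move=> [sf [s [si cs cv]]] [sg [s' [si' cs' cv']]].
have [f' mf' ff'] := strongly_measurable_smeas sf.
have [g' mg' gg'] := strongly_measurable_smeas sg.
have ae1 : {ae mu, forall x, D x -> a *: f' x + g' x = a *: f x + g x}.
 by apply: filterS2 ff' gg' => x fx gx Dx; rewrite fx// gx.
apply: (is_bochner_ae ae1).
split.
 apply: smeas_strongly_measurable; apply: smeasD => //.
 by apply: (smeasZ (c := cst a)) => //; exact: smeas_cst.
exists (fun k x => a *: s k x + s' k x); split.
- by move=> k; case: (simple_integral_lin mD a (si k) (si' k)).
- have sD k : (\int[mu]_(x in D) (`|a *: f' x + g' x - (a *: s k x + s' k x)|)%:E
  <= `|a|%:E * \int[mu]_(x in D) (`|f x - s k x|)%:E +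
    \int[mu]_(x in D) (`|g x - s' k x|)%:E)%E.
  have -> : (\int[mu]_(x in D) (`|f x - s k x|)%:E =
    \int[mu]_(x in D) (`|f' x - s k x|)%:E)%E.
   apply: ge0_ae_eq_integralW => //.
   by apply: filterS ff' => x ffx Dx; rewrite ffx.
  have -> : (\int[mu]_(x in D) (`|g x - s' k x|)%:E =
    \int[mu]_(x in D) (`|g' x - s' k x|)%:E)%E.
   apply: ge0_ae_eq_integralW => //.
   by apply: filterS gg' => x ffx Dx; rewrite ffx.
  have mfs : measurable_fun D (fun x => `|f' x - s k x|).
   apply: measurable_funTS; apply: smeas_norm; apply: smeasB => //.
   by apply: fsimple_smeas; case: (si k).
  have mgs : measurable_fun D (fun x => `|g' x - s' k x|).
   apply: measurable_funTS; apply: smeas_norm; apply: smeasB => //.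
   by apply: fsimple_smeas; case: (si' k).
  rewrite -ge0_integralZl//; last side.
  rewrite -ge0_integralD//; last 2 first.
  - by apply/measurable_EFinP; apply: measurable_funM.
  - side.
  apply: le_integralW => // x _; rewrite -EFinM -EFinD lee_fin.
  rewrite opprD addrACA -scalerBr; apply: le_trans (ler_normD _ _) _.
  by rewrite normrZ.
 apply: cvge0I; first side.
 move=> e e0.
 have e2 : 0 < e / 2 by side.
 have e3 : 0 < e / 2 / (`|a| + 1) by side.
 near=> k; apply: le_trans (sD k) _; rewrite (splitr e) EFinD leeD//.
  apply: (@le_trans _ _ ((`|a| + 1)%:E * (e / 2 / (`|a| + 1))%:E)%E).
   apply: lee_pmul => //; rewrite ?lee_fin ?lerDl//.
    side.
   by near: k; exact: cvge0_le cs.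
  by rewrite -EFinM lee_fin mulrC divfK// gt_eqF// ltr_wpDl.
 by near: k; exact: cvge0_le cs'.
have -> : (fun k => simple_integral mu D (fun x => a *: s k x + s' k x)) =
  (fun k => a *: simple_integral mu D (s k) + simple_integral mu D (s' k)).
 by apply/funext => k; case: (simple_integral_lin mD a (si k) (si' k)).
by apply: cvgD => //; exact: cvgZr.
Unshelve. all: by end_near. Qed.

Lemma is_bochner_norm_le (f : T -> B) (v : B) : is_bochner f v ->
 ((`|v|)%:E <= \int[mu]_(x in D) (`|f x|)%:E)%E.
apply: (@is_bochner_semi_norm_le _ 1); [exact: ler_normD|exact: normrZ|].
by move=> x; rewrite mul1r.
Qed.

Lemma is_bochner_unique (f : T -> B) (v w : B) :
 is_bochner f v -> is_bochner f w -> v = w.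
move=> fv fw; have /is_bochner_norm_le := is_bochner_lin (-1) fv fw.
under eq_integral do rewrite scaleN1r addNr normr0.
by rewrite integral0 lee_fin normr_le0 scaleN1r addrC subr_eq0 => /eqP.
Qed.

Lemma bochner_integral_eq (f : T -> B) (v : B) :
 is_bochner f v -> bochner_integral mu D f = v.
by move=> fv; apply: xget_unique => // w fw; exact: is_bochner_unique fw fv.
Qed.

Lemma bochner_semi_norm_le (N : B -> R) (C : R) (f : T -> B) :
 (forall x y, N (x + y) <= N x + N y) ->
 (forall (a : R) x, N (a *: x) = `|a| * N x) ->
 (forall x, N x <= C * `|x|) ->
 ((N (bochner_integral mu D f))%:E <= \int[mu]_(x in D) (N (f x))%:E)%E.
move=> ND NZ NC; rewrite /bochner_integral; case: xgetP => [v _ /= fv|_].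
 exact: is_bochner_semi_norm_le NC fv.
have N0 : N 0 = 0 by rewrite -(scale0r 0) NZ normr0 mul0r.
rewrite N0; apply: integral_ge0 => x _; rewrite lee_fin.
have := ND (f x) (- f x); rewrite subrr N0 -scaleN1r NZ normrN1 mul1r -mulr2n.
by rewrite pmulrn_lge0.
Qed.

Lemma bochner_norm_le (f : T -> B) :
 ((`|bochner_integral mu D f|)%:E <= \int[mu]_(x in D) (`|f x|)%:E)%E.
apply: (@bochner_semi_norm_le _ 1); [exact: ler_normD|exact: normrZ|].
by move=> x; rewrite mul1r.
Qed.

Lemma smeas_Lp_approx (r : R) (f : T -> B) : 0 < r -> smeas f ->
 (\int[mu]_(x in D) (`|f x| `^ r)%:E < +oo)%E ->
 exists s : nat -> T -> B, [/\ forall k, simple_integrable mu D (s k),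
  forall k x, `|s k x| <= 2 * `|f x|,
  forall x, s k x @[k --> \oo] --> f x &
  (\int[mu]_(x in D) (`|f x - s k x| `^ r)%:E)%E @[k --> \oo] --> 0%E].
move=> r0 sf fi; have [s [fs sle cs]] := smeas_dominated_approx sf.
have mf : measurable_fun D (fun x => `|f x|).
 by apply: measurable_funTS; exact: smeas_norm.
have i2 (c : R) : 0 <= c -> (\int[mu]_(x in D) ((c * `|f x|) `^ r)%:E < +oo)%E.
 move=> c0; under eq_integral do rewrite powRM// EFinM.
 rewrite ge0_integralZl//; last 2 first.
 - apply/measurable_EFinP.
  exact: (measurableT_comp (f := fun y : R => y `^ r)).
 - side.
 by apply: lte_mul_pinfty => //; rewrite lee_fin powR_ge0.
exists s; split => //.
 move=> k; split; [exact: fs|move=> b b0].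
 exact: (fsimple_fibre_fin mD (fs k) (fun x _ => sle k x) r0 (i2 2 (ler0n _ _)) b0).
have mk k : measurable_fun D (fun x => (`|f x - s k x| `^ r)%:E).
 apply/measurable_EFinP.
 apply: (measurableT_comp (f := fun y : R => y `^ r)) => //.
 apply: measurable_funTS; apply: smeas_norm; apply: smeasB => //.
 exact: fsimple_smeas.
have /= := @dominated_convergence _ _ _ mu D mD
 (fun k x => (`|f x - s k x| `^ r)%:E) (cst 0%E)
 (fun x => ((3 * `|f x|) `^ r)%:E) mk (measurable_cst _).
case.
- apply: aeW => x Dx; apply: cvg_EFin; first by near=> k.
 apply: cvg0_powR => //.
 rewrite [X in _ --> X](_ : _ = `|f x - f x|); last by rewrite subrr normr0.
 by apply: cvg_norm; apply: cvgB => //; exact: cvg_cst.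
- apply/integrableP; split.
  apply/measurable_EFinP.
  apply: (measurableT_comp (f := fun y : R => y `^ r)) => //.
  side.
 under eq_integral do rewrite gee0_abs ?lee_fin ?powR_ge0//.
 exact: i2.
- apply: aeW => x k Dx; rewrite lee_fin ger0_norm ?powR_ge0//.
 apply: ge0_ler_powR; rewrite ?nnegrE ?(ltW r0)// ?mulr_ge0//.
 apply: le_trans (ler_normB _ _) _.
 by have := sle k x; lra.
move=> _ + _; apply: cvg_trans; apply: near_eq_cvg; near=> k.
apply: eq_integral => x _.
by rewrite subr0 ger0_norm// powR_ge0.
Unshelve. all: by end_near. Qed.

(** Completeness of [B]: the integrals of simple functions converging in [L^1] form a Cauchy
    sequence. *)
Lemma is_bochner_ex (f : T -> B) : strongly_measurable mu D f ->
 (\int[mu]_(x in D) (`|f x|)%:E < +oo)%E -> exists v, is_bochner f v.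
move=> sf fi; have [f' sf' ff'] := strongly_measurable_smeas sf.
have fi' : (\int[mu]_(x in D) (`|f' x| `^ 1)%:E < +oo)%E.
 apply: le_lt_trans fi; rewrite le_eqVlt; apply/orP; left; apply/eqP.
 apply: ge0_ae_eq_integralW => //.
 by apply: filterS ff' => x ffx Dx; rewrite powRr1// ffx.
have [s [si _ _ cs]] := smeas_Lp_approx ltr01 sf' fi'.
suff [v cv] : exists v : B, simple_integral mu D (s k) @[k --> \oo] --> v.
 exists v.
 have ff : {ae mu, forall x, D x -> f' x = f x}.
  by apply: filterS ff' => x ffx Dx; rewrite ffx.
 apply: (is_bochner_ae ff); split; first exact: smeas_strongly_measurable.
 exists s; split => //; move: cs; apply: cvg_trans; apply: near_eq_cvg.
 by near=> k; apply: eq_integral => x _; rewrite powRr1.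
have dist k l : ((`|simple_integral mu D (s k) - simple_integral mu D (s l)|)%:E
  <= \int[mu]_(x in D) (`|f' x - s k x| `^ 1)%:E +
    \int[mu]_(x in D) (`|f' x - s l x| `^ 1)%:E)%E.
 have [i E] := simple_integral_lin mD (-1) (si l) (si k).
 rewrite addrC -scaleN1r -E.
 apply: le_trans (@simple_integral_semi_norm_le _ _ _ _ mu D mD
  (fun x => `|x|) _ (@ler_normD _ _) (@normrZ _ _) i) _.
 have m j : measurable_fun D (fun x => (`|f' x - s j x| `^ 1)%:E).
  apply/measurable_EFinP.
  apply: (measurableT_comp (f := fun y : R => y `^ 1)) => //.
  apply: measurable_funTS; apply: smeas_norm; apply: smeasB => //.
  by apply: fsimple_smeas; case: (si j).
 rewrite -ge0_integralD//; apply: le_integralW => // x _.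
 rewrite -EFinD lee_fin !powRr1// scaleN1r.
 rewrite [X in `|X|](_ : _ = (f' x - s l x) - (f' x - s k x)); last first.
  by rewrite [RHS]addrC opprB addrA subrK addrC.
 by rewrite [leRHS]addrC; exact: ler_normB.
suff : cvg (simple_integral mu D (s k) @[k --> \oo]).
 by move=> cv; exists (lim (simple_integral mu D (s k) @[k --> \oo])).
apply/cauchy_cvgP/cauchyP => e e0.
have e2 : 0 < e / 3 by side.
have /= [k _ hk] := cvge0_le e2 cs.
exists (simple_integral mu D (s k)); exists k => // l /= kl.
rewrite -ball_normE /ball_ /= -lte_fin; apply: le_lt_trans (dist k l) _.
apply: (@le_lt_trans _ _ ((e / 3)%:E + (e / 3)%:E)%E).
 by apply: leeD; apply: hk => /=.
by rewrite -EFinD lte_fin; lra.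
Unshelve. all: by end_near. Qed.

Lemma bochner_integralP (f : T -> B) : strongly_measurable mu D f ->
 (\int[mu]_(x in D) (`|f x|)%:E < +oo)%E ->
 is_bochner f (bochner_integral mu D f).
by move=> sf /(is_bochner_ex sf)[v fv]; rewrite (bochner_integral_eq fv).
Qed.

End bochner_theory.

Section bochner_scalar.
Context d (T : measurableType d) (R : realType).
Variables (mu : {measure set T -> \bar R}) (D : set T).
Hypothesis mD : measurable D.

Lemma simple_integral_Rintegral (s : T -> R^o) : simple_integrable mu D s ->
 mu.-integrable D (EFin \o s) /\ simple_integral mu D s = \int[mu]_(x in D) s x.
move=> [fs fin]; have [fr _] := fs.
pose g (b : R) (x : T) : \bar R := (b%:E * (\1_(s @^-1` [set b]) x)%:E)%E.
have mb b : measurable (s @^-1` [set b]) by exact: fsimple_pre.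
have ig b : mu.-integrable D (g b).
 have [->|b0] := eqVneq b 0.
  rewrite (_ : g 0 = cst 0%E); first exact: integrable0.
  by apply/funext => x; rewrite /g mul0e.
 apply: integrableZl => //; apply/integrableP; split.
  side.
 under eq_integral do rewrite gee0_abs ?lee_fin//.
 by rewrite integral_indic// setIC fin.
pose rs : seq R := finmap.enum_fset (fset_set (range (s : T -> R))).
have sE x : (s x)%:E = (\sum_(b <- rs) g b x)%E.
 rewrite /rs -fsbig_finite// (fsbigD1 (s x))//=; last by exists x.
 rewrite /g indicE mem_set// mule1 fsbig1 ?adde0// => b [_ /= bs].
 by rewrite indicE memNset ?mule0// => /= sb; exact: bs.
have is_ : mu.-integrable D (EFin \o s).
 rewrite (_ : EFin \o s = (fun x => \sum_(b <- rs) g b x)%E).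
  exact: integrable_sum.
 by apply/funext => x; exact: sE.
split => //; rewrite /Rintegral.
under eq_integral do rewrite sE.
rewrite integral_sum// /simple_integral fsbig_finite//=.
rewrite (_ : (\sum_(b <- _) _)%E = (\sum_(b <- rs)
  (fine (mu (D `&` s @^-1` [set b])) * b)%:E)%E).
 by rewrite sumEFin.
apply: eq_bigr => b _; rewrite /g.
have [->|b0] := eqVneq b 0.
 by rewrite mulr0; under eq_integral do rewrite mul0e; rewrite integral0.
rewrite integralZl//; last first.
 have := integrableZl mD (b^-1)%R (ig b); apply: eq_integrable => // x _.
 by rewrite /g -!EFinM mulKf.
by rewrite integral_indic// setIC mulrC EFinM fineK// ge0_fin_numE// fin.
Qed.

(** Simple approximations of [c] in [L^1] are multiplied by [b]. Heat flows of constants and of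
    modes, and fractional derivatives of exponentials, are computed from this reduction to Lebesgue
    integrals. *)
Lemma is_bochner_scale (B : completeNormedModType R) (c : T -> R) (b : B) :
 measurable_fun setT c -> mu.-integrable D (EFin \o c) ->
 is_bochner_integral mu D (fun x => c x *: b) ((\int[mu]_(x in D) c x) *: b).
move=> mc ic; have sc := meas_smeas mc.
have [_ ic'] := integrableP _ _ _ ic.
have ic1 : (\int[mu]_(x in D) (`|(c : T -> R^o) x| `^ 1)%:E < +oo)%E by under eq_integral do rewrite powRr1//.
have [s [si _ cs cis]] := smeas_Lp_approx mD ltr01 sc ic1.
have intb (e : T -> R) : measurable_fun setT e ->
  (\int[mu]_(x in D) (`|e x *: b|)%:E =
  `|b|%:E * \int[mu]_(x in D) (`|e x|)%:E)%E.
 move=> me; rewrite -ge0_integralZl//.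
  by apply: eq_integral => x _; rewrite normrZ mulrC.
 apply/measurable_EFinP; apply: measurableT_comp => //.
 exact: measurable_funTS.
split.
 apply: smeas_strongly_measurable; apply: smeasZ => //; exact: smeas_cst.
exists (fun k x => s k x *: b); split.
- move=> k; have [fs fin] := si k; split.
  exact: (fsimple_comp (fun r => r *: b) fs).
 move=> v v0.
 have [->|b0] := eqVneq b 0.
  rewrite (_ : _ @^-1` _ = set0) ?setI0 ?measure0 ?ltry//.
  by rewrite -subset0 => x /=; rewrite scaler0 => /esym/eqP; rewrite (negbTE v0).
 have [[r rv]|nr] := pselect (exists r, r *: b = v); last first.
  rewrite (_ : _ @^-1` _ = set0) ?setI0 ?measure0 ?ltry//.
  by rewrite -subset0 => x /= sv; apply: nr; exists (s k x).
 rewrite (_ : _ @^-1` _ = s k @^-1` [set r]).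
  by apply: fin; apply: contra_neq v0 => r0; rewrite -rv r0 scale0r.
 apply/seteqP; split => x /= => [|->//]; rewrite -rv => /eqP.
 by rewrite -subr_eq0 -scalerBl scaler_eq0 (negbTE b0) orbF subr_eq0 => /eqP.
- apply: cvge0I; first side.
 move=> e e0; have e1 : 0 < e / (`|b| + 1) by rewrite divr_gt0// ltr_wpDl.
 near=> k; under eq_integral do rewrite -scalerBl.
 rewrite intb; last first.
  apply: measurable_funB => //; apply: meas_fsimple.
  by case: (si k).
 apply: (@le_trans _ _ ((`|b| + 1)%:E * (e / (`|b| + 1))%:E)%E).
  apply: lee_pmul => //; rewrite ?lee_fin ?lerDl//.
   side.
  under eq_integral do rewrite -(powRr1 (normr_ge0 _)).
  by near: k; exact: cvge0_le cis.
 by rewrite -EFinM lee_fin mulrC divfK// gt_eqF// ltr_wpDl.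
have -> : (fun k => simple_integral mu D (fun x => s k x *: b)) =
  (fun k => (\int[mu]_(x in D) s k x) *: b).
 apply/funext => k; have [fs fin] := si k.
 rewrite -(simple_integral_Rintegral (si k)).2.
 have /= := @simple_integral_comp _ _ _ _ mu D mD _ (s k) (fun r : R => r *: b) fs.
 rewrite /comp => ->.
  rewrite /simple_integral !fsbig_finite//; try by case: fs.
  by rewrite scaler_suml; apply: eq_bigr => r _; rewrite scalerA.
 by move=> r rb; apply: fin; apply: contra_neq rb => ->; rewrite scale0r.
apply: cvgZr_tmp; apply/cvgrPdist_le => e e0; near=> k.
have [isk _] := simple_integral_Rintegral (si k).
rewrite -RintegralB//.
have icB : mu.-integrable D (EFin \o (fun x => c x - s k x)).
 by have := integrableB mD ic isk; apply: eq_integrable => // x _; rewrite EFinB.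
apply: le_trans (le_normr_Rintegral mD icB) _.
have [_ icB'] := integrableP _ _ _ icB.
rewrite -lee_fin fineK; last by rewrite ge0_fin_numE ?integral_ge0.
under eq_integral do rewrite -(powRr1 (normr_ge0 _)).
by near: k; exact: cvge0_le cis.
Unshelve. all: by end_near. Qed.

End bochner_scalar.

(** * The heat kernel and its time derivatives *)

Section euclidean_space.
Context (R : realType).
Local Notation mu n := (lebesgue_Rn R n).

(** The square of [eucl_dist]. Gaussian exponents involve only the square, which is additive over
    coordinates. *)
Definition sqd (n : nat) (x y : Rn R n) : R :=
 \sum_(i < n) ((tnth x i : R) - (tnth y i : R)) ^+ 2.

Lemma sqd_ge0 n (x y : Rn R n) : 0 <= sqd x y.
by apply: sumr_ge0 => i _; exact: sqr_ge0. Qed.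

Lemma eucl_dist_sqr n (x y : Rn R n) : eucl_dist x y ^+ 2 = sqd x y.
by rewrite /eucl_dist sqr_sqrtr// sqd_ge0. Qed.

Lemma sqdC n (x y : Rn R n) : sqd x y = sqd y x.
by apply: eq_bigr => i _; rewrite -sqrrN opprB. Qed.

(** Coordinatewise [(a + b)^2 <= (1 + e) a^2 + (1 + 1/e) b^2], with defect [(e a - b)^2 / e]. A
    small [e] keeps the coefficient of the main term close to 1, at a large cost in the
    displacement. *)
Lemma sqd_triangle n (e : R) (x y z : Rn R n) : 0 < e ->
 sqd x z <= (1 + e) * sqd y z + (1 + e^-1) * sqd x y.
move=> e0; rewrite /sqd !mulr_sumr -big_split/=; apply: ler_sum => i _.
set a := tnth y i - tnth z i : R; set b := tnth x i - tnth y i : R.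
rewrite (_ : tnth x i - tnth z i = a + b :> R); last by rewrite /a /b; ring.
have -> : (1 + e) * a ^+ 2 + (1 + e^-1) * b ^+ 2 =
  (a + b) ^+ 2 + e^-1 * (e * a - b) ^+ 2.
 by field; rewrite gt_eqF.
by rewrite lerDl mulr_ge0 ?sqr_ge0// invr_ge0 ltW.
Qed.

Lemma sqd_cons n (a b : R) (v w : Rn R n) :
 sqd (rn_cons (a, v)) (rn_cons (b, w)) = (a - b) ^+ 2 + sqd v w.
rewrite /sqd big_ord_recl /=; congr (_ + _).
by apply: eq_bigr => i _; rewrite !tnthS.
Qed.

Lemma rn_consK n (x : Rn R n.+1) :
 rn_cons (tnth x ord0, [tuple of behead x]) = x.
apply/val_inj => /=; case: x => -[|a s]//= i; congr (_ :: _).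
Qed.

Lemma ge0_integral_cons n (F : Rn R n.+1 -> \bar R) :
 measurable_fun setT F -> (forall x, (0 <= F x)%E) ->
 (\int[mu n.+1]_x F x =
  \int[lebesgue_measure]_a \int[mu n]_v F (rn_cons (a, v)))%E.
move=> mF F0.
rewrite -[LHS]/(\int[pushforward (lebesgue_measure \x mu n)%E (@rn_cons R n)]_x F x)%E.
rewrite (ge0_integral_pushforward (@measurable_rn_cons R n))//.
rewrite preimage_setT fubini_tonelli1//; last by move=> x; exact: F0.
exact: measurableT_comp (@measurable_rn_cons R n).
Qed.

Lemma meas_sqd n : measurable_fun setT (fun z : Rn R n * Rn R n => sqd z.1 z.2).
apply: measurable_sum => i; apply: measurable_funX; apply: measurable_funB.
 exact: (measurableT_comp (measurable_tnth i) measurable_fst).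
exact: (measurableT_comp (measurable_tnth i) measurable_snd).
Qed.

Local Notation K := (@heat_kernel R).

Lemma kernelE n t (x y : Rn R n) : K t x y =
 ((4 * pi * t) `^ (n%:R / 2))^-1 * expR (- (sqd x y / (4 * t))).
by rewrite /heat_kernel eucl_dist_sqr. Qed.

Lemma fourpi_gt0 (t : R) : 0 < t -> 0 < 4 * pi * t.
by move=> t0; rewrite !mulr_gt0// pi_gt0. Qed.

Lemma kernel_ge0 n t (x y : Rn R n) : 0 <= K t x y.
by rewrite mulr_ge0 ?expR_ge0// invr_ge0 powR_ge0. Qed.

Lemma kernelC n t (x y : Rn R n) : K t x y = K t y x.
by rewrite !kernelE sqdC. Qed.

Lemma meas_heat_kernel2 n t :
 measurable_fun setT (fun z : Rn R n * Rn R n => K t z.1 z.2).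
under eq_fun do rewrite kernelE.
apply: measurable_funM => //; apply: measurableT_comp => //.
apply: measurableT_comp => //; apply: measurable_funM => //.
exact: meas_sqd.
Qed.

Lemma meas_heat_kernel n t (x : Rn R n) : measurable_fun setT (K t x).
exact: (measurableT_comp (meas_heat_kernel2 t) (measurable_pair1 x)).
Qed.

(** One-dimensional heat kernel, the Gaussian density of variance [2 * t]. The kernel in dimension
    [n] is the product over coordinates, so mass and semigroup law follow by induction on [n]. *)
Definition heat1 (t a b : R) : R :=
 (Num.sqrt (4 * pi * t))^-1 * expR (- ((a - b) ^+ 2 / (4 * t))).

Lemma heat1_pdf t a : 0 < t -> heat1 t a = normal_pdf a (Num.sqrt (2 * t)).
move=> t0; have t20 : Num.sqrt (2 * t) != 0 by rewrite gt_eqF// sqrtr_gt0 mulr_gt0.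
apply/funext => b.
rewrite normal_pdfE// -[RHS]/(normal_peak _ * normal_fun _ _ _) /normal_peak /normal_fun /heat1.
rewrite sqr_sqrtr ?mulr_ge0// ?(ltW t0)//; congr (_^-1 * expR _).
 by congr (Num.sqrt _); rewrite -mulr_natr; ring.
by rewrite -mulr_natr mulNr -[X in - (X / _) = _]sqrrN opprB; congr (- (_ / _)); ring.
Qed.

Lemma heat1_ge0 t a b : 0 <= heat1 t a b.
by rewrite mulr_ge0 ?expR_ge0// invr_ge0 sqrtr_ge0. Qed.

Lemma integral_heat1 t a : 0 < t ->
 (\int[lebesgue_measure]_b (heat1 t a b)%:E = 1)%E.
by move=> t0; rewrite heat1_pdf// integral_normal_pdf. Qed.

Lemma meas_heat1 t a : measurable_fun setT (heat1 t a).
apply: measurable_funM => //; apply: measurableT_comp => //.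
apply: measurableT_comp => //; apply: measurable_funM => //.
by apply: measurable_funX; apply: measurable_funB.
Qed.

(** Completing the square in [b]: the product of two Gaussians is the kernel at time [s + t] times a
    Gaussian density in [b], which has total mass 1. *)
Lemma heat1_semigroup s t a b c : 0 < s -> 0 < t ->
 heat1 s a b * heat1 t b c =
 heat1 (s + t) a c * heat1 (s * t / (s + t)) ((t * a + s * c) / (s + t)) b.
move=> s0 t0; have st0 : 0 < s + t by exact: addr_gt0.
rewrite /heat1 mulrACA [RHS]mulrACA -!invfM -!sqrtrM ?(ltW (fourpi_gt0 _))//.
rewrite -!expRD; congr (_^-1 * expR _).
 by congr Num.sqrt; field; rewrite gt_eqF.
by field; rewrite !gt_eqF.
Qed.

Lemma heat_kernel_cons n t (a b : R) (v w : Rn R n) : 0 < t ->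
 K t (rn_cons (a, v)) (rn_cons (b, w)) = heat1 t a b * K t v w.
move=> t0; rewrite !kernelE sqd_cons /heat1 mulrACA -invfM.
rewrite -expRD -opprD -mulrDl; congr (_^-1 * _).
have c0 := fourpi_gt0 t0.
rewrite (_ : n.+1%:R / 2 = 2^-1 + n%:R / 2 :> R); last first.
 by rewrite -natr1 mulrDl mul1r addrC.
rewrite powRD; first by rewrite powR12_sqrt// ltW.
by apply/implyP => _; rewrite gt_eqF.
Qed.

Lemma integral_kernel n t (x : Rn R n) : 0 < t ->
 (\int[mu n]_y (K t x y)%:E = 1)%E.
move=> t0; elim: n x => [|n IH] x.
 rewrite integral_dirac//; last first.
  by apply/measurable_EFinP; exact: meas_heat_kernel.
 rewrite diracT mul1e kernelE /sqd big_ord0 !mul0r powRr0 oppr0 expR0.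
 by rewrite invr1 mulr1.
rewrite ge0_integral_cons//; last 2 first.
- by apply/measurable_EFinP; exact: meas_heat_kernel.
- by move=> y; rewrite lee_fin kernel_ge0.
rewrite -(integral_heat1 (tnth x ord0) t0); apply: eq_integral => a _.
rewrite -[in LHS](rn_consK x).
under eq_integral do rewrite heat_kernel_cons// EFinM.
rewrite ge0_integralZl//.
- by rewrite IH mule1.
- by apply/measurable_EFinP; exact: meas_heat_kernel.
- by move=> y _; rewrite lee_fin kernel_ge0.
- by rewrite lee_fin heat1_ge0.
Qed.

Lemma heat_kernel_semigroup n s t (x z : Rn R n) : 0 < s -> 0 < t ->
 (\int[mu n]_y (K s x y * K t y z)%:E = (K (s + t) x z)%:E)%E.
move=> s0 t0; have st0 : 0 < s + t by exact: addr_gt0.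
have mK m (x' z' : Rn R m) : measurable_fun setT (fun y => K s x' y * K t y z').
 apply: measurable_funM; first exact: meas_heat_kernel.
 by under eq_fun do rewrite kernelC; exact: meas_heat_kernel.
elim: n x z => [|n IH] x z.
 rewrite integral_dirac//; last by apply/measurable_EFinP; exact: mK.
 rewrite diracT mul1e !kernelE /sqd !big_ord0 !mul0r !powRr0 oppr0 expR0.
 by rewrite invr1 !mulr1.
rewrite ge0_integral_cons//; last 2 first.
- by apply/measurable_EFinP; exact: mK.
- by move=> y; rewrite lee_fin mulr_ge0 ?kernel_ge0.
rewrite -(rn_consK x) -(rn_consK z).
set a := tnth x ord0; set c := tnth z ord0.
set v := [tuple of behead x]; set w := [tuple of behead z].
rewrite heat_kernel_cons//.
transitivity (\int[lebesgue_measure]_b ((heat1 (s + t) a c * K (s + t) v w)%:E *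
  (heat1 (s * t / (s + t)) ((t * a + s * c) / (s + t)) b)%:E))%E.
 apply: eq_integral => b _.
 rewrite -EFinM mulrAC -heat1_semigroup// EFinM.
 under eq_integral do rewrite !heat_kernel_cons// mulrACA EFinM.
 rewrite ge0_integralZl ?IH//.
 - by apply/measurable_EFinP; exact: mK.
 - by move=> y _; rewrite lee_fin mulr_ge0 ?kernel_ge0.
 - by rewrite lee_fin mulr_ge0// heat1_ge0.
rewrite ge0_integralZl//.
- by rewrite integral_heat1 ?mule1// divr_gt0// mulr_gt0.
- by apply/measurable_EFinP; exact: meas_heat1.
- by move=> y _; rewrite lee_fin heat1_ge0.
- by rewrite lee_fin mulr_ge0 ?heat1_ge0 ?kernel_ge0.
Qed.

(** The exponential factor increases with time; only the normalization decreases, by the stated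
    power of [t / s]. *)
Lemma heat_kernel_le n s t (x y : Rn R n) : 0 < s -> s <= t ->
 K s x y <= (t / s) `^ (n%:R / 2) * K t x y.
move=> s0 st; have t0 : 0 < t := lt_le_trans s0 st.
rewrite !kernelE mulrA ler_pM ?expR_ge0 ?invr_ge0 ?powR_ge0//.
 rewrite (_ : 4 * pi * t = (t / s) * (4 * pi * s)); last first.
  by field; rewrite gt_eqF.
 rewrite (@powRM _ (t / s) (4 * pi * s)) ?divr_ge0 ?(ltW t0) ?(ltW s0) ?(ltW (fourpi_gt0 s0))//.
 by rewrite invfM mulVKf// gt_eqF// powR_gt0// divr_gt0.
rewrite ler_expR lerN2 ler_pdivrMr ?mulr_gt0//.
rewrite mulrAC -mulrA ler_peMr ?sqd_ge0// ler_pdivlMr ?mulr_gt0//.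
by rewrite mul1r ler_pM2l.
Qed.

(* Replacing the point y by x costs a Gaussian factor in d(x,y) and a slightly
  larger time. *)
Lemma heat_kernel_shift n t e (x y z : Rn R n) : 0 < t -> 0 < e ->
 K t y z <= (1 + e) `^ (n%:R / 2) * expR (sqd x y / (4 * t * e)) *
  K ((1 + e) * t) x z.
move=> t0 e0; have e1 : 0 < 1 + e by exact: addr_gt0.
rewrite !kernelE.
rewrite (_ : 4 * pi * ((1 + e) * t) = (1 + e) * (4 * pi * t)); last by ring.
rewrite (@powRM _ (1 + e) (4 * pi * t)) ?(ltW e1)// ?(ltW (fourpi_gt0 t0))//.
set A := (1 + e) `^ _; set P := (4 * pi * t) `^ _.
have A0 : 0 < A by exact: powR_gt0.
have P0 : 0 < P by rewrite powR_gt0// fourpi_gt0.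
set E2 := expR (sqd x y / _); set E3 := expR (- (sqd x z / _)).
rewrite [leRHS](_ : _ = P^-1 * (E2 * E3)); last by field; rewrite !gt_eqF.
rewrite ler_wpM2l ?invr_ge0 ?(ltW P0)// /E2 /E3 -expRD.
rewrite ler_expR.
have h := sqd_triangle x y z e0.
rewrite -subr_ge0 [X in 0 <= X](_ : _ = ((1 + e) * sqd y z +
  (1 + e^-1) * sqd x y - sqd x z) / (4 * t * (1 + e))); last first.
 by field; rewrite !gt_eqF//=.
side.
Qed.

(** Each degree spends half of the available exponent on one factor [r]. *)
Lemma poly_expR_bound (Q : {poly R}) (e : R) : 0 < e ->
 exists2 C, 0 < C & forall r, 0 <= r -> `|Q.[r]| <= C * expR (e * r).
elim/poly_ind : Q e => [|Q c IH] e e0.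
 by exists 1 => // r r0; rewrite horner0 normr0 mul1r expR_ge0.
have e2 : 0 < e / 2 by side.
have [C C0 QC] := IH _ e2.
exists (C / (e / 2) + `|c| + 1).
 side.
move=> r r0; rewrite hornerMXaddC; apply: le_trans (ler_normD _ _) _.
have er1 : 1 <= expR (e * r) by rewrite -expR0 ler_expR mulr_ge0// ltW.
have er : r <= (e / 2)^-1 * expR (e / 2 * r).
 rewrite mulrC ler_pdivlMr// mulrC; apply: le_trans (expR_ge1Dx _).
 by rewrite lerDr.
rewrite -addrA mulrDl lerD//; last first.
 by rewrite mulrDl mul1r -[leLHS]addr0 lerD ?expR_ge0// ler_peMr.
rewrite normrM (ger0_norm r0).
apply: (@le_trans _ _ (C * expR (e / 2 * r) * ((e / 2)^-1 * expR (e / 2 * r)))).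
 by apply: ler_pM => //; exact: QC.
rewrite mulrACA -expRD -mulrDl -splitr//.
Qed.

(* The m-th time derivative of the heat kernel is its product by
  t ^ (- m) * Q_m (|x - y|^2 / t), with Q_m defined by this recursion. *)
Fixpoint heat_poly (n m : nat) : {poly R} :=
 if m is k.+1 then
  (- (n%:R / 2 + k%:R)) *: heat_poly n k - 'X * (heat_poly n k)^`() +
  4^-1 *: ('X * heat_poly n k)
 else 1.

Definition dkernel (m n : nat) (t : R) (x y : Rn R n) : R :=
 (heat_poly n m).[sqd x y / t] * t ^- m * K t x y.

Lemma dheat_kernel0 n t (x y : Rn R n) : dkernel 0 t x y = K t x y.
by rewrite /dkernel /= hornerC expr0 invr1 !mul1r. Qed.

Lemma meas_dkernel m n t (x : Rn R n) :
 measurable_fun setT (dkernel m t x).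
apply: measurable_funM; last exact: meas_heat_kernel.
apply: measurable_funM => //.
apply: (measurableT_comp (f := horner (heat_poly n m))); first exact: measurable_poly.
apply: measurable_funM => //.
exact: (measurableT_comp (@meas_sqd n) (measurable_pair1 x)).
Qed.

(** With [r = |x - y|^2 / t], the exponents [r / 4] at time [t] and [r / 8] at time [2 * t] differ
    by [r / 8], which absorbs the polynomial factor. *)
Lemma dkernel_bound m n : exists2 C, 0 < C &
 forall t (x y : Rn R n), 0 < t ->
 `|dkernel m t x y| <= C * t ^- m * K (2 * t) x y.
have [C C0 QC] := @poly_expR_bound (heat_poly n m) (8^-1) (ltac:(by rewrite invr_gt0)).
exists (C * 2 `^ (n%:R / 2)); first side.
move=> t x y t0; rewrite /dkernel 2!normrM.
rewrite (ger0_norm (kernel_ge0 t x y)) normrV ?unitfE ?expf_neq0 ?gt_eqF//.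
rewrite (ger0_norm (exprn_ge0 _ (ltW t0))) !kernelE.
rewrite (_ : 4 * pi * (2 * t) = 2 * (4 * pi * t)); last by ring.
rewrite (@powRM _ 2 (4 * pi * t)) ?(ltW (fourpi_gt0 t0))//.
set A := 2 `^ _; set P := (4 * pi * t) `^ _.
have A0 : 0 < A by exact: powR_gt0.
have P0 : 0 < P by rewrite powR_gt0// fourpi_gt0.
set r := sqd x y / t; have r0 : 0 <= r by rewrite divr_ge0 ?sqd_ge0 ?ltW.
rewrite (_ : sqd x y / (4 * t) = r / 4); last by rewrite /r; field; rewrite gt_eqF.
rewrite (_ : sqd x y / (4 * (2 * t)) = r / 8); last first.
 by rewrite /r; field; rewrite gt_eqF.
rewrite [leRHS](_ : _ = C * expR (8^-1 * r) * t ^- m * (P^-1 * expR (- (r / 4)))).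
 rewrite ler_wpM2r ?mulr_ge0 ?expR_ge0 ?invr_ge0 ?(ltW P0)//.
 by rewrite ler_wpM2r ?invr_ge0 ?exprn_ge0 ?(ltW t0)// QC.
rewrite (_ : - (r / 8) = 8^-1 * r + - (r / 4)); last by field.
by rewrite expRD; field; rewrite !gt_eqF ?exprn_gt0.
Qed.

Lemma is_derive_heat_kernel n (t : R) (x y : Rn R n) : 0 < t ->
 is_derive t 1 (fun s => K s x y)
  ((- (n%:R / 2) / t + sqd x y / (4 * t ^+ 2)) * K t x y).
move=> t0.
have c0 : 0 < 4 * pi :> R by side.
pose c := ((4 * pi) `^ (n%:R / 2))^-1 : R.
pose g s := c * (s `^ (- (n%:R / 2)) * expR (- (sqd x y / 4) * s^-1)).
have Kg s : 0 < s -> K s x y = g s.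
 move=> s0; rewrite kernelE powRM ?(ltW s0) ?(ltW c0)// /g /c powRN invfM -mulrA.
 by congr (_ * (_ * expR _)); field; rewrite gt_eqF.
have dV : is_derive t 1 (fun s : R => s^-1) (- t ^- 2).
 have h := @is_deriveV R id t 1 1 (lt0r_neq0 t0) (is_derive_id _ _).
 by apply: (is_derive_eq h); exact: mulr1.
have dE : is_derive t 1 (fun s : R => expR (- (sqd x y / 4) * s^-1))
  (expR (- (sqd x y / 4) * t^-1) * (- (sqd x y / 4) * - t ^- 2)).
 apply: (is_derive1_comp (f := expR) (g := fun s => - (sqd x y / 4) * s^-1)).
have dP := is_derive1_powR (- (n%:R / 2)) t0.
have dg : is_derive t 1 g (c * ((t `^ (- (n%:R / 2))) * (expR (- (sqd x y / 4) * t^-1) * (- (sqd x y / 4) * - t ^- 2)) +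
  expR (- (sqd x y / 4) * t^-1) * (- (n%:R / 2) * t `^ (- (n%:R / 2) - 1)))).
 exact: (is_deriveZ c (is_deriveM dP dE)).
apply: (@near_eq_is_derive _ _ _ g).
 by near=> s; rewrite Kg//; near: s; exact: lt_nbhsr.
apply: (is_derive_eq dg); rewrite Kg// /g powRB// ?powRr1 ?(ltW t0)//; last first.
 by apply/implyP => _; rewrite gt_eqF.
by field; rewrite gt_eqF.
Unshelve. all: by end_near. Qed.

Lemma is_derive_dkernel m n (t : R) (x y : Rn R n) : 0 < t ->
 is_derive t 1 (fun s => dkernel m s x y) (dkernel m.+1 t x y).
move=> t0; have tn0 := lt0r_neq0 t0.
have dV : is_derive t 1 (fun s : R => s^-1) (- t ^- 2).
 have h := @is_deriveV R id t 1 1 tn0 (is_derive_id _ _).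
 by apply: (is_derive_eq h); exact: mulr1.
have dQ : is_derive t 1 (fun s : R => (heat_poly n m).[sqd x y * s^-1])
  ((heat_poly n m)^`().[sqd x y * t^-1] * (sqd x y * - t ^- 2)).
 apply: (is_derive1_comp (f := horner (heat_poly n m))
  (g := fun s => sqd x y * s^-1)).
have dX : is_derive t 1 (fun s : R => (s^-1) ^+ m) ((m%:R * t^-1 ^+ m.-1) * (- t ^- 2)).
 rewrite (_ : (fun s : R => _) = (fun s : R => s^-1) ^+ m); last first.
  by apply/funext => s; rewrite exprfctE.
 exact: (is_deriveX m dV).
have h : is_derive t 1 ((fun s : R => (heat_poly n m).[sqd x y * s^-1]) *
  (fun s : R => (s^-1) ^+ m) * (fun s => K s x y))
  ((heat_poly n m).[sqd x y * t^-1] * t^-1 ^+ m *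
   ((- (n%:R / 2) / t + sqd x y / (4 * t ^+ 2)) * K t x y) +
   K t x y * ((heat_poly n m).[sqd x y * t^-1] *
    (m%:R * t^-1 ^+ m.-1 * - t ^- 2) +
   t^-1 ^+ m * ((heat_poly n m)^`().[sqd x y * t^-1] * (sqd x y * - t ^- 2)))).
 exact: (is_deriveM (is_deriveM dQ dX) (is_derive_heat_kernel x y t0)).
rewrite (_ : (fun s => _) = ((fun s : R => (heat_poly n m).[sqd x y * s^-1]) *
  (fun s : R => (s^-1) ^+ m) * (fun s => K s x y))); last first.
 by apply/funext => s; rewrite /dkernel !fctE exprVn.
apply: (is_derive_eq h).
rewrite /dkernel; move: (K t x y) => k.
have -> : (heat_poly n m.+1).[sqd x y / t] =
  - (n%:R / 2 + m%:R) * (heat_poly n m).[sqd x y / t] -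
  sqd x y / t * (heat_poly n m)^`().[sqd x y / t] +
  4^-1 * (sqd x y / t * (heat_poly n m).[sqd x y / t]).
 by rewrite /= hornerD hornerD hornerN !hornerZ !hornerM !hornerX.
move: (heat_poly n m).[_] (_^`()).[_] => Q Q'.
have -> : m%:R * t^-1 ^+ m.-1 * - t ^- 2 = - m%:R * (t^-1 * t^-1 ^+ m).
 case: m {dQ dX h} => [|m]; first by rewrite !mul0r oppr0 mul0r.
 rewrite /= [t^-1 ^+ m.+1]exprS expr2; move: (t^-1 ^+ m) (m.+1%:R : R) => a b.
 by field.
rewrite exprVn [t ^+ m.+1]exprS expr2.
have X0 : t ^+ m != 0 by side.
move: (t ^+ m) X0 (m%:R : R) => X X0 b.
by field; rewrite X0.
Qed.

End euclidean_space.

#[export] Hint Extern 1 (is_true (@Order.le _ _ _ (sqd _ _))) => exact: sqd_ge0 : side.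
#[export] Hint Extern 1 (is_true (@Order.le _ _ _ (heat_kernel _ _ _))) => exact: kernel_ge0 : side.
#[export] Hint Extern 1 (measurable_fun _ (heat_kernel _ _)) => exact: meas_heat_kernel : side.
#[export] Hint Extern 1 (measurable_fun _ (fun _ => heat_kernel _ _ _)) => exact: meas_heat_kernel : side.

(** * Inequalities for real powers *)

Section powR_inequalities.
Context (R : realType).
Implicit Types a b r d x y : R.

Lemma powR_mulr1 x r : 0 <= x -> 1 <= r -> x `^ r = x * x `^ (r - 1).
move=> x0 r1; have r0 : r != 0 by rewrite gt_eqF// (lt_le_trans ltr01).
move: x0; rewrite le_eqVlt => /predU1P[<-|x0]; first by rewrite powR0// mul0r.
rewrite -{2}[x]powRr1 ?ltW// -powRD; first by congr (_ `^ _); ring.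
by apply/implyP => _; rewrite gt_eqF.
Qed.

(** Young's inequality arranged as the tangent-line inequality of the convex function [b ^ r] at the
    point [a]. *)
Lemma young_powR r a b : 1 <= r -> 0 <= a -> 0 <= b ->
 r * a `^ (r - 1) * b <= b `^ r + (r - 1) * a `^ r.
move=> r1 a0 b0; have [->|r_neq1] := eqVneq r 1.
 by rewrite subrr powRr0 !powRr1// mul0r addr0 !mul1r.
have r0 : 0 < r by side.
have r10 : 0 < r - 1 by rewrite subr_gt0 lt_neqAle eq_sym r_neq1.
have q0 : 0 < r / (r - 1) by side.
have := @conjugate_powR R (a `^ (r - 1)) b (r / (r - 1)) r (powR_ge0 _ _) b0 q0 r0.
rewrite -powRrM.
have -> : (r - 1) * (r / (r - 1)) = r by field; rewrite gt_eqF.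
have -> : (r / (r - 1))^-1 + r^-1 = 1 by field; rewrite !gt_eqF.
move=> /(_ erefl) h; rewrite -mulrA mulrC -ler_pdivlMr//.
apply: le_trans h _; rewrite le_eqVlt; apply/orP; left; apply/eqP.
by field; rewrite !gt_eqF.
Qed.

Lemma powR_sub_le r x y : 1 <= r -> 0 <= y -> y <= x ->
 x `^ r - y `^ r <= r * (x - y) * x `^ (r - 1).
move=> r1 y0 yx; have x0 := le_trans y0 yx.
have := young_powR r1 x0 y0; rewrite (powR_mulr1 x0 r1).
by move: (x `^ (r - 1)) (y `^ r) => A B; nra.
Qed.

Lemma powR_add_ge r x d : 1 <= r -> 0 <= x -> 0 <= d ->
 x `^ r + r * d * x `^ (r - 1) <= (x + d) `^ r.
move=> r1 x0 d0; have := young_powR r1 x0 (addr_ge0 x0 d0).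
rewrite (powR_mulr1 x0 r1).
by move: (x `^ (r - 1)) ((x + d) `^ r) => A B; nra.
Qed.

Lemma ler_powR2 r x y : 0 <= r -> 0 <= x -> x <= y -> x `^ r <= y `^ r.
by move=> r0 x0 xy; apply: ge0_ler_powR; rewrite ?nnegrE// (le_trans x0).
Qed.

Lemma powRD_le r x y : 0 <= r -> 0 <= x -> 0 <= y ->
 (x + y) `^ r <= 2 `^ r * (x `^ r + y `^ r).
move=> r0 x0 y0; wlog xy : x y x0 y0 / x <= y.
 move=> h; have [/h|/ltW/h] := leP x y; first exact.
 by rewrite addrC [X in _ <= _ * X]addrC; exact.
apply: (@le_trans _ _ ((2 * y) `^ r)).
 by apply: ler_powR2 => //; [exact: addr_ge0|lra].
by rewrite powRM// ler_wpM2l ?powR_ge0// lerDr powR_ge0.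
Qed.

(* Young's inequality for the conjugate exponents p and p/(p-1), with
  unoptimized constants. *)
Lemma young_powR_eps p d a v : 1 < p -> 0 < d -> 0 <= a -> 0 <= v ->
 a * v <= d * v `^ (p / (p - 1)) + d `^ (1 - p) * a `^ p.
move=> p1 d0 a0 v0; have p10 : 0 < p - 1 by rewrite subr_gt0.
have p0 : 0 < p by side.
have q1 : 1 <= p / (p - 1) by rewrite ler_pdivlMr// mul1r gerBl.
have [h|h] := leP a (d * v `^ (p / (p - 1) - 1)).
 rewrite -[leLHS]addr0 lerD ?mulr_ge0 ?powR_ge0//.
 by rewrite (powR_mulr1 v0 q1) mulrCA mulrC ler_wpM2l.
rewrite -[leLHS]add0r lerD ?mulr_ge0 ?powR_ge0 ?(ltW d0)//.
have e1 : p / (p - 1) - 1 = (p - 1)^-1 by field; rewrite gt_eqF.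
have vle : v <= (a / d) `^ (p - 1).
 have -> : v = (v `^ (p - 1)^-1) `^ (p - 1) by rewrite -powRrM mulVf ?gt_eqF// powRr1.
 apply: ler_powR2; rewrite ?(ltW p10) ?powR_ge0//.
 by rewrite ler_pdivlMr// mulrC -e1 ltW.
rewrite (powR_mulr1 a0 (ltW p1)) mulrCA ler_wpM2l//.
apply: le_trans vle _; rewrite powRM ?invr_ge0 ?(ltW d0)//.
by rewrite mulrC -powR_inv1 ?(ltW d0)// -powRrM mulN1r opprB.
Qed.

(** Half of the left-hand side is absorbed, which is legitimate because [W] is finite. *)
Lemma absorb_half_ereal (W S V H : \bar R) (d D e : R) : 0 < d -> d * D = 2^-1 ->
 (0 <= W)%E -> (W < +oo)%E -> (0 <= H)%E -> (H < +oo)%E -> (W <= S)%E ->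
 (S <= d%:E * V + e%:E * H)%E -> (V <= D%:E * W)%E -> (W <= (2 * e)%:E * H)%E.
move=> d0 dD W0 Wf H0 Hf s1 s2 s3.
have : (W <= d%:E * (D%:E * W) + e%:E * H)%E.
 apply: (le_trans s1); apply: (le_trans s2); apply: leeD => //.
 by apply: lee_wpmul2l => //; rewrite lee_fin ltW.
case: W {s1 s3} W0 Wf => [W||] // _ _; case: H {s2} H0 Hf => [H||] // _ _.
by rewrite -!EFinM -EFinD !lee_fin mulrA dD; lra.
Qed.

Lemma integral_young disp (T : measurableType disp) (mu : {measure set T -> \bar R}) p e (F v : T -> R) :
 1 < p -> 0 < e -> measurable_fun setT F -> measurable_fun setT v ->
 (forall z, 0 <= F z) -> (forall z, 0 <= v z) ->
 (\int[mu]_z (F z * v z)%:E <= e%:E * \int[mu]_z (v z `^ (p / (p - 1)))%:E +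
  (e `^ (1 - p))%:E * \int[mu]_z (F z `^ p)%:E)%E.
move=> p1 e0 mF mv F0 v0.
rewrite -ge0_integralZl//; [|side..].
rewrite -ge0_integralZl//; [|side..].
rewrite -ge0_integralD//; [|side..].
apply: le_integralW => // z _; first side.
by rewrite -!EFinM -EFinD lee_fin; exact: young_powR_eps.
Qed.

Lemma powR_sum_le (N : nat) r (a : nat -> R) : 0 < r -> (forall i, 0 <= a i) ->
 (\sum_(i < N) a i) `^ r <= N%:R `^ r * \sum_(i < N) a i `^ r.
move=> r0 a0; case: N => [|N].
 by rewrite !big_ord0 mulr0 powR0// gt_eqF.
have [i0 _ hi0] := @arg_maxP _ R 'I_N.+1 ord0 xpredT (fun i => a i) isT.
apply: (@le_trans _ _ (N.+1%:R `^ r * a i0 `^ r)).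
 rewrite -powRM//; apply: ler_powR2; rewrite ?(ltW r0)//; first side.
 rewrite -[X in X%:R * _](card_ord N.+1) -sum1_card natr_sum mulr_suml.
 by apply: ler_sum => i _; rewrite mul1r; exact: hi0.
rewrite ler_wpM2l ?powR_ge0// (bigD1 i0)//= lerDl; apply: sumr_ge0 => i _; exact: powR_ge0.
Qed.

(** Discrete form of [d(S^r) = r S^(r-1) dS] for the tails [S_j], the sum of [a_k] over [k >= j].
    Each [a_j] is thereby paired with later terms only, that is, with coarser scales in the
    application. *)
Lemma powR_sum_tails r (N : nat) (a : nat -> R) : 1 <= r ->
 (forall i, 0 <= a i) ->
 (\sum_(i < N) a i) `^ r <=
  r * \sum_(j < N) a j * (\sum_(j <= k < N) a k) `^ (r - 1).
move=> r1 a0; have r0 : r != 0 by rewrite gt_eqF// (lt_le_trans ltr01).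
pose S j := \sum_(j <= k < N) a k.
have S0 j : 0 <= S j by exact: sumr_ge0.
suff h m : (m <= N)%N -> S (N - m)%N `^ r <=
  r * \sum_(N - m <= j < N) a j * S j `^ (r - 1).
 by have := h N (leqnn _); rewrite subnn /S !big_mkord.
elim: m => [_|m IH mN].
 by rewrite subn0 /S !big_geq// mulr0 powR0.
have mN' : (N - m.+1 < N)%N by rewrite ltn_subrL (leq_trans _ mN).
have := IH (ltnW mN); rewrite -subnSK// => {}IH.
rewrite big_ltn// mulrDr -lerBlDr.
move: (N - m.+1)%N mN' IH => l lN IH.
have SE : S l = a l + S l.+1 by rewrite /S big_ltn.
have SS : S l.+1 <= S l by rewrite SE lerDr.
apply: le_trans (lerB (lexx _) IH) _.
apply: le_trans (powR_sub_le r1 (S0 l.+1) SS) _.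
by rewrite {1}SE addrK mulrA.
Qed.

End powR_inequalities.

(** * Jensen's inequality and the heat semigroup on nonnegative functions *)

Section probability_kernel.
Context d (T : measurableType d) (R : realType) (mu : {measure set T -> \bar R}).
Variable k : T -> R.
Hypotheses (mk : measurable_fun setT k) (k0 : forall x, 0 <= k x)
 (k1 : (\int[mu]_x (k x)%:E = 1)%E).

Lemma kernel_cst (c : R) : 0 <= c -> (\int[mu]_x (k x * c)%:E = c%:E)%E.
move=> c0; under eq_integral do rewrite mulrC EFinM.
rewrite ge0_integralZl//; first by rewrite k1 mule1.
- side.
- side.
Qed.

(** The tangent-line inequality [young_powR] at the mean [m], integrated against the kernel. *)
Lemma kernel_jensen (r m : R) (u : T -> R) : 1 <= r -> measurable_fun setT u ->
 (forall x, 0 <= u x) -> (\int[mu]_x (k x * u x)%:E = m%:E)%E ->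
 ((m `^ r)%:E <= \int[mu]_x (k x * u x `^ r)%:E)%E.
move=> r1 mu_ u0 um.
have m0 : 0 <= m.
 by rewrite -lee_fin -um integral_ge0// => x _; rewrite lee_fin mulr_ge0.
have r10 : 0 <= r - 1 by side.
have mur : measurable_fun setT (fun x => u x `^ r).
 side.
have h : (\int[mu]_x (k x * (r * m `^ (r - 1) * u x))%:E <=
  \int[mu]_x (k x * (u x `^ r + (r - 1) * m `^ r))%:E)%E.
 apply: le_integralW => // x _.
  side.
 by rewrite lee_fin ler_wpM2l// young_powR.
have c0 : 0 <= r * m `^ (r - 1) by side.
have L : (\int[mu]_x (k x * (r * m `^ (r - 1) * u x))%:E = (r * m `^ r)%:E)%E.
 under eq_integral do rewrite mulrCA EFinM.
 rewrite ge0_integralZl//.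
 - by rewrite um -EFinM -mulrA [m `^ _ * m]mulrC -powR_mulr1.
 - side.
 - side.
have Rr : (\int[mu]_x (k x * (u x `^ r + (r - 1) * m `^ r))%:E =
  \int[mu]_x (k x * u x `^ r)%:E + ((r - 1) * m `^ r)%:E)%E.
 under eq_integral do rewrite mulrDr EFinD.
 rewrite ge0_integralD//.
 - by rewrite kernel_cst// mulr_ge0 ?powR_ge0.
 - side.
 - side.
 - side.
 - side.
move: h; rewrite L Rr -leeBlDr// -EFinB (_ : _ - _ = m `^ r)//.
by ring.
Qed.

End probability_kernel.

Local Opaque heat_kernel.

Section scalar_heat.
Context (R : realType) (n : nat).
Local Notation T := (Rn R n).
Local Notation mu := (lebesgue_Rn R n).
Local Notation K := (@heat_kernel R n).
Implicit Types (h g phi psi : T -> R) (r s t : R).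

(** Extended-real, so that Tonelli's theorem applies without integrability. [heatop] is its real
    value, and agrees with it at positive times on [Lplus r] functions with [1 <= r] and on bounded
    nonnegative functions. *)
Definition heat_int t h x : \bar R := (\int[mu]_y (K t x y * h y)%:E)%E.

Definition Lplus r h := [/\ measurable_fun setT h, forall x, 0 <= h x &
 (\int[mu]_x (h x `^ r)%:E < +oo)%E].

Lemma meas_heat_int2 t h : measurable_fun setT h ->
 measurable_fun setT (fun z : T * T => (K t z.1 z.2 * h z.2)%:E).
move=> mh; apply/measurable_EFinP; apply: measurable_funM.
 exact: meas_heat_kernel2.
exact: (measurableT_comp mh measurable_snd).
Qed.

Lemma meas_heat_intl t x h : measurable_fun setT h ->
 measurable_fun setT (fun y => K t x y * h y).
by move=> mh; apply: measurable_funM => //; exact: meas_heat_kernel. Qed.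

Lemma heat_int_ge0 t h x : (forall y, 0 <= h y) -> (0 <= heat_int t h x)%E.
move=> h0; apply: integral_ge0 => y _.
side.
Qed.

Lemma meas_heat_int t h : measurable_fun setT h ->
 (forall x, 0 <= h x) -> measurable_fun setT (heat_int t h).
move=> mh h0.
apply: (measurable_fun_fubini_tonelli_F (m2 := mu)
 (fun z : T * T => (K t z.1 z.2 * h z.2)%:E)).
 exact: meas_heat_int2.
side.
Qed.

Lemma heat_int_sym t phi psi : measurable_fun setT phi ->
 measurable_fun setT psi -> (forall x, 0 <= phi x) -> (forall x, 0 <= psi x) ->
 (\int[mu]_x ((phi x)%:E * heat_int t psi x) =
  \int[mu]_x (heat_int t phi x * (psi x)%:E))%E.
move=> mp ms p0 s0.
pose F (z : T * T) := (phi z.1 * (K t z.1 z.2 * psi z.2))%:E.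
have F0 z : (0 <= F z)%E.
 by rewrite /F lee_fin mulr_ge0// mulr_ge0// kernel_ge0.
have mF : measurable_fun setT F.
 apply/measurable_EFinP; apply: measurable_funM.
  exact: (measurableT_comp mp measurable_fst).
 by apply/measurable_EFinP; exact: meas_heat_int2.
transitivity (\int[mu]_x \int[mu]_y F (x, y))%E.
 apply: eq_integral => x _; rewrite -ge0_integralZl//.
 - side.
 - side.
 - side.
rewrite fubini_tonelli//; apply: eq_integral => y _.
rewrite -ge0_integralZr//.
- by apply: eq_integral => x _; rewrite /F/= kernelC -EFinM; congr (_%:E); ring.
- side.
- side.
- side.
Qed.

Lemma heat_int_semigroup s t h x : 0 < s -> 0 < t -> measurable_fun setT h ->
 (forall x, 0 <= h x) ->
 (\int[mu]_y ((K s x y)%:E * heat_int t h y) = heat_int (s + t) h x)%E.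
move=> s0 t0 mh h0.
pose F (z : T * T) := (K s x z.1 * (K t z.1 z.2 * h z.2))%:E.
have F0 z : (0 <= F z)%E.
 rewrite /F lee_fin mulr_ge0 ?kernel_ge0//.
 side.
have mF : measurable_fun setT F.
 apply/measurable_EFinP; apply: measurable_funM.
  exact: (measurableT_comp (meas_heat_kernel s x) measurable_fst).
 by apply/measurable_EFinP; exact: meas_heat_int2.
transitivity (\int[mu]_y \int[mu]_z F (y, z))%E.
 apply: eq_integral => y _; rewrite -ge0_integralZl//.
 - side.
 - side.
 - side.
rewrite fubini_tonelli//; apply: eq_integral => z _.
rewrite EFinM -heat_kernel_semigroup// -ge0_integralZr//.
- by apply: eq_integral => y _; rewrite /F/= -EFinM; congr (_%:E); ring.
- apply/measurable_EFinP; apply: measurable_funM; first side.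
 by under eq_fun do rewrite kernelC; exact: meas_heat_kernel.
- side.
- side.
Qed.

Lemma heat_kernel_ub t (x y : T) : 0 < t ->
 K t x y <= ((4 * pi * t) `^ (n%:R / 2))^-1.
move=> t0; rewrite kernelE ler_piMr ?invr_ge0 ?powR_ge0//.
by rewrite -expR0 ler_expR oppr_le0 divr_ge0 ?sqd_ge0// mulr_ge0// ltW.
Qed.

Lemma heat_int_cst t x c : 0 < t -> 0 <= c -> heat_int t (cst c) x = c%:E.
move=> t0 c0; apply: kernel_cst => //.
- side.
- side.
- exact: integral_kernel.
Qed.

(** Where [h <= 1] the kernel bounds the integrand; elsewhere [h <= h ^ r] and the kernel is bounded
    by its normalization. *)
Lemma heat_int_fin r t h x : 0 < t -> 1 <= r -> Lplus r h ->
 heat_int t h x \is a fin_num.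
move=> t0 r1 [mh h0 hr]; rewrite ge0_fin_numE ?heat_int_ge0//.
have mhr : measurable_fun setT (fun x => h x `^ r).
 side.
pose c := ((4 * pi * t) `^ (n%:R / 2))^-1 : R.
have c0 : 0 <= c by rewrite invr_ge0 powR_ge0.
apply: (@le_lt_trans _ _ (\int[mu]_y ((K t x y)%:E + c%:E * (h y `^ r)%:E))%E).
 apply: le_integralW => // y _.
  side.
 rewrite -EFinM -EFinD lee_fin.
 have := @young_powR R r 1 (h y) r1 ler01 (h0 y).
 rewrite !powR1 !mulr1 => hy.
 have [h1|h1] := leP (h y) 1.
  by rewrite ler_wpDr ?mulr_ge0 ?powR_ge0// ler_piMr// kernel_ge0.
 rewrite ler_wpDl ?kernel_ge0//.
 apply: ler_pM => //; rewrite ?kernel_ge0//; first exact: heat_kernel_ub.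
 by rewrite -{1}[h y]powRr1// ler_powR// ltW.
rewrite ge0_integralD//.
- rewrite integral_kernel// ge0_integralZl//.
 + by rewrite lte_add_pinfty ?ltry// lte_mul_pinfty.
 + side.
 + side.
- side.
- side.
- side.
- side.
Qed.

Lemma heat_int_jensen r t h x : 0 < t -> 1 <= r -> Lplus r h ->
 ((fine (heat_int t h x) `^ r)%:E <= heat_int t (fun y => (h y `^ r)%R) x)%E.
move=> t0 r1 hr; have [mh h0 _] := hr; apply: kernel_jensen => //.
- side.
- side.
- exact: integral_kernel.
- by rewrite -[LHS]/(heat_int t h x) fineK// (heat_int_fin _ t0 r1 hr).
Qed.

Definition heatop t h x : R := fine (heat_int t h x).

Lemma heatop_ge0 t h x : (forall y, 0 <= h y) -> 0 <= heatop t h x.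
by move=> h0; exact: fine_ge0 (heat_int_ge0 _ _ h0). Qed.

Lemma heatopK r t h x : 0 < t -> 1 <= r -> Lplus r h ->
 (heatop t h x)%:E = heat_int t h x.
by move=> t0 r1 hr; rewrite fineK// (heat_int_fin _ t0 r1 hr). Qed.

Lemma integral_heat_int t h : 0 < t -> measurable_fun setT h ->
 (forall x, 0 <= h x) -> (\int[mu]_x heat_int t h x = \int[mu]_x (h x)%:E)%E.
move=> t0 mh h0.
rewrite -[LHS](eq_integral _ _ (fun x _ => mul1e (heat_int t h x))).
have := @heat_int_sym t (cst 1) h (measurable_cst _) mh (fun=> ler01) h0.
rewrite /= => ->; apply: eq_integral => x _.
by rewrite heat_int_cst// mul1e.
Qed.

Lemma meas_heatop t h : measurable_fun setT h ->
 (forall x, 0 <= h x) -> measurable_fun setT (heatop t h).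
by move=> mh h0; apply: measurableT_comp => //; exact: meas_heat_int. Qed.

Lemma integral_heatop_powR r t h : 0 < t -> 1 <= r -> Lplus r h ->
 (\int[mu]_x (heatop t h x `^ r)%:E <= \int[mu]_x (h x `^ r)%:E)%E.
move=> t0 r1 hr; have [mh h0 _] := hr.
rewrite -(integral_heat_int t0 (h := fun y => h y `^ r)).
- apply: le_integralW => // x _; first side.
 exact: heat_int_jensen.
- side.
- side.
Qed.

Lemma Lplus_heatop r t h : 0 < t -> 1 <= r -> Lplus r h -> Lplus r (heatop t h).
move=> t0 r1 hr; have [mh h0 hf] := hr; split.
- exact: meas_heatop.
- by move=> x; exact: heatop_ge0.
- exact: le_lt_trans (integral_heatop_powR t0 r1 hr) hf.
Qed.

Lemma heatop_semigroup r s t h x : 0 < s -> 0 < t -> 1 <= r -> Lplus r h ->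
 heatop s (heatop t h) x = heatop (s + t) h x.
move=> s0 t0 r1 hr; have [mh h0 _] := hr; congr fine.
rewrite -heat_int_semigroup//; apply: eq_integral => y _.
by rewrite EFinM (heatopK _ t0 r1 hr).
Qed.

Lemma heat_int_le t g h x : (forall y, 0 <= g y) -> (forall y, g y <= h y) ->
 (heat_int t g x <= heat_int t h x)%E.
move=> g0 gh; apply: le_integralW => // y _.
 side.
by rewrite lee_fin ler_wpM2l// kernel_ge0.
Qed.

Lemma heatop_shift r t e h x y : 0 < t -> 0 < e -> 1 <= r -> Lplus r h ->
 heatop t h y <= (1 + e) `^ (n%:R / 2) * expR (sqd x y / (4 * t * e)) *
  heatop ((1 + e) * t) h x.
move=> t0 e0 r1 hr; have [mh h0 _] := hr.
have et0 : 0 < (1 + e) * t by side.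
set c := _ * expR _.
have c0 : 0 <= c by rewrite mulr_ge0 ?powR_ge0 ?expR_ge0.
rewrite -lee_fin EFinM (heatopK _ t0 r1 hr) (heatopK _ et0 r1 hr).
rewrite -ge0_integralZl//.
- apply: le_integralW => // z _.
  side.
 by rewrite -EFinM lee_fin mulrA ler_wpM2r// heat_kernel_shift.
- side.
- side.
Qed.

(** A Gaussian weight of rate [1 / (8 t)] is paid for exactly by doubling the time. Most constants
    in the times below come from this identity. *)
Lemma heat_kernel_gauss t (x y : T) : 0 < t ->
 expR (sqd x y / (8 * t)) * K t x y = 2 `^ (n%:R / 2) * K (2 * t) x y.
move=> t0; rewrite !kernelE.
rewrite (_ : 4 * pi * (2 * t) = 2 * (4 * pi * t)); last by ring.
rewrite (@powRM _ 2 (4 * pi * t)) ?(ltW (fourpi_gt0 t0))//.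
have A0 : 0 < 2 `^ (n%:R / 2) :> R by side.
have P0 : 0 < (4 * pi * t) `^ (n%:R / 2) by side.
rewrite (_ : - (sqd x y / (4 * (2 * t))) =
  sqd x y / (8 * t) + - (sqd x y / (4 * t))); last by field; rewrite gt_eqF.
by rewrite expRD; field; rewrite !gt_eqF.
Qed.

End scalar_heat.

(** * Maximal theorem for dyadic heat times *)

Section maximal_theorem.
Context (R : realType) (n : nat).
Local Notation T := (Rn R n).
Local Notation mu := (lebesgue_Rn R n).
Implicit Types (h g : T -> R) (phi : nat -> T -> R) (r t : R).

Lemma LplusS r (g h : T -> R) : 0 <= r -> measurable_fun setT g ->
 (forall x, 0 <= g x) -> (forall x, g x <= h x) -> Lplus r h -> Lplus r g.
move=> r0 mg g0 gh [mh h0 hr]; split; [exact: mg|exact: g0|].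
apply: le_lt_trans hr; apply: le_integralW => // x _.
 side.
by rewrite lee_fin ler_powR2.
Qed.

Lemma meas_sum_fun (N : nat) (F : nat -> T -> R) (a : nat) :
 (forall i, measurable_fun setT (F i)) ->
 measurable_fun setT (fun x => \sum_(a <= i < N) F i x).
by move=> mF; apply: measurable_sum. Qed.

(* c bounds the norm of the operator (phi_i) |-> sum_i P_{t 4^i} phi_i, dual to
  the maximal operator over N consecutive dyadic times. *)
Definition dual_bound r (N : nat) (c : R) := forall t phi, 0 < t ->
 (forall i, measurable_fun setT (phi i)) -> (forall i x, 0 <= phi i x) ->
 (\int[mu]_x ((\sum_(i < N) phi i x) `^ r)%:E < +oo)%E ->
 (\int[mu]_x ((\sum_(i < N) heatop (t * 4 ^+ i) (phi i) x) `^ r)%:E <=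
  c%:E * \int[mu]_x ((\sum_(i < N) phi i x) `^ r)%:E)%E.

Lemma time4_gt0 t i : 0 < t -> 0 < t * 4 ^+ i.
by move=> t0; rewrite mulr_gt0// exprn_gt0. Qed.

Lemma Lplus_summand r (N : nat) phi (i : 'I_N) : 1 <= r ->
 (forall i, measurable_fun setT (phi i)) -> (forall i x, 0 <= phi i x) ->
 (\int[mu]_x ((\sum_(i < N) phi i x) `^ r)%:E < +oo)%E -> Lplus r (phi i).
move=> r1 mp p0 pr; have r0 : 0 <= r by exact: le_trans r1.
apply: (@LplusS _ _ (fun x => \sum_(i < N) phi i x)) => //.
 by move=> x; rewrite (bigD1 i)//= lerDl sumr_ge0.
split => //; last side.
side.
Qed.

(** A bound depending on [N], from which the contraction of [dual_bound_step] can be iterated. *)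
Lemma dual_bound_trivial r N : 1 <= r -> dual_bound r N (N%:R `^ r * N%:R).
move=> r1 t phi t0 mp p0 pr; have r0 : 0 < r by exact: lt_le_trans r1.
have L i : Lplus r (phi (nat_of_ord i)) := @Lplus_summand r N phi i r1 mp p0 pr.
apply: (@le_trans _ _ (\int[mu]_x (N%:R `^ r *
  \sum_(i < N) heatop (t * 4 ^+ i) (phi i) x `^ r)%:E)%E).
 apply: le_integralW => // x _; first side.
 rewrite lee_fin (powR_sum_le N (a := fun i => heatop (t * 4 ^+ i) (phi i) x))//.
 by move=> i; exact: heatop_ge0.
under eq_integral do rewrite EFinM -sumEFin.
rewrite ge0_integralZl//; last 2 first.
- apply: emeasurable_sum => i; apply/measurable_EFinP.
 by apply: meas_powR; exact: meas_heatop.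
- side.
rewrite EFinM -muleA; apply: lee_pmul => //.
 side.
rewrite ge0_integral_sum//; last first.
- side.
- move=> i; apply/measurable_EFinP.
 by apply: meas_powR; exact: meas_heatop.
set I := (\int[mu]_x _)%E.
apply: (@le_trans _ _ (\sum_(i < N) I)%E).
 apply: lee_sum => i _.
 apply: le_trans (integral_heatop_powR (time4_gt0 _ t0) r1 (L i)) _.
 apply: le_integralW => // x _; first side.
 rewrite lee_fin ler_powR2 ?(ltW r0)//.
 by rewrite (bigD1 i)//= lerDl sumr_ge0.
rewrite le_eqVlt; apply/orP; left; apply/eqP.
by rewrite sumr_const card_ord mule_natl.
Qed.

Lemma heatop_le_time s t h x r : 0 < s -> s <= t -> 1 <= r -> Lplus r h ->
 heatop s h x <= (t / s) `^ (n%:R / 2) * heatop t h x.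
move=> s0 st r1 hr; have t0 := lt_le_trans s0 st; have [mh h0 _] := hr.
have c0 : 0 <= (t / s) `^ (n%:R / 2) by side.
rewrite -lee_fin EFinM (heatopK _ s0 r1 hr) (heatopK _ t0 r1 hr).
rewrite -ge0_integralZl//.
- apply: le_integralW => // y _.
  side.
 by rewrite -EFinM lee_fin mulrA ler_wpM2r// heat_kernel_le.
- side.
- side.
Qed.

(* Duality moves P_{t_j} from phi_j onto the tail of coarser scales, which
  varies slowly at scale t_j. *)
Lemma dual_bound_step r : 1 < r -> exists2 C, 0 < C &
 forall N c, dual_bound r N c -> dual_bound r N (c / 2 + C).
move=> r1; have r10 : 0 < r - 1 by rewrite subr_gt0.
have r0 : 0 < r by side.
have r1w := ltW r1.
(* With this [e], the power [r - 1] of the weight [exp (|x - y|^2 / (4 tau e))] from [heatop_shift]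
   is [exp (|x - y|^2 / (8 tau))], the weight that [heat_kernel_gauss] absorbs. *)
pose e := 2 * (r - 1) : R.
have e0 : 0 < e by exact: mulr_gt0.
pose A := ((1 + e) `^ (n%:R / 2)) `^ (r - 1) * 2 `^ (n%:R / 2) : R.
have A0 : 0 < A by rewrite mulr_gt0// !powR_gt0// addr_gt0.
(* Makes [r * A * d = 1 / 2], the factor by which the old constant [c] is contracted. *)
pose d := (2 * r * A)^-1 : R.
have d0 : 0 < d.
 by rewrite invr_gt0; apply: mulr_gt0 => //; apply: mulr_gt0.
exists (r * A * d `^ (1 - r)).
 side.
move=> N c cb t phi t0 mp p0 pr.
have L i : Lplus r (phi (nat_of_ord i)) := @Lplus_summand r N phi i r1w mp p0 pr.
pose tau i := t * 4 ^+ i.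
have tau0 i : 0 < tau i by exact: time4_gt0.
pose te := (1 + e) * t.
have te0 : 0 < te by rewrite mulr_gt0// addr_gt0.
have tauE i : te * 4 ^+ i = (1 + e) * tau i by rewrite mulrA.
pose a i x := heatop (tau i) (phi i) x.
pose u x := \sum_(i < N) heatop (te * 4 ^+ i) (phi i) x.
pose S j x := \sum_(j <= k < N) a k x.
have a0 i x : 0 <= a i x by exact: heatop_ge0.
have ma i : measurable_fun setT (a i) by exact: meas_heatop.
have S0 j x : 0 <= S j x by exact: sumr_ge0.
have mS j : measurable_fun setT (S j) by exact: meas_sum_fun.
have u0 x : 0 <= u x by apply: sumr_ge0 => i _; exact: heatop_ge0.
have mu_ : measurable_fun setT u.
 by apply: measurable_sum => i; exact: meas_heatop.
pose F x := \sum_(i < N) phi i x.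
have F0 x : 0 <= F x by exact: sumr_ge0.
have mF : measurable_fun setT F by apply: measurable_sum => i; exact: mp.
(* All times in the tail [S j] are at least [tau j], so its value at [y] is controlled by [u x] up
   to a Gaussian weight at the single scale [tau j], which averaging at time [tau j] removes. *)
have shift (j : 'I_N) x : (heat_int (tau j) (fun y => (S j y `^ (r - 1))%R) x <=
  (A * u x `^ (r - 1))%:E)%E.
 pose B := ((1 + e) `^ (n%:R / 2)) `^ (r - 1) : R.
 apply: (@le_trans _ _ (\int[mu]_y ((B * u x `^ (r - 1) * 2 `^ (n%:R / 2))%:E *
   (heat_kernel (2 * tau j) x y)%:E))%E).
  apply: le_integralW => // y _.
   side.
  rewrite -EFinM lee_fin -[leRHS]mulrA -heat_kernel_gauss// mulrA mulrC.
  rewrite ler_wpM2r ?kernel_ge0//.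
  rewrite (_ : expR _ = expR (sqd x y / (4 * tau j * e)) `^ (r - 1)); last first.
   rewrite -expRM; congr expR; rewrite /e; field.
   side.
  rewrite mulrAC /B -powRM ?powR_ge0 ?expR_ge0//.
  rewrite -powRM ?mulr_ge0 ?powR_ge0 ?expR_ge0//.
  apply: ler_powR2; rewrite ?(ltW r10)//.
  apply: (@le_trans _ _ (\sum_(j <= k < N) ((1 + e) `^ (n%:R / 2) *
    expR (sqd x y / (4 * tau j * e))) * heatop (te * 4 ^+ k) (phi k) x)).
   rewrite /S !big_nat; apply: ler_sum => k /andP[jk kN].
   rewrite tauE; apply: le_trans (heatop_shift x y (tau0 k) e0 r1w (L (Ordinal kN))) _.
   rewrite ler_wpM2r ?heatop_ge0// ler_wpM2l ?powR_ge0// ler_expR.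
   rewrite ler_wpM2l ?sqd_ge0// lef_pV2 ?posrE ?mulr_gt0//.
   by rewrite ler_pM2r// ler_pM2l// ler_pM2l// ler_weXn2l// ler1n.
  rewrite -mulr_sumr ler_wpM2l ?mulr_ge0 ?powR_ge0 ?expR_ge0//.
  rewrite /u -(big_mkord xpredT (fun k => heatop (te * 4 ^+ k) (phi k) x)).
  rewrite [leRHS](@big_cat_nat _ _ _ j)//= ?(ltnW (ltn_ord j))//.
  by rewrite lerDr sumr_ge0// => k _; exact: heatop_ge0.
 rewrite ge0_integralZl//; last 3 first.
 - side.
 - side.
 - by rewrite lee_fin !mulr_ge0 ?powR_ge0.
 rewrite integral_kernel ?mulr_gt0// mule1 lee_fin /A -/B.
 by rewrite mulrAC.
have main : (\int[mu]_x ((\sum_(i < N) a i x) `^ r)%:E <=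
  (r * A)%:E * \int[mu]_x (F x * u x `^ (r - 1))%:E)%E.
 have mSr j : measurable_fun setT (fun x => S j x `^ (r - 1)).
  side.
 have mur : measurable_fun setT (fun x => u x `^ (r - 1)).
  side.
 apply: (@le_trans _ _ (\int[mu]_x (r%:E *
   \sum_(j < N) (a j x * S j x `^ (r - 1))%:E))%E).
  apply: le_integralW => // x _; first side.
  by rewrite sumEFin -EFinM lee_fin (powR_sum_tails N (a := fun i => a i x)).
 rewrite ge0_integralZl//; last 3 first.
 - apply: emeasurable_sum => i; apply/measurable_EFinP; exact: measurable_funM.
 - side.
 - side.
 rewrite EFinM -muleA; apply: lee_pmul => //.
 - side.
 - side.
 rewrite ge0_integral_sum//; [|side..].
 rewrite -ge0_integralZl//; [|side..].
 rewrite (_ : (fun x => (A%:E * (F x * u x `^ (r - 1))%:E)%E) =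
  (fun x => \sum_(j < N) (phi j x * (A * u x `^ (r - 1)))%:E)%E); last first.
  by apply/funext => x; rewrite sumEFin -mulr_suml -EFinM mulrCA.
 rewrite ge0_integral_sum//; [|side..].
 apply: lee_sum => j _.
 under eq_integral do rewrite EFinM (heatopK _ (tau0 j) r1w (L j)).
 rewrite -(@heat_int_sym _ _ (tau j) (phi j) (fun x => S j x `^ (r - 1)))//; last side.
 apply: le_integralW => // x _.
  by apply: mule_ge0; rewrite ?lee_fin// heat_int_ge0// => y; exact: powR_ge0.
 by rewrite EFinM lee_wpmul2l ?lee_fin//; exact: shift.
apply: le_trans main _.
have young : (\int[mu]_x (F x * u x `^ (r - 1))%:E <=
  d%:E * \int[mu]_x (u x `^ r)%:E + (d `^ (1 - r))%:E * \int[mu]_x (F x `^ r)%:E)%E.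
 have := @integral_young _ _ _ mu r d F (fun x => u x `^ (r - 1)) r1 d0.
 have -> : (fun x => ((u x `^ (r - 1)) `^ (r / (r - 1)))%:E) = (fun x => (u x `^ r)%:E).
  by apply/funext => x; rewrite -powRrM [(r - 1) * _]mulrC divfK ?gt_eqF.
 by apply => //; side.
have U := cb te phi te0 mp p0 pr.
set I := (\int[mu]_x ((F x) `^ r)%:E)%E in young U *.
have I0 : (0 <= I)%E by apply: integral_ge0 => x _; rewrite lee_fin powR_ge0.
have rA0 : (0 <= (r * A)%:E)%E by side.
apply: (le_trans (lee_wpmul2l rA0 young)).
apply: (@le_trans _ _ ((r * A)%:E * (d%:E * (c%:E * I) + (d `^ (1 - r))%:E * I))%E).
 apply: lee_wpmul2l => //; apply: leeD => //.
 by apply: lee_wpmul2l => //; rewrite lee_fin ltW.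
have rA : r * A * d = 2^-1 by rewrite /d; field; rewrite !gt_eqF.
rewrite le_eqVlt; apply/orP; left; apply/eqP; rewrite -(fineK (_ : I \is a fin_num)) ?(ge0_fin_numE I0)//.
move: (fine I) => J; rewrite -!(EFinM, EFinD); congr EFin.
by rewrite mulrDr mulrDl mulrA rA; ring.
Qed.

(** The map sending [c] to [c / 2 + C] has fixed point [2 * C]. Iterated from the trivial constant,
    it brings the excess over [2 * C] below 1 after finitely many steps, and the dependence on [N]
    disappears. *)
Lemma dual_theorem r : 1 < r -> exists2 C, 0 < C & forall N, dual_bound r N C.
move=> r1; have [C C0 step] := dual_bound_step r1.
exists (2 * C + 1); first side.
move=> N; pose c0 : R := N%:R `^ r * N%:R.
have c00 : 0 <= c0 by rewrite mulr_ge0// powR_ge0.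
have it k : dual_bound r N (c0 / 2 ^+ k + 2 * C).
 elim: k => [|k /step].
  rewrite expr0 divr1 => t phi t0 mp p0 pr.
  apply: le_trans (dual_bound_trivial (ltW r1) t0 mp p0 pr) _.
  rewrite lee_wpmul2r//; last by rewrite lee_fin lerDl mulr_ge0// ltW.
  side.
 congr dual_bound; rewrite exprS; field.
 side.
move=> t phi t0 mp p0 pr.
have [k hk] : exists k : nat, c0 / 2 ^+ k <= 1.
 exists (Num.truncn c0).+1; rewrite ler_pdivrMr ?exprn_gt0// mul1r.
 apply: le_trans (ltW (truncnS_gt _)) _.
 by rewrite -natrX ler_nat ltnW// ltn_expl.
apply: le_trans (it k t phi t0 mp p0 pr) _.
rewrite lee_wpmul2r//; last by rewrite lee_fin addrC lerD2l.
side.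
Qed.

Fixpoint heat_max (N : nat) t h x : R :=
 if N is k.+1 then Num.max (heat_max k t h x) (heatop (t * 4 ^+ k) h x) else 0.

Lemma heat_max_ge0 N t h x : 0 <= heat_max N t h x.
by elim: N => //= N IH; rewrite le_max IH. Qed.

Lemma le_heat_max N t h x i : (i < N)%N -> heatop (t * 4 ^+ i) h x <= heat_max N t h x.
elim: N => //= N IH; rewrite ltnS leq_eqVlt => /predU1P[->|/IH h'].
 by rewrite le_max lexx orbT.
by rewrite le_max h'.
Qed.

Lemma meas_heat_max N t h : measurable_fun setT h -> (forall x, 0 <= h x) ->
 measurable_fun setT (heat_max N t h).
move=> mh h0; elim: N => [|N IH] /=; first side.
apply: measurable_maxr => //; exact: meas_heatop.
Qed.

Lemma heat_max_Lplus r N t h : 0 < t -> 1 <= r -> Lplus r h -> Lplus r (heat_max N t h).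
move=> t0 r1 hr; have [mh h0 _] := hr; have r0 : 0 < r by exact: lt_le_trans r1.
elim: N => [|N IH].
 split; [exact: measurable_cst|by []|].
 under eq_integral do rewrite /= powR0 ?gt_eqF//.
 by rewrite integral0.
have [m1 _ i1] := IH; have [m2 _ i2] := Lplus_heatop (time4_gt0 N t0) r1 hr.
split; [exact: meas_heat_max|by move=> x; exact: heat_max_ge0|].
apply: (@le_lt_trans _ _ (\int[mu]_x ((heat_max N t h x `^ r)%:E +
  (heatop (t * 4 ^+ N) h x `^ r)%:E))%E).
 apply: le_integralW => // x _; first side.
 rewrite -EFinD lee_fin /=; case: (leP (heat_max N t h x)) => _.
  by rewrite lerDr powR_ge0.
 by rewrite lerDl powR_ge0.
rewrite ge0_integralD//.
- by apply: lte_add_pinfty; [exact: i1|exact: i2].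
- side.
- side.
- side.
- side.
Qed.

(** Linearization: [w ^ (p - 1)] is split into pieces [phi i] according to the scale attaining the
    maximum. Symmetry moves the semigroup onto the pieces, the dual bound controls their sum, and
    Young's inequality leaves half of the integral of [w ^ p], which is absorbed because it is
    finite for each [N]. *)
Theorem heat_maximal_theorem p : 1 < p -> exists2 C, 0 < C &
 forall N t h, 0 < t -> Lplus p h ->
 (\int[mu]_x (heat_max N t h x `^ p)%:E <= C%:E * \int[mu]_x (h x `^ p)%:E)%E.
move=> p1; have p10 : 0 < p - 1 by rewrite subr_gt0.
have p0 : 0 < p by side.
pose q := p / (p - 1); have q1 : 1 < q by rewrite ltr_pdivlMr// mul1r gtrBl.
have [D D0 dual] := dual_theorem q1.
pose d : R := (2 * D)^-1; have d0 : 0 < d by rewrite invr_gt0 mulr_gt0.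
exists (2 * d `^ (1 - p)); first side.
move=> N t h t0 hp; have [mh h0 hf] := hp; have p1w := ltW p1.
pose w := heat_max N t h.
have [mw w0 wf] : Lplus p w := heat_max_Lplus N t0 p1w hp.
pose A i := [set x | heat_max i t h x < w x].
have mA i : measurable (A i).
 rewrite -[A i]setTI; apply: measurable_fun_ltr => //; exact: meas_heat_max.
(* phi_i is w ^ (p - 1) on the set where the maximum is first attained at i *)
pose phi i x := w x `^ (p - 1) * (\1_(A i) x - \1_(A i.+1) x).
have indE i x : \1_(A i) x = (heat_max i t h x < w x)%R%:R :> R.
 rewrite indicE; have [h1|h1] := boolP (heat_max i t h x < w x)%R.
  by rewrite mem_set.
 by rewrite memNset//; exact/negP.
have phi_ge i x : 0 <= phi i x.
 rewrite mulr_ge0 ?powR_ge0// subr_ge0 !indE ler_nat.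
 case: (ltP (heat_max i.+1 t h x)) => //= h1.
 by move: h1; rewrite gt_max => /andP[-> _].
have phi_w i x : phi i x * w x <= phi i x * heatop (t * 4 ^+ i) h x.
 have [->|] := eqVneq (phi i x) 0; first by rewrite !mul0r.
 move=> phin; rewrite ler_wpM2l//; move: phin; rewrite /phi !indE.
 case: (ltP (heat_max i t h x)) => h1; case: (ltP (heat_max i.+1 t h x)) => h2.
 - by rewrite subrr mulr0 eqxx.
 - by move: h2; rewrite /= le_max leNgt h1.
 - move: h2; rewrite /= gt_max => /andP[h2 _].
  by move: h1; rewrite leNgt h2.
 - by rewrite subrr mulr0 eqxx.
have phi_sum x : \sum_(i < N) phi i x = w x `^ (p - 1) * (0 < w x)%R%:R.
 rewrite -mulr_sumr; congr (_ * _).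
 rewrite -(big_mkord xpredT (fun i => \1_(A i) x - \1_(A i.+1) x : R)).
 rewrite (@telescope_sumr_eq _ 0 N (fun i => - \1_(A i) x))//; last first.
  by move=> i _; rewrite opprK addrC.
 by rewrite opprK addrC !indE ltxx /= subr0.
have mphi i : measurable_fun setT (phi i).
 apply: measurable_funM; first side.
 side.
have phi_q : (\int[mu]_x ((\sum_(i < N) phi i x) `^ q)%:E <=
  \int[mu]_x (w x `^ p)%:E)%E.
 apply: le_integralW => // x _; first side.
 rewrite lee_fin phi_sum.
 have -> : w x `^ p = (w x `^ (p - 1)) `^ q by rewrite -powRrM /q mulrC divfK// gt_eqF.
 apply: ler_powR2; [exact: le_trans ler01 (ltW q1)|by rewrite mulr_ge0 ?powR_ge0|].
 by case: (0 < w x); rewrite ?mulr1 ?mulr0 ?powR_ge0.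
have phi_fin := le_lt_trans phi_q wf.
have L (i : 'I_N) : Lplus q (phi i) := @Lplus_summand q N phi i (ltW q1) mphi phi_ge phi_fin.
pose v x := \sum_(i < N) heatop (t * 4 ^+ i) (phi i) x.
have v0 x : 0 <= v x by apply: sumr_ge0 => i _; exact: heatop_ge0.
have mv : measurable_fun setT v by apply: measurable_sum => i; exact: meas_heatop.
have dualv := dual N t phi t0 mphi phi_ge phi_fin.
have step1 : (\int[mu]_x (w x `^ p)%:E <= \int[mu]_x (h x * v x)%:E)%E.
 apply: (@le_trans _ _ (\int[mu]_x
   \sum_(i < N) (phi i x * heatop (t * 4 ^+ i) h x)%:E)%E).
  apply: le_integralW => // x _; first side.
  rewrite sumEFin lee_fin; apply: (@le_trans _ _ (\sum_(i < N) phi i x * w x)).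
   rewrite -mulr_suml phi_sum (powR_mulr1 (w0 x) p1w).
   have := w0 x; rewrite le_eqVlt => /predU1P[<-|->]; last by rewrite mulr1 mulrC.
   by rewrite mul0r mulr0.
  by apply: ler_sum => i _; exact: phi_w.
 rewrite ge0_integral_sum//; last 2 first.
 - move=> i; apply/measurable_EFinP; apply: measurable_funM => //.
  exact: meas_heatop.
 - by move=> i x _; rewrite lee_fin mulr_ge0// heatop_ge0.
 rewrite (_ : (fun x => (h x * v x)%:E) =
   (fun x => \sum_(i < N) (heatop (t * 4 ^+ i) (phi i) x * h x)%:E)%E); last first.
  by apply/funext => x; rewrite sumEFin -mulr_suml mulrC.
 rewrite ge0_integral_sum//; last 2 first.
 - move=> i; apply/measurable_EFinP; apply: measurable_funM => //.
  exact: meas_heatop.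
 - by move=> i x _; rewrite lee_fin mulr_ge0// heatop_ge0.
 apply: lee_sum => i _.
 under eq_integral do rewrite EFinM (heatopK _ (time4_gt0 i t0) p1w hp).
 rewrite heat_int_sym// le_eqVlt; apply/orP; left; apply/eqP.
 apply: eq_integral => x _.
 by rewrite EFinM (heatopK _ (time4_gt0 i t0) (ltW q1) (L i)).
have dD : d * D = 2^-1 by rewrite /d; field; rewrite gt_eqF.
have W0 : (0 <= \int[mu]_x (w x `^ p)%:E)%E by side.
have H0 : (0 <= \int[mu]_x (h x `^ p)%:E)%E by side.
have D0e : (0 <= D%:E)%E by side.
have s2 := integral_young mu p1 d0 mh mv h0 v0.
exact: (absorb_half_ereal d0 dD W0 wf H0 hf step1 s2 (le_trans dualv (lee_wpmul2l D0e phi_q))).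
Qed.

End maximal_theorem.

#[export] Hint Extern 1 (is_true (@Order.le _ _ _ (heatop _ _ _))) => apply: heatop_ge0; pos : side.
#[export] Hint Extern 1 (is_true (@Order.le _ _ _ (heat_int _ _ _))) => apply: heat_int_ge0; pos : side.
#[export] Hint Extern 1 (measurable_fun _ (heatop _ _)) => apply: meas_heatop; meas : side.
#[export] Hint Extern 1 (measurable_fun _ (fun _ => heatop _ _ _)) => apply: meas_heatop; meas : side.

(** Vector identities by coordinates: to prove a relation between three vectors it suffices to treat
    them as images of the unit triples under a map compatible with sums, multiples and opposites.
    The tactic [lin] then leaves one scalar equation per coordinate. *)
Lemma linear_comb3 (R : realType) (B : lmodType R) (P : B -> B -> B -> Prop) a b c :
 (forall f : R -> R -> R -> B,
  (forall x y z x' y' z', f x y z + f x' y' z' = f (x + x') (y + y') (z + z')) ->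
  (forall r x y z, r *: f x y z = f (r * x) (r * y) (r * z)) ->
  (forall x y z, - f x y z = f (- x) (- y) (- z)) ->
  P (f 1 0 0) (f 0 1 0) (f 0 0 1)) -> P a b c.
move=> /(_ (fun x y z => x *: a + y *: b + z *: c)).
rewrite !scale1r !scale0r !addr0 !add0r; apply.
- by move=> *; rewrite !scalerDl addrACA; congr (_ + _); rewrite addrACA.
- by move=> *; rewrite !scalerDr !scalerA.
- by move=> *; rewrite !scaleNr !opprD.
Qed.

Ltac lin a b c := pattern a, b, c; refine (@linear_comb3 _ _ _ a b c _); intros ? D Z Ne;
 rewrite ?(D, Z, Ne); rewrite ?(D, Z, Ne); apply: f_equal3.

(** * Two-point inequality in a uniformly convex norm *)

Section two_point_inequality.
Context (R : realType) (B : normedModType R) (N : B -> R) (q : R).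
Hypotheses (Nn : is_norm N) (q2 : 2 <= q) (Nq : uniformly_convex q N).

Let ND x y : N (x + y) <= N x + N y. Proof. by case: Nn. Qed.
Let NZ (a : R) x : N (a *: x) = `|a| * N x. Proof. by case: Nn. Qed.

Lemma is_norm0 : N 0 = 0.
by rewrite -(scale0r 0) NZ normr0 mul0r. Qed.

Lemma is_normN x : N (- x) = N x.
by rewrite -scaleN1r NZ normrN1 mul1r. Qed.

Lemma is_norm_ge0 x : 0 <= N x.
by have := ND x (- x); rewrite subrr is_norm0 is_normN -mulr2n pmulrn_lge0.
Qed.

Lemma is_norm_distC x y : N (x - y) = N (y - x).
by rewrite -is_normN opprB. Qed.

Lemma is_norm_le0 x : N x <= 0 -> x = 0.
by case: Nn => _ _ h; move=> Nx; apply: h; apply/eqP; rewrite eq_le Nx is_norm_ge0.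
Qed.

Lemma is_normB_le x y : N (x - y) <= N x + N y.
by rewrite -(is_normN y); exact: ND. Qed.

Lemma is_norm_triB x y : N x - N y <= N (x - y).
by rewrite lerBlDr -{1}(subrK y x); exact: ND. Qed.

Let half (a b : B) := 2^-1 *: (a + b).

Lemma unit_midpoint_lt2 : exists2 c, 0 < c & forall a b, N a = 1 -> N b = 1 ->
 N (a - b) < 2 -> N (half a b) <= 1 - c * N (a - b) `^ q.
case: Nq => c c0 h; exists c => // a b a1 b1 ab2.
have [ab0|ab0] := leP (N (a - b)) 0.
 have -> : N (a - b) = 0 by apply/eqP; rewrite eq_le ab0 is_norm_ge0.
 rewrite powR0 ?gt_eqF ?(lt_le_trans _ q2)// mulr0 subr0 NZ ger0_norm//.
 rewrite mulrC ler_pdivrMr// mul1r; apply: le_trans (ND _ _) _.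
 by rewrite a1 b1.
have := h (N (a - b)); rewrite ab0 ab2 => /(_ isT) h'.
have : ((c * N (a - b) `^ q)%:E <= (1 - N (half a b))%:E)%E.
 by apply: le_trans h' _; apply: ereal_inf_lbound; exists (a, b).
by rewrite lee_fin => h''; lra.
Qed.

(** The modulus says nothing about pairs at distance exactly 2. If such a pair had a midpoint [m] of
    norm above [1 - e], then [a] and the normalization [m'] of [m] would be at distance between
    [1 - e] and 2, so their midpoint would be short. Since [m] is [2/3] of the midpoint of [a] and
    [m] plus [b / 3], it would be short too. *)
Lemma unit_midpoint : exists2 c, 0 < c & forall a b, N a = 1 -> N b = 1 ->
 N (half a b) <= 1 - c * N (a - b) `^ q.
have q0 : 0 <= q by exact: le_trans q2.
have [c c0 h] := unit_midpoint_lt2.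
have tq : 0 < 2 `^ q :> R by side.
pose e := Num.min (2^-1) (c / 2 `^ q / 2) : R.
have e0 : 0 < e by rewrite lt_min invr_gt0 ltr0n /= !divr_gt0.
have e1 : e <= 2^-1 by rewrite ge_min lexx.
have e2 : e <= c / 2 `^ q / 2 by rewrite ge_min lexx orbT.
exists (Num.min c (e / 2 `^ q)); first by rewrite lt_min c0 divr_gt0.
move=> a b a1 b1.
have ab2 : N (a - b) <= 2 by apply: le_trans (is_normB_le _ _) _; rewrite a1 b1; lra.
move: ab2; rewrite le_eqVlt => /predU1P[ab|ab]; last first.
 apply: le_trans (h _ _ a1 b1 ab) _.
 by rewrite lerD2l lerN2 ler_wpM2r ?powR_ge0// ge_min lexx.
suff hm : N (half a b) <= 1 - e.
 apply: le_trans hm _; rewrite lerD2l lerN2 ab.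
 by rewrite -ler_pdivlMr// ge_min lexx orbT.
rewrite leNgt; apply/negP => me.
set m := half a b in me *.
have Nm0 : 0 < N m by apply: lt_trans me; lra.
have Nm1 : N m <= 1.
 rewrite /m NZ ger0_norm ?invr_ge0//; have := ND a b; rewrite a1 b1; lra.
pose m' := (N m)^-1 *: m.
have m'1 : N m' = 1 by rewrite NZ ger0_norm ?invr_ge0 ?(ltW Nm0)// mulVf ?gt_eqF.
have mm' : N (m - m') = 1 - N m.
 rewrite (_ : m - m' = (1 - (N m)^-1) *: m); last by rewrite scalerBl scale1r.
 rewrite NZ ler0_norm ?subr_le0 ?invf_ge1//.
 by field; rewrite gt_eqF.
have am : N (a - m) = 1.
 rewrite (_ : a - m = 2^-1 *: (a - b)).
  by rewrite NZ ab ger0_norm ?invr_ge0// mulVf.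
 by rewrite /m /half; lin a b (0 : B); field.
have am'_ge : 1 - e <= N (a - m').
 have := is_norm_triB (a - m) (m' - m).
 rewrite opprB addrA subrK am is_norm_distC mm'; lra.
have am'_lt : N (a - m') < 2.
 rewrite (_ : a - m' = (a - m) + (m - m')); last by rewrite addrA subrK.
 by apply: le_lt_trans (ND _ _) _; rewrite am mm'; lra.
have h1 := h _ _ a1 m'1 am'_lt.
have h2 : c / 2 `^ q <= c * N (a - m') `^ q.
 rewrite ler_wpM2l ?(ltW c0)// -powR_inv1 ?(ltW tq)// -powRrM mulrC powRrM.
 apply: ler_powR2; rewrite ?powR_ge0//; rewrite powR_inv1//; lra.
have h3 : N (half a m) <= N (half a m') + 2^-1 * N (m - m').
 rewrite (_ : half a m = half a m' + 2^-1 *: (m - m')).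
  by apply: le_trans (ND _ _) _; rewrite [X in _ + X]NZ ger0_norm ?invr_ge0.
 by rewrite /half; lin a m m'; field.
have h4 : N m <= 2 / 3 * N (half a m) + 3^-1.
 rewrite {1}(_ : m = (2 / 3) *: half a m + 3^-1 *: b); last first.
  by rewrite /m /half; lin a b (0 : B); field.
 apply: le_trans (ND _ _) _; rewrite !NZ b1 !ger0_norm ?invr_ge0//; lra.
lra.
Qed.

(** Quantitative convexity of the power [r], used when the two norms differ. A quadratic gain is
    enough because [q >= 2], by [powR_le_sqr]. *)
Lemma powR_strict_convex r : 1 < r -> exists2 c, 0 < c &
 forall b : R, 0 <= b <= 1 -> ((1 + b) / 2) `^ r + c * (1 - b) ^+ 2 <= (1 + b `^ r) / 2.
move=> r1; have r1w := ltW r1.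
have s0 : 0 < r - 1 by side.
have r0 : 0 < r by side.
pose k : R := (2^-1) `^ (r - 1).
have k0 : 0 < k by rewrite powR_gt0// invr_gt0.
exists (r * (r - 1) * k / 32); first by rewrite divr_gt0// !mulr_gt0.
move=> b /andP[b0 b1].
pose m := (1 + b) / 2; pose h := (1 - b) / 2; pose y := (1 + m) / 2.
have m0 : 0 < m by rewrite /m; lra.
have mh : 2^-1 <= m by rewrite /m; lra.
have h0 : 0 <= h by rewrite /h; lra.
have y0 : 0 < y by rewrite /y; lra.
have y1 : y <= 1 by rewrite /y /m; lra.
have my : m <= y by rewrite /y /m; lra.
(* tangents at m and at the midpoint y of m and 1 *)
have t1 := powR_add_ge r1w (ltW y0) (ltac:(rewrite /y /m; lra) : 0 <= h / 2).
have t2 := powR_add_ge r1w (ltW m0) (ltac:(rewrite /y /m; lra) : 0 <= h / 2).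
have t3 := young_powR r1w (ltW m0) b0.
rewrite (_ : y + h / 2 = 1) ?powR1 in t1; last by rewrite /y /h /m; field.
rewrite (_ : m + h / 2 = y) in t2; last by rewrite /y /h /m; field.
have key : m `^ (r - 1) + k * ((r - 1) * (h / 2)) <= y `^ (r - 1).
 have -> : y = m * (y / m) by field; rewrite gt_eqF.
 have ym0 : 0 < y / m by side.
 rewrite (powRM _ (ltW m0) (ltW ym0)).
 have km : k <= m `^ (r - 1) by apply: ler_powR2; rewrite ?(ltW s0) ?invr_ge0.
 have : 1 + (r - 1) * (h / 2) <= (y / m) `^ (r - 1).
  have -> : (y / m) `^ (r - 1) = expR ((r - 1) * ln (y / m)) by rewrite /powR gt_eqF.
  apply: le_trans (expR_ge1Dx _).
  rewrite lerD2l ler_wpM2l ?(ltW s0)//.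
  have my0 : 0 < m / y by side.
  have := @le_ln1Dx R (m / y - 1); rewrite [1 + _]addrC subrK.
  rewrite (_ : ln (m / y) = - ln (y / m)); last by rewrite -invf_div lnV ?posrE.
  move=> hl; have {}hl := hl ltac:(lra).
  have : m / y <= 1 - h / 2.
   rewrite ler_pdivrMr// /h /y /m; nra.
  lra.
 move=> hp; apply: le_trans (ler_wpM2l (powR_ge0 _ _) hp).
 rewrite mulrDr mulr1 lerD2l; apply: ler_wpM2r => //.
 side.
rewrite -/m.
have Em := powR_mulr1 (ltW m0) r1w.
have Ey := powR_mulr1 (ltW y0) r1w.
have hh : (1 - b) ^+ 2 = 4 * h * h by rewrite /h; field.
have bE : b = m - h by rewrite /m /h; field.
have key2 : r * h / 2 * (k * ((r - 1) * (h / 2))) <= r * h / 2 * (y `^ (r - 1) - m `^ (r - 1)).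
 by apply: ler_wpM2l; [apply: divr_ge0 => //; apply: mulr_ge0 => //; exact: ltW|rewrite lerBrDl; exact: key].
rewrite hh; rewrite Em in t3; rewrite Em in t2 *; rewrite Ey in t2 t1.
move: t1 t2 t3 key2; move: (y `^ (r - 1)) (m `^ (r - 1)) (b `^ r) => Y M Bt.
move=> t1 t2 t3 key2.
have : r * M * b = r * M * (m - h) by rewrite -bE.
move: t1 t2 t3 key2; clear; clearbody h y m k.
lra.
Qed.

Lemma powR_le_sqr x : 0 <= x <= 1 -> x `^ q <= x ^+ 2.
move=> /andP[]; rewrite le_eqVlt => /predU1P[<- _|x0 x1].
 by rewrite powR0 ?expr0n// gt_eqF// (lt_le_trans _ q2).
rewrite -powR_mulrn ?(ltW x0)//.
have x01 : 0 < x <= 1 by rewrite x0.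
exact: (ger_powR x01 q2).
Qed.

(** If [1 - N b] is at least a quarter of [N (a - b)], the gain comes from the difference of the
    norms, by [powR_strict_convex]. Otherwise [b] is close to its normalization [b'], and the gain
    comes from uniform convexity of the unit sphere at the pair [a], [b']. *)
Lemma two_point_unit r : 1 < r -> exists2 c, 0 < c & forall a b, N a = 1 -> N b <= 1 ->
 N (half a b) `^ r + c * N (a - b) `^ q <= (1 + N b `^ r) / 2.
move=> r1; have r0 : 0 < r by exact: lt_trans r1.
have s0 : 0 <= r - 1 by rewrite subr_ge0 ltW.
have [c1 c10 h1] := powR_strict_convex r1.
have [c2 c20 h2] := unit_midpoint.
pose T : R := 2^-1 `^ q; pose K : R := 2^-1 `^ (r - 1).
have T0 : 0 < T by rewrite powR_gt0 ?invr_gt0.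
have K0 : 0 < K by rewrite powR_gt0 ?invr_gt0.
exists (Num.min (c1 * T / 4) (K * c2 * T / 2)).
 by rewrite lt_min !divr_gt0// !mulr_gt0.
move=> a b a1 b1; set c := Num.min _ _; set be := N b in b1 *; set e := N (a - b).
have b0 : 0 <= be := is_norm_ge0 _.
have e0 : 0 <= e := is_norm_ge0 _.
have e2 : e <= 2 by have := is_normB_le a b; rewrite a1 -/e -/be; lra.
have eT : (e / 2) `^ q = e `^ q * T by rewrite powRM ?invr_ge0.
have hb : N (half a b) <= (1 + be) / 2.
 by rewrite NZ ger0_norm ?invr_ge0//; have := ND a b; rewrite a1 -/be; lra.
have hc := h1 be; rewrite b0 b1 in hc; have {}hc := hc isT.
have [he|he] := leP (e / 4) (1 - be).
 have : N (half a b) `^ r <= ((1 + be) / 2) `^ r.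
  by apply: ler_powR2; rewrite ?(ltW r0) ?is_norm_ge0.
 have : c * e `^ q <= c1 * T / 4 * e `^ q by rewrite ler_wpM2r ?powR_ge0// ge_min lexx.
 have : (e / 2) `^ q <= (e / 2) ^+ 2 by apply: powR_le_sqr; lra.
 rewrite eT; move: (N (half a b) `^ r) (e `^ q) (be `^ r) hc => A E Bt.
 move: (((1 + be) / 2) `^ r) => M hc g1 g2 g3.
 have g4 : c1 * (E * T) <= c1 * (4 * (1 - be) ^+ 2).
  by rewrite ler_pM2l//; apply: le_trans g1 _; nra.
 lra.
have be0 : 2^-1 < be by lra.
have be0' : 0 < be by apply: lt_trans be0; rewrite invr_gt0.
pose b' := be^-1 *: b.
have Nb' : N b' = 1 by rewrite NZ ger0_norm ?invr_ge0// mulVf// gt_eqF.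
have bb' : b = be *: b' by rewrite scalerA divff ?gt_eqF// scale1r.
have Nbb' : N (b - b') = 1 - be.
 rewrite {1}bb' (_ : _ - _ = (be - 1) *: b'); last by rewrite scalerBl scale1r.
 by rewrite NZ Nb' mulr1 ler0_norm ?opprB// subr_le0.
have ab' : e / 2 <= N (a - b').
 have := is_norm_triB (a - b) (b' - b); rewrite opprB addrA subrK.
 by rewrite (is_norm_distC b') Nbb' -/e; lra.
have hm := h2 a b' a1 Nb'.
have hm2 : c2 * (e `^ q * T) <= c2 * N (a - b') `^ q.
 rewrite ler_pM2l// -eT; apply: ler_powR2 => //; first exact: le_trans q2.
 side.
have hab : N (half a b) <= be * N (half a b') + (1 - be) / 2.
 have -> : half a b = be *: half a b' + ((1 - be) / 2) *: a.
  by rewrite bb' /half; lin a b' (0 : B); field.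
 apply: le_trans (ND _ _) _; rewrite !NZ a1 mulr1 !ger0_norm//; lra.
set x := N (half a b) in hb hab *; set M := (1 + be) / 2 in hb hc.
have x0 : 0 <= x := is_norm_ge0 _.
have M0 : 2^-1 <= M by rewrite /M; lra.
have hx : x `^ r <= x * M `^ (r - 1).
 by rewrite (powR_mulr1 x0 (ltW r1)); apply: ler_wpM2l => //; exact: ler_powR2.
have KM : K <= M `^ (r - 1) by apply: ler_powR2; rewrite ?invr_ge0.
have EM : M `^ r = M * M `^ (r - 1) by apply: powR_mulr1; [lra|exact: ltW].
have ce : c * e `^ q <= K * c2 * T / 2 * e `^ q.
 by rewrite ler_wpM2r ?powR_ge0// ge_min lexx orbT.
have hd : c2 * (e `^ q * T) / 2 <= M - x.
 have : 0 <= c2 * (e `^ q * T) by rewrite mulr_ge0 ?mulr_ge0 ?powR_ge0 ?ltW.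
 by move: hm hm2 hab; rewrite /M; move: (N (half a b')) (c2 * (e `^ q * T)) (c2 * N (a - b') `^ q) => u v w; nra.
have hd0 : 0 <= c2 * (e `^ q * T) / 2.
 by rewrite divr_ge0// mulr_ge0 ?mulr_ge0 ?powR_ge0 ?ltW.
have : K * (c2 * (e `^ q * T) / 2) <= M `^ (r - 1) * (M - x).
 by apply: ler_pM => //; exact: ltW.
have : 0 <= c1 * (1 - be) ^+ 2 by side.
move: hx EM hc ce; move: (x `^ r) (M `^ r) (M `^ (r - 1)) (be `^ r) (e `^ q) => A Mr Ms Br E.
lra.
Qed.

(** By homogeneity the larger norm may be taken to be 1. The factor [(N a + N b) ^ (r - q)] gives
    all terms degree [r]; as [r <= q] it is at most 1 after scaling. *)
Lemma two_point r : 1 < r -> r <= q -> exists2 c, 0 < c & forall a b,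
 N (half a b) `^ r + c * (N (a - b) `^ q * (N a + N b) `^ (r - q)) <= (N a `^ r + N b `^ r) / 2.
move=> r1 rq; have r0 : 0 < r by exact: lt_trans r1.
have [c c0 h] := two_point_unit r1; exists c => // a b.
wlog ab : a b / N b <= N a.
 move=> w; have [|/ltW] := leP (N b) (N a); first exact: w.
 move=> /w; rewrite /half (addrC b) is_norm_distC (addrC (N b)).
 by rewrite [N b `^ r + _]addrC.
have [a0|a0] := leP (N a) 0.
 have Na : N a = 0 by apply/eqP; rewrite eq_le a0 is_norm_ge0.
 rewrite (is_norm_le0 a0) (is_norm_le0 (le_trans ab a0)) /half addr0 scaler0 subr0 is_norm0.
 by rewrite !powR0 ?gt_eqF ?(lt_le_trans _ rq)// mul0r !mulr0 addr0 mul0r.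
pose a' := (N a)^-1 *: a; pose b' := (N a)^-1 *: b.
have iA : 0 <= (N a)^-1 by side.
have Na' : N a' = 1 by rewrite NZ ger0_norm// mulVf// gt_eqF.
have aE : a = N a *: a' by rewrite scalerA divff ?gt_eqF// scale1r.
have bE : b = N a *: b' by rewrite scalerA divff ?gt_eqF// scale1r.
have Nb : N b = N a * N b' by rewrite {1}bE NZ ger0_norm// ltW.
have Nb' : N b' <= 1 by rewrite NZ ger0_norm// mulrC ler_pdivrMr// mul1r.
have {}h := h a' b' Na' Nb'.
have hE : half a b = N a *: half a' b'.
 by rewrite {1}aE {1}bE /half -scalerDr !scalerA mulrC.
have dE : a - b = N a *: (a' - b') by rewrite scalerBr -aE -bE.
rewrite hE dE (NZ _ (half a' b')) (NZ _ (a' - b')) (ger0_norm (ltW a0)) Nb !powRM ?is_norm_ge0//.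
have -> : N a + N a * N b' = N a * (1 + N b') by rewrite mulrDr mulr1.
rewrite powRM ?is_norm_ge0 ?addr_ge0 ?is_norm_ge0//.
have s1 : (1 + N b') `^ (r - q) <= 1.
 rewrite -[leRHS](powRr0 (1 + N b')); apply: ler_powR; last by rewrite subr_le0.
 by rewrite lerDl is_norm_ge0.
have aq : N a `^ q * N a `^ (r - q) = N a `^ r.
 by rewrite -powRD ?gt_eqF ?implybT// addrC subrK.
apply: (@le_trans _ _ (N a `^ r * (N (half a' b') `^ r + c * N (a' - b') `^ q))).
 rewrite [leRHS]mulrDr; apply: lerD => //.
 rewrite (_ : c * _ = (N a `^ q * N a `^ (r - q)) * (c * N (a' - b') `^ q) * (1 + N b') `^ (r - q)); last by ring.
 rewrite aq -mulrA; apply: ler_wpM2l; first exact: powR_ge0.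
 by apply: ler_piMr => //; rewrite mulr_ge0 ?powR_ge0 ?ltW.
apply: le_trans (ler_wpM2l (powR_ge0 _ _) h) _.
by rewrite mulrA mulrDr mulr1.
Qed.

End two_point_inequality.

(** * Strong measurability of pointwise limits *)

Section strongly_measurable_limits.
Context d (T : measurableType d) (R : realType) (B : normedModType R).

(** [s k x] is the point nearest to [g x] among [D 0], ..., [D k]. *)
Lemma smeas_dense (g : T -> B) (D : nat -> B) :
 (forall i, measurable_fun setT (fun x => `|g x - D i|)) ->
 (forall x (e : R), 0 < e -> exists i, `|g x - D i| < e) -> smeas g.
move=> mD dD.
pose s := fix s (k : nat) (x : T) : B := match k with
 | 0 => D 0
 | k.+1 => if `|g x - D k.+1| < `|g x - s k x| then D k.+1 else s k x end.
have sE k x : `|g x - s k.+1 x| = Num.min `|g x - D k.+1| `|g x - s k x|.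
 by rewrite /= minElt; case: ifP.
have ms k : fsimple (s k) /\ measurable_fun setT (fun x => `|g x - s k x|).
 elim: k => [|k [fk mk]]; first by split; [exact: fsimple_cst|exact: mD].
 split; last first.
  rewrite (_ : (fun x => _) = (fun x => `|g x - D k.+1|) \min (fun x => `|g x - s k x|)).
   by apply: measurable_minr; [exact: mD|exact: mk].
  by apply/funext => x; exact: sE.
 pose A := [set x | `|g x - D k.+1| < `|g x - s k x|].
 have mA : measurable A.
  have := measurable_fun_ltr (mD k.+1) mk.
  move=> /(_ measurableT [set true] I); rewrite setTI.
  side.
 have := fsimple_comp2 (fun (b : bool) v => if b then D k.+1 else v) (fsimple_bool mA) fk.
 by congr fsimple; apply/funext => x /=; rewrite asboolb.
have le_s i k x : (i <= k)%N -> `|g x - s k x| <= `|g x - D i|.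
 elim: k => [|k ih] in i *; first by rewrite leqn0 => /eqP ->.
 rewrite leq_eqVlt sE => /predU1P[->|ik]; first by rewrite ge_min lexx.
 by rewrite ge_min ih ?orbT.
exists s; split => [k|x]; first by case: (ms k).
apply/cvgrPdist_lt => e e0; have [i hi] := dD x e e0.
by exists i => // k /= ik; exact: le_lt_trans (le_s _ _ _ ik) hi.
Qed.

(** The approximants of all the [g_ k] take countably many values together, and these come
    arbitrarily close to every value of [g]. *)
Lemma smeas_cvg (g_ : nat -> T -> B) (g : T -> B) : (forall k, smeas (g_ k)) ->
 (forall x, g_ k x @[k --> \oo] --> g x) -> smeas g.
move=> mg cg.
have [s hs] := choice mg.
have [L hL] := choice (fun kj => (proj1 (finite_seqP (range (s kj.1 kj.2))))
 (proj1 (proj1 (hs kj.1) kj.2))).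
pose D i := match unpickle i : option (nat * nat * nat) with
 | Some (k, j, l) => nth 0 (L (k, j)) l | None => 0 end.
apply: (@smeas_dense _ D) => [i|x e e0].
 apply: (measurable_fun_cvg (h := fun k x => `|g_ k x - D i|)) => [k|x _].
  by apply: smeas_norm; apply: smeasB => //; exact: smeas_cst.
 by apply: cvg_norm; apply: cvgB => //; exact: cvg_cst.
have e20 : 0 < e / 2 by side.
have [k _ hk] : \forall k \near \oo, `|g x - g_ k x| < e / 2.
 by move/cvgrPdist_lt : (cg x); exact.
have [j _ hj] : \forall j \near \oo, `|g_ k x - s k j x| < e / 2.
 by move/cvgrPdist_lt : (proj2 (hs k) x); exact.
have : s k j x \in L (k, j).
 have : range (s (k, j).1 (k, j).2) (s k j x) by exists x.
 by rewrite hL.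
move=> /(nthP 0)[l _ hl].
exists (pickle (k, j, l)); rewrite /D pickleK hl.
rewrite -(subrK (g_ k x) (g x)) -addrA [e]splitr; apply: le_lt_trans (ler_normD _ _) _.
by apply: ltrD; [exact: hk k (leqnn k)|exact: hj j (leqnn j)].
Qed.

End strongly_measurable_limits.

(** * The heat semigroup on Banach-valued functions *)

Section vector_heat.
Context (R : realType) (B : completeNormedModType R) (n : nat).
Local Notation T := (Rn R n).
Local Notation mu := (lebesgue_Rn R n).
Local Notation K := (@heat_kernel R n).
Implicit Types (f g : T -> B) (r s t : R) (x y : T).
Local Opaque heat_kernel.

(** Integrability against the kernels at all positive times: a class containing constants, bounded
    strongly measurable functions and [L^p] functions, on which the heat flow is smooth in time. *)
Definition heat_L1 f := smeas f /\
 forall t x, 0 < t -> (heat_int t (fun y => `|f y|%R) x < +oo)%E.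

Lemma heat_L1_meas f : heat_L1 f ->
 measurable_fun setT (fun y => `|f y|).
by case=> mf _; exact: smeas_norm. Qed.

Lemma heat_L1D f g : heat_L1 f -> heat_L1 g ->
 heat_L1 (fun x => f x + g x).
move=> hf hg; split; first by apply: smeasD; [case: hf|case: hg].
have mf := heat_L1_meas hf; have mg := heat_L1_meas hg.
move=> t x t0.
apply: (@le_lt_trans _ _ (heat_int t (fun y => `|f y|%R) x + heat_int t (fun y => `|g y|%R) x)%E).
 rewrite /heat_int -ge0_integralD//; [|side..].
 apply: le_integralW => // y _.
  side.
 by rewrite -EFinD lee_fin -mulrDr; apply: ler_wpM2l; [exact: kernel_ge0|exact: ler_normD].
by apply: lte_add_pinfty; [case: hf => _; exact|case: hg => _; exact].
Qed.

Lemma heat_L1_cst (b : B) : heat_L1 (fun _ => b).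
split; first exact: smeas_cst.
by move=> t x t0; rewrite heat_int_cst// ltry.
Qed.

Lemma heat_L1N f : heat_L1 f -> heat_L1 (fun x => - f x).
move=> [mf hf]; split.
 have := smeasB (smeas_cst _ (0 : B)) mf; congr smeas.
 by apply/funext => x; rewrite sub0r.
move=> t x t0; rewrite (_ : (fun y => _) = (fun y => `|f y|)); first exact: hf.
by apply/funext => y; rewrite normrN.
Qed.

(** Time derivative of order [m] of the heat flow, taken under the integral; [derive1n_heat]
    identifies it with the iterated derivative. *)
Definition dheat (m : nat) (t : R) f x : B :=
 bochner_integral mu setT (fun z => dkernel m t x z *: f z).

Lemma dheat0 t f x : dheat 0 t f x = heat t f x.
by congr bochner_integral; apply/funext => z; rewrite dheat_kernel0.
Qed.

Lemma dheat_norm_int (m : nat) : exists2 C, 0 < C & forall t f x, 0 < t -> heat_L1 f ->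
 (\int[mu]_z (`|dkernel m t x z *: f z|)%:E <=
  (C * t ^- m)%:E * heat_int (2 * t) (fun z => `|f z|%R) x)%E.
have [C C0 hC] := dkernel_bound R m n; exists C => // t f x t0 hf.
have mf := heat_L1_meas hf.
rewrite /heat_int -ge0_integralZl//; [|side..].
apply: le_integralW => // y _.
by rewrite -EFinM lee_fin normrZ mulrA; apply: ler_wpM2r => //; exact: hC.
Qed.

Lemma dheat_bochner m t f x : 0 < t -> heat_L1 f ->
 is_bochner_integral mu setT (fun z => dkernel m t x z *: f z) (dheat m t f x).
move=> t0 hf; apply: bochner_integralP => //.
 apply: smeas_strongly_measurable => //; apply: smeasZ; last by case: hf.
 exact: meas_smeas (meas_dkernel m t x).
have [C C0 hC] := dheat_norm_int m.
apply: le_lt_trans (hC t f x t0 hf) _.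
apply: lte_mul_pinfty => //; first side.
by case: hf => _; apply; exact: mulr_gt0.
Qed.

Lemma dheat_lin m t (a : R) f g x : 0 < t -> heat_L1 f -> heat_L1 g ->
 dheat m t (fun z => a *: f z + g z) x = a *: dheat m t f x + dheat m t g x.
move=> t0 hf hg; apply: bochner_integral_eq => //.
have := is_bochner_lin measurableT a (dheat_bochner m x t0 hf) (dheat_bochner m x t0 hg).
congr is_bochner_integral; apply/funext => z.
by rewrite scalerDr !scalerA mulrC.
Qed.

Lemma dheat_norm_le m : exists2 C, 0 < C & forall t f x, 0 < t -> heat_L1 f ->
 ((`|dheat m t f x|)%:E <= (C * t ^- m)%:E * heat_int (2 * t) (fun z => `|f z|%R) x)%E.
have [C C0 hC] := dheat_norm_int m; exists C => // t f x t0 hf.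
by apply: le_trans (hC t f x t0 hf); exact: bochner_norm_le.
Qed.

Lemma heat_semi_norm_le (N : B -> R) (C : R) t f x :
 (forall a b, N (a + b) <= N a + N b) ->
 (forall (a : R) b, N (a *: b) = `|a| * N b) ->
 (forall b, N b <= C * `|b|) ->
 ((N (heat t f x))%:E <= heat_int t (N \o f) x)%E.
move=> ND NZ NC.
have := @bochner_semi_norm_le _ _ _ _ mu setT measurableT N C (fun y => K t x y *: f y) ND NZ NC.
move=> h; apply: le_trans h _.
rewrite le_eqVlt; apply/orP; left; apply/eqP; apply: eq_integral => y _.
by rewrite NZ ger0_norm// kernel_ge0.
Qed.

Lemma heat_norm_le t f x : ((`|heat t f x|)%:E <= heat_int t (fun y => `|f y|%R) x)%E.
apply: (@heat_semi_norm_le (fun b => `|b|) 1) => [| |b]; last by rewrite mul1r.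
- exact: ler_normD.
- exact: normrZ.
Qed.

Lemma is_derive_quadratic (F : R -> B) (t : R) (dF : B) (C e : R) : 0 < e -> 0 <= C ->
 (forall h, `|h| <= e -> `|F (t + h) - F t - h *: dF| <= C * h ^+ 2) ->
 is_derive t 1 F dF.
move=> e0 C0 hF.
suff c : h^-1 *: ((F \o shift t) (h *: 1) - F t) @[h --> 0^'] --> dF.
 by split; [apply/cvg_ex; exists dF|exact: cvg_lim c].
apply/cvgrPdist_le => d d0.
have C1 : 0 < C + 1 by side.
near=> h.
have h0 : h != 0 by near: h; exact: nbhs_dnbhs_neq.
have he : `|h| <= e.
 by near: h; apply: dnbhs0_le.
have hd : `|h| <= d / (C + 1).
 by near: h; apply: dnbhs0_le; exact: divr_gt0.
rewrite /= [_ *: 1]mulr1 [h + t]addrC.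
have -> : dF - h^-1 *: (F (t + h) - F t) = - (h^-1 *: (F (t + h) - F t - h *: dF)).
 by rewrite [h^-1 *: (_ - h *: dF)]scalerBr scalerA mulVf// scale1r opprB.
rewrite normrN normrZ normfV ler_pdivrMl ?normr_gt0//.
apply: le_trans (hF _ he) _.
rewrite -[h ^+ 2]ger0_norm ?sqr_ge0// normrX expr2 mulrCA.
apply: ler_wpM2l => //.
move: hd; rewrite ler_pdivlMr// => hd; apply: le_trans hd.
by rewrite mulrC; apply: ler_wpM2l => //; rewrite lerDl.
Unshelve. all: by end_near. Qed.

Lemma derive_shift (F : R -> B) (s t : R) :
 'D_1 (fun u => F (u + t)) s = 'D_1 F (s + t).
rewrite /derive; have -> // : (fun h : R => h^-1 *: (((fun u => F (u + t)) \o shift s) (h *: 1) - F (s + t)))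
 = (fun h => h^-1 *: ((F \o shift (s + t)) (h *: 1) - F (s + t))).
by apply/funext => h /=; rewrite addrA.
Qed.

Lemma mvt_sym (g g1 : R -> R) (t e : R) :
 (forall s, `|s - t| <= e -> is_derive s 1 g (g1 s)) ->
 forall h, `|h| <= e -> exists2 c, `|c - t| <= `|h| & g (t + h) - g t = g1 c * h.
move=> dg h he.
have key a b : a <= b -> (forall s, a <= s <= b -> is_derive s 1 g (g1 s)) ->
  exists2 c, a <= c <= b & g b - g a = g1 c * (b - a).
 move=> ab hab.
 have [||c] := @MVT_segment R g g1 a b ab; last by rewrite in_itv /=; exists c.
  by move=> s; rewrite in_itv /= => /andP[? ?]; apply: hab; rewrite !ltW.
 apply: derivable_within_continuous => s; rewrite in_itv /= => /hab hs.
 side.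
have [h0|h0] := leP 0 h.
 have [|s|c /andP[c1 c2] hc] := key t (t + h); first by rewrite lerDl.
  move=> /andP[s1 s2]; apply: dg; rewrite ger0_norm ?subr_ge0//.
  by apply: le_trans he; rewrite ger0_norm// lerBlDl.
 exists c; first by rewrite !ger0_norm ?subr_ge0// lerBlDl.
 by rewrite hc [t + h]addrC addrK.
have [|s|c /andP[c1 c2] hc] := key (t + h) t; first by rewrite gerDl ltW.
 move=> /andP[s1 s2]; apply: dg; rewrite ler0_norm ?subr_le0// opprB.
 by apply: le_trans he; rewrite ltr0_norm//; lra.
exists c; first by rewrite (ltr0_norm h0) ler0_norm ?subr_le0//; lra.
by rewrite -opprB hc; lra.
Qed.

Lemma taylor_quadratic (g g1 g2 : R -> R) (t e M : R) :
 (forall s, `|s - t| <= e -> is_derive s 1 g (g1 s)) ->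
 (forall s, `|s - t| <= e -> is_derive s 1 g1 (g2 s)) ->
 (forall s, `|s - t| <= e -> `|g2 s| <= M) ->
 forall h, `|h| <= e -> `|g (t + h) - g t - h * g1 t| <= M * h ^+ 2.
move=> dg dg1 hM h he.
have [c ct ->] := mvt_sym dg he.
have [|c' ct' hc] := mvt_sym dg1 (h := c - t); first exact: le_trans he.
rewrite (addrC t) subrK in hc.
rewrite mulrC -mulrBr hc !normrM expr2 mulrCA.
have := hM c' (le_trans ct' (le_trans ct he)) => h2.
have -> : h * h = `|h| * `|h| by rewrite -!expr2 real_normK ?num_real.
by apply: ler_pM => //; rewrite ?mulr_ge0//; apply: ler_wpM2l.
Qed.

(** Differentiation under the integral by a second-order Taylor bound. For [|h| <= t / 2] the second
    derivatives of the kernel are dominated by one multiple of the kernel at time [3 * t],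
    integrable against [|f|]. *)
Lemma is_derive_dheat m t f x : 0 < t -> heat_L1 f ->
 is_derive t 1 (fun u => dheat m u f x) (dheat m.+1 t f x).
move=> t0 hf; have mf := heat_L1_meas hf.
have [C C0 hC] := dkernel_bound R m.+2 n.
pose M := C * (t / 2) ^- m.+2 * 3 `^ (n%:R / 2).
have M0 : 0 <= M.
 rewrite /M; apply: mulr_ge0; last side.
 side.
have t30 : 0 < 3 * t by side.
have I0 : (0 <= heat_int (3 * t) (fun z => `|f z|%R) x)%E by side.
have Ioo := proj2 hf _ x t30.
pose I := fine (heat_int (3 * t) (fun z => `|f z|) x).
have IE : (I%:E = heat_int (3 * t) (fun z => `|f z|%R) x)%E by rewrite /I fineK// ge0_fin_numE.
apply: (@is_derive_quadratic _ _ _ (M * I) (t / 2)).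
- side.
- by rewrite mulr_ge0// fine_ge0.
move=> h he.
have th0 : 0 < t + h by move: he; rewrite ler_norml => /andP[? ?]; lra.
have b1 := dheat_bochner m x th0 hf.
have b2 := is_bochner_lin measurableT (-1) (dheat_bochner m x t0 hf) b1.
have b3 := is_bochner_lin measurableT (- h) (dheat_bochner m.+1 x t0 hf) b2.
rewrite (_ : _ - _ - _ = - h *: dheat m.+1 t f x + (-1 *: dheat m t f x + dheat m (t + h) f x)); last first.
 by rewrite scaleN1r scaleNr addrC [- _ + dheat _ _ _ _]addrC.
rewrite -lee_fin; apply: le_trans (is_bochner_norm_le measurableT b3) _.
rewrite EFinM EFinM IE muleAC -EFinM /heat_int -ge0_integralZl//; last 3 first.
- side.
- side.
- by rewrite lee_fin mulr_ge0// sqr_ge0.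
apply: le_integralW => // z _.
rewrite -EFinM lee_fin !scalerA -!scalerDl normrZ [leRHS]mulrA; apply: ler_wpM2r => //.
have := @taylor_quadratic (fun s => dkernel m s x z) (fun s => dkernel m.+1 s x z)
 (fun s => dkernel m.+2 s x z) t (t / 2) (M * K (3 * t) x z).
have st s : `|s - t| <= t / 2 -> t / 2 <= s <= 3 / 2 * t.
 by rewrite ler_norml => /andP[? ?]; apply/andP; split; lra.
have s0 s : `|s - t| <= t / 2 -> 0 < s.
 by move=> /st /andP[h1 _]; apply: lt_le_trans h1; exact: divr_gt0.
move=> /(_ _ _ _ h he) tq; rewrite mulrAC.
apply: le_trans (tq _ _ _).
- by rewrite le_eqVlt; apply/orP; left; apply/eqP; congr `|_|; rewrite mulN1r; ring.
- by move=> s /s0 s1; exact: is_derive_dkernel.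
- by move=> s /s0 s1; exact: is_derive_dkernel.
move=> s sh; have s1 := s0 _ sh; have /andP[s2 s3] := st _ sh.
apply: le_trans (hC s x z s1) _; rewrite /M -!mulrA; apply: ler_wpM2l; first exact: ltW.
apply: ler_pM.
- side.
- side.
- have t2 : 0 < t / 2 by side.
 by rewrite lef_pV2 ?posrE ?exprn_gt0// ler_pXn2r// nnegrE ltW.
have s20 : 0 < 2 * s by side.
have s2t : 2 * s <= 3 * t by lra.
apply: le_trans (heat_kernel_le x z s20 s2t) _.
apply: ler_wpM2r; first side.
apply: ler_powR2.
- side.
- side.
by rewrite ler_pdivrMr//; lra.
Qed.

Lemma derive1n_heat m f x t : 0 < t -> heat_L1 f ->
 derive1n m (fun u => heat u f x) t = dheat m t f x.
move=> t0 hf; elim: m => [|m ih] in t t0 *; first by rewrite derive1n0 dheat0.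
rewrite derive1nS derive1E.
rewrite (@near_eq_derive _ _ _ _ (fun u => dheat m u f x)).
 by have d := is_derive_dheat m x t0 hf; exact: derive_val.
near=> u; apply: ih; near: u; exact: lt_nbhsr.
Unshelve. all: by end_near. Qed.

Lemma heat_cst t (b : B) x : 0 < t -> heat t (fun _ => b) x = b.
move=> t0; apply: bochner_integral_eq => //.
have iK : mu.-integrable setT (EFin \o K t x).
 apply/integrableP; split; first side.
 under eq_integral do rewrite /= ger0_norm ?kernel_ge0//.
 by rewrite integral_kernel// ltry.
have := is_bochner_scale measurableT b (meas_heat_kernel t x) iK.
by rewrite /Rintegral integral_kernel//= scale1r.
Qed.

Lemma dheat_cst m t (b : B) x : 0 < t -> dheat m.+1 t (fun _ => b) x = 0.
have hb := heat_L1_cst b.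
have cst0 k (c : B) : (forall t, 0 < t -> dheat k t (fun _ => b) x = c) ->
  forall t, 0 < t -> dheat k.+1 t (fun _ => b) x = 0.
 move=> hc u u0; have d := is_derive_dheat k x u0 hb.
 rewrite -(@derive_val _ _ _ _ _ _ _ d).
 rewrite (@near_eq_derive _ _ _ _ (fun _ => c)) ?derive_cst//.
 by near=> v; apply: hc; near: v; exact: lt_nbhsr.
elim: m t => [|m ih] t; last exact: (cst0 m.+1 0).
by apply: (cst0 0 b) => u u0; rewrite dheat0 heat_cst.
Unshelve. all: by end_near. Qed.

(** Derivatives of positive order annihilate constants, so any vector [c] may be subtracted. This is
    how time derivatives are controlled by differences of heat flows. *)
Lemma dheat_norm_sub m : exists2 C, 0 < C & forall t f x (c : B), 0 < t -> heat_L1 f ->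
 ((`|dheat m.+1 t f x|)%:E <= (C * t ^- m.+1)%:E * heat_int (2 * t) (fun z => `|f z - c|%R) x)%E.
have [C C0 hC] := dheat_norm_le m.+1; exists C => // t f x c t0 hf.
have hfc : heat_L1 (fun z => f z - c).
 by apply: heat_L1D => //; exact: heat_L1_cst.
rewrite (_ : dheat m.+1 t f x = dheat m.+1 t (fun z => f z - c) x); first exact: hC.
have e := dheat_lin m.+1 1 x t0 hfc (heat_L1_cst c).
rewrite (dheat_cst m c x t0) scale1r addr0 in e; rewrite -e.
by congr dheat; apply/funext => z; rewrite scale1r subrK.
Qed.

Lemma heatD t f g x : 0 < t -> heat_L1 f -> heat_L1 g ->
 heat t (fun z => f z + g z) x = heat t f x + heat t g x.
move=> t0 hf hg; have -> : (fun z => f z + g z) = (fun z => 1 *: f z + g z).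
 by apply/funext => z; rewrite scale1r.
by rewrite -!dheat0 (dheat_lin 0 1 x t0 hf hg) scale1r.
Qed.

Lemma heatB t f g x : 0 < t -> heat_L1 f -> heat_L1 g ->
 heat t (fun z => f z - g z) x = heat t f x - heat t g x.
move=> t0 hf hg; have -> : (fun z => f z - g z) = (fun z => -1 *: g z + f z).
 by apply/funext => z; rewrite scaleN1r addrC.
by rewrite -!dheat0 (dheat_lin 0 (-1) x t0 hg hf) scaleN1r addrC.
Qed.

Lemma heat_scalar (c : T -> R) (b : B) t x : 0 < t -> Lplus 1 c ->
 heat t (fun z => c z *: b) x = heatop t c x *: b.
move=> t0 Lc; have [mc c0 _] := Lc; apply: bochner_integral_eq => //.
have iK : mu.-integrable setT (EFin \o (fun z => K t x z * c z)).
 apply/integrableP; split; first side.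
 rewrite (_ : (\int[mu]_z _)%E = heat_int t c x); last first.
  apply: eq_integral => z _; rewrite /= ger0_norm//.
  side.
 by rewrite ltey_eq (heat_int_fin x t0 (lexx 1) Lc).
have := is_bochner_scale measurableT b (meas_heat_intl t x mc) iK.
by congr is_bochner_integral; apply/funext => z; rewrite scalerA.
Qed.

Local Opaque heat dheat heatop.

Lemma heat_L1_heat t f : 0 < t -> heat_L1 f -> smeas (heat t f) ->
 heat_L1 (heat t f).
move=> t0 hf ms; split => // s x s0; have mf := heat_L1_meas hf.
apply: le_lt_trans (proj2 hf (s + t) x (addr_gt0 s0 t0)).
rewrite -heat_int_semigroup//; apply: le_integralW => // y _.
 side.
by rewrite EFinM; apply: lee_wpmul2l; [rewrite lee_fin kernel_ge0|exact: heat_norm_le].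
Qed.

(** Strong measurability of the flow and the vector-valued semigroup law. Both are immediate for a
    scalar function times a vector, pass to sums, hence to simple functions, and reach [L^p] by
    approximation; a Fubini theorem for Bochner integrals is thereby avoided. *)
Definition heat_good f := [/\ heat_L1 f, forall t, 0 < t -> smeas (heat t f) &
 forall s t x, 0 < s -> 0 < t -> heat s (heat t f) x = heat (s + t) f x].

Lemma heat_goodD f g : heat_good f -> heat_good g -> heat_good (fun x => f x + g x).
move=> [hf mf cf] [hg mg cg].
have E t : 0 < t -> heat t (fun x => f x + g x) = (fun x => heat t f x + heat t g x).
 by move=> t0; apply/funext => x; exact: heatD.
split; first exact: heat_L1D.
 by move=> t t0; rewrite E//; apply: smeasD; [exact: mf|exact: mg].
move=> s t x s0 t0; rewrite (E _ t0) (E _ (addr_gt0 s0 t0)) heatD.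
- by rewrite (cf s t x s0 t0) (cg s t x s0 t0).
- exact: s0.
- exact: (heat_L1_heat t0 hf (mf t t0)).
- exact: (heat_L1_heat t0 hg (mg t t0)).
Qed.

Lemma heat_good_cst (b : B) : heat_good (fun _ => b).
have E t : 0 < t -> heat t (fun _ : T => b) = (fun _ => b).
 by move=> t0; apply/funext => x; exact: heat_cst.
split; first exact: heat_L1_cst.
 by move=> t t0; rewrite E//; exact: smeas_cst.
by move=> s t x s0 t0; rewrite !E ?addr_gt0.
Qed.

Lemma heat_good_scalar (c : T -> R) (b : B) : Lplus 1 c ->
 heat_good (fun z => c z *: b).
move=> Lc; have [mc c0 _] := Lc.
have E t : 0 < t -> heat t (fun z => c z *: b) = (fun x => heatop t c x *: b).
 by move=> t0; apply/funext => x; exact: heat_scalar.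
split.
- split; first by apply: (smeasZ (c := c)); [exact: meas_smeas|exact: smeas_cst].
 move=> t x t0.
 have -> : heat_int t (fun y => `|c y *: b|) x = (heat_int t c x * (`|b|)%:E)%E.
  rewrite muleC /heat_int -ge0_integralZl//.
  + by apply: eq_integral => y _; rewrite normrZ (ger0_norm (c0 y)) -EFinM; congr EFin; ring.
  + side.
  + side.
 by rewrite -(heatopK x t0 (lexx 1) Lc) -EFinM ltry.
- move=> t t0; rewrite E//; apply: (smeasZ (c := heatop t c)); last exact: smeas_cst.
 by apply: meas_smeas; exact: meas_heatop.
move=> s t x s0 t0; rewrite (E _ t0) (E _ (addr_gt0 s0 t0)) heat_scalar.
- by rewrite (heatop_semigroup x s0 t0 (lexx 1) Lc).
- exact: s0.
- exact: Lplus_heatop t0 (lexx 1) Lc.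
Qed.

Lemma heat_good_simple (s : T -> B) : simple_integrable mu setT s -> heat_good s.
move=> [[/finite_seqP[L hL] ms] fs].
pose F b x := (if b == 0 then 0 else \1_(s @^-1` [set b]) x) *: b.
have -> : s = (fun x => \sum_(b <- undup L) F b x).
 apply/funext => x; have sL : s x \in undup L.
  rewrite mem_undup; have : range s (s x) by exists x.
  by rewrite hL.
 rewrite (bigD1_seq (s x))//= ?undup_uniq// big1 ?addr0.
  by rewrite /F indicE mem_set//; case: eqP => [->|_]; rewrite ?scaler0 ?scale1r.
 move=> b bs; rewrite /F indicE; case: eqP => _; first by rewrite scale0r.
 rewrite memNset ?scale0r//= => sb; by move: bs; rewrite sb eqxx.
elim: (undup L) => [|b l ih].
 by under eq_fun do rewrite big_nil; exact: heat_good_cst.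
under eq_fun do rewrite big_cons.
apply: heat_goodD; last exact: ih.
rewrite /F.
have [->|b0] := eqVneq b 0.
 by under eq_fun do rewrite scaler0; exact: heat_good_cst.
apply: heat_good_scalar; split => //.
rewrite (_ : (\int[mu]_x _)%E = mu (s @^-1` [set b])); last first.
 rewrite -[in RHS](setIT (s @^-1` _)) -integral_indic//.
 by apply: eq_integral => x _; rewrite powRr1.
by have := fs b b0; rewrite setTI.
Qed.

Definition heat_Lp (p : R) f := smeas f /\ Lplus p (fun x => `|f x|).

Lemma heat_Lp_integrable p f : 1 <= p -> heat_Lp p f -> heat_L1 f.
move=> p1 [mf Lf]; split => // t x t0.
by rewrite ltey_eq (heat_int_fin x t0 p1 Lf).
Qed.

Lemma heat_int_cvg0 p t x (h : nat -> T -> R) : 0 < t -> 1 <= p ->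
 (forall k, Lplus p (h k)) -> (\int[mu]_z (h k z `^ p)%:E)%E @[k --> \oo] --> 0%E ->
 heat_int t (h k) x @[k --> \oo] --> 0%E.
move=> t0 p1 Lh ch; have p0 : 0 < p by exact: lt_le_trans p1.
apply: cvge0I => [k|e e0]; first by apply: heat_int_ge0 => y; case: (Lh k).
pose c := ((4 * pi * t) `^ (n%:R / 2))^-1.
have c0 : 0 < c by rewrite invr_gt0 powR_gt0// fourpi_gt0.
have ep : 0 < e `^ p / c by side.
apply: filterS (cvge0_le ep ch) => k hk.
rewrite -(heatopK x t0 p1 (Lh k)) lee_fin leNgt; apply/negP => eh.
have [mh h0 _] := Lh k.
have : (((heatop t (h k) x) `^ p)%:E <= (e `^ p)%:E)%E.
 apply: le_trans (heat_int_jensen x t0 p1 (Lh k)) _.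
 apply: (@le_trans _ _ (c%:E * \int[mu]_z (h k z `^ p)%:E)%E); last first.
  apply: le_trans (lee_wpmul2l _ hk) _; first side.
  by rewrite -EFinM lee_fin mulrC divfK ?gt_eqF.
 rewrite -ge0_integralZl//; [|side..].
 apply: le_integralW => // z _.
  side.
 rewrite -EFinM lee_fin; apply: ler_wpM2r; first side.
 exact: heat_kernel_ub.
rewrite lee_fin leNgt => /negP; apply.
by apply: gt0_ltr_powR; rewrite ?nnegrE// ltW// (lt_trans e0).
Qed.

Lemma LplusZ p (c : R) (h : T -> R) : 0 <= c -> Lplus p h -> Lplus p (fun x => c * h x).
move=> c0 [mh h0 fh]; split.
- side.
- side.
under eq_integral do rewrite powRM// EFinM.
rewrite ge0_integralZl//.
- by apply: lte_mul_pinfty => //; rewrite lee_fin powR_ge0.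
- side.
- side.
- side.
Qed.

Lemma heat_Lp_good p f : 1 <= p -> heat_Lp p f -> heat_good f.
move=> p1 hf; have p0 : 0 < p by exact: lt_le_trans p1.
have hi := heat_Lp_integrable p1 hf; have [mf Lf] := hf.
have [sk [isk bsk csk isk0]] := smeas_Lp_approx measurableT p0 mf (let: And3 _ _ h := Lf in h).
have gk k := heat_good_simple (isk k).
have Lk k : Lplus p (fun z => `|f z - sk k z|).
 apply: (@LplusS _ _ _ _ (fun z => 3 * `|f z|)); first exact: ltW.
 - by apply: smeas_norm; apply: smeasB => //; apply: fsimple_smeas; case: (isk k).
 - by [].
 - move=> z; apply: le_trans (ler_normB _ _) _.
  by have := bsk k z; lra.
 by apply: LplusZ.
have ck t x : 0 < t -> heat_int t (fun z => `|f z - sk k z|) x @[k --> \oo] --> 0%E.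
 by move=> t0; exact: (heat_int_cvg0 x t0 p1 Lk isk0).
have hk k : heat_L1 (sk k) by case: (gk k).
have hd k : heat_L1 (fun z => f z - sk k z).
 by apply: heat_L1D => //; exact: heat_L1N.
have sm t : 0 < t -> smeas (heat t f).
 move=> t0; apply: (@smeas_cvg _ _ _ _ (fun k => heat t (sk k))) => [k|x].
  by case: (gk k) => _ + _; exact.
 apply/cvgrPdist_le => e e0; apply: filterS (cvge0_le e0 (ck t x t0)) => k.
 by rewrite -heatB// -lee_fin; apply: le_trans; exact: heat_norm_le.
split; [exact: hi|exact: sm|move=> s t x s0 t0].
apply/eqP; rewrite -subr_eq0 -normr_le0; apply/ler_addgt0Pl => e e0; rewrite addr0.
have e20 : 0 < e / 2 by side.
have st0 : 0 < s + t by side.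
have [k _ /(_ k (leqnn k)) ek] := cvge0_le e20 (ck (s + t) x st0).
have [_ smk CKk] := gk k.
have ht : heat_L1 (heat t f) by apply: heat_L1_heat => //; exact: sm.
have htk : heat_L1 (heat t (sk k)) by apply: heat_L1_heat => //; exact: smk.
rewrite -(subrK (heat s (heat t (sk k)) x) (heat s (heat t f) x)) -addrA.
apply: le_trans (ler_normD _ _) _; rewrite [e]splitr; apply: lerD.
 rewrite -heatB// -lee_fin; apply: le_trans ek; apply: le_trans (heat_norm_le _ _ _) _.
 rewrite -heat_int_semigroup//; last exact: heat_L1_meas.
 apply: le_integralW => // y _; first side.
 rewrite EFinM; apply: lee_wpmul2l; first side.
 by rewrite -heatB//; exact: heat_norm_le.
rewrite CKk// distrC -heatB// -lee_fin; apply: le_trans ek.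
exact: heat_norm_le.
Qed.

Lemma heat_Lp_heat p t f : 0 < t -> 1 <= p -> heat_Lp p f -> heat_Lp p (heat t f).
move=> t0 p1 hf; have [_ sm _] := heat_Lp_good p1 hf; have [mf Lf] := hf.
split; first exact: sm.
apply: (@LplusS _ _ _ _ (heatop t (fun x => `|f x|))).
- side.
- by apply: smeas_norm; exact: sm.
- by [].
- by move=> x; rewrite -lee_fin (heatopK x t0 p1 Lf); exact: heat_norm_le.
- exact: Lplus_heatop.
Qed.

Lemma heat_semigroup p s t f x : 0 < s -> 0 < t -> 1 <= p -> heat_Lp p f ->
 heat s (heat t f) x = heat (s + t) f x.
move=> s0 t0 p1 hf; have [_ _ h] := heat_Lp_good p1 hf; exact: (h s t x s0 t0). Qed.

Lemma dheat_semigroup p m s t f x : 0 < s -> 0 < t -> 1 <= p -> heat_Lp p f ->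
 dheat m s (heat t f) x = dheat m (s + t) f x.
move=> s0 t0 p1 hf; have hi := heat_Lp_integrable p1 hf.
have hit := heat_Lp_integrable p1 (heat_Lp_heat t0 p1 hf).
elim: m s s0 => [|m ih] s s0; first by rewrite !dheat0 (heat_semigroup _ s0 t0 p1 hf).
have d1 := is_derive_dheat m x s0 hit.
have d2 := is_derive_dheat m x (addr_gt0 s0 t0) hi.
rewrite -(@derive_val _ _ _ _ _ _ _ d1) -(@derive_val _ _ _ _ _ _ _ d2).
rewrite (@near_eq_derive _ _ _ _ (fun u => dheat m (u + t) f x)).
 exact: derive_shift.
near=> u; apply: ih; near: u; exact: lt_nbhsr.
Unshelve. all: by end_near. Qed.

End vector_heat.

(** * Heat averages of bounded functions of two points *)

Section bounded_kernel_integrals.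
Context (R : realType) (n : nat).
Local Notation T := (Rn R n).
Local Notation mu := (lebesgue_Rn R n).
Local Notation K := (@heat_kernel R n).
Implicit Types (h : T -> R) (G : T -> T -> R) (s t : R) (x : T).
Local Opaque heat_kernel.

Lemma heat_int_bounded t h x (b : R) : 0 < t -> (forall y, 0 <= h y <= b) ->
 (heat_int t h x <= b%:E)%E.
move=> t0 hb; have b0 : 0 <= b by have /andP[h1 h2] := hb x; exact: le_trans h2.
rewrite -(heat_int_cst x t0 b0); apply: heat_int_le => y; first by case/andP: (hb y).
by case/andP: (hb y).
Qed.

Lemma heatopE t h x (b : R) : 0 < t -> (forall y, 0 <= h y <= b) ->
 (heatop t h x)%:E = heat_int t h x.
move=> t0 hb; rewrite /heatop fineK// ge0_fin_numE.
 exact: le_lt_trans (heat_int_bounded x t0 hb) (ltry _).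
by apply: heat_int_ge0 => y; case/andP: (hb y).
Qed.

Lemma heatop_le_int s t g h x y (c a b : R) : 0 < s -> (forall y, 0 <= g y <= a) ->
 0 < t -> (forall y, 0 <= h y <= b) ->
 (heat_int s g x <= c%:E * heat_int t h y)%E -> heatop s g x <= c * heatop t h y.
move=> s0 ga t0 hb; rewrite -lee_fin EFinM.
by rewrite (heatopE x s0 ga) (heatopE y t0 hb).
Qed.

Lemma heatop_bounded t h x (b : R) : 0 < t -> (forall y, 0 <= h y <= b) ->
 0 <= heatop t h x <= b.
move=> t0 hb; rewrite -!lee_fin (heatopE x t0 hb) (heat_int_bounded x t0 hb) andbT.
by apply: heat_int_ge0 => y; case/andP: (hb y).
Qed.

Lemma heatop_ub r t h : 0 < t -> 1 <= r -> Lplus r h ->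
 exists2 b : R, 0 <= b & forall x, heatop t h x <= b.
move=> t0 r1 Lh; have [mh h0 fh] := Lh.
pose c := ((4 * pi * t) `^ (n%:R / 2))^-1.
have c0 : 0 <= c by rewrite invr_ge0 powR_ge0.
pose I := fine (\int[mu]_x (h x `^ r)%:E)%E.
have I0 : (0 <= \int[mu]_x (h x `^ r)%:E)%E by side.
have IE : (I%:E = \int[mu]_x (h x `^ r)%:E)%E by rewrite /I fineK// ge0_fin_numE.
exists (1 + c * I); first by rewrite addr_ge0// mulr_ge0// fine_ge0.
move=> x; have [h1|h1] := leP (heatop t h x) 1.
 by apply: le_trans h1 _; rewrite lerDl mulr_ge0// fine_ge0.
apply: le_trans (le1r_powR (ltW h1) r1) _; apply: (@le_trans _ _ (c * I)); last by rewrite lerDr.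
rewrite -lee_fin; apply: le_trans (heat_int_jensen x t0 r1 Lh) _.
rewrite EFinM IE -ge0_integralZl//; [|side..].
apply: le_integralW => // z _.
 side.
rewrite -EFinM lee_fin; apply: ler_wpM2r; first side.
exact: heat_kernel_ub.
Qed.

Lemma heatop_mono t g h x (b : R) : 0 < t -> (forall y, 0 <= g y) -> (forall y, g y <= h y) ->
 (forall y, h y <= b) -> heatop t g x <= heatop t h x.
move=> t0 g0 gh hb; rewrite -lee_fin (@heatopE t g x b)//; last first.
 by move=> y; rewrite g0 (le_trans (gh y)).
rewrite (@heatopE t h x b)//; first exact: heat_int_le.
by move=> y; rewrite hb (le_trans (g0 y)).
Qed.

Lemma heatop_linear t h1 h2 x (c b : R) : 0 < t -> 0 <= c -> measurable_fun setT h1 ->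
 measurable_fun setT h2 -> (forall y, 0 <= h1 y <= b) -> (forall y, 0 <= h2 y <= b) ->
 heatop t (fun y => h1 y + c * h2 y) x = heatop t h1 x + c * heatop t h2 x.
move=> t0 c0 m1 m2 hb1 hb2; apply: EFin_inj; rewrite EFinD EFinM.
have p1 y : 0 <= h1 y by case/andP: (hb1 y).
have p2 y : 0 <= h2 y by case/andP: (hb2 y).
rewrite (heatopE x t0 hb1) (heatopE x t0 hb2).
rewrite (@heatopE _ _ x (b + c * b))//; last first.
 move=> y; have /andP[_ u1] := hb1 y; have /andP[_ u2] := hb2 y.
 by rewrite addr_ge0 ?mulr_ge0//= lerD// ler_wpM2l.
rewrite /heat_int -ge0_integralZl//; [|side..].
rewrite -ge0_integralD//; [|side..].
by apply: eq_integral => y _; rewrite -EFinM -EFinD; congr EFin; ring.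
Qed.

Lemma heatop_cst t (c : R) x : 0 < t -> 0 <= c -> heatop t (fun=> c) x = c.
by move=> t0 c0; rewrite /heatop heat_int_cst. Qed.

Lemma heatop_jensen_bounded r t h x (b : R) : 0 < t -> 1 <= r -> measurable_fun setT h ->
 (forall y, 0 <= h y <= b) -> heatop t h x `^ r <= heatop t (fun y => h y `^ r) x.
move=> t0 r1 mh hb; have h0 y : 0 <= h y by case/andP: (hb y).
have hbr y : 0 <= h y `^ r <= b `^ r.
 rewrite powR_ge0 /=; apply: ler_powR2 => //; first side.
 by case/andP: (hb y).
rewrite -lee_fin (heatopE x t0 hbr).
apply: kernel_jensen => //.
- side.
- side.
- exact: integral_kernel.
- by rewrite (heatopE x t0 hb).
Qed.

(** The companion of [heat_kernel_gauss]: for [s < t], a Gaussian damping turns the kernel at time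
    [t] into the one at the shorter time [s]. *)
Lemma heat_kernel_damp s t x y : 0 < s -> 0 < t ->
 K t x y * expR (- (sqd x y * ((4 * s)^-1 - (4 * t)^-1))) = (s / t) `^ (n%:R / 2) * K s x y.
move=> s0 t0; rewrite !kernelE.
have -> : 4 * pi * s = (s / t) * (4 * pi * t) by field; rewrite gt_eqF.
rewrite (powRM _ (ltW (divr_gt0 s0 t0)) (ltW (fourpi_gt0 t0))) -[LHS]mulrA -expRD.
have a0 : (s / t) `^ (n%:R / 2) != 0 by side.
have b0 : (4 * pi * t) `^ (n%:R / 2) != 0 by side.
have -> : - (sqd x y / (4 * t)) - sqd x y * ((4 * s)^-1 - (4 * t)^-1) = - (sqd x y / (4 * s)).
 by field; rewrite !gt_eqF.
move: (_ `^ _) (_ `^ _) a0 b0 (expR _) => a b a0 b0 c.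
by field; rewrite a0 b0.
Qed.

(** The averaged function may depend on the base point [x], as do differences between a flow at [z]
    and a later flow at [x]. *)
Definition kint_int s G x : \bar R := (\int[mu]_z (K s x z * G x z)%:E)%E.
Definition kint s G x : R := fine (kint_int s G x).
Definition bounded_by (b : R) G := measurable_fun setT (fun w : T * T => G w.1 w.2) /\
 forall x z, 0 <= G x z <= b.

Lemma bounded_by_measurable b G x : bounded_by b G -> measurable_fun setT (G x).
case=> mG _; apply: (measurableT_comp (f := fun w : T * T => G w.1 w.2) (g := fun z => (x, z))) => //.
exact: measurable_pair1.
Qed.

Lemma kintE s G x b : 0 < s -> bounded_by b G -> (kint s G x)%:E = kint_int s G x.
by move=> s0 [_ hG]; exact: (@heatopE s (G x) x b). Qed.

Lemma kint_bounded s G x b : 0 < s -> bounded_by b G -> 0 <= kint s G x <= b.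
by move=> s0 [_ hG]; exact: (@heatop_bounded s (G x) x b). Qed.

Lemma meas_kint s G b : 0 < s -> bounded_by b G -> measurable_fun setT (kint s G).
move=> s0 [mG hG].
have m1 : measurable_fun setT (kint_int s G).
 apply: (measurable_fun_fubini_tonelli_F (m2 := mu)
  (fun z : T * T => (K s z.1 z.2 * G z.1 z.2)%:E)).
  apply/measurable_EFinP; apply: measurable_funM => //.
  exact: meas_heat_kernel2.
 move=> z; rewrite lee_fin mulr_ge0//; first side.
 by case/andP: (hG z.1 z.2).
by apply: measurableT_comp m1; exact: fine_measurable.
Qed.

Lemma kint_le_time s t G x b : 0 < s -> s <= t -> bounded_by b G ->
 kint s G x <= (t / s) `^ (n%:R / 2) * kint t G x.
move=> s0 st hG; have t0 := lt_le_trans s0 st.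
rewrite -lee_fin EFinM (kintE x s0 hG) (kintE x t0 hG) /kint_int -ge0_integralZl//; last 3 first.
- apply/measurable_EFinP; apply: measurable_funM; first side.
 exact: bounded_by_measurable hG.
- move=> z _; rewrite lee_fin mulr_ge0//; first side.
 by case: hG => _ /(_ x z)/andP[].
- side.
apply: le_integralW => // z _; have /andP[G0 _] := proj2 hG x z.
 side.
rewrite -EFinM lee_fin mulrA; apply: ler_wpM2r => //.
exact: heat_kernel_le.
Qed.

End bounded_kernel_integrals.

Lemma powR_expR (R : realType) (x a : R) : expR x `^ a = expR (a * x).
by rewrite /powR gt_eqF ?expR_gt0// expRK. Qed.

(** A pointwise substitute for Hölder's inequality: both factors are compared with the larger of [w]
    and [b ^ (1/p)]. *)
Lemma powR_interpolate (R : realType) (p q w b : R) : 0 < p -> p <= q -> 0 <= w -> 0 <= b ->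
 (w `^ (q - p) * b) `^ (p / q) <= w `^ p + b.
move=> p0 pq w0 b0; have q0 : 0 < q by exact: lt_le_trans pq.
pose m := Num.max w (b `^ p^-1).
have wm : w <= m by rewrite le_max lexx.
have bm : b `^ p^-1 <= m by rewrite le_max lexx orbT.
have m0 : 0 <= m by exact: le_trans wm.
have qp : 0 <= q - p by side.
have bp : b = (b `^ p^-1) `^ p by rewrite -powRrM mulVf ?gt_eqF// powRr1.
have h1 : w `^ (q - p) * b <= m `^ q.
 have [mz|mz] := eqVneq m 0.
  have -> : b = 0.
   rewrite bp; have -> : b `^ p^-1 = 0.
    by apply/eqP; rewrite eq_le powR_ge0 andbT -mz.
   by rewrite powR0// gt_eqF.
  by rewrite mulr0 powR_ge0.
 apply: (@le_trans _ _ (m `^ (q - p) * m `^ p)).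
  apply: ler_pM => //; [exact: powR_ge0|exact: ler_powR2|].
  by rewrite {1}bp; apply: ler_powR2 => //; [exact: ltW|exact: powR_ge0].
 by rewrite -powRD ?mz ?implybT// subrK.
have pq0 : 0 <= p / q by side.
have h2 := ler_powR2 pq0 (mulr_ge0 (powR_ge0 w (q - p)) b0) h1.
apply: le_trans h2 _; rewrite -powRrM mulrC divfK ?gt_eqF//.
rewrite /m maxEle; case: ifP => _; first by rewrite -bp lerDr powR_ge0.
by rewrite lerDl.
Qed.

Lemma absorb_half (R : realType) (a u g h : R) : a <= u -> u + g <= h / 2 + a / 2 ->
 a + 2 * g <= h.
by move=> au ug; lra. Qed.

Lemma weights336 (R : realType) (a b : R) : 0 <= a ->
 336^-1 * (a + b) <= 21 / 336 * a + 336^-1 * b.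
by move=> a0; lra. Qed.

(** * Gaps between heat flows and their weights *)

Section square_function.
Context (R : realType) (B : completeNormedModType R) (n : nat) (N : B -> R) (q M : R).
Hypotheses (Nn : is_norm N) (q2 : 2 <= q) (M0 : 0 < M) (NM : forall b, N b <= M * `|b|).
Local Notation T := (Rn R n).
Local Notation mu := (lebesgue_Rn R n).
Local Notation K := (@heat_kernel R n).
Implicit Types (f F H : T -> B) (r s t : R) (x y z : T).
Local Opaque heat_kernel heat heatop.

Let N0 b : 0 <= N b. Proof. exact: is_norm_ge0. Qed.
Let ND a b : N (a + b) <= N a + N b. Proof. by case: Nn. Qed.
Let NZ (a : R) b : N (a *: b) = `|a| * N b. Proof. by case: Nn. Qed.
Let q0 : 0 < q. Proof. exact: lt_le_trans q2. Qed.

Lemma norm_cvg (u : nat -> B) (a : B) : u k @[k --> \oo] --> a -> N (u k) @[k --> \oo] --> N a.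
move=> ua; apply/cvgrPdist_le => e e0.
have M1 : 0 < `|M| + 1 by side.
have e1 : 0 < e / (`|M| + 1) by side.
move/cvgrPdist_le : ua => /(_ _ e1); apply: filterS => k hk.
apply: (@le_trans _ _ (N (a - u k))).
 rewrite ler_norml lerNl opprB (is_norm_triB Nn) andbT.
 by rewrite is_norm_distC//; exact: is_norm_triB.
apply: le_trans (NM _) _; apply: (@le_trans _ _ ((`|M| + 1) * `|a - u k|)).
 by apply: ler_wpM2r => //; apply: le_trans (ler_norm _) _; rewrite lerDl.
by rewrite mulrC -ler_pdivlMr.
Qed.

Lemma meas_norm d (T' : measurableType d) (F : T' -> B) : smeas F ->
 measurable_fun setT (fun w => N (F w)).
by apply: smeas_measurable => u a; exact: norm_cvg. Qed.

(** The gain of [two_point] for the exponent [r]; for [r = q] it is [N (a - b) ^ q]. *)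
Definition gap r (a b : B) := N (a - b) `^ q * (N a + N b) `^ (r - q).

Lemma gap_ge0 r a b : 0 <= gap r a b.
by apply: mulr_ge0; exact: powR_ge0. Qed.

Lemma gap_mul r a b : gap q a b = gap r a b * (N a + N b) `^ (q - r).
rewrite /gap subrr powRr0 mulr1.
have [S0|S0] := leP (N a + N b) 0.
 have -> : N (a - b) = 0.
  by apply/eqP; rewrite eq_le N0 andbT; apply: le_trans S0; exact: is_normB_le.
 by rewrite powR0 ?mul0r// gt_eqF.
rewrite -mulrA -powRD; last by rewrite (gt_eqF S0) implybT.
by rewrite addrA subrK subrr powRr0 mulr1.
Qed.

Lemma gap_le r a b : gap r a b <= (N a + N b) `^ r.
rewrite /gap; have [S0|S0] := leP (N a + N b) 0.
 have -> : N (a - b) = 0.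
  by apply/eqP; rewrite eq_le N0 andbT; apply: le_trans S0; exact: is_normB_le.
 by rewrite powR0 ?mul0r ?powR_ge0// gt_eqF.
apply: (@le_trans _ _ ((N a + N b) `^ q * (N a + N b) `^ (r - q))).
 apply: ler_wpM2r; first side.
 by apply: ler_powR2 => //; [exact: ltW|exact: is_normB_le].
by rewrite -powRD ?(gt_eqF S0) ?implybT// addrCA subrr addr0.
Qed.

Lemma gap_bounded r F H (b : R) : 0 <= r -> smeas F -> smeas H -> (forall x, N (F x) <= b) ->
 (forall x, N (H x) <= b) -> bounded_by ((b + b) `^ r) (fun x z => gap r (F z) (H x)).
move=> r0 mF mH Fb Hb; split; last first.
 move=> x z; rewrite gap_ge0 /=; apply: le_trans (gap_le _ _ _) _.
 by apply: ler_powR2 => //; [rewrite addr_ge0|exact: lerD].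
have mF2 : smeas (fun w : T * T => F w.2) by exact: (smeas_comp measurable_snd mF).
have mH1 : smeas (fun w : T * T => H w.1) by exact: (smeas_comp measurable_fst mH).
apply: measurable_funM; apply: meas_powR.
 by apply: meas_norm; exact: smeasB.
by apply: measurable_funD; exact: meas_norm.
Qed.

(** A strengthened Jensen inequality. The two-point inequality is applied to [F z] and the mean [m];
    the midpoints again have mean [m], so [N m ^ r] is at most the average of their [r]-th powers,
    and [N m ^ r / 2] is absorbed. *)
Lemma heat_gain r c F s x (b : R) : 1 < r ->
 (forall a b, N (2^-1 *: (a + b)) `^ r + c * gap r a b <= (N a `^ r + N b `^ r) / 2) ->
 0 < c -> 0 < s -> heat_L1 F -> (forall z, N (F z) <= b) ->
 N (heat s F x) `^ r + 2 * c * heatop s (fun z => gap r (F z) (heat s F x)) x <=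
  heatop s (fun z => N (F z) `^ r) x.
move=> r1 tp c0 s0 hF Fb; have r0 : 0 <= r by apply: ltW; exact: lt_trans r1.
set m := heat s F x; have mF := proj1 hF.
pose u z := N (2^-1 *: (F z + m)).
have b0 : 0 <= b by exact: le_trans (Fb x).
have hm : heat_L1 (fun z => 2^-1 *: (F z + m)).
 have -> : (fun z => 2^-1 *: (F z + m)) = (fun z => F z + 2^-1 *: (m - F z)).
  by apply/funext => z; lin (F z) m (0 : B); field.
 apply: heat_L1D => //; split.
  apply: (smeasZ (c := fun=> 2^-1)); first exact: smeas_cst.
  by apply: smeasB => //; exact: smeas_cst.
 move=> t y t0; have hd : heat_L1 (fun z => m - F z).
  by apply: heat_L1D; [exact: heat_L1_cst|exact: heat_L1N].
 apply: le_lt_trans (proj2 hd t y t0); apply: heat_int_le => z //.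
 by rewrite normrZ ger0_norm ?invr_ge0//; have := normr_ge0 (m - F z); lra.
have mu_ : measurable_fun setT u by apply: meas_norm; case: hm.
have u0 z : 0 <= u z by exact: N0.
have ub z : 0 <= u z <= b + N m.
 apply/andP; split; first exact: u0.
 rewrite /u NZ ger0_norm ?invr_ge0 ?ler0n// mulrC ler_pdivrMr ?ltr0n//.
 by apply: le_trans (ND _ _) _; have := Fb z; have := N0 m; have := N0 (F z); lra.
have j1 : N m <= heatop s u x.
 have Em : heat s (fun z => 2^-1 *: (F z + m)) x = m.
  rewrite (_ : (fun z => _) = (fun z => 2^-1 *: F z + 2^-1 *: m)); last first.
   by apply/funext => z; rewrite scalerDr.
  rewrite -dheat0 (dheat_lin 0 _ x s0 hF (heat_L1_cst n (2^-1 *: m))) !dheat0 heat_cst//.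
  by rewrite -/m; lin m (0 : B) (0 : B); field.
 rewrite -lee_fin (heatopE x s0 ub) -{1}Em.
 by apply: (@heat_semi_norm_le _ _ _ N M).
pose g z := gap r (F z) m.
have mg : measurable_fun setT g.
 apply: measurable_funM; apply: meas_powR.
  by apply: meas_norm; apply: smeasB => //; exact: smeas_cst.
 by apply: measurable_funD; [exact: meas_norm|exact: measurable_cst].
have gb z : 0 <= g z <= (b + N m) `^ r.
 rewrite gap_ge0 /=; apply: le_trans (gap_le _ _ _) _.
 by apply: ler_powR2; [exact: r0|exact: addr_ge0|rewrite lerD2r; exact: Fb].
have Fbb z : 0 <= N (F z) `^ r <= b `^ r.
 by rewrite powR_ge0 /=; apply: ler_powR2.
have urb z : 0 <= u z `^ r <= (b + N m) `^ r.
 by rewrite powR_ge0 /=; apply: ler_powR2 => //; case/andP: (ub z).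
have j3 : N m `^ r <= heatop s (fun z => u z `^ r) x.
 apply: (@le_trans _ _ (heatop s u x `^ r)); first exact: ler_powR2.
 by apply: heatop_jensen_bounded ub => //; exact: ltW.
have j4 : heatop s (fun z => u z `^ r) x + c * heatop s g x <=
  heatop s (fun z => N (F z) `^ r) x / 2 + N m `^ r / 2.
 pose bb := (b + N m) `^ r.
 have bb0 : 0 <= bb by exact: powR_ge0.
 have bbb : b `^ r <= bb by apply: ler_powR2 => //; rewrite lerDl.
 have h1 : heatop s (fun z => u z `^ r + c * g z) x = heatop s (fun z => u z `^ r) x + c * heatop s g x.
  apply: (@heatop_linear _ _ _ _ _ _ _ bb) ; [exact: s0|exact: (ltW c0)|exact: (meas_powR _ mu_)|exact: mg|exact: urb|exact: gb].
 have h2 : heatop s (fun z => N m `^ r / 2 + 2^-1 * N (F z) `^ r) x =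
   N m `^ r / 2 + 2^-1 * heatop s (fun z => N (F z) `^ r) x.
  rewrite (@heatop_linear _ _ _ _ _ _ _ bb).
  - by rewrite heatop_cst// divr_ge0 ?powR_ge0.
  - exact: s0.
  - side.
  - side.
  - by apply: meas_powR; exact: meas_norm.
  - move=> z; rewrite divr_ge0 ?powR_ge0//=.
   have : N m `^ r <= bb by apply: ler_powR2 => //; rewrite lerDr.
   by have := powR_ge0 (N m) r; lra.
  - by move=> z; rewrite powR_ge0 /=; case/andP: (Fbb z) => _ h; exact: le_trans bbb.
 rewrite -h1.
 apply: (@le_trans _ _ (heatop s (fun z => N m `^ r / 2 + 2^-1 * N (F z) `^ r) x)); last first.
  by rewrite h2 addrC (mulrC 2^-1).
 apply: (@heatop_mono _ _ _ _ _ _ (N m `^ r / 2 + 2^-1 * b `^ r)); first exact: s0.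
 - move=> z.
  by case/andP: (gb z) => g0 _; rewrite addr_ge0 ?powR_ge0// mulr_ge0// ltW.
 - move=> z.
  by apply: le_trans (tp (F z) m) _; rewrite mulrDl addrC (mulrC 2^-1).
 - move=> z.
  by rewrite lerD2l ler_wpM2l//; case/andP: (Fbb z).
have -> : 2 * c * heatop s g x = 2 * (c * heatop s g x) by rewrite mulrA.
exact: absorb_half j3 j4.
Qed.

Lemma norm_heat_le p t f x : 0 < t -> 1 <= p -> heat_Lp p f ->
 N (heat t f x) <= M * heatop t (fun z => `|f z|) x.
move=> t0 p1 [mf Lf]; apply: le_trans (NM _) _; apply: ler_wpM2l; first exact: ltW.
by rewrite -lee_fin (heatopK x t0 p1 Lf); exact: heat_norm_le.
Qed.

Lemma norm_heat_ub p t f : 0 < t -> 1 <= p -> heat_Lp p f ->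
 exists2 b, 0 <= b & forall x, N (heat t f x) <= b.
move=> t0 p1 hf; have [b b0 hb] := heatop_ub t0 p1 (proj2 hf).
exists (M * b) => [|x]; first side.
by apply: le_trans (norm_heat_le x t0 p1 hf) _; apply: ler_wpM2l => //; exact: ltW.
Qed.

(** The vector [heat (256 * t) f x] is the mean of [heat t f] at time [255 * t], so [heat_gain]
    applies to it. *)
Definition heat_gap r f t x z := gap r (heat t f z) (heat (256 * t) f x).

Lemma heat_gap_bounded p r t f : 0 < t -> 1 <= p -> heat_Lp p f -> 0 <= r ->
 exists b, bounded_by b (heat_gap r f t).
move=> t0 p1 hf r0; have t1 : 0 < 256 * t by exact: (mulr_gt0 (ltr0Sn _ 255) t0).
have [b1 b10 hb1] := norm_heat_ub t0 p1 hf.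
have [b2 b20 hb2] := norm_heat_ub t1 p1 hf.
exists ((Num.max b1 b2 + Num.max b1 b2) `^ r); apply: gap_bounded => //.
- by case: (heat_Lp_heat t0 p1 hf).
- by case: (heat_Lp_heat t1 p1 hf).
- by move=> x; rewrite le_max hb1.
- by move=> x; rewrite le_max hb2 orbT.
Qed.

Lemma heat_gap_gain p r c f t x : 1 <= p -> heat_Lp p f -> 0 < t -> 1 < r -> 0 < c ->
 (forall a b, N (2^-1 *: (a + b)) `^ r + c * gap r a b <= (N a `^ r + N b `^ r) / 2) ->
 N (heat (256 * t) f x) `^ r + 2 * c * kint (255 * t) (heat_gap r f t) x <=
  heatop (255 * t) (fun z => N (heat t f z) `^ r) x.
move=> p1 hf t0 r1 c0 tp; have t1 : 0 < 255 * t by exact: (mulr_gt0 (ltr0Sn _ 254) t0).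
have [b b0 hb] := norm_heat_ub t0 p1 hf.
have hi := heat_Lp_integrable p1 (heat_Lp_heat t0 p1 hf).
have := heat_gain x r1 tp c0 t1 hi hb.
rewrite (heat_semigroup x t1 t0 p1 hf) (_ : 255 * t + t = 256 * t); last by ring.
exact.
Qed.

Lemma integral_norm_heat_le p t f : 0 < t -> 1 <= p -> heat_Lp p f ->
 (\int[mu]_x (N (heat t f x) `^ p)%:E <= (M `^ p)%:E * \int[mu]_x (`|f x| `^ p)%:E)%E.
move=> t0 p1 hf; have p0 : 0 <= p by exact: le_trans p1.
apply: (@le_trans _ _ ((M `^ p)%:E * \int[mu]_x (heatop t (fun z => `|f z|%R) x `^ p)%:E)%E).
 have [mh _ _] := Lplus_heatop t0 p1 (proj2 hf).
 rewrite -ge0_integralZl//; [|side..].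
 apply: le_integralW => // x _; first side.
 have g0 : 0 <= heatop t (fun z => `|f z|) x by side.
 rewrite -EFinM lee_fin -(powRM _ (ltW M0) g0).
 by apply: ler_powR2 => //; exact: norm_heat_le p1 hf.
by apply: lee_wpmul2l; [rewrite lee_fin powR_ge0|exact: integral_heatop_powR t0 p1 (proj2 hf)].
Qed.

(** Controls the contribution of scale [t] to the area integral at [x]. The times come from
    [dheat_pointwise]: there a kernel of time at most [14 * t] changes its base point at the cost of
    tripling its time, and the average at [2 * t] absorbs the remaining Gaussian weight. *)
Definition square_piece f t x := heatop (2 * t) (kint (42 * t) (heat_gap q f t)) x.

Lemma square_piece_weight p : 1 < p -> p <= q -> exists (C : R) (k : nat), 0 < C /\
 forall f Nm t0 i x, heat_Lp p f -> 0 < t0 -> (i + k < Nm)%N ->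
  square_piece f (t0 * 4 ^+ i) x <= C * heat_max Nm t0 (fun z => `|f z|) x `^ (q - p) *
   heatop (4 * (t0 * 4 ^+ i)) (kint (255 * (t0 * 4 ^+ i)) (heat_gap p f (t0 * 4 ^+ i))) x.
move=> p1 pq; have p1w := ltW p1.
have qp : 0 <= q - p by side.
(* Makes [(q - p) / (2 * e) <= 1 / 336], where [336 = 8 * 42] is the rate absorbed at time [42 * t];
   the rate [21 / 336 = 1 / 16] is absorbed at time [2 * t]. *)
have [k0 hk0] : exists k : nat, 168 * (q - p) <= k%:R.
 exists (Num.bound (168 * (q - p))); apply: ltW.
 by apply: archi_boundP; rewrite mulr_ge0.
pose k := k0.+1; pose e : R := 4 ^+ k - 1.
have ek : k0%:R <= e.
 rewrite lerBrDr -natrX -[1]/(1%:R) -natrD ler_nat addn1.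
 exact: ltn_trans (ltnSn k0) (ltn_expl _ (isT : (1 < 4)%N)).
have e0 : 0 < e.
 rewrite subr_gt0 exprn_egt1//; lra.
have e4 : 1 + e = 4 ^+ k by rewrite /e addrC subrK.
pose D : R := (1 + e) `^ (n%:R / 2).
have D0 : 0 < D by rewrite powR_gt0// addr_gt0.
pose C1 := (2 * M * D) `^ (q - p).
have C10 : 0 < C1 by rewrite powR_gt0// !mulr_gt0.
pose G : R := 2 `^ (n%:R / 2).
have G0 : 0 < G by rewrite powR_gt0.
pose L : R := (255 / 84) `^ (n%:R / 2).
have L0 : 0 < L by exact: (powR_gt0 _ (divr_gt0 (ltr0Sn _ 254) (ltr0Sn _ 83))).
exists (C1 * G * L * G), (k + 4)%N; split; first side.
move=> f Nm t0 i x hf t00 ikN; set t := t0 * 4 ^+ i.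
have t1 : 0 < t by rewrite mulr_gt0// exprn_gt0.
set w := heat_max _ _ _ x.
have w0 : 0 <= w by exact: heat_max_ge0.
have Lf := proj2 hf.
have pt (a : R) : 0 < a -> 0 < a * t by side.
have hb (j : nat) y : (j <= 4)%N -> N (heat (t * 4 ^+ j) f y) <=
  M * (D * expR (sqd x y / (4 * t * e)) * w).
 move=> j4; have tj : 0 < t * 4 ^+ j by rewrite mulr_gt0// exprn_gt0.
 apply: le_trans (norm_heat_le y tj p1w hf) _; apply: ler_wpM2l; first exact: ltW.
 apply: le_trans (heatop_shift x y tj e0 p1w Lf) _; rewrite -/D.
 apply: ler_pM.
 - side.
 - side.
 - apply: ler_wpM2l; first exact: ltW.
  rewrite ler_expR; apply: ler_wpM2l; first side.
  rewrite lef_pV2 ?posrE ?mulr_gt0//; apply: ler_wpM2r; first exact: ltW.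
  by rewrite ler_pM2l// ler_peMr ?exprn_ege1 ?ltW//; lra.
 rewrite (_ : (1 + e) * (t * 4 ^+ j) = t0 * 4 ^+ (i + (k + j))); last first.
  by rewrite e4 /t !exprD; ring.
 apply: le_heat_max; apply: leq_ltn_trans ikN.
 by rewrite leq_add2l leq_add2l.
have e168 : (q - p) / (2 * e) <= 336^-1.
 by rewrite ler_pdivrMr ?mulr_gt0//; have := le_trans hk0 ek; lra.
have hS x' z : (N (heat t f z) + N (heat (256 * t) f x')) `^ (q - p) <=
  C1 * w `^ (q - p) * (expR (sqd x x' / (16 * t)) * expR (sqd x' z / (336 * t))).
 pose X := (sqd x x' + sqd x' z) / (2 * t * e).
 have tte : 0 < t * e by side.
 have xz : sqd x z <= 2 * sqd x' z + 2 * sqd x x'.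
  have := sqd_triangle x x' z (ltr01 : 0 < 1 :> R).
  by rewrite invr1 [1 + 1](_ : _ = 2)//.
 have b1 : N (heat t f z) <= M * (D * expR X * w).
  have := hb 0 z isT; rewrite expr0 mulr1 => h; apply: le_trans h _.
  apply: ler_wpM2l; first exact: ltW.
  apply: ler_wpM2r => //; apply: ler_wpM2l; first exact: ltW.
  rewrite ler_expR /X ler_pdivrMr ?mulr_gt0//.
  rewrite (_ : _ / _ * _ = 2 * (sqd x x' + sqd x' z)); first by lra.
  by field; rewrite !gt_eqF.
 have b2 : N (heat (256 * t) f x') <= M * (D * expR X * w).
  have := hb 4 x' isT; rewrite (_ : t * 4 ^+ 4 = 256 * t); last by ring.
  move=> h; apply: le_trans h _.
  apply: ler_wpM2l; first exact: ltW.
  apply: ler_wpM2r => //; apply: ler_wpM2l; first exact: ltW.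
  rewrite ler_expR /X ler_pdivrMr ?mulr_gt0//.
  rewrite (_ : _ / _ * _ = 2 * (sqd x x' + sqd x' z)); last by field; rewrite !gt_eqF.
  by have := sqd_ge0 x x'; have := sqd_ge0 x' z; lra.
 apply: (@le_trans _ _ ((2 * M * D * w * expR X) `^ (q - p))).
  have -> : 2 * M * D * w * expR X = M * (D * expR X * w) + M * (D * expR X * w) by ring.
  by apply: ler_powR2; [exact: qp|exact: (addr_ge0 (N0 _) (N0 _))|exact: (lerD b1 b2)].
 have MD0 : 0 <= 2 * M * D by side.
 rewrite (powRM _ (mulr_ge0 MD0 w0) (expR_ge0 _)) (powRM _ MD0 w0) -/C1 powR_expR -expRD.
 apply: ler_wpM2l; first side.
 rewrite ler_expR /X.
 have -> : (q - p) * ((sqd x x' + sqd x' z) / (2 * t * e)) =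
  (q - p) / (2 * e) * ((sqd x x' + sqd x' z) / t) by field; rewrite !gt_eqF.
 apply: (@le_trans _ _ (336^-1 * ((sqd x x' + sqd x' z) / t))).
  by apply: ler_wpM2r => //; rewrite divr_ge0 ?addr_ge0 ?sqd_ge0 ?ltW.
 have -> : sqd x x' / (16 * t) + sqd x' z / (336 * t) = (21 / 336 * sqd x x' + 336^-1 * sqd x' z) / t.
  by field; rewrite gt_eqF.
 rewrite mulrA; apply: ler_wpM2r; first side.
 exact: weights336 (sqd_ge0 _ _).
have [bq hbq] := heat_gap_bounded t1 p1w hf (ltW q0).
have [bp hbp] := heat_gap_bounded t1 p1w hf (le_trans ler01 p1w).
have t42 := pt 42 (ltr0Sn _ 41); have t84 := pt 84 (ltr0Sn _ 83); have t255 := pt 255 (ltr0Sn _ 254).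
have t2 := pt 2 (ltr0Sn _ 1); have t4 := pt 4 (ltr0Sn _ 3).
have hE x' : kint (42 * t) (heat_gap q f t) x' <=
  C1 * w `^ (q - p) * G * L * expR (sqd x x' / (16 * t)) * kint (255 * t) (heat_gap p f t) x'.
 have h84 : kint (84 * t) (heat_gap p f t) x' <= L * kint (255 * t) (heat_gap p f t) x'.
  have := kint_le_time x' t84 (ltac:(lra) : 84 * t <= 255 * t) hbp.
  by rewrite (_ : 255 * t / (84 * t) = 255 / 84)//; field; rewrite gt_eqF.
 apply: (@le_trans _ _ (C1 * w `^ (q - p) * G * expR (sqd x x' / (16 * t)) *
   kint (84 * t) (heat_gap p f t) x')); last first.
  have -> : C1 * w `^ (q - p) * G * L * expR (sqd x x' / (16 * t)) * kint (255 * t) (heat_gap p f t) x' =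
   C1 * w `^ (q - p) * G * expR (sqd x x' / (16 * t)) * (L * kint (255 * t) (heat_gap p f t) x') by ring.
  apply: ler_wpM2l => //.
  by rewrite !mulr_ge0 ?expR_ge0 ?powR_ge0 ?ltW.
 apply: (heatop_le_int t42 (proj2 hbq x') t84 (proj2 hbp x')); rewrite /heat_int -ge0_integralZl//; last 3 first.
 - apply/measurable_EFinP; apply: measurable_funM; first side.
  exact: bounded_by_measurable hbp.
 - by move=> z _; rewrite lee_fin mulr_ge0// ?gap_ge0//; exact: kernel_ge0.
 - by rewrite lee_fin !mulr_ge0 ?expR_ge0 ?powR_ge0 ?ltW.
 apply: le_integralW => // z _.
  by rewrite lee_fin mulr_ge0// ?gap_ge0//; exact: kernel_ge0.
 rewrite -EFinM lee_fin {1}/heat_gap (gap_mul p) -/(heat_gap p f t x' z).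
 have g0 : 0 <= heat_gap p f t x' z by exact: gap_ge0.
 have gs := heat_kernel_gauss x' z t42.
 rewrite (_ : 8 * (42 * t) = 336 * t) in gs; last by ring.
 rewrite (_ : 2 * (42 * t) = 84 * t) -/G in gs; last by ring.
 have K0 := kernel_ge0 (42 * t) x' z.
 apply: (@le_trans _ _ (K (42 * t) x' z * (heat_gap p f t x' z * (C1 * w `^ (q - p) *
   (expR (sqd x x' / (16 * t)) * expR (sqd x' z / (336 * t))))))).
  by apply: ler_wpM2l => //; apply: ler_wpM2l.
 rewrite le_eqVlt; apply/orP; left; apply/eqP.
 transitivity (C1 * w `^ (q - p) * expR (sqd x x' / (16 * t)) *
  (expR (sqd x' z / (336 * t)) * K (42 * t) x' z) * heat_gap p f t x' z); first by ring.
 by rewrite gs; ring.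
have k2 x' := kint_bounded x' t42 hbq; have kp x' := kint_bounded x' t255 hbp.
apply: (heatop_le_int t2 k2 t4 kp).
rewrite /heat_int -ge0_integralZl//; last 3 first.
- apply/measurable_EFinP; apply: meas_heat_intl; exact: meas_kint hbp.
- by move=> z _; rewrite lee_fin mulr_ge0//; [exact: kernel_ge0|case/andP: (kp z)].
- by rewrite lee_fin !mulr_ge0 ?expR_ge0 ?powR_ge0 ?ltW.
apply: le_integralW => // x' _.
 by rewrite lee_fin mulr_ge0//; [exact: kernel_ge0|case/andP: (k2 x')].
rewrite -EFinM lee_fin.
have gs := heat_kernel_gauss x x' t2.
rewrite (_ : 8 * (2 * t) = 16 * t) in gs; last by ring.
rewrite (_ : 2 * (2 * t) = 4 * t) -/G in gs; last by ring.
apply: le_trans (ler_wpM2l (kernel_ge0 _ _ _) (hE x')) _.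
rewrite le_eqVlt; apply/orP; left; apply/eqP.
transitivity (C1 * w `^ (q - p) * G * L * (expR (sqd x x' / (16 * t)) * K (2 * t) x x') *
 kint (255 * t) (heat_gap p f t) x'); first by ring.
by rewrite gs; ring.
Qed.

End square_function.

#[export] Hint Extern 1 (measurable_fun _ (kint _ _)) => apply: meas_kint; eassumption : side.
#[export] Hint Extern 1 (measurable_fun _ (fun _ => kint _ _ _)) => apply: meas_kint; eassumption : side.

(** A gain links the scale [l] to [l + 4], since [256 = 4 ^ 4]. The four residue classes telescope
    together, leaving four initial terms. *)
Lemma telescope4 (R : realType) (A E : nat -> \bar R) (L : nat) :
 (forall l, (A (l + 4)%N + E l <= A l)%E) ->
 (\sum_(l < L) E l + (A L + A (L + 1)%N + A (L + 2)%N + A (L + 3)%N) <=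
  A 0%N + A 1%N + A 2%N + A 3%N)%E.
move=> h; elim: L => [|L ih]; first by rewrite big_ord0 add0e !add0n.
apply: le_trans ih; rewrite big_ord_recr /= -addeA; apply: leeD2l.
rewrite -[L.+1]addn1 -!addnA /=.
have -> : (E L + (A (L + 1)%N + A (L + 2)%N + A (L + 3)%N + A (L + 4)%N) =
 (A (L + 4)%N + E L) + (A (L + 1)%N + A (L + 2)%N + A (L + 3)%N))%E.
 by rewrite [(_ + _ + _ + A (L + 4)%N)%E]addeC addeA [(E L + _)%E]addeC.
rewrite (_ : A L + _ + _ + _ = A L + (A (L + 1)%N + A (L + 2)%N + A (L + 3)%N))%E.
 by apply: leeD.
by rewrite !addeA.
Qed.

Lemma ge0_integral_add_le d (T : measurableType d) (R : realType)
  (mu : {measure set T -> \bar R}) (F G : T -> R) (H : T -> \bar R) :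
 measurable_fun setT F -> measurable_fun setT G -> (forall x, 0 <= F x) ->
 (forall x, 0 <= G x) -> (forall x, ((F x + G x)%:E <= H x)%E) ->
 (\int[mu]_x (F x)%:E + \int[mu]_x (G x)%:E <= \int[mu]_x H x)%E.
move=> mF mG F0 G0 FGH; rewrite -ge0_integralD//; [|side..].
apply: le_integralW => // x _; rewrite -EFinD//.
side.
Qed.

Lemma ge0_integral_scale d (T : measurableType d) (R : realType)
  (mu : {measure set T -> \bar R}) (F : T -> R) (c : R) :
 measurable_fun setT F -> (forall x, 0 <= F x) -> 0 <= c ->
 (\int[mu]_x (c * F x)%:E = c%:E * \int[mu]_x (F x)%:E)%E.
move=> mF F0 c0; under eq_integral do rewrite EFinM.
rewrite ge0_integralZl//; first side.
side.
Qed.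

Lemma absorb_epsilon (R : realType) (e D F I : R) :
 e * I <= D * F + e / 2 * I -> e * I <= 2 * D * F.
by move=> h; lra. Qed.

Lemma damp_exponent (R : realType) (X k t : R) : 0 < t ->
 X * ((4 * ((256^-1 + k / 12)^-1 * t))^-1 - (4 * (256 * t))^-1) = k * (X / (48 * t)).
move=> t0; have -> : (4 * ((256^-1 + k / 12)^-1 * t))^-1 = 4^-1 * ((256^-1 + k / 12) * t^-1).
 by rewrite !invfM invrK.
by field; rewrite gt_eqF.
Qed.

(** * Square sums over dyadic times in L^(p/q) *)

Section square_sum.
Context (R : realType) (B : completeNormedModType R) (n : nat) (N : B -> R) (q M : R).
Hypotheses (Nn : is_norm N) (q2 : 2 <= q) (M0 : 0 < M) (NM : forall b, N b <= M * `|b|)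
 (Nq : uniformly_convex q N).
Local Notation T := (Rn R n).
Local Notation mu := (lebesgue_Rn R n).
Local Notation K := (@heat_kernel R n).
Local Notation Y := (square_piece N q).
Implicit Types (f : T -> B) (g h : T -> R) (p r s t : R) (x y z : T).
Local Opaque heat_kernel heat heatop.

Let N0 b : 0 <= N b. Proof. exact: is_norm_ge0. Qed.
Let q0 : 0 < q. Proof. exact: lt_le_trans q2. Qed.

Lemma two_point_gap r : 1 < r -> r <= q -> exists2 c, 0 < c & forall a b,
 N (2^-1 *: (a + b)) `^ r + c * gap N q r a b <= (N a `^ r + N b `^ r) / 2.
exact: (two_point Nn q2 Nq). Qed.

Lemma square_piece_ge0 p t f x : 0 < t -> 1 <= p -> heat_Lp p f -> 0 <= Y f t x.
move=> t0 p1 hf; apply: heatop_ge0 => y.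
have [b hb] := heat_gap_bounded Nn q2 M0 NM t0 p1 hf (ltW q0).
by have /andP[] := kint_bounded y (mulr_gt0 (ltr0Sn _ 41) t0) hb.
Qed.

Lemma meas_square_piece p t f : 0 < t -> 1 <= p -> heat_Lp p f ->
 measurable_fun setT (Y f t).
move=> t0 p1 hf; have [b hb] := heat_gap_bounded Nn q2 M0 NM t0 p1 hf (ltW q0).
have t42 := mulr_gt0 (ltr0Sn R 41) t0.
apply: meas_heatop; first side.
by move=> y; have /andP[] := kint_bounded y t42 hb.
Qed.

Let A p f t : \bar R := (\int[mu]_x (N (heat t f x) `^ p)%:E)%E.

Lemma sum_four_norms p t0 f : 0 < t0 -> 1 <= p -> heat_Lp p f ->
 (A p f (t0 * 4 ^+ 0) + A p f (t0 * 4 ^+ 1) + A p f (t0 * 4 ^+ 2) + A p f (t0 * 4 ^+ 3) <=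
  (4 * M `^ p)%:E * \int[mu]_x (`|f x| `^ p)%:E)%E.
move=> t00 p1 hf.
have h j : (A p f (t0 * 4 ^+ j) <= (M `^ p)%:E * \int[mu]_x (`|f x| `^ p)%:E)%E.
 by apply: integral_norm_heat_le => //; rewrite time4_gt0.
have -> : 4 * M `^ p = M `^ p + M `^ p + M `^ p + M `^ p by ring.
have I0 : (0 <= \int[mu]_x (`|f x| `^ p)%:E)%E by side.
rewrite !EFinD !ge0_muleDl ?lee_fin ?powR_ge0 ?addr_ge0 ?powR_ge0//.
by apply: leeD; [apply: leeD; [apply: leeD|]|]; exact: h.
Qed.

Lemma integral_gain p c t f : 1 < p -> p <= q -> heat_Lp p f -> 0 < t -> 0 < c ->
 (forall a b, N (2^-1 *: (a + b)) `^ p + c * gap N q p a b <= (N a `^ p + N b `^ p) / 2) ->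
 (A p f (256 * t) + \int[mu]_x (2 * c * kint (255 * t) (heat_gap N q p f t) x)%:E <= A p f t)%E.
move=> p1 pq hf t0 c0 tp; have p1w := ltW p1.
have p0 : 0 <= p by side.
have t1 : 0 < 255 * t by side.
have t2 : 0 < 256 * t by side.
have [b b0 hb] := norm_heat_ub M0 NM t0 p1w hf.
have [bg hbg] := heat_gap_bounded Nn q2 M0 NM t0 p1w hf p0.
have mN s : 0 < s -> measurable_fun setT (fun x => N (heat s f x) `^ p).
 move=> s0; apply: meas_powR; apply: (meas_norm Nn NM).
 by case: (heat_Lp_heat s0 p1w hf).
have mk := meas_kint t1 hbg.
have k0 x : 0 <= kint (255 * t) (heat_gap N q p f t) x by have /andP[] := kint_bounded x t1 hbg.
rewrite /A -ge0_integralD//; last 4 first.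
- side.
- by apply/measurable_EFinP; exact: mN.
- side.
- side.
rewrite -(integral_heat_int t1 (mN _ t0)); last side.
apply: le_integralW => // x _.
 side.
rewrite -EFinD -(@heatopE _ _ _ _ x (b `^ p))//; last first.
 by move=> y; rewrite powR_ge0 /=; exact: ler_powR2.
rewrite lee_fin; exact: (heat_gap_gain Nn q2 M0 NM x p1w hf t0 p1 c0 tp).
Qed.

(** The [p]-gaps telescope, so their sum [b] is integrable. The square sum is at most a constant
    times [w ^ (q - p) * b] with [w] a maximal function, and [powR_interpolate] followed by the
    maximal theorem concludes. *)
Lemma square_sum_le p : 1 < p -> p <= q -> exists2 C : R, 0 < C & forall L t0 f,
 0 < t0 -> heat_Lp p f ->
 (\int[mu]_x ((\sum_(l < L) Y f (t0 * 4 ^+ l) x) `^ (p / q))%:E <=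
  C%:E * \int[mu]_x (`|f x| `^ p)%:E)%E.
move=> p1 pq; have p1w := ltW p1; have p0 : 0 < p by exact: lt_trans p1.
have [C1 [k [C10 hw]]] := square_piece_weight n Nn q2 M0 NM p1 pq.
have [c c0 tp] := two_point_gap p1 pq.
have [Cm Cm0 hm] := heat_maximal_theorem n p1.
pose D := (2 * c)^-1 * (4 * M `^ p).
have c20 : 0 < 2 * c by side.
have D0 : 0 <= D by rewrite mulr_ge0 ?invr_ge0 ?mulr_ge0 ?powR_ge0 ?ltW.
exists (C1 `^ (p / q) * (Cm + D)).
 side.
move=> L t0 f t00 hf; have Lf := proj2 hf.
set w := heat_max (L + k) t0 (fun z => `|f z|).
have [mw w0 _] : Lplus p w by exact: heat_max_Lplus.
pose tl (l : nat) := t0 * 4 ^+ l.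
have tl0 l : 0 < tl l by exact: time4_gt0.
pose e l := kint (255 * tl l) (heat_gap N q p f (tl l)).
have t255 l : 0 < 255 * tl l by side.
have t4 l : 0 < 4 * tl l by side.
have be l : exists b, bounded_by b (heat_gap N q p f (tl l)).
 exact: (heat_gap_bounded Nn q2 M0 NM (tl0 l) p1w hf (ltW p0)).
have eb l : exists b, forall x, 0 <= e l x <= b.
 by have [b hb] := be l; exists b => x; exact: kint_bounded.
have me l : measurable_fun setT (e l).
 by have [b hb] := be l; exact: meas_kint hb.
have e0 l x : 0 <= e l x by have [b /(_ x)/andP[]] := eb l.
pose b x := \sum_(l < L) heatop (4 * tl l) (e l) x.
have mb : measurable_fun setT b.
 by apply: measurable_sum => l; exact: meas_heatop.
have b0 x : 0 <= b x by apply: sumr_ge0 => l _; exact: heatop_ge0.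
have pq0 : 0 <= p / q by side.
have Yb x : \sum_(l < L) Y f (t0 * 4 ^+ l) x <= C1 * (w x `^ (q - p) * b x).
 rewrite mulrA mulr_sumr; apply: ler_sum => l _; apply: hw => //.
 by rewrite ltn_add2r.
apply: (@le_trans _ _ (\int[mu]_x ((C1 `^ (p / q))%:E * (w x `^ p + b x)%:E))%E).
 apply: le_integralW => // x _; first side.
 rewrite -EFinM lee_fin.
 apply: (@le_trans _ _ ((C1 * (w x `^ (q - p) * b x)) `^ (p / q))).
  apply: ler_powR2 => //; apply: sumr_ge0 => l _.
  by apply: square_piece_ge0 p1w hf; exact: time4_gt0.
 rewrite powRM ?mulr_ge0 ?powR_ge0 ?(ltW C10)//.
 by apply: ler_wpM2l; [exact: powR_ge0|exact: powR_interpolate].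
rewrite ge0_integralZl//; [|side..].
rewrite EFinM -muleA; apply: lee_wpmul2l; first side.
under eq_integral do rewrite EFinD.
rewrite ge0_integralD//; [|side..].
have I0 : (0 <= \int[mu]_x (`|f x| `^ p)%:E)%E by side.
rewrite EFinD ge0_muleDl ?lee_fin ?(ltW Cm0)//; apply: leeD.
 exact: hm.
under eq_integral do rewrite /b -sumEFin.
rewrite ge0_integral_sum//; last 2 first.
- by move=> l; apply/measurable_EFinP; exact: meas_heatop.
- side.
have E1 l : (\int[mu]_x (heatop (4 * tl l) (e l) x)%:E = \int[mu]_x (e l x)%:E)%E.
 rewrite -(integral_heat_int (t4 l) (me l) (e0 l)); apply: eq_integral => x _.
 by have [bl hbl] := eb l; exact: (heatopE x (t4 l) hbl).
under eq_bigr do rewrite E1.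
have c1 : (1 = ((2 * c)^-1 * (2 * c))%:E)%E by rewrite mulVf// gt_eqF.
rewrite /D EFinM -muleA -[leLHS]mul1e [X in (X * _ <= _)%E]c1 EFinM -muleA.
apply: lee_wpmul2l; first side.
apply: le_trans (sum_four_norms t00 p1w hf).
have := @telescope4 R (fun l => A p f (tl l)) (fun l => \int[mu]_x (2 * c * e l x)%:E)%E L.
move=> /(_ _)/le_trans h; apply: le_trans (h _ _ (lexx _)) => [|l]; last first.
 have := integral_gain p1 pq hf (tl0 l) c0 tp.
 by rewrite (_ : 256 * tl l = tl (l + 4)%N)// /tl exprD; ring.
rewrite ge0_sume_distrr; last side.
have An l : (0 <= A p f (tl l))%E by apply: integral_ge0 => x _; rewrite lee_fin powR_ge0.
rewrite (eq_bigr (fun l : 'I_L => \int[mu]_x (2 * c * e l x)%:E)%E).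
 by apply: leeDl; do 3 (apply: adde_ge0; last exact: An); exact: An.
move=> l _; rewrite -ge0_integralZl//; last 3 first.
- by apply/measurable_EFinP.
- side.
- side.
Qed.

Let V f g t x := N (heat t f x) `^ q + heatop t g x `^ q.

Lemma weight_bounded p f g t : 1 <= p -> heat_Lp p f -> Lplus p g -> 0 < t ->
 measurable_fun setT (V f g t) /\ exists b, forall x, 0 <= V f g t x <= b.
move=> p1 hf Lg t0; have qw := ltW q0.
have [b1 b10 hb1] := norm_heat_ub M0 NM t0 p1 hf.
have [b2 b20 hb2] := heatop_ub t0 p1 Lg.
have [mg g0 _] := Lg.
split.
 apply: measurable_funD; apply: meas_powR.
  by apply: (meas_norm Nn NM); case: (heat_Lp_heat t0 p1 hf).
 side.
exists (b1 `^ q + b2 `^ q) => x; rewrite addr_ge0 ?powR_ge0//=.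
by apply: lerD; [exact: (ler_powR2 qw (N0 _) (hb1 x))|exact: (ler_powR2 qw (heatop_ge0 _ _ g0) (hb2 x))].
Qed.

(** The energy [V] carries an auxiliary function [g]. As [p / q >= 1], a gain in [V] raises
    [V ^ (p / q)] by at least [p / q] times the gain times [V ^ (p / q - 1)], and the latter power
    is at least the power [p - q] of the flow of [g]. Telescoping then bounds [q]-gaps weighted by
    [g], the form that duality requires. *)
Lemma weighted_gain p c f g t : q < p -> heat_Lp p f -> Lplus p g -> 0 < t -> 0 < c ->
 (forall a b, N (2^-1 *: (a + b)) `^ q + c * gap N q q a b <= (N a `^ q + N b `^ q) / 2) ->
 (\int[mu]_x (V f g (256 * t) x `^ (p / q))%:E +
  \int[mu]_x (p / q * (2 * c) * (kint (255 * t) (heat_gap N q q f t) x * heatop (256 * t) g x `^ (p - q)))%:E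
  <= \int[mu]_x (V f g t x `^ (p / q))%:E)%E.
move=> qp hf Lg t0 c0 tp; have qw := ltW q0.
have q1 : 1 < q by apply: lt_le_trans q2; rewrite ltr1n.
have p1 : 1 <= p by apply: le_trans (ltW q1) (ltW qp).
have r1 : 1 <= p / q by rewrite ler_pdivlMr// mul1r ltW.
have r0 : 0 <= p / q by side.
have s0 : 0 <= p / q - 1 by side.
have [mg g0 _] := Lg.
have t1 : 0 < 255 * t by side.
have t2 : 0 < 256 * t by side.
have [mV [b hb]] := weight_bounded p1 hf Lg t0.
have [mV2 [b2 hb2]] := weight_bounded p1 hf Lg t2.
have [bg hbg] := heat_gap_bounded Nn q2 M0 NM t0 p1 hf qw.
have mk := meas_kint t1 hbg.
have k0 x : 0 <= kint (255 * t) (heat_gap N q q f t) x by have /andP[] := kint_bounded x t1 hbg.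
have c20 : 0 <= 2 * c by side.
have mVr := meas_powR (p / q) mV.
have H0 x : 0 <= heatop (256 * t) g x by side.
have Vr0 x : 0 <= V f g t x `^ (p / q) by side.
rewrite -[leRHS](integral_heat_int t1 mVr Vr0); apply: ge0_integral_add_le => [||x|x|x].
- side.
- side.
- side.
- side.
have V0 y : 0 <= V f g t y by case/andP: (hb y).
have V20 : 0 <= V f g (256 * t) x by case/andP: (hb2 x).
rewrite -(@heatopE _ _ _ _ x (b `^ (p / q)) t1); last first.
 move=> y; rewrite powR_ge0 /=; apply: (ler_powR2 r0 (V0 y)); by case/andP: (hb y).
rewrite lee_fin.
have key : V f g (256 * t) x + 2 * c * kint (255 * t) (heat_gap N q q f t) x <= heatop (255 * t) (V f g t) x.
 have h1 := heat_gap_gain Nn q2 M0 NM x p1 hf t0 q1 c0 tp.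
 have [bf bf0 hbf] := norm_heat_ub M0 NM t0 p1 hf.
 have [bh bh0 hbh] := heatop_ub t0 p1 Lg.
 have mh : measurable_fun setT (heatop t g) by side.
 have h2 : heatop (256 * t) g x `^ q <= heatop (255 * t) (fun y => heatop t g y `^ q) x.
  rewrite (_ : 256 * t = 255 * t + t); last by ring.
  rewrite -(heatop_semigroup x t1 t0 p1 Lg).
  apply: (heatop_jensen_bounded x t1 (ltW q1) mh) => y.
  side.
 have h3 := @heatop_linear R n (255 * t) (fun y => N (heat t f y) `^ q)
  (fun y => heatop t g y `^ q) x 1 (bf `^ q + bh `^ q) t1 ler01.
 have EV : V f g t = (fun y => N (heat t f y) `^ q + 1 * heatop t g y `^ q).
  by apply/funext => y; rewrite mul1r.
 rewrite EV h3.
 - by rewrite mul1r /V addrAC; exact: (lerD h1 h2).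
 - by apply: meas_powR; apply: (meas_norm Nn NM); case: (heat_Lp_heat t0 p1 hf).
 - side.
 - move=> y; rewrite powR_ge0 /=; apply: (@le_trans _ _ (bf `^ q)); last by rewrite lerDl powR_ge0.
  exact: ler_powR2.
 - move=> y; rewrite powR_ge0 /=; apply: (@le_trans _ _ (bh `^ q)); last by rewrite lerDr powR_ge0.
  by apply: ler_powR2 => //; exact: heatop_ge0.
apply: le_trans (heatop_jensen_bounded x t1 r1 mV hb).
have ck0 : 0 <= 2 * c * kint (255 * t) (heat_gap N q q f t) x by exact: (mulr_ge0 c20 (k0 x)).
apply: le_trans (ler_powR2 r0 (addr_ge0 V20 ck0) key).
apply: le_trans (powR_add_ge r1 V20 ck0); rewrite lerD2l.
rewrite [leRHS](_ : _ = p / q * (2 * c) * (kint (255 * t) (heat_gap N q q f t) x *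
 V f g (256 * t) x `^ (p / q - 1))); last by rewrite -!mulrA.
apply: (ler_wpM2l (mulr_ge0 r0 c20)); apply: (ler_wpM2l (k0 x)).
have -> : p - q = q * (p / q - 1) by field; rewrite gt_eqF.
rewrite powRrM; apply: ler_powR2 => //; first side.
by rewrite lerDr powR_ge0.
Qed.

Lemma weighted_sum p : q < p -> exists2 C : R, 0 < C & forall L t0 f g, 0 < t0 ->
 heat_Lp p f -> Lplus p g ->
 (\sum_(l < L) \int[mu]_x (kint (255 * (t0 * 4 ^+ l)) (heat_gap N q q f (t0 * 4 ^+ l)) x *
   heatop (256 * (t0 * 4 ^+ l)) g x `^ (p - q))%:E <=
  C%:E * (\int[mu]_x (`|f x| `^ p)%:E + \int[mu]_x (g x `^ p)%:E))%E.
move=> qp; have q1 : 1 < q by apply: lt_le_trans q2; rewrite ltr1n.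
have p1 : 1 <= p by apply: le_trans (ltW q1) (ltW qp).
have p0 : 0 < p by side.
have r1 : 1 <= p / q by rewrite ler_pdivlMr// mul1r ltW.
have r0 : 0 < p / q by side.
have [c c0 tp] := two_point_gap q1 (lexx q).
have cr : 0 < p / q * (2 * c) by side.
pose D := 2 `^ (p / q) * (M `^ p + 1).
have D0 : 0 < D by rewrite mulr_gt0 ?powR_gt0// ltr_wpDl ?powR_ge0.
exists ((p / q * (2 * c))^-1 * (4 * D)); first side.
move=> L t0 f g t00 hf Lg; have [mg g0 _] := Lg.
pose tl (l : nat) := t0 * 4 ^+ l.
have tl0 l : 0 < tl l by exact: time4_gt0.
have t255 l : 0 < 255 * tl l by side.
have t256 l : 0 < 256 * tl l by side.
pose E l x := kint (255 * tl l) (heat_gap N q q f (tl l)) x * heatop (256 * tl l) g x `^ (p - q).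
have E0 l x : 0 <= E l x.
 rewrite mulr_ge0 ?powR_ge0//.
 have [bg hbg] := heat_gap_bounded Nn q2 M0 NM (tl0 l) p1 hf (ltW q0).
 by have /andP[] := kint_bounded x (t255 l) hbg.
have mE l : measurable_fun setT (E l).
 apply: measurable_funM; last side.
 have [bg hbg] := heat_gap_bounded Nn q2 M0 NM (tl0 l) p1 hf (ltW q0).
 exact: meas_kint hbg.
pose AV l : \bar R := (\int[mu]_x (V f g (tl l) x `^ (p / q))%:E)%E.
have AV0 l : (0 <= AV l)%E by apply: integral_ge0 => x _; rewrite lee_fin powR_ge0.
set If := (\int[mu]_x (`|f x| `^ p)%:E)%E; set Ig := (\int[mu]_x (g x `^ p)%:E)%E.
have If0 : (0 <= If)%E by apply: integral_ge0 => x _; rewrite lee_fin powR_ge0.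
have Ig0 : (0 <= Ig)%E by apply: integral_ge0 => x _; rewrite lee_fin powR_ge0.
have AVD l : (AV l <= D%:E * (If + Ig))%E.
 have mN : measurable_fun setT (fun x => N (heat (tl l) f x) `^ p).
  apply: meas_powR; apply: (meas_norm Nn NM).
  by case: (heat_Lp_heat (tl0 l) p1 hf).
 have mG : measurable_fun setT (fun x => heatop (tl l) g x `^ p) by side.
 apply: (@le_trans _ _ (\int[mu]_x ((2 `^ (p / q))%:E * (N (heat (tl l) f x) `^ p + heatop (tl l) g x `^ p)%:E))%E).
  apply: le_integralW => // x _; first side.
  rewrite -EFinM lee_fin.
  apply: le_trans (powRD_le (ltW r0) (powR_ge0 _ _) (powR_ge0 _ _)) _.
  by rewrite -!powRrM [q * _]mulrC divfK// gt_eqF.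
 rewrite ge0_integralZl//; [|side..].
 under eq_integral do rewrite EFinD.
 rewrite ge0_integralD//; [|side..].
 rewrite /D EFinM -muleA; apply: lee_wpmul2l; first side.
 rewrite EFinD ge0_muleDl ?lee_fin ?powR_ge0// mul1e; apply: leeD.
  apply: le_trans (integral_norm_heat_le Nn M0 NM (tl0 l) p1 hf) _.
  by apply: lee_wpmul2l; [rewrite lee_fin powR_ge0|exact: leeDl].
 apply: le_trans (integral_heatop_powR (tl0 l) p1 Lg) _.
 exact: (leeDr _ If0).
rewrite EFinM -muleA -[leLHS]mul1e.
have c1 : (1 = ((p / q * (2 * c))^-1 * (p / q * (2 * c)))%:E)%E by rewrite mulVf// gt_eqF.
rewrite [X in (X * _ <= _)%E]c1 EFinM -muleA.
apply: lee_wpmul2l; first side.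
have h4 : (AV 0%N + AV 1%N + AV 2%N + AV 3%N <= (4 * D)%:E * (If + Ig))%E.
 have -> : 4 * D = D + D + D + D by ring.
 have I0 : (0 <= If + Ig)%E by exact: (adde_ge0 If0 Ig0).
 have Dw := ltW D0.
 rewrite !EFinD !ge0_muleDl ?lee_fin ?addr_ge0//.
 by apply: leeD; [apply: leeD; [apply: leeD|]|]; exact: AVD.
apply: le_trans h4.
have := @telescope4 R AV (fun l => \int[mu]_x (p / q * (2 * c) * E l x)%:E)%E L.
move=> /(_ _)/le_trans h; apply: le_trans (h _ _ (lexx _)) => [|l]; last first.
 have e4 : tl (l + 4)%N = 256 * tl l by rewrite /tl exprD; ring.
 rewrite /AV e4; exact: (weighted_gain qp hf Lg (tl0 l) c0 tp).
rewrite ge0_sume_distrr; last first.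
 by move=> l _; apply: integral_ge0 => x _; rewrite lee_fin; exact: E0.
rewrite (eq_bigr (fun l : 'I_L => \int[mu]_x (p / q * (2 * c) * E l x)%:E)%E).
 by apply: leeDl; do 3 (apply: adde_ge0; last exact: AV0); exact: AV0.
move=> l _; rewrite -ge0_integralZl//; last 3 first.
- by apply/measurable_EFinP; exact: mE.
- by move=> x _; rewrite lee_fin; exact: E0.
- side.
Qed.

(** For [k < 1] Jensen's inequality goes the wrong way. Instead the left-hand side is bounded, for
    every [y], by the maximal function at [y] times a Gaussian in [|x - y|]; the [k]-th powers are
    then averaged over [y] at time [256 * t], where the inverse Gaussian still leaves a positive
    mass. *)
Lemma heat_weight_lower (k : R) : 0 < k -> exists2 C : R, 0 < C & forall L t0 h l x r p,
 0 < t0 -> 1 <= r -> Lplus r h -> (l + 2 < L)%N -> 1 <= p ->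
 Lplus p (fun y => heat_max L t0 h y `^ k) -> heatop (2 * (t0 * 4 ^+ l)) h x <=
  C * heatop (256 * (t0 * 4 ^+ l)) (fun y => heat_max L t0 h y `^ k) x `^ k^-1.
(* The time [sg * t] is the one whose kernel arises from that of time [256 * t] after damping by
   [exp (- k |x - y|^2 / (48 t))]. *)
move=> k0; pose sg := (256^-1 + k / 12)^-1.
have i256 : 0 < 256^-1 :> R by side.
have sg0 : 0 < sg by rewrite invr_gt0; exact: (addr_gt0 i256 (divr_gt0 k0 (ltr0Sn _ 11))).
pose D : R := 2 `^ (n%:R / 2) * (1 + 3) `^ (n%:R / 2).
have D0 : 0 < D by rewrite mulr_gt0 ?powR_gt0// addr_gt0.
pose a := (sg / 256) `^ (n%:R / 2).
have a0 : 0 < a by exact: (powR_gt0 _ (divr_gt0 sg0 (ltr0Sn _ 255))).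
have ai0 : 0 < a^-1 by side.
exists ((a^-1 * D `^ k) `^ k^-1); first side.
move=> L t0 h l x r p t00 r1 Lh lL p1 Lg; set t := t0 * 4 ^+ l.
have t1 : 0 < t by exact: time4_gt0.
set w := heat_max L t0 h; pose g y := w y `^ k.
have w0 y : 0 <= w y by exact: heat_max_ge0.
have [mh h0 _] := Lh.
have t2 : 0 < 2 * t by side.
have t4 : 0 < 4 * t by side.
have t256 : 0 < 256 * t by side.
have st : 0 < sg * t by side.
set b := heatop (2 * t) h x.
have b0 : 0 <= b by exact: heatop_ge0.
have h1 y : b <= D * expR (sqd y x / (48 * t)) * w y.
 have s1 := heatop_le_time x t2 (ler_wpM2r (ltW t1) (ltac:(lra) : 2 <= 4 :> R)) r1 Lh.
 have s2 := heatop_shift y x t4 (ltr0Sn R 2) r1 Lh.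
 have s3 : heatop ((1 + 3) * (4 * t)) h y <= w y.
  rewrite (_ : (1 + 3) * (4 * t) = t0 * 4 ^+ (l + 2)); first exact: le_heat_max.
  by rewrite /t exprD; ring.
 rewrite (_ : 4 * t / (2 * t) = 2) in s1; last by field; rewrite gt_eqF.
 rewrite (_ : 4 * (4 * t) * 3 = 48 * t) in s2; last by ring.
 apply: le_trans s1 _; rewrite /D -!mulrA; apply: ler_wpM2l; first side.
 apply: le_trans s2 _; rewrite -mulrA; apply: ler_wpM2l; first side.
 by apply: ler_wpM2l s3; exact: expR_ge0.
have h2 y : b `^ k * expR (- (sqd x y * ((4 * (sg * t))^-1 - (4 * (256 * t))^-1))) <= D `^ k * g y.
 have E0 := expR_ge0 (sqd y x / (48 * t)).
 have := ler_powR2 (ltW k0) b0 (h1 y).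
 rewrite (powRM _ (mulr_ge0 (ltW D0) E0) (w0 y)) (powRM _ (ltW D0) E0) powR_expR => s1.
 have -> : sqd x y * ((4 * (sg * t))^-1 - (4 * (256 * t))^-1) = k * (sqd y x / (48 * t)).
  by rewrite sqdC damp_exponent.
 rewrite expRN ler_pdivrMr ?expR_gt0//; apply: le_trans s1 _.
 by rewrite /g [leRHS]mulrAC.
have h3 : b `^ k * a <= D `^ k * heatop (256 * t) g x.
 rewrite -lee_fin [(D `^ k * _)%:E]EFinM (heatopK x t256 p1 Lg) /heat_int -ge0_integralZl//; last 3 first.
 - by apply/measurable_EFinP; apply: meas_heat_intl; case: Lg.
 - side.
 - side.
 apply: (@le_trans _ _ (\int[mu]_y ((b `^ k * a)%:E * (K (sg * t) x y)%:E))%E).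
  rewrite ge0_integralZl//; [|side..].
  by rewrite integral_kernel// mule1.
 apply: le_integralW => // y _.
  side.
 rewrite -!EFinM lee_fin -mulrA.
 have := heat_kernel_damp x y st t256.
 rewrite (_ : sg * t / (256 * t) = sg / 256); last first.
  by rewrite invfM mulrACA divff ?mulr1// gt_eqF.
 rewrite -/a => <-; rewrite mulrCA [leRHS]mulrCA; apply: ler_wpM2l; first side.
 exact: h2.
have G0 : 0 <= heatop (256 * t) g x by apply: heatop_ge0 => y; exact: powR_ge0.
have aD : 0 <= a^-1 * D `^ k by side.
have h4 : b `^ k <= a^-1 * D `^ k * heatop (256 * t) g x by rewrite -mulrA ler_pdivlMl// mulrC.
rewrite -(powRM _ aD G0) {1}(_ : b = (b `^ k) `^ k^-1); last first.
 by rewrite -powRrM divff ?gt_eqF// powRr1.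
by apply: ler_powR2 => //; [rewrite invr_ge0 ltW|exact: powR_ge0].
Qed.

(** Each piece is in [L^(p/q)], with a crude bound; this finiteness permits the absorption in
    [square_sum_gt]. *)
Lemma square_piece_Lplus p f t : q < p -> heat_Lp p f -> 0 < t -> Lplus (p / q) (Y f t).
move=> qp hf t0; have q1 : 1 < q by apply: lt_le_trans q2; rewrite ltr1n.
have p1 : 1 <= p by apply: le_trans (ltW q1) (ltW qp).
have p0 : 0 <= p by side.
have r1 : 1 <= p / q by rewrite ler_pdivlMr// mul1r ltW.
have r0 : 0 <= p / q by side.
have t2 : 0 < 2 * t by side.
have t42 : 0 < 42 * t by side.
have t256 : 0 < 256 * t by side.
have [bg hbg] := heat_gap_bounded Nn q2 M0 NM t0 p1 hf (ltW q0).
have mk := meas_kint t42 hbg.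
have kb x := kint_bounded x t42 hbg.
have k0 x : 0 <= kint (42 * t) (heat_gap N q q f t) x by case/andP: (kb x).
have [b b0 hb] := norm_heat_ub M0 NM t0 p1 hf.
have mN s : 0 < s -> measurable_fun setT (fun x => N (heat s f x) `^ p).
 move=> s0; apply: meas_powR; apply: (meas_norm Nn NM).
 by case: (heat_Lp_heat s0 p1 hf).
have tp0 : 0 <= 2 `^ p :> R by side.
pose S y x := N (heat (256 * t) f x) `^ p + 1 * N (heat t f y) `^ p.
have hk x : kint (42 * t) (heat_gap N q q f t) x `^ (p / q) <=
  2 `^ p * (N (heat (256 * t) f x) `^ p + heatop (42 * t) (fun y => N (heat t f y) `^ p) x).
 apply: le_trans (heatop_jensen_bounded x t42 r1 (bounded_by_measurable x hbg) (proj2 hbg x)) _.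
 have nb y : 0 <= N (heat t f y) `^ p <= b `^ p.
  by rewrite powR_ge0 /=; exact: (ler_powR2 p0 (N0 _) (hb y)).
 have hl := @heatop_linear R n (42 * t) (fun=> 0) (fun y => N (heat t f y) `^ p) x (2 `^ p)
   (b `^ p) t42 tp0 (measurable_cst _) (mN _ t0).
 have hc := @heatop_linear R n (42 * t) (fun=> 2 `^ p * N (heat (256 * t) f x) `^ p)
   (fun y => N (heat t f y) `^ p) x (2 `^ p)
   (b `^ p + 2 `^ p * N (heat (256 * t) f x) `^ p) t42 tp0 (measurable_cst _) (mN _ t0).
 rewrite heatop_cst in hc; [|exact: t42|by rewrite mulr_ge0 ?powR_ge0].
 rewrite mulrDr -hc.
 - apply: (@heatop_mono _ _ _ _ _ _ (2 `^ p * N (heat (256 * t) f x) `^ p + 2 `^ p * b `^ p)).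
  + exact: t42.
  + side.
  + move=> y; rewrite -mulrDr.
   have h1 := gap_le Nn q2 q (heat t f y) (heat (256 * t) f x).
   apply: le_trans (ler_powR2 r0 (gap_ge0 _ _ _ _ _) h1) _.
   rewrite -powRrM [q * _]mulrC divfK ?gt_eqF// addrC.
   exact: powRD_le.
  + move=> y; rewrite lerD2l; apply: ler_wpM2l => //; by case/andP: (nb y).
 - move=> y; rewrite mulr_ge0 ?powR_ge0//= lerDr powR_ge0 //.
 - move=> y; rewrite powR_ge0 /=; have /andP[_ h] := nb y; apply: le_trans h _.
  by rewrite lerDl mulr_ge0 ?powR_ge0.
have Lk : Lplus (p / q) (kint (42 * t) (heat_gap N q q f t)).
 split=> //; have If : (\int[mu]_x (`|f x| `^ p)%:E < +oo)%E by case: hf => _ [].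
 have fin s : 0 < s -> (\int[mu]_x (N (heat s f x) `^ p)%:E < +oo)%E.
  move=> s0; apply: le_lt_trans (integral_norm_heat_le Nn M0 NM s0 p1 hf) _.
  by apply: lte_mul_pinfty; rewrite ?lee_fin ?powR_ge0.
 have mH : measurable_fun setT (heatop (42 * t) (fun y => N (heat t f y) `^ p)).
  by apply: meas_heatop => [|y]; [exact: mN|exact: powR_ge0].
 have H0 x : 0 <= heatop (42 * t) (fun y => N (heat t f y) `^ p) x.
  by apply: heatop_ge0 => y; exact: powR_ge0.
 apply: (@le_lt_trans _ _ (\int[mu]_x ((2 `^ p)%:E * (N (heat (256 * t) f x) `^ p +
   heatop (42 * t) (fun y => N (heat t f y) `^ p)%R x)%:E))%E).
  apply: le_integralW => // x _; first side.
  by rewrite -EFinM lee_fin; exact: hk.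
 rewrite ge0_integralZl//; last 2 first.
 - by apply/measurable_EFinP; apply: measurable_funD => //; exact: mN.
 - side.
 apply: lte_mul_pinfty; rewrite ?lee_fin//.
 under eq_integral do rewrite EFinD.
 rewrite ge0_integralD//; last 4 first.
 - side.
 - by apply/measurable_EFinP; exact: mN.
 - side.
 - by apply/measurable_EFinP.
 apply: lte_add_pinfty; first exact: fin.
 under eq_integral => x _.
  rewrite (@heatopE _ _ _ _ x (b `^ p) t42); last first.
   by move=> y; rewrite powR_ge0 /=; exact: (ler_powR2 p0 (N0 _) (hb y)).
  over.
 rewrite (integral_heat_int t42 (mN _ t0)); first exact: fin.
 side.
exact: Lplus_heatop.
Qed.

(** Duality with the exponent [r' = p / (p - q)], conjugate to [p / q]. Against a test function [h]
    the outer average moves onto [h], which [heat_weight_lower] bounds by a flow of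
    [g = w ^ (1 / (p - q))], with [w] the maximal function of [h]; then [weighted_sum] applies and
    [g ^ p = w ^ r']. *)
Lemma square_sum_gt p : q < p -> exists2 C : R, 0 < C & forall L t0 f,
 0 < t0 -> heat_Lp p f ->
 (\int[mu]_x ((\sum_(l < L) Y f (t0 * 4 ^+ l) x) `^ (p / q))%:E <=
  C%:E * \int[mu]_x (`|f x| `^ p)%:E)%E.
move=> qp; have q1 : 1 < q by apply: lt_le_trans q2; rewrite ltr1n.
have p1 : 1 <= p by apply: le_trans (ltW q1) (ltW qp).
have p0 : 0 < p by side.
have r1 : 1 <= p / q by rewrite ler_pdivlMr// mul1r ltW.
have r0 : 0 < p / q by side.
have pq0 : 0 < p - q by side.
pose k := (p - q)^-1; have k0 : 0 < k by rewrite invr_gt0.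
pose r' := p * k.
have r'1 : 1 < r' by rewrite /r' /k ltr_pdivlMr// mul1r ltrBlDr ltrDl.
have r'1w := ltW r'1; have r'0 : 0 < r' by exact: lt_trans r'1.
have [C1 C10 h1] := weighted_sum qp.
have [C2 C20 h2] := heat_weight_lower k0.
have [Cm Cm0 hm] := heat_maximal_theorem n r'1.
pose LK : R := (255 / 42) `^ (n%:R / 2).
have LK0 : 0 < LK by exact: (powR_gt0 _ (divr_gt0 (ltr0Sn _ 254) (ltr0Sn _ 41))).
pose C2' := C2 `^ k^-1 .
pose D := LK * C2 * C1 * (1 + Cm).
have D0 : 0 < D.
 apply: mulr_gt0; last side.
 side.
(* Solves [D * e ^ r' = e / 2], so that the term in [h] is half of the left-hand side. *)
pose e := (2 * D) `^ (- (r' - 1)^-1).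
have D20 : 0 < 2 * D by side.
have e0 : 0 < e by exact: powR_gt0.
have eE : D * e `^ r' = e / 2.
 rewrite (powR_mulr1 (ltW e0) r'1w) -powRrM mulNr mulVf ?gt_eqF ?subr_gt0//.
 by rewrite (powR_inv1 (ltW D20)); field; rewrite gt_eqF.
exists (2 * D / e); first side.
move=> L t0 f t00 hf.
pose tl (l : nat) := t0 * 4 ^+ l.
have tl0 l : 0 < tl l by exact: time4_gt0.
pose S x := \sum_(l < L) Y f (tl l) x.
have LY l := square_piece_Lplus qp hf (tl0 l).
have Y0 l x : 0 <= Y f (tl l) x by case: (LY l).
have mY l : measurable_fun setT (Y f (tl l)) by case: (LY l).
have S0 x : 0 <= S x by exact: sumr_ge0.
have mS : measurable_fun setT S by exact: measurable_sum.
set If := (\int[mu]_x (`|f x| `^ p)%:E)%E.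
have If0 : (0 <= If)%E by apply: integral_ge0 => x _; rewrite lee_fin powR_ge0.
have Ioo : (If < +oo)%E by case: hf => _ [].
pose IS := (\int[mu]_x (S x `^ (p / q))%:E)%E.
have IS0 : (0 <= IS)%E by apply: integral_ge0 => x _; rewrite lee_fin powR_ge0.
have ISoo : (IS < +oo)%E.
 apply: (@le_lt_trans _ _ (\int[mu]_x ((L%:R `^ (p / q))%:E * (\sum_(l < L) Y f (tl l) x `^ (p / q))%:E))%E).
  apply: le_integralW => // x _; first side.
  by rewrite -EFinM lee_fin; apply: (@powR_sum_le R L _ (fun l => Y f (tl l) x)).
 rewrite ge0_integralZl//; [|side..].
 apply: lte_mul_pinfty; rewrite ?lee_fin ?powR_ge0//.
 under eq_integral do rewrite -sumEFin.
 rewrite ge0_integral_sum//; [|side..].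
 by apply: lte_sum_pinfty => l _; case: (LY l).
have dual h : Lplus r' h ->
  (\int[mu]_x (S x * h x)%:E <= D%:E * (If + \int[mu]_x (h x `^ r')%:E))%E.
 move=> Lh; have [mh hh0 _] := Lh.
 pose g y := heat_max (L + 3) t0 h y `^ k.
 have wL : Lplus r' (heat_max (L + 3) t0 h) by exact: heat_max_Lplus.
 have [mw w0 fw] := wL.
 have gp y : g y `^ p = heat_max (L + 3) t0 h y `^ r' by rewrite /g -powRrM mulrC.
 have Lg : Lplus p g.
  split; [exact: meas_powR|by move=> y; exact: powR_ge0|].
  by under eq_integral do rewrite gp.
 have [mg g0 _] := Lg.
 have H1 := h1 L t0 f g t00 hf Lg.
 have Ih0 : (0 <= \int[mu]_x (h x `^ r')%:E)%E by side.
 have Hg : (\int[mu]_x (g x `^ p)%:E <= Cm%:E * \int[mu]_x (h x `^ r')%:E)%E.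
  by under eq_integral do rewrite gp; exact: hm.
 apply: (@le_trans _ _ ((LK * C2)%:E * (C1%:E * (If + \int[mu]_x (g x `^ p)%:E)))%E); last first.
  rewrite /D !EFinM -!muleA; do 3 (apply: lee_wpmul2l; first by rewrite lee_fin ltW).
  rewrite EFinD ge0_muleDl ?lee_fin ?(ltW Cm0)// mul1e.
  apply: leeD; first exact: leeDl.
  by apply: le_trans Hg _; apply: lee_wpmul2l; [rewrite lee_fin ltW|exact: (leeDr _ If0)].
 have LC0 : 0 <= LK * C2 by side.
 apply: le_trans (lee_wpmul2l _ H1); last side.
 rewrite ge0_sume_distrr; last first.
  move=> l _; apply: integral_ge0 => x _; rewrite lee_fin mulr_ge0 ?powR_ge0//.
  have [bg hbg] := heat_gap_bounded Nn q2 M0 NM (tl0 l) p1 hf (ltW q0).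
  by have /andP[] := kint_bounded x (mulr_gt0 (ltr0Sn _ 254) (tl0 l)) hbg.
 under eq_integral do rewrite /S mulr_suml -sumEFin.
 rewrite ge0_integral_sum//; last 2 first.
 - by move=> l; apply/measurable_EFinP; exact: measurable_funM.
 - side.
 apply: lee_sum => l _; set t := t0 * 4 ^+ l.
 have t1 : 0 < t by exact: time4_gt0.
 have t2 : 0 < 2 * t by side.
 have t42 : 0 < 42 * t by side.
 have t255 : 0 < 255 * t by side.
 have [bg hbg] := heat_gap_bounded Nn q2 M0 NM t1 p1 hf (ltW q0).
 have mk := meas_kint t42 hbg; have mk2 := meas_kint t255 hbg.
 have kb x := kint_bounded x t42 hbg; have kb2 x := kint_bounded x t255 hbg.
 have k_0 x : 0 <= kint (42 * t) (heat_gap N q q f t) x by case/andP: (kb x).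
 have k_1 x : 0 <= kint (255 * t) (heat_gap N q q f t) x by case/andP: (kb2 x).
 have -> : (\int[mu]_x (Y f (tl l) x * h x)%:E =
   \int[mu]_x (kint (42 * t) (heat_gap N q q f t) x * heatop (2 * t) h x)%:E)%E.
  transitivity (\int[mu]_x (heat_int (2 * t) (kint (42 * t) (heat_gap N q q f t)) x * (h x)%:E))%E.
   by apply: eq_integral => x _; rewrite EFinM -(heatopE x t2 kb).
  rewrite -heat_int_sym//; apply: eq_integral => x _.
  by rewrite EFinM (heatopK x t2 r'1w Lh).
 rewrite -ge0_integralZl//; [|side..].
 apply: le_integralW => // x _.
  side.
 rewrite -EFinM lee_fin mulrACA; apply: ler_pM => //; first side.
  have := kint_le_time x t42 (ler_wpM2r (ltW t1) (ler_nat R 42 255)) hbg.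
  rewrite (_ : 255 * t / (42 * t) = 255 / 42)//.
  by rewrite invfM mulrACA divff ?mulr1// gt_eqF.
 have lL : (l + 2 < L + 3)%N by rewrite addn3 !addn2 !ltnS; exact: ltnW.
 have := h2 (L + 3)%N t0 h l x r' p t00 r'1w Lh lL p1 Lg.
 by rewrite /k invrK.
have mSr := meas_powR (p / q) mS.
have Sr0 x : 0 <= S x `^ (p / q) by side.
(* The extremal function for the duality: both [S * h] and [h ^ r'] are multiples of
   [S ^ (p / q)]. *)
pose h x := e * S x `^ (p / q - 1).
have hr x : h x `^ r' = e `^ r' * S x `^ (p / q).
 rewrite powRM ?powR_ge0 ?(ltW e0)// -powRrM; congr (_ * _ `^ _).
 by rewrite /r' /k; field; rewrite !gt_eqF.
have Lh : Lplus r' h.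
 split.
 - by apply: measurable_funM => //; exact: meas_powR.
 - by move=> x; rewrite mulr_ge0 ?powR_ge0 ?ltW.
 under eq_integral do rewrite hr.
 rewrite (ge0_integral_scale _ mSr Sr0 (powR_ge0 _ _)).
 by apply: lte_mul_pinfty; rewrite ?lee_fin ?powR_ge0.
have := dual h Lh.
have -> : (\int[mu]_x (S x * h x)%:E = e%:E * IS)%E.
 rewrite /IS -(ge0_integral_scale _ mSr Sr0 (ltW e0)).
 by apply: eq_integral => x _; rewrite /h mulrCA -(powR_mulr1 (S0 x) r1).
have -> : (\int[mu]_x (h x `^ r')%:E = (e `^ r')%:E * IS)%E.
 rewrite /IS -(ge0_integral_scale _ mSr Sr0 (powR_ge0 _ _)).
 by apply: eq_integral => x _; rewrite hr.
have Ifn : If \is a fin_num by rewrite (ge0_fin_numE If0) Ioo.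
have ISn : IS \is a fin_num by rewrite (ge0_fin_numE IS0) ISoo.
rewrite -/IS -(fineK Ifn) -(fineK ISn).
generalize (fine If) (fine IS) => F I.
have -> : (D%:E * (F%:E + (e `^ r')%:E * I%:E) = (D * F + e / 2 * I)%:E)%E.
 by congr EFin; rewrite -eE; ring.
rewrite -!EFinM !lee_fin => hI.
by rewrite mulrAC ler_pdivlMr// [I * e]mulrC; exact: absorb_epsilon hI.
Qed.

End square_sum.

(** * Integrals bounded by countable layers *)

Section layered_integrals.
Context (R : realType).

Lemma geo_scale (b y : R) : 2 <= b -> 1 <= y -> exists k : nat, b ^+ k <= y < b ^+ k.+1.
move=> b2 y1; have b0 : 0 < b by apply: lt_le_trans b2; exact: ltr0Sn.
have ex : exists k, y < b ^+ k.+1.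
 exists (Num.bound y); have hb := archi_boundP (le_trans ler01 y1).
 apply: lt_le_trans hb _; apply: (@le_trans _ _ (2 ^+ (Num.bound y).+1)).
  rewrite -natrX ler_nat; apply: ltnW; apply: ltn_trans (ltn_expl _ (isT : (1 < 2)%N)) _.
  by rewrite ltn_exp2l.
 by rewrite lerXn2r// nnegrE// ltW.
exists (ex_minn ex); case: ex_minnP => k yk kmin; rewrite yk andbT.
case: k yk kmin => [|k] yk kmin; first side.
by rewrite leNgt; apply/negP => /kmin; rewrite ltnn.
Qed.

Lemma geometric_sum_le (a : R) (k : nat) : 0 <= a -> a < 1 ->
 \sum_(i < k) a ^+ i <= (1 - a)^-1.
move=> a0 a1; have a10 : 0 < 1 - a by rewrite subr_gt0.
rewrite -[leRHS]mul1r ler_pdivlMr//.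
suff -> : (\sum_(i < k) a ^+ i) * (1 - a) = 1 - a ^+ k by rewrite gerBl exprn_ge0.
elim: k => [|k ih]; first by rewrite big_ord0 mul0r expr0 subrr.
by rewrite big_ord_recr /= mulrDl ih exprS; ring.
Qed.

Lemma powR_exprn (a b : R) (k : nat) : 0 <= a -> (a ^+ k) `^ b = (a `^ b) ^+ k.
move=> a0; elim: k => [|k ih]; first by rewrite !expr0 powR1.
by rewrite !exprS powRM ?exprn_ge0// ih.
Qed.

Lemma powR_neg_le (a x y : R) : a <= 0 -> 0 < x -> x <= y -> y `^ a <= x `^ a.
move=> a0 x0 xy; have y0 : 0 < y by exact: lt_le_trans xy.
rewrite -[a]opprK (powRN y (- a)) (powRN x (- a)) lef_pV2 ?posrE ?powR_gt0//.
by apply: ler_powR2; rewrite ?oppr_ge0// ltW.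
Qed.

(** The integrand lies below the series of the constants [c k] on the sets [I k], which may overlap;
    [h] itself need not be measurable. *)
Lemma integral_layers d (T : measurableType d) (mu : {measure set T -> \bar R})
  (A : set T) (h : T -> \bar R) (I : nat -> set T) (c : nat -> \bar R) (S : \bar R) :
 measurable A -> (forall k, measurable (I k)) -> (forall k, 0 <= c k)%E ->
 (forall x, A x -> (0 <= h x)%E) ->
 (forall x, A x -> exists k, I k x /\ (h x <= c k)%E) ->
 (forall K, (\sum_(k < K) c k * mu (I k) <= S)%E) ->
 (\int[mu]_(x in A) h x <= S)%E.
move=> mA mI c0 h0 hI hS.
pose g k x : \bar R := (c k * (\1_(I k) x)%:E)%E.
have g0 k x : (0 <= g k x)%E by rewrite mule_ge0// lee_fin.
have mg k : measurable_fun setT (g k).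
 by apply: measurable_funeM; apply/measurable_EFinP; exact: measurable_indic.
apply: (@le_trans _ _ (\int[mu]_(x in A) \big[+%E/0%R]_(0 <= k <oo) g k x)%E).
 apply: le_integralW => // x Ax; have [k [Ix hk]] := hI x Ax.
 apply: (@le_trans _ _ (g k x)).
  by rewrite /g indicE mem_set// mule1.
 apply: le_trans (nneseries_lim_ge k.+1 _) => //.
 by rewrite big_nat_recr//= leeDr// sume_ge0.
rewrite integral_nneseries//; last by move=> k; exact: measurable_funTS.
apply: lime_le; first by apply: is_cvg_nneseries => k _ _; apply: integral_ge0.
near=> K; rewrite big_mkord; apply: le_trans (hS K); apply: lee_sum => k _.
apply: (@le_trans _ _ (\int[mu]_x g k x)%E).
 by apply: ge0_subset_integral => //.
rewrite ge0_integralZl//.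
 by rewrite integral_indic// setIT.
by apply/measurable_EFinP; exact: measurable_indic.
Unshelve. all: by end_near. Qed.

(** On the shell where [x - s] is between [c / 2^(k+1)] and [c / 2^k] the integrand is bounded, and
    the shells contribute a geometric series of ratio [2 ^ (- b)]. *)
Lemma integral_powR_near (b : R) : 0 < b -> b <= 1 -> exists2 C : R, 0 < C &
 forall s c : R, 0 < c ->
 (\int[lebesgue_measure]_(x in `]s, (s + c)%R]) ((x - s) `^ (b - 1))%:E <= (C * c `^ b)%:E)%E.
move=> b0 b1; pose a : R := 2^-1 `^ b.
have h0 : 0 < 2^-1 :> R by side.
have a0 : 0 <= a by exact: powR_ge0.
have a1 : a < 1.
 have e1 : 1 `^ b = 1 :> R by rewrite powR1.
 rewrite -[ltRHS]e1; apply: gt0_ltr_powR; rewrite ?nnegrE//.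
 by rewrite invf_lt1// ltr1n.
exists ((1 - a)^-1); first side.
move=> s c c0.
pose x k : R := c * 2^-1 ^+ k.
have x0 k : 0 < x k by rewrite mulr_gt0// exprn_gt0.
have xS k : x k - x k.+1 = x k.+1 by rewrite /x exprS; field.
have mI k : lebesgue_measure (`](s + x k.+1), (s + x k)] : set R) = (x k.+1)%:E.
 rewrite lebesgue_measure_itv /= lte_fin ltrD2l.
 rewrite -[x k](subrK (x k.+1)) xS ltrDr x0 -EFinB.
 by congr EFin; ring.
apply: (@integral_layers _ _ (@lebesgue_measure R) _ _ (fun k => `](s + x k.+1), (s + x k)]%classic)
 (fun k => (x k.+1 `^ (b - 1))%:E)) => //.
- side.
- side.
- move=> u /=; rewrite in_itv /= => /andP[su usc].
 have u0 : 0 < u - s by side.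
 have uc : u - s <= c by rewrite lerBlDl.
 have y1 : 1 <= c / (u - s) by rewrite ler_pdivlMr// mul1r.
 have [k /andP[k1 k2]] := @geo_scale 2 (c / (u - s)) (lexx _) y1.
 have e2 j : x j * 2 ^+ j = c.
  by rewrite /x -mulrA -exprMn mulVf// expr1n mulr1.
 have i1 : u - s <= x k.
  by rewrite -(ler_pM2r (exprn_gt0 k (ltr0Sn R 1))) e2 mulrC -ler_pdivlMr.
 have i2 : x k.+1 < u - s.
  by rewrite -(ltr_pM2r (exprn_gt0 k.+1 (ltr0Sn R 1))) e2 mulrC -ltr_pdivrMr.
 exists k; split.
  by rewrite in_itv /=; apply/andP; split; lra.
 by rewrite lee_fin; apply: powR_neg_le; rewrite ?subr_le0// ltW.
move=> K; apply: (@le_trans _ _ (\sum_(k < K) (c `^ b * a ^+ k)%:E)%E).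
 apply: lee_sum => k _; rewrite [X in (_ * X)%E](mI k) -EFinM lee_fin.
 rewrite mulrC -{1}[x k.+1]powRr1 ?(ltW (x0 _))// -powRD; last by rewrite (gt_eqF (x0 _)) implybT.
 rewrite addrCA subrr addr0 /x powRM ?exprn_ge0 ?(ltW c0) ?(ltW h0)//.
 apply: ler_wpM2l; first side.
 rewrite powR_exprn ?(ltW h0)// -/a exprS; apply: ler_piMl; first side.
 exact: ltW.
rewrite sumEFin lee_fin -mulr_sumr mulrC; apply: ler_wpM2r; first side.
exact: geometric_sum_le.
Qed.

Lemma integral_powR_tail (g : R) : 0 < g -> exists2 C : R, 0 < C &
 forall c : R, 0 < c ->
 (\int[lebesgue_measure]_(x in `]c, +oo[) (x `^ (- g - 1))%:E <= (C * c `^ (- g))%:E)%E.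
move=> g0; pose a : R := 2 `^ (- g).
have a0 : 0 <= a by exact: powR_ge0.
have a1 : a < 1.
 have e1 : 1 `^ g = 1 :> R by rewrite powR1.
 rewrite /a powRN invf_lt1 ?powR_gt0// -[ltLHS]e1.
 by apply: gt0_ltr_powR; rewrite ?nnegrE// ltr1n.
exists ((1 - a)^-1); first side.
move=> c c0; pose x k : R := c * 2 ^+ k.
have x0 k : 0 < x k by rewrite mulr_gt0// exprn_gt0.
have xS k : x k.+1 - x k = x k by rewrite /x exprS; ring.
have mI k : lebesgue_measure (`[x k, x k.+1] : set R) = (x k)%:E.
 rewrite lebesgue_measure_itv /= lte_fin.
 by rewrite -[x k.+1](subrK (x k)) xS ltrDr x0 -EFinB addrK.
apply: (@integral_layers _ _ (@lebesgue_measure R) _ _ (fun k => `[x k, x k.+1]%classic)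
 (fun k => (x k `^ (- g - 1))%:E)) => //.
- side.
- side.
- move=> u /=; rewrite in_itv /= andbT => cu.
 have u0 := lt_trans cu.
 have uc : 1 <= u / c by rewrite ler_pdivlMr// mul1r ltW.
 have [k /andP[k1 k2]] := @geo_scale 2 (u / c) (lexx _) uc.
 have i1 : x k <= u by rewrite /x mulrC -ler_pdivlMr.
 exists k; split.
  by rewrite in_itv /= i1 /x mulrC -ler_pdivrMr// ltW.
 rewrite lee_fin; apply: powR_neg_le => //.
 by rewrite -opprD oppr_le0 addr_ge0 ?ltW.
move=> K; apply: (@le_trans _ _ (\sum_(k < K) (c `^ (- g) * a ^+ k)%:E)%E).
 apply: lee_sum => k _; rewrite [X in (_ * X)%E](mI k) -EFinM lee_fin.
 rewrite mulrC -{1}[x k]powRr1 ?(ltW (x0 _))// -powRD; last by rewrite (gt_eqF (x0 _)) implybT.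
 rewrite addrCA subrr addr0 /x powRM ?exprn_ge0 ?(ltW c0)//.
 by rewrite powR_exprn.
rewrite sumEFin lee_fin -mulr_sumr mulrC; apply: ler_wpM2r; first side.
exact: geometric_sum_le.
Qed.

(* The beta integral behind the fractional derivative; near [s] the second
  factor is bounded, far from [s] we have [u - s >= u / 2]. *)
Lemma integral_beta (b d : R) : 0 < b -> b <= 1 -> b < d -> exists2 C : R, 0 < C &
 forall s : R, 0 < s ->
 (\int[lebesgue_measure]_(u in `]s, +oo[) ((u - s) `^ (b - 1) * u `^ (- d))%:E <=
  (C * s `^ (b - d))%:E)%E.
move=> b0 b1 bd.
have [C1 C10 h1] := integral_powR_near b0 b1.
have db : 0 < d - b by side.
have [C2 C20 h2] := integral_powR_tail db.
have d0 : 0 < d by exact: lt_trans bd.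
exists (C1 + 2 `^ (1 - b) * C2 * 2 `^ (b - d)).
 side.
move=> s s0; have s20 : 0 < 2 * s by exact: mulr_gt0.
have F0 (u : R) : (0 <= ((u - s) `^ (b - 1) * u `^ (- d))%:E)%E by side.
have mpow (r a : R) : measurable_fun setT (fun u : R => (u - a) `^ r) by side.
have mF D : measurable_fun D (fun u : R => ((u - s) `^ (b - 1) * u `^ (- d))%:E).
 apply/measurable_EFinP; apply: measurable_funTS; apply: measurable_funM; first exact: mpow.
 side.
have -> : `]s, +oo[%classic = `]s, (s + s)%R] `|` `](s + s)%R, +oo[ :> set R.
 apply/seteqP; split => u /=; rewrite !in_itv /= ?andbT.
  by move=> su; case: (leP u (s + s)) => h; [left; rewrite su|right].
 by move=> [/andP[]//|h]; apply: lt_trans h; rewrite ltrDl.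
rewrite ge0_integral_setU//=; last first.
 rewrite disj_set2E; apply/eqP/seteqP; split => u //=; rewrite !in_itv /= andbT.
 by move=> [/andP[_ h1'] h2']; move: (le_lt_trans h1' h2'); rewrite ltxx.
 exact: mF.
rewrite mulrDl EFinD; apply: leeD.
 apply: (@le_trans _ _ (\int[lebesgue_measure]_(u in `]s, (s + s)%R]) ((s `^ (- d))%:E * ((u - s) `^ (b - 1))%:E))%E).
  apply: le_integralW => //= u; rewrite in_itv /= => /andP[su us].
  rewrite -EFinM lee_fin mulrC; apply: ler_wpM2r; first side.
  by apply: powR_neg_le; rewrite ?oppr_le0// ltW.
 rewrite ge0_integralZl//; last first.
 - side.
 - side.
 - by apply/measurable_EFinP; apply: measurable_funTS; exact: mpow.
 apply: le_trans (lee_wpmul2l _ (h1 s s s0)) _; first side.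
 rewrite -EFinM lee_fin mulrCA -powRD; last by rewrite (gt_eqF s0) implybT.
 by rewrite [- d + b]addrC.
apply: (@le_trans _ _ (\int[lebesgue_measure]_(u in `](2 * s)%R, +oo[) ((2 `^ (1 - b))%:E * (u `^ (- (d - b) - 1))%:E))%E).
 rewrite (_ : s + s = 2 * s); last by ring.
 apply: le_integralW => //= u; rewrite in_itv /= andbT => su.
 have u0 : 0 < u by exact: lt_trans su.
 have us : u / 2 <= u - s by lra.
 have e : (u - s) `^ (b - 1) <= (u / 2) `^ (b - 1).
  by apply: powR_neg_le; rewrite ?subr_le0// divr_gt0.
 rewrite -EFinM lee_fin; apply: le_trans (ler_wpM2r (powR_ge0 _ _) e) _.
 rewrite (powRM _ (ltW u0)) ?invr_ge0// -powR_inv1// -powRrM mulN1r opprB.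
 rewrite mulrAC mulrC -powRD; last by rewrite (gt_eqF u0) implybT.
 by rewrite (_ : b - 1 - d = - (d - b) - 1)//; ring.
rewrite ge0_integralZl//; last first.
- side.
- apply/measurable_EFinP; apply: measurable_funTS; apply: meas_powR; exact: measurable_id.
apply: le_trans (lee_wpmul2l _ (h2 _ s20)) _; first side.
by rewrite -EFinM lee_fin opprB (powRM _ (ltW (ltr0Sn R 1)) (ltW s0)) !mulrA.
Qed.

End layered_integrals.

Lemma shift_exponent (R : realType) (t u v1 v2 v3 : R) : u <= 8 * t -> 0 <= t -> v3 <= u ->
 0 <= v1 -> v2 <= (1 + 1) * v3 + (1 + 1) * v1 -> v2 <= 112 * t + 14 * v1.
by move=> *; lra. Qed.

Lemma powR_root_le (R : realType) (q a r W : R) : 0 < q -> 0 <= a -> 0 <= r -> 0 <= W ->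
 a `^ q <= W * r `^ q -> a <= W `^ q^-1 * r.
move=> q0 a0 r0 W0; have W1 := powR_ge0 W q^-1.
have -> : W * r `^ q = (W `^ q^-1 * r) `^ q.
 by rewrite powRM// -powRrM mulVf ?gt_eqF// powRr1.
move=> h; rewrite leNgt; apply/negP => lt; move: h; apply/negP; rewrite -ltNge.
by apply: gt0_ltr_powR; rewrite ?nnegrE ?mulr_ge0.
Qed.

(** * Dyadic scales *)

Section dyadic_scales.
Context (R : realType).

(* An enumeration of all the powers of 2, indexed by nat. *)
Definition dyad (k : nat) : R := if odd k then 2^-1 ^+ (k./2).+1 else 2 ^+ k./2.

Lemma dyad_gt0 k : 0 < dyad k.
by rewrite /dyad; case: ifP => _; rewrite exprn_gt0 ?invr_gt0. Qed.

Lemma dyad_cover (v : R) : 0 < v -> exists k, 2 * dyad k ^+ 2 <= v <= 8 * dyad k ^+ 2.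
move=> v0; have [v1|v1] := leP 1 (v / 2).
 have [j /andP[j1 j2]] := geo_scale (ler_nat R 2 4 : _ = true) v1.
 exists j.*2; rewrite /dyad odd_double doubleK -exprM mulnC exprM.
 rewrite (_ : 2 ^+ 2 = 4); last by ring.
 by move: j1 j2; rewrite exprS; move: (4 ^+ j) => w w1 w2; apply/andP; split; lra.
have v2 : 1 <= 2 / v by rewrite ler_pdivlMr// mul1r; lra.
have [j /andP[j1 j2]] := geo_scale (ler_nat R 2 4 : _ = true) v2.
exists (j.*2.+1); rewrite /dyad /= odd_double /= uphalf_double -exprM mulnC exprM.
rewrite (_ : 2^-1 ^+ 2 = 4^-1); last by rewrite exprVn; congr (_^-1); ring.
have w0 : 0 < 4 ^+ j :> R by side.
move: j1 j2; rewrite ler_pdivlMr// ltr_pdivrMr// exprVn exprS; move: (4 ^+ j) w0 => w w0 w1 w2.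
have w40 : 0 < 4 * w by side.
by apply/andP; split; [rewrite ler_pdivrMr//|rewrite ler_pdivlMr//]; nra.
Qed.

(** The squares of the first [2 * L] scales are [4 ^ (- L)], ..., [4 ^ (L - 1)] in another order, so
    that sums over them become sums over consecutive dyadic times. *)
Lemma dyad_sum (G : R -> R) (L : nat) :
 \sum_(k < L.*2) G (dyad k ^+ 2) = \sum_(i < L + L) G ((4 ^+ L)^-1 * 4 ^+ i).
rewrite big_split_ord /=.
have -> : \sum_(i < L) G ((4 ^+ L)^-1 * 4 ^+ i) = \sum_(i < L) G ((4 ^+ i.+1)^-1).
 rewrite (reindex_inj rev_ord_inj) /=; apply: eq_bigr => i _; congr G.
 have e : 4 ^+ L = 4 ^+ (L - i.+1) * 4 ^+ i.+1 :> R by rewrite -exprD subnK.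
 by rewrite e invfM mulrAC mulVf ?mul1r// expf_neq0// pnatr_eq0.
have -> : \sum_(i < L) G ((4 ^+ L)^-1 * 4 ^+ (L + i)) = \sum_(i < L) G (4 ^+ i).
 by apply: eq_bigr => i _; rewrite exprD mulKf// expf_neq0// pnatr_eq0.
elim: L => [|L ih]; first by rewrite !big_ord0 addr0.
rewrite doubleS !big_ord_recr /= ih /dyad /= odd_double /= doubleK uphalf_double.
have e : 2 ^+ 2 = 4 :> R by ring.
rewrite -!exprM (mulnC L) (mulnC L.+1) exprM e exprVn exprM e; ring.
Qed.

Lemma sum_shift_le (F : nat -> R) (a b c : nat) : (forall i, 0 <= F i) -> (a + b <= c)%N ->
 \sum_(i < b) F (a + i)%N <= \sum_(l < c) F l.
move=> F0 abc; rewrite -(subnKC abc) !big_split_ord /=.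
by rewrite -addrA addrCA lerDl addr_ge0// sumr_ge0.
Qed.

End dyadic_scales.

(** [U] will be an area integral, not known to be measurable. It is bounded through the increasing
    measurable sequence [a L], to which monotone convergence applies; the hypothesis with an
    arbitrary [c] says that [U] is at most [D] times the supremum of that sequence. *)
Lemma integral_powR_sup d (X : measurableType d) (R : realType) (nu : {measure set X -> \bar R}) (U : X -> \bar R)
  (a : nat -> X -> R) (D r : R) (S : \bar R) : 0 < D -> 0 < r ->
 (forall x, (0 <= U x)%E) -> (forall L, measurable_fun setT (a L)) -> (forall L x, 0 <= a L x) ->
 (forall x L, a L x <= a L.+1 x) ->
 (forall x (c : \bar R), (forall L, ((a L x)%:E <= c)%E) -> (U x <= D%:E * c)%E) ->
 (forall L, (\int[nu]_x (a L x `^ r)%:E <= S)%E) ->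
 (\int[nu]_x (U x `^ r) <= (D `^ r)%:E * S)%E.
move=> D0 r0 U0 ma a0 aS Ua aI.
pose G x : \bar R := limn (fun L => (a L x `^ r)%:E).
have nd x : {homo (fun L => (a L x `^ r)%:E) : k l / (k <= l)%N >-> (k <= l)%E}.
 apply/nondecreasing_seqP => L; rewrite lee_fin; apply: ler_powR2; [exact: ltW|exact: a0|exact: aS].
have aG L x : ((a L x `^ r)%:E <= G x)%E.
 have := ereal_nondecreasing_cvgn (nd x) => /cvg_lim; rewrite /G => -> //.
 by apply: ereal_sup_ubound; exists L.
have G0 x : (0 <= G x)%E by apply: le_trans (aG 0%N x); rewrite lee_fin powR_ge0.
have mar L : measurable_fun setT (fun x => (a L x `^ r)%:E) by side.
have mG : measurable_fun setT G.
 apply: (emeasurable_fun_cvg (fun L x => (a L x `^ r)%:E)) => // x _.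
 exact: ereal_nondecreasing_is_cvgn (nd x).
apply: (@le_trans _ _ (\int[nu]_x ((D `^ r)%:E * G x))%E).
 apply: le_integralW => // [x _|x _]; first side.
 case EG : (G x) (G0 x) => [g| |] // g0; last first.
  by rewrite gt0_muley ?leey// lte_fin powR_gt0.
 rewrite lee_fin in g0; rewrite -EFinM.
 have h : (U x <= (D * g `^ r^-1)%:E)%E.
  rewrite EFinM; apply: Ua => L; rewrite lee_fin.
  have := aG L x; rewrite EG lee_fin => h.
  rewrite -[leLHS](powRr1 (a0 L x)) -(divff (lt0r_neq0 r0)) powRrM.
  by apply: ler_powR2 => //; [rewrite invr_ge0 ltW|exact: powR_ge0].
 case EU : (U x) h (U0 x) => [v| |] //; rewrite !lee_fin => h v0.
 apply: le_trans (ler_powR2 (ltW r0) v0 h) _.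
 by rewrite (powRM _ (ltW D0) (powR_ge0 _ _)) -powRrM mulVf ?gt_eqF// powRr1.
rewrite ge0_integralZl//; last side.
apply: lee_wpmul2l; first side.
rewrite (monotone_convergence nu measurableT)//; last side.
apply: lime_le; last exact: nearW.
apply: ereal_nondecreasing_is_cvgn; apply/nondecreasing_seqP => L.
apply: le_integralW => // x _; first side.
exact: nd.
Qed.

(** * Area integral bounded by square sums *)

Section area_bound.
Context (R : realType) (B : completeNormedModType R) (n : nat) (N : B -> R) (q M kap alpha : R).
Hypotheses (Nn : is_norm N) (q2 : 2 <= q) (M0 : 0 < M) (NM : forall b, N b <= M * `|b|)
 (kap0 : 0 < kap) (kN : forall b : B, `|b| <= kap * N b)
 (Nq : uniformly_convex q N) (alpha0 : 0 < alpha).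
Local Notation T := (Rn R n).
Local Notation mu := (lebesgue_Rn R n).
Local Notation K := (@heat_kernel R n).
Local Notation Y := (square_piece N q).
Implicit Types (f : T -> B) (p r s t u : R) (x y z : T).
Local Opaque heat_kernel heat heatop.

Let q0 : 0 < q. Proof. exact: lt_le_trans q2. Qed.
Let N0 b : 0 <= N b. Proof. exact: is_norm_ge0. Qed.

(** With [u = s + t] the derivative is [dheat m.+1 s] of the flow at time [t], from which
    [heat (256 * t) f x'] may be subtracted for any [x']. Jensen's inequality and the change of base
    point from [y] to [x'] give the [q]-gap at [x'] times a Gaussian weight in [|x - x'|], removed
    by averaging over [x'] at time [t]. *)
Lemma dheat_pointwise p (m : nat) : 1 <= p -> exists2 C : R, 0 < C & forall f t u x y,
 heat_Lp p f -> 0 < t -> 2 * t <= u <= 8 * t -> sqd x y <= u ->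
 (u ^+ m.+1 * `|dheat m.+1 u f y|) `^ q <= C * Y f t x.
move=> p1; have [C1 C10 h1] := @dheat_norm_sub R B n m.
pose A := (C1 * 2 ^+ m.+1 * kap) `^ q.
have A0 : 0 < A by rewrite powR_gt0// !mulr_gt0// exprn_gt0.
pose D : R := 7 `^ (n%:R / 2) * (1 + 2) `^ (n%:R / 2) * expR 1.
have D0 : 0 < D by rewrite !mulr_gt0 ?expR_gt0 ?powR_gt0// addr_gt0.
pose G : R := 2 `^ (n%:R / 2); have G0 : 0 < G by rewrite powR_gt0.
exists (A * D * G); first side.
move=> f t u x y hf t0 /andP[tu ut] xyu.
pose s := u - t; have us : s + t = u by rewrite subrK.
have st : t <= s by rewrite /s; lra.
have s7 : s <= 7 * t by rewrite /s; lra.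
have s0 : 0 < s by exact: lt_le_trans st.
have u0 : 0 < u by rewrite -us addr_gt0.
have s20 : 0 < 2 * s by side.
have t20 : 0 < 2 * t by side.
have t140 : 0 < 14 * t by side.
have t420 : 0 < 42 * t by side.
have [b b0 hb] := norm_heat_ub M0 NM t0 p1 hf.
have ft := heat_Lp_heat t0 p1 hf.
have hi := heat_Lp_integrable p1 ft.
have [bg hbg] := heat_gap_bounded Nn q2 M0 NM t0 p1 hf (ltW q0).
set a := u ^+ m.+1 * `|dheat m.+1 u f y|.
have a0 : 0 <= a by exact: (mulr_ge0 (exprn_ge0 _ (ltW u0)) (normr_ge0 _)).
have key x' : a `^ q <= A * D * expR (sqd x x' / (8 * t)) * kint (42 * t) (heat_gap N q q f t) x'.
 set c := heat (256 * t) f x'.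
 pose h z := `|heat t f z - c|.
 have mh : measurable_fun setT h.
  by apply: smeas_norm; apply: smeasB; [case: ft|exact: smeas_cst].
 have hg z : h z `^ q <= kap `^ q * heat_gap N q q f t x' z.
  rewrite /heat_gap /gap (subrr q) powRr0 mulr1 -/c -(powRM _ (ltW kap0) (N0 (heat t f z - c))).
  exact: (ler_powR2 (ltW q0) (normr_ge0 _) (kN _)).
 have hb2 z : 0 <= h z <= kap * (b + N c).
  rewrite normr_ge0 /=; apply: le_trans (kN _) _; apply: ler_wpM2l; first exact: ltW.
  by apply: le_trans (is_normB_le Nn _ _) _; rewrite lerD2r.
 have e1 : a <= C1 * 2 ^+ m.+1 * heatop (2 * s) h y.
  have := h1 s (heat t f) y c s0 hi.
  rewrite (dheat_semigroup m.+1 y s0 t0 p1 hf) us -(heatopE y s20 hb2) -EFinM lee_fin => e.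
  apply: le_trans (ler_wpM2l _ e) _; first side.
  rewrite mulrA; apply: ler_wpM2r; first by apply: heatop_ge0 => z; exact: normr_ge0.
  rewrite mulrCA; apply: ler_wpM2l; first exact: ltW.
  rewrite ler_pdivrMr ?exprn_gt0// -exprMn lerXn2r ?nnegrE ?(ltW u0) ?(ltW s20)//.
  by rewrite -us; lra.
 have H0 : 0 <= heatop (2 * s) h y by apply: heatop_ge0 => z; exact: normr_ge0.
 have C0 : 0 <= C1 * 2 ^+ m.+1 by side.
 apply: le_trans (ler_powR2 (ltW q0) a0 e1) _; rewrite (powRM _ C0 H0).
 have q1 : 1 <= q by apply: le_trans q2; rewrite ler1n.
 have e2 := heatop_jensen_bounded y s20 q1 mh hb2.
 have hbr z : 0 <= h z `^ q <= kap `^ q * bg.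
  rewrite powR_ge0 /=; apply: le_trans (hg z) _; apply: ler_wpM2l; first side.
  by case/andP: (proj2 hbg x' z).
 have e3 : heatop (2 * s) (fun z => h z `^ q) y <=
   kap `^ q * (D * expR (sqd x x' / (8 * t))) * kint (42 * t) (heat_gap N q q f t) x'.
  apply: (heatop_le_int s20 hbr t420 (proj2 hbg x')).
  have c0 : 0 <= kap `^ q * (D * expR (sqd x x' / (8 * t))) by side.
  rewrite /heat_int -ge0_integralZl//; last 2 first.
  - apply/measurable_EFinP; apply: measurable_funM; first side.
   exact: bounded_by_measurable hbg.
  - move=> z _; rewrite lee_fin; apply: mulr_ge0; first side.
   by case/andP: (proj2 hbg x' z).
  apply: le_integralW => // z _.
   side.
  rewrite -EFinM lee_fin.
  have k1 : K (2 * s) y z <= D * expR (sqd x x' / (8 * t)) * K (42 * t) x' z.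
   have s214 : 2 * s <= 14 * t by lra.
   apply: le_trans (heat_kernel_le y z s20 s214) _.
   have l7 : (14 * t / (2 * s)) `^ (n%:R / 2) <= 7 `^ (n%:R / 2).
    apply: ler_powR2; rewrite ?divr_ge0// ?(ltW t140) ?(ltW s20)//.
    by rewrite ler_pdivrMr//; lra.
   apply: le_trans (ler_wpM2r (kernel_ge0 _ _ _) l7) _.
   have := heat_kernel_shift x' y z t140 (ltr0Sn R 1).
   rewrite (_ : (1 + 2) * (14 * t) = 42 * t); last by ring.
   move=> k2; apply: le_trans (ler_wpM2l (powR_ge0 _ _) k2) _.
   rewrite /D -!mulrA; apply: ler_wpM2l; first side.
   apply: ler_wpM2l; first side.
   rewrite [leRHS]mulrA; apply: ler_wpM2r; first side.
   rewrite -expRD ler_expR (_ : 4 * (14 * (t * 2)) = 112 * t); last by ring.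
   rewrite ler_pdivrMr; last side.
   rewrite (_ : (1 + sqd x x' / (8 * t)) * (112 * t) = 112 * t + 14 * sqd x x'); last first.
    by field; rewrite gt_eqF.
   have := sqd_triangle x' x y (ltr01 : 0 < 1 :> R); rewrite invr1 (sqdC x' x).
   exact: shift_exponent ut (ltW t0) xyu (sqd_ge0 x x').
  apply: le_trans (ler_wpM2l (kernel_ge0 _ _ _) (hg z)) _.
  have gp : 0 <= heat_gap N q q f t x' z by exact: gap_ge0.
  rewrite mulrCA -[leRHS]mulrA; apply: ler_wpM2l; first side.
  by rewrite [leRHS]mulrA; apply: ler_wpM2r.
 apply: le_trans (ler_wpM2l (powR_ge0 _ _) (le_trans e2 e3)) _.
 rewrite /A (powRM _ C0 (ltW kap0)) le_eqVlt; apply/orP; left; apply/eqP.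
 by move: (_ `^ q) (_ `^ q) (kint _ _ _) (expR _) => v1 v2 v3 v4; ring.
have kb x' := kint_bounded x' t420 hbg.
have cb x' : 0 <= (fun _ : T => a `^ q) x' <= a `^ q by side.
rewrite -[leLHS](heatop_cst x t0 (powR_ge0 a q)).
apply: (heatop_le_int t0 cb t20 kb).
have ADG0 : 0 <= A * D * G by side.
rewrite /heat_int -ge0_integralZl//; last 2 first.
- side.
- by move=> z _; rewrite lee_fin; apply: mulr_ge0; [exact: kernel_ge0|case/andP: (kb z)].
apply: le_integralW => // x' _.
 side.
rewrite -EFinM lee_fin; apply: le_trans (ler_wpM2l (kernel_ge0 _ _ _) (key x')) _.
have gs := heat_kernel_gauss x x' t0; rewrite -/G in gs.
rewrite le_eqVlt; apply/orP; left; apply/eqP.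
transitivity (A * D * (expR (sqd x x' / (8 * t)) * K t x x') * kint (42 * t) (heat_gap N q q f t) x').
 by move: (kint _ _ _) (expR _) (K _ _ _) => v1 v2 v3; ring.
by rewrite gs; move: (kint _ _ _) (K _ _ _) => v1 v2; ring.
Qed.

Let m := (Num.truncn alpha).+1.
Let b := m%:R - alpha.
Let e := alpha / 2.
Let sg : R := (4 `^ (e * q))^-1.

Let b0 : 0 < b.
by rewrite subr_gt0; have /andP[] := truncn_itv (ltW alpha0). Qed.

Let b1 : b <= 1.
rewrite lerBlDr /m mulrSr addrC lerD2l.
by have /andP[] := truncn_itv (ltW alpha0).
Qed.

Let sg0 : 0 < sg. Proof. by rewrite invr_gt0 powR_gt0. Qed.

Let sg1 : sg < 1.
have e1 : 1 `^ (e * q) = 1 :> R by rewrite powR1.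
rewrite invf_lt1 ?powR_gt0// -[ltLHS]e1.
by apply: gt0_ltr_powR; rewrite ?nnegrE ?mulr_gt0// ltr1n.
Qed.

Let e0 : 0 < e. Proof. exact: divr_gt0. Qed.

(** The fractional derivative involves all times [u > s]. The hypothesis on [S] lets the piece at
    time [t * 4 ^ j] grow like [sg ^ (- j)], hence the derivative of order [m] at [u] like
    [u ^ (- m) * (u / s) ^ e]. As [e = alpha / 2 < alpha], the beta integral still converges. *)
Lemma frac_pointwise p : 1 <= p -> exists2 C : R, 0 < C & forall f t s x y (S : R),
 heat_Lp p f -> 0 < t -> 2 * t <= s <= 8 * t -> sqd x y <= s -> 0 <= S ->
 (forall j : nat, sg ^+ j * Y f (t * 4 ^+ j) x <= S) ->
 `|s `^ alpha *: frac_deriv alpha (fun u => heat u f y) s| `^ q <= C * S.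
move=> p1; have [C1 C10 h1] := dheat_pointwise (Num.truncn alpha) p1.
have bd : b < m%:R - e.
 by rewrite /b ltrD2l ltrN2 /e ltr_pdivrMr// ltr_pMr// ltr1n.
have [C2 C20 h2] := integral_beta b0 b1 bd.
pose g : R := `|(Gamma b)^-1|.
have g0 : 0 <= g by exact: normr_ge0.
pose c4 : R := 4 `^ e.
have c40 : 0 < c4 by exact: powR_gt0.
exists ((g * c4 * C2) `^ q * C1 + 1); first side.
move=> f t s x y S hf t0 /andP[ts st] xys S0 hS.
have hi := heat_Lp_integrable p1 hf.
have s0 : 0 < s by apply: lt_le_trans ts; exact: (mulr_gt0 (ltr0Sn _ 1) t0).
pose A := (C1 * S) `^ q^-1 * c4 * s `^ (- e).
have CS0 : 0 <= C1 * S by side.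
have A0 : 0 <= A by rewrite !mulr_ge0 ?powR_ge0.
have key u : s < u -> `|dheat m u f y| <= A * u `^ (- (m%:R - e)).
 move=> su; have u0 : 0 < u by exact: lt_trans su.
 have t20 : 0 < 2 * t by side.
 have ut1 : 1 <= u / (2 * t) by rewrite ler_pdivlMr// mul1r (le_trans ts)// ltW.
 have [j /andP[j1 j2]] := @geo_scale R 4 (u / (2 * t)) (ler_nat R 2 4) ut1.
 have tj0 : 0 < t * 4 ^+ j by side.
 have j3 : 2 * (t * 4 ^+ j) <= u <= 8 * (t * 4 ^+ j).
  move: j1 j2; rewrite ler_pdivlMr// ltr_pdivrMr// exprS => j1 j2.
  apply/andP; split; first by apply: le_trans j1; rewrite le_eqVlt; apply/orP; left; apply/eqP; ring.
  by apply: le_trans (ltW j2) _; rewrite le_eqVlt; apply/orP; left; apply/eqP; ring.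
 have xyu : sqd x y <= u by apply: le_trans xys _; exact: ltW.
 have h3 := h1 f (t * 4 ^+ j) u x y hf tj0 j3 xyu.
 have hj : 4 ^+ j <= 4 * u / s.
  apply: le_trans j1 _; rewrite ler_pdivrMr// mulrAC ler_pdivlMr//.
  rewrite [leRHS](_ : _ = u * (8 * t)); last by ring.
  by apply: ler_wpM2l => //; exact: ltW.
 have us0 : 0 < 4 * u / s by side.
 have hY : Y f (t * 4 ^+ j) x <= ((4 * u / s) `^ e) `^ q * S.
  have sgj : 0 < sg ^+ j by side.
  have := hS j; rewrite mulrC -ler_pdivlMr// => h; apply: le_trans h _.
  rewrite mulrC; apply: ler_wpM2r => //.
  rewrite /sg -exprVn invrK -powR_exprn// -powRrM.
  by apply: ler_powR2 => //; rewrite ?exprn_ge0// mulr_ge0 ?ltW.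
 have h4 : u ^+ m * `|dheat m u f y| <= (C1 * S) `^ q^-1 * (4 * u / s) `^ e.
  have l0 : 0 <= u ^+ m * `|dheat m u f y| by side.
  apply: (powR_root_le q0 l0 (powR_ge0 _ _) CS0).
  apply: le_trans h3 _; rewrite -mulrA; apply: ler_wpM2l; first exact: ltW.
  by rewrite [leRHS]mulrC.
 have um : u ^+ m = u `^ m%:R by rewrite powR_mulrn// ltW.
 have us : (4 * u / s) `^ e = c4 * s `^ (- e) * u `^ e.
  rewrite powRM ?mulr_ge0 ?invr_ge0 ?(ltW u0) ?(ltW s0)// powRM ?(ltW u0)//.
  by rewrite -powR_inv1 ?(ltW s0)// -powRrM mulN1r mulrAC.
 have um0 : 0 < u `^ m%:R by side.
 rewrite -(ler_pM2l um0) -{1}um; apply: le_trans h4 _.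
 rewrite us /A [leRHS]mulrCA -powRD; last by rewrite (gt_eqF u0) implybT.
 rewrite (_ : m%:R - (m%:R - e) = e); last by ring.
 by rewrite !mulrA.
have I1 : `|bochner_integral lebesgue_measure `]s, +oo[
  (fun u => (u - s) `^ (m%:R - alpha - 1) *: derive1n m (fun u => heat u f y) u)| <=
  A * (C2 * s `^ (b - (m%:R - e))).
 rewrite -lee_fin; apply: le_trans (bochner_norm_le _ _ _) _ => //.
 apply: (@le_trans _ _ (\int[lebesgue_measure]_(u in `]s, +oo[)
   (A%:E * ((u - s) `^ (b - 1) * u `^ (- (m%:R - e)))%:E))%E).
  apply: le_integralW => // u us.
  have su : s < u by move: us; rewrite /= in_itv /= andbT.
  have u0 : 0 < u by exact: lt_trans su.
  rewrite derive1n_heat// -EFinM lee_fin normrZ ger0_norm ?powR_ge0// mulrCA.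
  by apply: ler_wpM2l; [exact: powR_ge0|exact: key].
 rewrite ge0_integralZl//.
 - apply: le_trans (lee_wpmul2l _ (h2 s s0)) _; first side.
  side.
 - apply/measurable_EFinP; apply: measurable_funTS; apply: measurable_funM; apply: meas_powR.
   side.
  side.
 - side.
have I2 : `|s `^ alpha *: frac_deriv alpha (fun u => heat u f y) s| <=
  g * c4 * C2 * (C1 * S) `^ q^-1.
 rewrite /frac_deriv -/m -/b !normrZ -/g (ger0_norm (powR_ge0 _ _)).
 apply: le_trans (ler_wpM2l (powR_ge0 _ _) (ler_wpM2l g0 I1)) _.
 have es : s `^ alpha * s `^ (- e) * s `^ (b - (m%:R - e)) = 1.
  rewrite -!powRD ?(gt_eqF s0) ?implybT//.
  rewrite (_ : alpha - e + (b - (m%:R - e)) = 0); first by rewrite powRr0.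
  by rewrite /b; ring.
 rewrite [leLHS](_ : _ = g * c4 * C2 * (C1 * S) `^ q^-1 *
   (s `^ alpha * s `^ (- e) * s `^ (b - (m%:R - e)))); last by rewrite /A; ring.
 by rewrite es mulr1.
have gc0 : 0 <= g * c4 * C2 by side.
apply: le_trans (ler_powR2 (ltW q0) (normr_ge0 _) I2) _.
rewrite (powRM _ gc0 (powR_ge0 _ _)) -powRrM mulVf ?gt_eqF// powRr1//.
by rewrite mulrDl mul1r mulrA lerDl.
Qed.

(** Every base scale sees the later times with geometric weights [sg ^ j]. Summed over base scales,
    each dyadic time has total weight at most [1 / (1 - sg)]. *)
Let area_sum f (L : nat) x := \sum_(j < L) sg ^+ j * \sum_(k < L.*2) Y f (dyad R k ^+ 2 * 4 ^+ j) x.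

Lemma area_sum_le p f L x : 1 <= p -> heat_Lp p f ->
 area_sum f L x <= (1 - sg)^-1 * \sum_(l < 3 * L) Y f ((4 ^+ L)^-1 * 4 ^+ l) x.
move=> p1 hf; have t0 : 0 < (4 ^+ L)^-1 :> R by rewrite invr_gt0 exprn_gt0.
have Y0 l : 0 <= Y f ((4 ^+ L)^-1 * 4 ^+ l) x.
 by apply: (square_piece_ge0 Nn q2 M0 NM x _ p1 hf); exact: time4_gt0.
set S := \sum_(l < _) _; have S0 : 0 <= S by exact: sumr_ge0.
apply: (@le_trans _ _ (\sum_(j < L) sg ^+ j * S)); last first.
 rewrite -mulr_suml; apply: ler_wpM2r => //; apply: geometric_sum_le => //; exact: ltW.
apply: ler_sum => j _; apply: ler_wpM2l; first side.
rewrite (dyad_sum (fun t => Y f (t * 4 ^+ j) x)).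
rewrite (eq_bigr (fun i : 'I_(L + L) => Y f ((4 ^+ L)^-1 * 4 ^+ (j + i)%N) x)); last first.
 by move=> i _; rewrite -mulrA -exprD addnC.
apply: (sum_shift_le (F := fun l => Y f ((4 ^+ L)^-1 * 4 ^+ l) x)) => //.
by rewrite mulSn mul2n -addnn leq_add2r ltnW.
Qed.

Lemma meas_sqd_ball x r : measurable [set y | (sqd x y <= r)%R].
have ms : measurable_fun setT (sqd x).
 apply: (measurableT_comp (f := fun z : T * T => sqd z.1 z.2) (g := fun y => (x, y))).
  exact: meas_sqd.
 exact: measurable_pair1.
rewrite (_ : [set y | _] = sqd x @^-1` `]-oo, r]); last side.
by rewrite -[X in measurable X]setTI; apply: ms.
Qed.

(** On the ball the heat kernel at time [r ^ 2] is at least a multiple of [r ^ (- n)], and its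
    integral is 1. *)
Lemma ball_measure_le : exists2 C : R, 0 < C & forall (r : R) x, 0 < r ->
 (mu [set y | (sqd x y <= 9 * r ^+ 2)%R] <= (C * r ^+ n)%:E)%E.
pose c : R := expR (9 / 4) * (4 * pi) `^ (n%:R / 2).
have pi40 : 0 < 4 * pi :> R by side.
exists c; first by rewrite mulr_gt0 ?expR_gt0 ?powR_gt0.
move=> r x r0; set A := [set y | _].
have r20 : 0 < r ^+ 2 by side.
have mA : measurable A by exact: meas_sqd_ball.
rewrite -[A]setIT -integral_indic//.
have e4 : (4 * pi * r ^+ 2) `^ (n%:R / 2) = (4 * pi) `^ (n%:R / 2) * r ^+ n.
 rewrite powRM ?(ltW pi40) ?(ltW r20)//; congr (_ * _).
 rewrite powR_exprn ?(ltW r0)// -powR_mulrn ?powR_ge0// -powRrM divfK ?pnatr_eq0//.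
 by rewrite powR_mulrn// ltW.
apply: (@le_trans _ _ (\int[mu]_y ((c * r ^+ n)%:E * (K (r ^+ 2) x y)%:E))%E).
 apply: le_integralW => // y _.
 rewrite -EFinM lee_fin indicE; case: (boolP (y \in A)) => [|_]; last first.
  by rewrite mulr_ge0 ?kernel_ge0// mulr_ge0 ?exprn_ge0 ?(ltW r0)// mulr_ge0 ?expR_ge0 ?powR_ge0.
 rewrite inE /A /= => yA; rewrite kernelE e4 /c.
 have P0 := lt0r_neq0 (powR_gt0 (n%:R / 2) pi40).
 have Q0 := lt0r_neq0 (exprn_gt0 n r0).
 rewrite [leRHS](_ : _ = expR (9 / 4) * expR (- (sqd x y / (4 * r ^+ 2)))).
  rewrite -expRD -[leLHS]expR0 ler_expR subr_ge0 ler_pdivrMr ?mulr_gt0//.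
  rewrite (_ : 9 / 4 * (4 * r ^+ 2) = 9 * r ^+ 2)//; by field.
 move: (expR _) (expR _) (_ `^ _) (r ^+ n) P0 Q0 => v1 v2 v3 v4 P0 Q0.
 by field; rewrite P0 Q0.
rewrite ge0_integralZl//.
- by rewrite integral_kernel// mule1.
- side.
- side.
- by rewrite lee_fin mulr_ge0 ?exprn_ge0 ?(ltW r0)// mulr_ge0 ?expR_ge0 ?powR_ge0.
Qed.

Lemma meas_cone x : measurable (cone x).
have m2 := measurable_snd.
have m1 : measurable_fun setT (fun yt : T * measurableTypeR R => sqd x yt.1).
 apply: (measurableT_comp (f := fun z : T * T => sqd z.1 z.2) (g := fun yt : T * measurableTypeR R => (x, yt.1))).
  exact: meas_sqd.
 apply/measurable_fun_pairP; split; first side.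
 exact: measurable_fst.
have -> : cone x = [set yt | 0 < (yt.2 : R)] `&` [set yt | sqd x yt.1 < (yt.2 : R) ^+ 2].
 apply/seteqP; split => -[y t] /= [t0 h]; split => //.
  by rewrite -eucl_dist_sqr ltrXn2r// ?nnegrE ?sqrtr_ge0// ltW.
 move: h; rewrite -eucl_dist_sqr => h; rewrite ltNge; apply/negP => le; move: h.
 by apply/negP; rewrite -leNgt lerXn2r// nnegrE ?sqrtr_ge0// ltW.
have mb (g : T * measurableTypeR R -> bool) : measurable_fun setT g -> measurable [set yt | g yt].
 by move=> mg; have := mg measurableT [set true] I; rewrite setTI; congr measurable.
by apply: measurableI; apply: mb; apply: measurable_fun_ltr => //; exact: measurable_funX.
Qed.

Let J f (y : T) t : \bar R :=
 (`|(t ^+ 2) `^ alpha *: frac_deriv alpha (fun u => heat u f y) (t ^+ 2)| `^ q / t ^+ n.+1)%:E.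

(** Points of the cone with [t ^ 2] between [2 r ^ 2] and [8 r ^ 2] lie in a ball of radius [3 r]
    times [[0, 3 r]], whose measure is at most a multiple of [r ^ (n + 1)] and cancels the weight of
    the cone. The scales [r = dyad k] cover all heights. *)
Lemma area_pointwise p : 1 <= p -> exists2 C : R, 0 < C & forall f x (c : \bar R),
 heat_Lp p f -> (forall L, ((area_sum f L x)%:E <= c)%E) ->
 (\int[mu \x lebesgue_measure]_(yt in cone x) J f yt.1 yt.2 <= C%:E * c)%E.
move=> p1; have [C1 C10 h1] := frac_pointwise p1.
have [C2 C20 h2] := ball_measure_le.
exists (C1 * C2 * 3); first side.
move=> f x c hf hc.
have Y0 k j : 0 <= Y f (dyad R k ^+ 2 * 4 ^+ j) x.
 apply: (square_piece_ge0 Nn q2 M0 NM x _ p1 hf); apply: mulr_gt0; last side.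
 by rewrite exprn_gt0// dyad_gt0.
pose F k j : \bar R := (sg ^+ j * Y f (dyad R k ^+ 2 * 4 ^+ j) x)%:E.
have F0 k j : (0 <= F k j)%E by rewrite lee_fin mulr_ge0// exprn_ge0// ltW.
pose S k : \bar R := (\sum_(0 <= j <oo) F k j)%E.
have S0 k : (0 <= S k)%E by exact: nneseries_ge0.
have SF k j : (F k j <= S k)%E.
 apply: le_trans (nneseries_lim_ge j.+1 _) => //.
 by rewrite big_nat_recr//= leeDr// sume_ge0.
have Sc L : (\sum_(k < L) S k <= c)%E.
 rewrite -(big_mkord xpredT S) -nneseries_sum_nat//.
 apply: lime_le; first by apply: is_cvg_nneseries => j _ _; rewrite sume_ge0.
 near=> j; rewrite big_mkord; apply: le_trans (hc (maxn L j)).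
 rewrite /area_sum -sumEFin.
 apply: (@le_trans _ _ (\sum_(i < maxn L j) (sg ^+ i * \sum_(k < (maxn L j).*2) Y f (dyad R k ^+ 2 * 4 ^+ i) x)%:E)%E); last by [].
 rewrite (big_ord_widen _ (fun i => \sum_(0 <= k < L) F k i)%E (leq_maxr L j)) big_mkcond /=.
 apply: lee_sum => i _; rewrite mulr_sumr -sumEFin; case: ifP => _; last side.
 rewrite big_mkord.
 have Lm : (L <= (maxn L j).*2)%N by rewrite -addnn (leq_trans (leq_maxl L j))// leq_addr.
 rewrite (big_ord_widen _ (fun k => F k i) Lm) big_mkcond /=.
 by apply: lee_sum => k _; case: ifP => _; [|exact: F0].
pose r k := dyad R k; have r0 k : 0 < r k by exact: dyad_gt0.
have rn0 k : 0 < r k ^+ n.+1 by side.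
apply: (@integral_layers _ _ _ _ _ _
 (fun k => [set y | sqd x y <= 9 * r k ^+ 2] `*` (`[0, 3 * r k]%classic : set (measurableTypeR R)))
 (fun k => ((C1 / r k ^+ n.+1)%:E * S k)%E)).
- exact: meas_cone.
- by move=> k; apply: measurableX; [exact: meas_sqd_ball|exact: measurable_itv].
- side.
- move=> [y t] /= [t0 _]; rewrite lee_fin divr_ge0 ?powR_ge0//.
 side.
- move=> [y t] [/= t0 xyt].
 have t20 : 0 < t ^+ 2 by side.
 have [k /andP[k1 k2]] := dyad_cover t20; exists k.
 have xyt2 : sqd x y <= t ^+ 2.
  by rewrite -eucl_dist_sqr lerXn2r// ?nnegrE ?sqrtr_ge0// ltW.
 have t3 : t <= 3 * r k.
  rewrite leNgt; apply/negP => h; have := k2; apply/negP; rewrite -ltNge.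
  apply: (@le_lt_trans _ _ ((3 * r k) ^+ 2)).
   by rewrite exprMn; apply: ler_wpM2r; [exact: sqr_ge0|lra].
  by rewrite ltrXn2r// ?nnegrE ?mulr_ge0 ?ltW.
 have rt : r k <= t.
  rewrite leNgt; apply/negP => h; have := k1; apply/negP; rewrite -ltNge.
  apply: (@lt_le_trans _ _ (r k ^+ 2)).
   by rewrite ltrXn2r// ?nnegrE ?ltW.
  by rewrite ler_peMl ?sqr_ge0// ler1n.
 split.
  split => /=; last by rewrite in_itv /= (ltW t0) t3.
  apply: le_trans xyt2 _; apply: le_trans k2 _; apply: ler_wpM2r; [exact: sqr_ge0|lra].
 have rt0 : 0 < t ^+ n.+1 by side.
 case ES : (S k) (S0 k) => [v| |] // v0; last first.
  by rewrite gt0_muley ?leey// lte_fin divr_gt0.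
 rewrite -EFinM lee_fin mulrAC.
 have vj j : sg ^+ j * Y f (r k ^+ 2 * 4 ^+ j) x <= v.
  by rewrite -lee_fin -ES; exact: SF.
 have rk20 : 0 < r k ^+ 2 by side.
 have := h1 f (r k ^+ 2) (t ^+ 2) x y v hf rk20 _ xyt2 _ vj.
 rewrite k1 k2 -lee_fin => /(_ isT v0) h3.
 apply: ler_pM; rewrite ?powR_ge0 ?invr_ge0 ?(ltW rt0)//.
 by rewrite lef_pV2 ?posrE// lerXn2r// nnegrE ltW.
move=> L; apply: (@le_trans _ _ (\sum_(k < L) (C1 * C2 * 3)%:E * S k)%E); last first.
 rewrite -ge0_sume_distrr//; apply: lee_wpmul2l; last exact: Sc.
 side.
apply: lee_sum => k _.
have mI : lebesgue_measure (`[0, 3 * r k] : set R) = (3 * r k)%:E.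
 by rewrite lebesgue_measure_itv /= lte_fin mulr_gt0// sube0.
rewrite [X in (_ * X <= _)%E](_ : _ = (mu [set y | (sqd x y <= 9 * r k ^+ 2)%R] * (3 * r k)%:E)%E); last first.
 rewrite -mI; apply: product_measure1E; [exact: meas_sqd_ball|exact: measurable_itv].
apply: (@le_trans _ _ ((C1 / r k ^+ n.+1)%:E * S k * (C2 * r k ^+ n * (3 * r k))%:E)%E).
 apply: lee_wpmul2l; first side.
 rewrite [(C2 * _ * _)%:E]EFinM; apply: lee_wpmul2r; last exact: h2.
 side.
rewrite muleAC -EFinM (_ : C1 / r k ^+ n.+1 * (C2 * r k ^+ n * (3 * r k)) = C1 * C2 * 3)//.
have Q0 := lt0r_neq0 (exprn_gt0 n (r0 k)); have Q1 := lt0r_neq0 (r0 k).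
rewrite exprS; move: (r k) (r k ^+ n) Q0 Q1 => v w Q0 Q1.
by field; rewrite Q0 Q1.
Unshelve. all: by end_near. Qed.

Lemma area_sum_integral p : 1 < p -> exists2 C : R, 0 < C & forall L f, heat_Lp p f ->
 (\int[mu]_x (area_sum f L x `^ (p / q))%:E <= C%:E * \int[mu]_x (`|f x| `^ p)%:E)%E.
move=> p1; have p0 : 0 < p by exact: lt_trans p1.
have r0 : 0 <= p / q by side.
have [C C0 hC] : exists2 C : R, 0 < C & forall L t0 f, 0 < t0 -> heat_Lp p f ->
  (\int[mu]_x ((\sum_(l < L) Y f (t0 * 4 ^+ l) x) `^ (p / q))%:E <=
  C%:E * \int[mu]_x (`|f x| `^ p)%:E)%E.
 have [pq|qp] := leP p q.
  exact: (square_sum_le n Nn q2 M0 NM Nq p1 pq).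
 exact: (square_sum_gt n Nn q2 M0 NM Nq qp).
pose g : R := (1 - sg)^-1.
have g0 : 0 < g by rewrite invr_gt0 subr_gt0.
exists (g `^ (p / q) * C); first side.
move=> L f hf; have p1w := ltW p1.
have t0 : 0 < (4 ^+ L)^-1 :> R by side.
have Y0 l x : 0 <= Y f ((4 ^+ L)^-1 * 4 ^+ l) x.
 by apply: (square_piece_ge0 Nn q2 M0 NM x _ p1w hf); exact: time4_gt0.
have mS : measurable_fun setT (fun x => \sum_(l < 3 * L) Y f ((4 ^+ L)^-1 * 4 ^+ l) x).
 by apply: measurable_sum => l; apply: (meas_square_piece Nn q2 M0 NM _ p1w hf); exact: time4_gt0.
have S0 x : 0 <= \sum_(l < 3 * L) Y f ((4 ^+ L)^-1 * 4 ^+ l) x by side.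
rewrite EFinM -muleA; apply: le_trans (lee_wpmul2l _ (hC (3 * L)%N _ f t0 hf)); last side.
rewrite -(ge0_integral_scale _ (meas_powR _ mS) (fun x => powR_ge0 _ _) (powR_ge0 _ _)).
apply: le_integralW => // x _; first side.
rewrite lee_fin -powRM ?(ltW g0)//; apply: ler_powR2 => //; last exact: area_sum_le p1w hf.
apply: sumr_ge0 => j _; apply: mulr_ge0; first side.
apply: sumr_ge0 => k _; apply: (square_piece_ge0 Nn q2 M0 NM x _ p1w hf).
by rewrite mulr_gt0 ?exprn_gt0// dyad_gt0.
Qed.

Theorem area_Lp_bound p : 1 < p -> exists2 C : R, 0 < C & forall f, heat_Lp p f ->
 (\int[mu]_x ((\int[mu \x lebesgue_measure]_(yt in cone x) J f yt.1 yt.2) `^ (p / q)) <=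
  C%:E * \int[mu]_x (`|f x| `^ p)%:E)%E.
move=> p1; have p0 : 0 < p by exact: lt_trans p1.
have p1w := ltW p1; have r0 : 0 < p / q by exact: divr_gt0.
have [C1 C10 h1] := area_pointwise p1w.
have [C2 C20 h2] := area_sum_integral p1.
exists (C1 `^ (p / q) * C2); first side.
move=> f hf.
have Y0 k j x : 0 <= Y f (dyad R k ^+ 2 * 4 ^+ j) x.
 apply: (square_piece_ge0 Nn q2 M0 NM x _ p1w hf); apply: mulr_gt0; last side.
 by rewrite exprn_gt0// dyad_gt0.
have mY k j : measurable_fun setT (Y f (dyad R k ^+ 2 * 4 ^+ j)).
 apply: (meas_square_piece Nn q2 M0 NM _ p1w hf).
 by rewrite mulr_gt0 ?exprn_gt0// dyad_gt0.
have sgj j : 0 <= sg ^+ j by side.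
rewrite EFinM -muleA.
apply: (@integral_powR_sup _ _ _ _ _ (area_sum f)) => //.
- move=> x; apply: integral_ge0 => -[y t] [/= t0 _].
 by rewrite lee_fin divr_ge0 ?powR_ge0// exprn_ge0// ltW.
- move=> L; apply: measurable_sum => j; apply: measurable_funM; first side.
 side.
- by move=> L x; apply: sumr_ge0 => j _; apply: mulr_ge0 => //; exact: sumr_ge0.
- move=> x L; rewrite /area_sum big_ord_recr /=; apply: ler_wpDr.
  side.
 apply: ler_sum => j _; apply: ler_wpM2l => //.
 by rewrite doubleS !big_ord_recr /= -addrA lerDl addr_ge0.
- by move=> x c; exact: h1.
- by move=> L; exact: h2.
Qed.

End area_bound.

(** * From the integrals to the L^p norms *)

Section norms.
Context (R : realType) (B : completeNormedModType R) (n : nat).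
Local Notation T := (Rn R n).
Local Notation mu := (lebesgue_Rn R n).
Implicit Types (f : T -> B) (p q alpha t : R).

Lemma bochner_norm_powR p f : 0 < p ->
 (bochner_norm p f `^ p = \int[mu]_x (`|f x| `^ p)%:E)%E.
move=> p0; rewrite /bochner_norm (powR_Lnorm _ _ (lt0r_neq0 p0)).
by apply: eq_integral => x _; rewrite gee0_abs ?lee_fin// poweR_EFin.
Qed.

Lemma bochner_norm_root p f : 0 < p ->
 (bochner_norm p f = (\int[mu]_x (`|f x| `^ p)%:E) `^ p^-1)%E.
move=> p0; rewrite -(bochner_norm_powR f p0) -poweRrM (divff (lt0r_neq0 p0)) poweRe1//.
exact: Lnorm_ge0.
Qed.

Lemma bochner_Lp_smeas p f : 0 < p -> bochner_Lp p f -> exists g, [/\ heat_Lp p g,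
 {ae mu, forall x, setT x -> f x = g x} &
 (\int[mu]_x (`|f x| `^ p)%:E = \int[mu]_x (`|g x| `^ p)%:E)%E].
move=> p0 [/(strongly_measurable_smeas measurableT)[g mg fg] foo].
have E : (\int[mu]_x (`|f x| `^ p)%:E = \int[mu]_x (`|g x| `^ p)%:E)%E.
 apply: ge0_ae_eq_integralW; last by apply: filterS fg => x h /h ->.
 - side.
 - side.
 - side.
have G : (\int[mu]_x (`|g x| `^ p)%:E < +oo)%E.
 by rewrite -E -(bochner_norm_powR f p0); exact: poweR_lty.
have H : Lplus p (fun x => `|g x|) by split=> //; exact: smeas_norm.
by exists g; split=> //; split.
Qed.

Lemma heat_ae f g t x : {ae mu, forall x, setT x -> f x = g x} -> heat t f x = heat t g x.
move=> fg; apply: (bochner_integral_ae measurableT).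
by apply: filterS fg => y h /h ->.
Qed.

Definition area_int q alpha f x : \bar R :=
 (\int[mu \x lebesgue_measure]_(yt in cone x)
  (`|((yt.2 : R) ^+ 2) `^ alpha *: frac_deriv alpha (fun u => heat u f yt.1) ((yt.2 : R) ^+ 2)| `^ q
    / (yt.2 : R) ^+ n.+1)%:E)%E.

Lemma area_integralE q alpha f x : area_integral q alpha f x = (area_int q alpha f x `^ q^-1)%E.
by []. Qed.

Lemma area_integral_ae q alpha f g : {ae mu, forall x, setT x -> f x = g x} ->
 area_integral q alpha f = area_integral q alpha g.
move=> fg; have E y : (fun u => heat u f y) = (fun u => heat u g y).
 by apply/funext => u; exact: heat_ae.
apply/funext => x; rewrite !area_integralE; apply: (congr1 (fun z => z `^ _)%E).
by apply: eq_integral => yt _; rewrite E.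
Qed.

Lemma area_integral_Lnorm p q alpha f : 0 < p -> 0 < q ->
 ('N[mu]_p%:E [area_integral q alpha f] =
  (\int[mu]_x (area_int q alpha f x `^ (p / q))) `^ p^-1)%E.
move=> p0 q0; rewrite -[LHS]poweRe1 ?Lnorm_ge0// -(divff (lt0r_neq0 p0)) poweRrM.
rewrite (powR_Lnorm _ _ (lt0r_neq0 p0)); apply: (congr1 (fun z => z `^ _)%E).
apply: eq_integral => x _.
by rewrite area_integralE gee0_abs ?poweR_ge0// -poweRrM [(q^-1 * p)%R]mulrC.
Qed.

End norms.

Theorem uniformly_convex_area (R : realType) (B : completeNormedModType R) (n : nat)
  (q p alpha : R) (N : B -> R) : 2 <= q -> 1 < p -> 0 < alpha ->
 is_norm N -> equivalent_norms (fun b : B => `|b|) N -> uniformly_convex q N ->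
 exists2 C : R, 0 < C & forall f : Rn R n -> B, bochner_Lp p f ->
  ('N[lebesgue_Rn R n]_p%:E [area_integral q alpha f] <= C%:E * bochner_norm p f)%E.
move=> q2 p1 a0 Nn [c [M [c0 M0 cM]]] Nq.
have p0 : 0 < p by side.
have q0 : 0 < q by exact: lt_le_trans q2.
have NM b : N b <= M * `|b| by case/andP: (cM b).
have ci0 : 0 < c^-1 by side.
have kN (b : B) : `|b| <= c^-1 * N b by rewrite ler_pdivlMl//; case/andP: (cM b).
have [C C0 hC] := area_Lp_bound n Nn q2 M0 NM ci0 kN Nq a0 p1.
exists (C `^ p^-1); first side.
move=> f hf; have [g [hg fg Efg]] := bochner_Lp_smeas p0 hf.
rewrite (area_integral_ae q alpha fg) (area_integral_Lnorm _ _ p0 q0) bochner_norm_root// Efg.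
have I0 : (0 <= \int[lebesgue_Rn R n]_x (`|g x| `^ p)%:E)%E by side.
have h := hC g hg.
rewrite -poweR_EFin -poweRM ?lee_fin ?(ltW C0)//.
apply: gt0_ler_poweR; last exact: h.
- side.
- rewrite in_itv /= leey andbT; apply: integral_ge0 => x _; exact: poweR_ge0.
- rewrite in_itv /= leey andbT; apply: mule_ge0 => //; rewrite lee_fin; exact: ltW.
Qed.

(** * Affine changes of variable on the line *)

Section affine.
Context (R : realType).
Local Notation mu := (@lebesgue_measure R).

Lemma meas_affine (r c : R) :
 measurable_fun setT (fun x : measurableTypeR R => (r * x + c : measurableTypeR R)).
apply: measurable_funD; last side.
side.
Qed.

Lemma lebesgue_measure_affine (r c : R) (A : set R) : 0 < r -> measurable A ->
 mu ((fun x => r * x + c) @^-1` A) = (r^-1%:E * mu A)%E.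
move=> r0 mA.
pose f (x : measurableTypeR R) : measurableTypeR R := r * x + c.
have mf : measurable_fun setT f := meas_affine r c.
pose m1 : {measure set (measurableTypeR R) -> \bar R} :=
 measure_function_pushforward__canonical__measure_function_Measure mu mf.
pose m2 : {measure set (measurableTypeR R) -> \bar R} := mscale (NngNum (ltW r0)) m1.
have E : forall B, measurable B -> mu B = m2 B.
 apply: lebesgue_measure_unique => X /ocitvP[->|[[a b] /= ab ->]].
  by rewrite !measure0.
 rewrite /m2 /mscale /= /pushforward.
 have -> : f @^-1` `]a, b]%classic = `]((a - c) / r), ((b - c) / r)]%classic.
  apply/seteqP; split => x /=; rewrite !in_itv /= /f ltr_pdivrMr// ler_pdivlMr//;
   by rewrite [x * r]mulrC ltrBlDr lerBrDr.
 rewrite !lebesgue_measure_itv /= !lte_fin ab ltr_pM2r ?invr_gt0// ltrD2r ab.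
 rewrite -!EFinB -EFinM; congr EFin.
 by rewrite -mulrBl opprB addrA subrK mulrC divfK// gt_eqF.
rewrite (E _ mA) /m2 /mscale /= /pushforward muleA -EFinM mulVf ?gt_eqF//.
by rewrite mul1e.
Qed.

Lemma ge0_integral_affine (r c : R) (h : R -> \bar R) : 0 < r ->
 measurable_fun setT h -> (forall x, (0 <= h x)%E) ->
 (\int[mu]_x h (r * x + c)%R = r^-1%:E * \int[mu]_x h x)%E.
move=> r0 mh h0; have mf := meas_affine r c.
have ri0 : 0 <= r^-1 by side.
pose m1 : {measure set (measurableTypeR R) -> \bar R} :=
 measure_function_pushforward__canonical__measure_function_Measure mu mf.
have -> : (\int[mu]_x h (r * x + c)%R = \int[m1]_x h x)%E.
 rewrite -[RHS]/(\int[pushforward mu (fun x : measurableTypeR R => (r * x + c : measurableTypeR R)%R)]_x h x)%E.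
 by rewrite (ge0_integral_pushforward mf)//; move=> x _; exact: h0.
have -> : (\int[m1]_x h x = \int[mscale (NngNum ri0) mu]_x h x)%E.
 apply: eq_measure_integral => A mA _; exact: lebesgue_measure_affine.
by rewrite ge0_integral_mscale.
Qed.

Lemma ge0_integral_opp (h : R -> \bar R) :
 measurable_fun setT h -> (forall x, (0 <= h x)%E) ->
 (\int[mu]_x h (- x)%R = \int[mu]_x h x)%E.
move=> mh h0; have mf : measurable_fun setT (-%R : measurableTypeR R -> measurableTypeR R).
 side.
rewrite -[LHS](@ge0_integral_pushforward _ _ _ _ _ _ mf mu setT h)//.
by apply: eq_measure_integral => A mA _; exact: lebesgue_measureN.
Qed.

End affine.

(** * Gaussian means of trigonometric functions *)

Section gaussian_mean.
Context (R : realType).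
Local Notation mu := (@lebesgue_measure R).
Implicit Types g : R -> R.

Lemma heat1_affine (t a w : R) : 0 < t ->
 Num.sqrt t * heat1 t a (Num.sqrt t * w + a) = heat1 1 0 w.
move=> t0; rewrite /heat1 mulr1 sub0r opprD addrCA subrr addr0 !sqrrN exprMn.
rewrite (sqr_sqrtr (ltW t0)) (sqrtrM _ (ltW (mulr_gt0 (ltr0Sn _ 3) (pi_gt0 R)))).
have st : Num.sqrt t != 0 by rewrite gt_eqF// sqrtr_gt0.
have sp : Num.sqrt (4 * pi) != 0 :> R by rewrite gt_eqF// sqrtr_gt0 mulr_gt0// pi_gt0.
rewrite mulrA invfM [_^-1 / _]mulrC mulVKf// mulr1; congr (_ * expR (- _)).
by field; rewrite gt_eqF.
Qed.

Definition gauss_mean g : R := \int[mu]_w (heat1 1 0 w * g w).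

Definition bounded_fun g := measurable_fun setT g /\ exists M, forall x, `|g x| <= M.

Lemma gauss_integrable g : bounded_fun g ->
 mu.-integrable setT (EFin \o (fun w => heat1 1 0 w * g w)).
move=> [mg [M hM]]; apply/integrableP; split.
 by apply/measurable_EFinP; apply: measurable_funM => //; exact: meas_heat1.
have M0 : 0 <= M by exact: le_trans (hM 0).
apply: (@le_lt_trans _ _ (\int[mu]_w (M * heat1 1 0 w)%:E)%E).
 apply: ge0_le_integral => //=.
 - apply/measurable_EFinP; apply: measurableT_comp => //.
  by apply: measurable_funM => //; exact: meas_heat1.
 - by apply/measurable_EFinP; apply: measurable_funM => //; exact: meas_heat1.
 - move=> w _; rewrite lee_fin normrM (ger0_norm (heat1_ge0 _ _ _)) mulrC.
  by apply: ler_wpM2r => //; exact: heat1_ge0.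
under eq_integral do rewrite EFinM.
rewrite ge0_integralZl//; first by rewrite integral_heat1// mule1 ltry.
- by apply/measurable_EFinP; exact: meas_heat1.
- by move=> w _; rewrite lee_fin heat1_ge0.
Qed.

Lemma gauss_meanK g : bounded_fun g ->
 (\int[mu]_w (heat1 1 0 w * g w)%:E)%E = (gauss_mean g)%:E.
by move=> /gauss_integrable /integrable_fin_num h; rewrite /gauss_mean /Rintegral fineK// h.
Qed.

Lemma gauss_meanD f g : bounded_fun f -> bounded_fun g ->
 gauss_mean (fun w => f w + g w) = gauss_mean f + gauss_mean g.
move=> bf bg; rewrite -(RintegralD measurableT (gauss_integrable bf) (gauss_integrable bg)).
by congr Rintegral; apply/funext => w; rewrite mulrDr.
Qed.

Lemma gauss_meanZ (a : R) g : bounded_fun g ->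
 gauss_mean (fun w => a * g w) = a * gauss_mean g.
move=> bg; rewrite -(RintegralZl a measurableT (gauss_integrable bg)).
by congr Rintegral; apply/funext => w; rewrite mulrCA.
Qed.

Lemma gauss_mean1 : gauss_mean (fun=> 1) = 1.
apply/EFin_inj; rewrite -gauss_meanK; last by split => //; exists 1 => x; rewrite normr1.
by under eq_integral do rewrite mulr1; rewrite integral_heat1.
Qed.

Lemma bounded_funZ (a : R) g : bounded_fun g -> bounded_fun (fun w => a * g w).
move=> [mg [M hM]]; split; first side.
by exists (`|a| * M) => x; rewrite normrM ler_wpM2l.
Qed.

Lemma bounded_funD f g : bounded_fun f -> bounded_fun g -> bounded_fun (fun w => f w + g w).
move=> [mf [M hM]] [mg [M' hM']]; split; first side.
by exists (M + M') => x; apply: le_trans (ler_normD _ _) _; exact: lerD.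
Qed.

Lemma meas_cos_affine (a b : R) : measurable_fun setT (fun w : R => cos (a * w + b)).
apply: measurableT_comp; last side.
apply: continuous_measurable_fun; exact: continuous_cos.
Qed.

Lemma bounded_cos (a b : R) : bounded_fun (fun w => cos (a * w + b)).
by split; [exact: meas_cos_affine|exists 1 => w; exact: cos_max]. Qed.

Lemma sin_cos_shift (x : R) : sin x = cos (x - pi / 2).
by rewrite cosB cos_pihalf sin_pihalf mulr0 mulr1 add0r. Qed.

Lemma bounded_cst (a : R) : bounded_fun (fun=> a).
by split => //; exists `|a|. Qed.

Lemma sin1_ge0 (x : R) : 0 <= 1 + sin x.
by rewrite -lerBlDl sub0r sin_geN1. Qed.

Lemma gauss_mean_sin (a : R) : gauss_mean (fun w => sin (a * w)) = 0.
have bs : bounded_fun (fun w => sin (a * w)).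
 under eq_fun do rewrite sin_cos_shift; exact: bounded_cos.
have bs1 : bounded_fun (fun w => 1 + sin (a * w)) by apply: bounded_funD => //; exact: bounded_cst.
have bs2 : bounded_fun (fun w => 1 + (-1) * sin (a * w)).
 by apply: bounded_funD; [exact: bounded_cst|exact: bounded_funZ].
have : gauss_mean (fun w => 1 + sin (a * w)) = gauss_mean (fun w => 1 + (-1) * sin (a * w)).
 apply/EFin_inj; rewrite -!gauss_meanK// -ge0_integral_opp.
 - apply: eq_integral => w _; rewrite mulrN sinN mulN1r; congr (_ * _)%:E.
  by rewrite /heat1 !sub0r opprK sqrrN.
 - apply/measurable_EFinP; apply: measurable_funM; first exact: meas_heat1.
  by case: bs1.
 - by move=> w; rewrite lee_fin; exact: (mulr_ge0 (heat1_ge0 _ _ _) (sin1_ge0 _)).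
rewrite !gauss_meanD ?gauss_meanZ//; try exact: bounded_cst; try exact: bounded_funZ.
by move=> /addrI; lra.
Qed.

(** Characteristic function of the Gaussian of variance 2. Its exact value is not computed:
    [gauss_cosE] yields [exp (- c a ^ 2)] with some [c > 0], which is all that is used. *)
Definition gauss_cos (a : R) : R := gauss_mean (fun w => cos (a * w)).

Lemma gauss_mean_cos (a b : R) : gauss_mean (fun w => cos (a * w + b)) = gauss_cos a * cos b.
have bc : bounded_fun (fun w => cos (a * w)).
 by have := bounded_cos a 0; under eq_fun do rewrite addr0.
have bs : bounded_fun (fun w => sin (a * w)).
 under eq_fun do rewrite sin_cos_shift; exact: bounded_cos.
under eq_fun do rewrite cosD -mulrN [cos _ * _]mulrC [sin _ * _]mulrC.
rewrite gauss_meanD; try exact: bounded_funZ.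
by rewrite !gauss_meanZ// gauss_mean_sin mulr0 addr0 mulrC.
Qed.

Lemma cos1_ge0 (x : R) : 0 <= 1 + cos x.
by rewrite -lerBlDl sub0r cos_geN1. Qed.

Lemma gauss_cos_le1 (a : R) : `|gauss_cos a| <= 1.
have bc : bounded_fun (fun w => cos (a * w)).
 by have := bounded_cos a 0; under eq_fun do rewrite addr0.
have key (e : R) : `|e| = 1 -> 0 <= 1 + e * gauss_cos a.
 move=> e1; rewrite -gauss_meanZ// -[X in X + _]gauss_mean1 -gauss_meanD; last 2 first.
 - exact: bounded_cst.
 - exact: bounded_funZ.
 apply: Rintegral_ge0 => w _; rewrite mulr_ge0 ?heat1_ge0//.
 rewrite -lerBlDl sub0r lerNl; apply: le_trans (ler_norm _) _.
 by rewrite normrN normrM e1 mul1r cos_max.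
have := key 1 (normr1 _); have := key (-1) (normrN1 _).
by rewrite ler_norml; lra.
Qed.

(** Adding 1 to the cosine makes the integrand nonnegative, so the affine substitution for
    nonnegative functions applies. *)
Lemma integral_heat1_cos (t a th ph : R) : 0 < t ->
 (\int[mu]_z (heat1 t a z * (1 + cos (th * z + ph)))%:E =
  (1 + gauss_cos (th * Num.sqrt t) * cos (th * a + ph))%:E)%E.
move=> t0; have s0 : 0 < Num.sqrt t by rewrite sqrtr_gt0.
pose h z : \bar R := (Num.sqrt t * (heat1 t a z * (1 + cos (th * z + ph))))%:E.
have mc : measurable_fun setT (fun z => heat1 t a z * (1 + cos (th * z + ph))).
 apply: measurable_funM; first exact: meas_heat1.
 by apply: measurable_funD => //; exact: meas_cos_affine.
have mh : measurable_fun setT h by apply/measurable_EFinP; exact: measurable_funM.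
have h0 z : (0 <= h z)%E.
 by rewrite lee_fin mulr_ge0 ?sqrtr_ge0// mulr_ge0 ?heat1_ge0 ?cos1_ge0.
have E : (\int[mu]_z (heat1 t a z * (1 + cos (th * z + ph)))%:E = (Num.sqrt t)^-1%:E * \int[mu]_z h z)%E.
 rewrite -ge0_integralZl//.
 by apply: eq_integral => z _; rewrite -EFinM mulKf// gt_eqF.
rewrite E -(ge0_integral_affine a s0 mh h0).
have b1 := bounded_cos.
rewrite -gauss_mean_cos -gauss_mean1 -gauss_meanD//; last exact: bounded_cst.
rewrite -gauss_meanK; last by apply: bounded_funD => //; exact: bounded_cst.
apply: eq_integral => w _; rewrite /h mulrA heat1_affine//; congr (_ * (_ + cos _))%:E.
by ring.
Qed.

End gaussian_mean.

(** * Multiplicative functions, and values of the characteristic function *)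

Section exponential.
Context (R : realType).
Implicit Types (g : R -> R).

(** Differentiating the multiplicative law in one variable gives [g' = - c * g]; hence
    [g u * exp (c u)] is constant, and multiplicativity forces the constant to be 1. *)
Lemma multiplicative_expR g (g1 : R -> R) (v : R) : 0 < v -> g v != 0 ->
 (forall s t : R, 0 < s -> 0 < t -> g (s + t) = g s * g t) ->
 (forall u : R, 0 < u -> is_derive u 1 g (g1 u)) ->
 exists c, forall u : R, 0 < u -> g u = expR (- (c * u)).
move=> v0 gv gM dg; pose c := - (g1 v / g v); exists c.
have dadd s t : 0 < s -> 0 < t -> g1 (s + t) = g1 s * g t.
 move=> s0 t0; have st0 : 0 < s + t by exact: addr_gt0.
 have d1 : is_derive s 1 (g \o (fun x => x + t)) (g1 (s + t) * (1 + 0)).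
  exact: (@is_derive1_comp _ g (fun x => x + t) s _ _ (dg _ st0)).
 have d2 : is_derive s 1 (fun x => g x * g t) (g1 s * g t).
  have d := dg s s0.
  have -> : (fun x => g x * g t) = (g t \*: g) by apply/funext => x; rewrite mulrC.
  by rewrite mulrC; exact: is_deriveZ.
 have : 'D_1 (g \o (fun x => x + t)) s = 'D_1 (fun x => g x * g t) s.
  apply: near_eq_derive; near=> x; rewrite /= gM//; near: x; exact: lt_nbhsr.
 by rewrite !derive_val addr0 mulr1.
have dE u : 0 < u -> g1 u = - c * g u.
 move=> u0; apply: (mulIf gv); rewrite -dadd// addrC dadd// /c opprK.
 by rewrite -mulrA [g u * g v]mulrC mulrA divfK.
(* The substitution [u = exp w] turns the half-line into the whole line, where a vanishing
   derivative gives a constant. *)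
pose H w := g (expR w) * expR (c * expR w).
have dH (w : R) : is_derive w (1 : R) H 0.
 have e0 := expR_gt0 w.
 have d1 : is_derive w 1 (g \o expR) (g1 (expR w) * expR w).
  exact: (@is_derive1_comp _ g expR w _ _ (dg _ e0)).
 have d2 : is_derive w 1 (fun w => c * expR w) (c * expR w).
  have d := is_derive_expR w; exact: (@is_deriveZ _ _ _ expR c w 1 _ d).
 have d3 : is_derive w 1 (expR \o (fun w => c * expR w)) (expR (c * expR w) * (c * expR w)).
  exact: is_derive1_comp.
 have d4 := is_deriveM d1 d3.
 apply: (is_derive_eq d4); rewrite /= dE//.
 rewrite -![_ *: _]/(_ * _); ring.
have HE u : 0 < u -> g u * expR (c * u) = g 1 * expR c.
 move=> u0; have := is_derive_0_is_cst (ln u) 0 dH.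
 by rewrite /H lnK// expR0 mulr1.
have E u : 0 < u -> g u = g 1 * expR c * expR (- (c * u)).
 by move=> u0; rewrite -(HE u u0) -mulrA -expRD subrr expR0 mulr1.
have A1 : g 1 * expR c = 1.
 have A0 : g 1 * expR c != 0.
  by apply: contraNneq gv => A0; rewrite E// A0 mul0r.
 have := gM 1 1 ltr01 ltr01; rewrite E; last side.
 move=> h; apply: (mulfI A0); rewrite mulr1 -[LHS]mulr1.
 have -> : g 1 * expR c * (g 1 * expR c) * 1 = g 1 * g 1 * expR (c * (1 + 1)).
  have -> : expR (c * (1 + 1)) = expR c * expR c by rewrite mulrDr mulr1 expRD.
  by ring.
 by rewrite -h -mulrA -expRD addNr expR0 mulr1.
by move=> u u0; rewrite E// A1 mul1r.
Unshelve. all: by end_near. Qed.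

Lemma gauss_cos_cvg : gauss_cos (k.+1%:R^-1 : R) @[k --> \oo] --> (1 : R).
pose f k w : \bar R := (heat1 1 0 w * cos (k.+1%:R^-1 * w))%:E.
have b k : bounded_fun (fun w : R => cos (k.+1%:R^-1 * w)).
 by have := bounded_cos (k.+1%:R^-1 : R) 0; under eq_fun do rewrite addr0.
have mh : measurable_fun setT (heat1 (1 : R) 0) by exact: meas_heat1.
have mu_h : (@lebesgue_measure R).-integrable setT (EFin \o heat1 (1 : R) 0).
 have := gauss_integrable (bounded_cst (1 : R)).
 by congr integrable; apply/funext => w; rewrite /= mulr1.
have [||||//|_ _ h] := @dominated_convergence _ _ _ (@lebesgue_measure R) setT measurableT f
  (EFin \o heat1 1 0) (EFin \o heat1 1 0).
- move=> k; apply/measurable_EFinP; apply: measurable_funM => //.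
 by case: (b k).
- side.
- apply: aeW => w _; apply: cvg_EFin; first by near=> k.
 rewrite -[X in _ --> X]mulr1; apply: cvgMr; rewrite -[X in _ --> X](@cos0 R) -(mul0r w).
 apply: (@cvg_comp _ _ _ _ cos); last exact: continuous_cos.
 apply: cvgMl; exact: cvg_harmonic.
- exact: mu_h.
- apply: aeW => w k _; rewrite lee_fin normrM (ger0_norm (heat1_ge0 _ _ _)).
 by rewrite -[leRHS]mulr1 ler_wpM2l ?heat1_ge0// cos_max.
move: h; rewrite integral_heat1// => h.
by case/fine_cvgP: h.
Unshelve. all: by end_near. Qed.

Lemma gauss_cos1_lt1 : gauss_cos (1 : R) < 1.
have bc : bounded_fun (fun w : R => cos (1 * w)).
 by have := bounded_cos (1 : R) 0; under eq_fun do rewrite addr0.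
have bN := bounded_funZ (-1) bc.
pose k := heat1 1 0 2 * (1 - cos 1) : R.
have c1 : cos 1 < 1 :> R.
 rewrite -[ltRHS](@cos0 R) ltr_cos ?ltr01// in_itv /= ?lexx ?ler01 ?pi_ge0//.
 by have := pi_ge2 R; lra.
have k0 : 0 < k.
 by rewrite mulr_gt0 ?subr_gt0// mulr_gt0 ?expR_gt0// invr_gt0 sqrtr_gt0 !mulr_gt0// pi_gt0.
have E : gauss_mean (fun w : R => 1 + (-1) * cos (1 * w)) = 1 - gauss_cos 1.
 by rewrite gauss_meanD ?gauss_meanZ// ?gauss_mean1 ?mulN1r//; exact: bounded_cst.
have bD : bounded_fun (fun w : R => 1 + (-1) * cos (1 * w)) by apply: bounded_funD => //; exact: bounded_cst.
have F0 (w : R) : 0 <= heat1 1 0 w * (1 + (-1) * cos (1 * w)).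
 by apply: mulr_ge0; [exact: heat1_ge0|rewrite mulN1r subr_ge0 cos_le1].
have mF : measurable_fun setT (fun w : R => (heat1 1 0 w * (1 + (-1) * cos (1 * w)))%:E).
 apply/measurable_EFinP; apply: measurable_funM; first exact: meas_heat1.
 by case: bD.
suff : (k%:E <= (1 - gauss_cos 1)%:E)%E by rewrite lee_fin; lra.
rewrite -E -gauss_meanK//.
have m12 : measurable `[1, 2 : R]%classic by side.
apply: (@le_trans _ _ (\int[lebesgue_measure]_(w in `[1%R, 2%R]) k%:E)%E).
 rewrite integral_cst//= lebesgue_measure_itv /= lte_fin ltr1n.
 by rewrite -EFinB -EFinM lee_fin -[leLHS]mulr1 ler_wpM2l ?(ltW k0)//; lra.
apply: (@le_trans _ _ (\int[lebesgue_measure]_(w in `[1%R, 2%R])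
  (heat1 1 0 w * (1 + (-1) * cos (1 * w)))%:E)%E).
 apply: ge0_le_integral => //.
 - side.
 - exact: measurable_funS mF.
 - move=> w; rewrite /= in_itv /= => /andP[w1 w2]; rewrite lee_fin.
  apply: ler_pM; [exact: heat1_ge0|by rewrite subr_ge0 cos_le1| |].
   rewrite ler_wpM2l ?invr_ge0 ?sqrtr_ge0// ler_expR lerN2 ler_pM2r ?invr_gt0//.
   by rewrite !sub0r !sqrrN lerXn2r// ?nnegrE; lra.
  rewrite mulN1r mul1r lerD2l lerN2; have [e|e] := eqVneq w 1; first by rewrite e.
  have w1' : 1 < w by rewrite lt_def e.
  by apply: ltW; rewrite ltr_cos ?in_itv /= ?mul1r//; have := pi_ge2 R; lra.
by apply: ge0_subset_integral => // w _; rewrite lee_fin.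
Qed.

End exponential.

(** * Cosine modes as eigenfunctions of the heat flow *)

Section modes.
Context (R : realType) (n : nat).
Local Notation T := (Rn R n.+1).
Local Notation mu := (lebesgue_Rn R n.+1).
Local Notation K := heat_kernel.
Implicit Types (th ph t a : R) (x : T).

(** Depends only on the first coordinate; the other coordinates of the kernel integrate to 1. *)
Definition mode th ph x : R := cos (th * tnth x ord0 + ph).

Lemma meas_mode th ph : measurable_fun setT (mode th ph).
apply: (measurableT_comp (f := fun w : R => cos (th * w + ph)) (g := fun x : T => tnth x ord0 : R)).
 exact: meas_cos_affine.
exact: measurable_tnth.
Qed.

Lemma mode_cons th ph (a : R) (v : Rn R n) : mode th ph (rn_cons (a, v)) = cos (th * a + ph).
by []. Qed.

Lemma mode_pi th ph x : mode th (ph + pi) x = - mode th ph x.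
by rewrite /mode addrA cosDpi. Qed.

Lemma heat_int_mode t th ph x : 0 < t ->
 heat_int t (fun y => 1 + mode th ph y) x =
 (1 + gauss_cos (th * Num.sqrt t) * mode th ph x)%:E.
move=> t0; have mm : measurable_fun setT (fun y => 1 + mode th ph y).
 by apply: measurable_funD => //; exact: meas_mode.
rewrite /heat_int ge0_integral_cons; last 2 first.
- side.
- by move=> y; rewrite lee_fin mulr_ge0 ?kernel_ge0 ?cos1_ge0.
rewrite -[x]rn_consK mode_cons -integral_heat1_cos//.
apply: eq_integral => a _.
under eq_integral => v _ do rewrite mode_cons heat_kernel_cons// mulrAC EFinM.
rewrite ge0_integralZl//.
- by rewrite integral_kernel// mule1.
- side.
- side.
- by rewrite lee_fin mulr_ge0 ?heat1_ge0 ?cos1_ge0.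
Qed.

(** For [d] in [[0, 1]] the function is [(1 - d) + d * (1 + mode)], a sum of nonnegative terms; a
    negative coefficient is a phase shift by [pi]. *)
Lemma heat_int_affine_mode t th c x : 0 < t -> `|c| <= 1 ->
 heat_int t (fun y => 1 + c * mode th 0 y) x =
 (1 + c * (gauss_cos (th * Num.sqrt t) * mode th 0 x))%:E.
move=> t0.
have key ph d : 0 <= d -> d <= 1 -> heat_int t (fun y => 1 + d * mode th ph y) x =
  (1 + d * (gauss_cos (th * Num.sqrt t) * mode th ph x))%:E.
 move=> d0 d1; have e0 : 0 <= 1 - d by rewrite subr_ge0.
 have mm : measurable_fun setT (fun y => 1 + mode th ph y).
  by apply: measurable_funD => //; exact: meas_mode.
 have -> : heat_int t (fun y => 1 + d * mode th ph y) x =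
   ((1 - d)%:E * heat_int t (fun => 1%R) x + d%:E * heat_int t (fun y => (1 + mode th ph y)%R) x)%E.
  rewrite /heat_int -!ge0_integralZl//; last 4 first.
  - side.
  - by move=> y _; rewrite lee_fin mulr_ge0 ?kernel_ge0 ?cos1_ge0.
  - side.
  - side.
  rewrite -ge0_integralD//; last 4 first.
  - side.
  - side.
  - by move=> y _; rewrite mule_ge0// lee_fin mulr_ge0 ?kernel_ge0 ?cos1_ge0.
  - side.
  by apply: eq_integral => y _; rewrite -!EFinM -EFinD; congr EFin; ring.
 rewrite heat_int_mode// heat_int_cst//.
 by rewrite -!EFinM -EFinD; congr EFin; ring.
move=> c1; have [c0|c0] := leP 0 c; first by apply: key => //; exact: le_trans (ler_norm _) c1.
have := key pi (- c); rewrite oppr_ge0 (ltW c0); move=> /(_ erefl).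
have -> : (fun y => 1 + - c * mode th pi y) = (fun y => 1 + c * mode th 0 y).
 by apply/funext => y; rewrite -[pi]add0r mode_pi mulrNN.
have -> : mode th pi x = - mode th 0 x by rewrite -[pi]add0r mode_pi.
move=> ->; first by congr EFin; ring.
by apply: le_trans (ler_norm _) _; rewrite normrN.
Qed.

Let zero_point : T := [tuple of nseq n.+1 (0 : R)].

Let mode0 th : mode th 0 zero_point = 1.
by rewrite /mode (tnth_nth 0) /= mulr0 addr0 cos0. Qed.

(** The semigroup law for [1 + mode], evaluated at the origin where the mode is 1. *)
Lemma gauss_cosM th s t : 0 < s -> 0 < t ->
 gauss_cos (th * Num.sqrt (s + t)) = gauss_cos (th * Num.sqrt s) * gauss_cos (th * Num.sqrt t).
move=> s0 t0; pose h y := 1 + mode th 0 y.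
have mh : measurable_fun setT h by apply: measurable_funD => //; exact: meas_mode.
have h0 y : 0 <= h y by exact: cos1_ge0.
have := heat_int_semigroup zero_point s0 t0 mh h0.
rewrite heat_int_mode ?addr_gt0// mode0 mulr1.
have -> : (\int[mu]_y ((K s zero_point y)%:E * heat_int t h y))%E =
  heat_int s (fun y => 1 + gauss_cos (th * Num.sqrt t) * mode th 0 y) zero_point.
 by apply: eq_integral => y _; rewrite heat_int_mode// -EFinM.
rewrite heat_int_affine_mode// ?gauss_cos_le1// mode0 mulr1 => e.
by rewrite [RHS]mulrC; move: (EFin_inj e) => h1; lra.
Qed.

Section vector_modes.
Variable B : completeNormedModType R.
Implicit Types (f g : T -> B) (b : B).

Lemma bounded_heat_L1 f (M : R) : smeas f -> (forall x, `|f x| <= M) -> heat_L1 f.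
move=> mf fM; split => // t x t0; have mn := smeas_norm mf.
have M0 : 0 <= M by exact: le_trans (fM x).
apply: (@le_lt_trans _ _ (heat_int t (fun=> M) x)); last by rewrite heat_int_cst// ltry.
apply: ge0_le_integral => //.
- side.
- side.
- side.
- by move=> y _; rewrite lee_fin ler_wpM2l ?kernel_ge0.
Qed.

Lemma smeas_mode th ph b : smeas (fun x => mode th ph x *: b).
apply: smeasZ; [exact: meas_smeas (meas_mode th ph)|exact: smeas_cst].
Qed.

Lemma heat_L1_mode th ph b : heat_L1 (fun x => mode th ph x *: b).
apply: (@bounded_heat_L1 _ `|b|); first exact: smeas_mode.
by move=> x; rewrite normrZ -[leRHS]mul1r ler_wpM2r ?cos_max.
Qed.

Lemma heat_mode t th ph b x : 0 < t ->
 heat t (fun y => mode th ph y *: b) x = (gauss_cos (th * Num.sqrt t) * mode th ph x) *: b.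
move=> t0; pose h y := 1 + mode th ph y.
have mh : measurable_fun setT h by apply: measurable_funD => //; exact: meas_mode.
have h0 y : 0 <= h y by exact: cos1_ge0.
have iK : mu.-integrable setT (EFin \o (fun z => K t x z * h z)).
 apply/integrableP; split; first side.
 rewrite (_ : (\int[mu]_z _)%E = heat_int t h x); last first.
  apply: eq_integral => z _; rewrite /= ger0_norm//.
  side.
 by rewrite heat_int_mode// ltry.
have E : heat t (fun y => h y *: b) x = (1 + gauss_cos (th * Num.sqrt t) * mode th ph x) *: b.
 apply: bochner_integral_eq => //.
 have := is_bochner_scale measurableT b (meas_heat_intl t x mh) iK.
 have -> : \int[mu]_z (K t x z * h z) = 1 + gauss_cos (th * Num.sqrt t) * mode th ph x.
  by rewrite /Rintegral -[X in fine X]/(heat_int t h x) heat_int_mode.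
 by congr is_bochner_integral; apply/funext => z; rewrite scalerA.
have : heat t (fun y => h y *: b) x = heat t (fun _ => b) x + heat t (fun y => mode th ph y *: b) x.
 rewrite -(heatD x t0 (heat_L1_cst _ b) (heat_L1_mode th ph b)).
 by congr heat; apply/funext => y; rewrite scalerDl scale1r.
by rewrite E heat_cst// scalerDl scale1r => /addrI ->.
Qed.

End vector_modes.
End modes.

(** As a function of [u = a ^ 2] this is the heat flow of a mode at the origin, hence
    differentiable, and [gauss_cosM] makes it multiplicative. [gauss_cos_cvg] provides a point where
    it does not vanish, and [gauss_cos1_lt1] makes [c] positive. *)
Lemma gauss_cosE (R : realType) : exists2 c : R, 0 < c &
 forall a : R, 0 < a -> gauss_cos a = expR (- (c * a ^+ 2)).
pose x0 : Rn R 1 := [tuple of nseq 1 (0 : R)].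
pose g (u : R) := heat u (fun y : Rn R 1 => mode 1 0 y *: (1 : R^o)) x0 : R.
have m0 : mode 1 0 x0 = 1 by rewrite /mode (tnth_nth 0) /= mulr0 addr0 cos0.
have gE (u : R) : 0 < u -> g u = gauss_cos (Num.sqrt u).
 by move=> u0; rewrite /g heat_mode// m0 mulr1 mul1r; exact: mulr1.
have [v v0 gv] : exists2 v : R, 0 < v & g v != 0.
 have := @gauss_cos_cvg R; move=> /cvgrPdist_lt/(_ 1 ltr01)[N _ /(_ N (leqnn N)) /=] h.
 have v0 : 0 < N.+1%:R^-1 :> R by side.
 exists (N.+1%:R^-1 ^+ 2); first side.
 rewrite gE ?exprn_gt0// sqrtr_sqr (ger0_norm (ltW v0)).
 by apply: contraTneq h => ->; rewrite subr0 normr1 ltxx.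
have gM (s t : R) : 0 < s -> 0 < t -> g (s + t) = g s * g t.
 move=> s0 t0; rewrite !gE ?addr_gt0//.
 by have := gauss_cosM 0 1 s0 t0; rewrite !mul1r.
have dg (u : R) : 0 < u -> is_derive u (1 : R) g
  (dheat 1 u (fun y : Rn R 1 => mode 1 0 y *: (1 : R^o)) x0 : R).
 move=> u0; have := is_derive_dheat 0 x0 u0 (heat_L1_mode 0 1 0 (1 : R^o)).
 by under eq_fun do rewrite dheat0.
have [c hc] := multiplicative_expR v0 gv gM dg.
have E (a : R) : 0 < a -> gauss_cos a = expR (- (c * a ^+ 2)).
 by move=> a0; rewrite -hc ?exprn_gt0// gE ?exprn_gt0// sqrtr_sqr gtr0_norm.
exists c => //; have := gauss_cos1_lt1 R; rewrite E// expr1n mulr1.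
by rewrite -[ltRHS](@expR0 R) ltr_expR oppr_lt0.
Qed.

Lemma lty_scale (R : realType) (k : R) (x : \bar R) : 0 < k -> (0 <= x)%E ->
 (k%:E * x < +oo)%E -> (x < +oo)%E.
by move=> k0; case: x => // [r _ _|_]; rewrite ?ltry// gt0_muley. Qed.

(** * Finiteness and positivity of the Gamma integral *)

Section gamma.
Context (R : realType).
Local Notation mu := (@lebesgue_measure R).
Implicit Types b s u x : R.

Lemma meas_gamma_integrand b :
 measurable_fun setT (fun x : R => (x `^ (b - 1) * expR (- x))%:E).
apply/measurable_EFinP; apply: measurable_funM.
 side.
apply: measurableT_comp; first side.
side.
Qed.

Lemma expR_le_inv_sqr x : 0 < x -> expR (- x) <= 4 * x `^ (- 2).
move=> x0; have e : (x / 2) ^+ 2 <= expR x.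
 have -> : expR x = expR (x / 2) ^+ 2 by rewrite expr2 -expRD -splitr.
 rewrite lerXn2r ?nnegrE ?expR_ge0 ?divr_ge0 ?(ltW x0)//.
 by apply: le_trans (expR_ge1Dx _); rewrite lerDr.
have -> : x `^ (- 2) = (x ^+ 2)^-1 by rewrite powRN -powR_mulrn ?(ltW x0).
rewrite expRN.
have -> : 4 / x ^+ 2 = ((x / 2) ^+ 2)^-1 by field; rewrite gt_eqF.
by rewrite lef_pV2// posrE ?expR_gt0// exprn_gt0// divr_gt0.
Qed.

Lemma exp_integral b m s : 0 < m ->
 (\int[mu]_(u in `]s, +oo[) ((u - s) `^ (b - 1) * expR (- (m * u)))%:E =
  (m `^ (- b) * expR (- (m * s)))%:E * \int[mu]_(x in `]0%R, +oo[) (x `^ (b - 1) * expR (- x))%:E)%E.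
move=> m0; have mi0 : 0 < m^-1 by rewrite invr_gt0.
pose h u : \bar R := (((u - s) `^ (b - 1) * expR (- (m * u))) * \1_(`]s, +oo[%classic : set R) u)%:E.
have mf : measurable_fun setT (fun u : R => (u - s) `^ (b - 1) * expR (- (m * u))).
 apply: measurable_funM; first side.
 apply: measurableT_comp; first side.
 by apply: measurable_funN; exact: measurable_funM.
have mh : measurable_fun setT h.
 by apply/measurable_EFinP; apply: measurable_funM => //; exact: measurable_indic.
have h0 u : (0 <= h u)%E by rewrite lee_fin !mulr_ge0 ?powR_ge0 ?expR_ge0.
have -> : (\int[mu]_(u in `]s, +oo[) ((u - s) `^ (b - 1) * expR (- (m * u)))%:E = \int[mu]_u h u)%E.
 rewrite integral_mkcond; apply: eq_integral => u _; rewrite patchE /h indicE.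
 by case: ifP => hu; rewrite ?mulr1 ?mulr0.
have := ge0_integral_affine s mi0 mh h0; rewrite invrK => hE.
have {hE} -> : (\int[mu]_u h u = (m^-1)%:E * \int[mu]_x h (m^-1 * x + s)%R)%E.
 by rewrite hE muleA -EFinM mulVf ?gt_eqF// mul1e.
rewrite [in RHS]integral_mkcond -!ge0_integralZl//; last 5 first.
- apply: (measurableT_comp (f := h) (g := fun x : R => m^-1 * x + s)) => //.
 side.
- side.
- have mD : measurable (`]0%R, +oo[%classic : set R) by side.
 apply/(measurable_restrictT _ mD); apply: measurable_funTS; exact: meas_gamma_integrand.
- by move=> x _; rewrite patchE; case: ifP => // _; rewrite lee_fin mulr_ge0 ?powR_ge0 ?expR_ge0.
- side.
apply: eq_integral => x _; rewrite patchE /h indicE.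
have -> : ((m^-1 * x + s) \in (`]s, +oo[%classic : set R)) = (0 < x).
 by apply/idP/idP; rewrite ?inE /= in_itv /= andbT ltrDr pmulr_rgt0.
rewrite mem_setE in_itv /= andbT; have [x0|x0] := ltP 0 x; last by rewrite mulr0 !mule0.
rewrite mulr1 -EFinM; congr EFin.
rewrite addrK mulrDr mulVKf ?gt_eqF// opprD expRD (powRM _ (ltW mi0) (ltW x0)).
rewrite -[in X in X * _ = _]powR_inv1 ?(ltW m0)//.
rewrite -powR_inv1 ?(ltW m0)// -powRrM.
rewrite [LHS](_ : _ = (m `^ (-1) * m `^ (-1 * (b - 1))) * expR (- (m * s)) * (x `^ (b - 1) * expR (- x))); last by ring.
rewrite -powRD; last by rewrite (gt_eqF m0) implybT.
by congr (_ `^ _ * _ * _); ring.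
Qed.

(** Finiteness follows from the beta integral with exponent [d = 2], after a shift by 1 and
    [exp (- u) <= 4 u ^ (- 2)]. It is needed to cancel the normalization of [frac_deriv] on
    exponentials. *)
Lemma Gamma_fin b : 0 < b -> b <= 1 -> 0 < Gamma b /\
 (\int[mu]_(x in `]0%R, +oo[) (x `^ (b - 1) * expR (- x))%:E = (Gamma b)%:E)%E.
move=> b0 b1; set I := (\int[mu]_(x in _) _)%E.
have I0 : (0 <= I)%E by apply: integral_ge0 => x _; rewrite lee_fin mulr_ge0 ?powR_ge0 ?expR_ge0.
have [C C0 hC] := @integral_beta R b 2 b0 b1 (le_lt_trans b1 (ltr1n R 2)).
have Ioo : (I < +oo)%E.
 have := exp_integral b 1 ltr01; rewrite mulr1 -/I => e.
 suff : ((1 `^ (- b) * expR (-1))%:E * I < +oo)%E.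
  have k0 : 0 < 1 `^ (- b) * expR (-1) :> R by side.
  exact: lty_scale k0 I0.
 rewrite -e; apply: (@le_lt_trans _ _ (\int[mu]_(u in `]1%R, +oo[) (4%:E * ((u - 1) `^ (b - 1) * u `^ (- 2))%:E))%E).
  apply: le_integralW => // u; first side.
  rewrite /= in_itv /= andbT => u1; rewrite -EFinM lee_fin mulrCA ler_wpM2l ?powR_ge0//.
  by rewrite mul1r; apply: expR_le_inv_sqr; exact: lt_trans u1.
 rewrite ge0_integralZl//; last 2 first.
 - apply/measurable_EFinP/measurable_funTS; apply: measurable_funM.
   side.
  side.
 - side.
 apply: lte_mul_pinfty => //.
 by apply: le_lt_trans (hC 1 ltr01) _; rewrite ltry.
have E : I = (Gamma b)%:E by rewrite /Gamma /Rintegral fineK// ge0_fin_numE.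
split => //; rewrite -lte_fin -E; apply: (@lt_le_trans _ _ (expR (-1))%:E); first by rewrite lte_fin expR_gt0.
apply: (@le_trans _ _ (\int[mu]_(x in `]0%R, 1%R]) (expR (-1))%:E)%E).
 by rewrite integral_cst//= lebesgue_measure_itv /= lte_fin ltr01 oppr0 adde0 mule1.
apply: (@le_trans _ _ (\int[mu]_(x in `]0%R, 1%R]) (x `^ (b - 1) * expR (- x))%:E)%E).
 apply: le_integralW => // x.
 rewrite /= in_itv /= => /andP[x0 x1]; rewrite lee_fin -[leLHS]mul1r.
 apply: ler_pM; rewrite ?expR_ge0 ?ler_expR ?lerN2//.
 have e1 : 1 `^ (b - 1) = 1 :> R by rewrite powR1.
 by rewrite -[leLHS]e1; apply: powR_neg_le; rewrite ?subr_le0.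
apply: ge0_subset_integral => //.
- by apply/measurable_funTS; exact: meas_gamma_integrand.
- side.
- by move=> x /=; rewrite !in_itv /= andbT => /andP[].
Qed.

End gamma.

(** * Fractional derivatives of exponential sums *)

Section exponential_sums.
Context (R : realType) (B : completeNormedModType R) (alpha : R).
Hypothesis a0 : 0 < alpha.
Local Notation m := (Num.truncn alpha).+1.
Local Notation b := (m%:R - alpha).
Implicit Types (l : seq (R * B)) (F : R -> B).

Lemma frac_order : 0 < b /\ b <= 1.
have /andP[h1 h2] := truncn_itv (ltW a0); split; first side.
by rewrite -natr1 lerBlDr addrC lerD2l.
Qed.

(** At a fixed point, the heat flow of a trigonometric polynomial is such a function of time, plus a
    constant. *)
Definition exp_sum l (u : R) : B := \sum_(z <- l) expR (- (z.1 * u)) *: z.2.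

Definition pos_rates l := all (fun z : R * B => 0 < z.1) l.

Definition scale_rates (c : R -> R) l : seq (R * B) := [seq (z.1, c z.1 *: z.2) | z <- l].

Lemma exp_sum_scale c l u :
 exp_sum (scale_rates c l) u = \sum_(z <- l) (c z.1 * expR (- (z.1 * u))) *: z.2.
by rewrite /exp_sum big_map; apply: eq_bigr => z _; rewrite scalerA mulrC.
Qed.

Lemma is_derive_scalel (f : R -> R) (v : B) (u d : R) :
 is_derive u (1 : R) f d -> is_derive u (1 : R) (fun x => f x *: v) (d *: v).
move=> df; have c : h^-1 *: (f (h + u) *: v - f u *: v) @[h --> 0^'] --> d *: v.
 have -> : (fun h : R => h^-1 *: (f (h + u) *: v - f u *: v)) =
   (fun h : R => (h^-1 *: (f (h + u) - f u)) *: v).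
  by apply/funext => h; rewrite -scalerBl scalerA.
 apply: cvgZr_tmp.
 have /derivable1P := @ex_derive _ _ _ _ _ _ _ df.
 rewrite -(@derive_val _ _ _ _ _ _ _ df).
 have := @ex_derive _ _ _ _ _ _ _ df.
 rewrite /derivable /derive; under eq_fun do rewrite [_ *: 1]mulr1.
 by [].
have E : (fun h : R => h^-1 *: (f (h *: 1 + u) *: v - f u *: v)) =
  (fun h : R => h^-1 *: (f (h + u) *: v - f u *: v)).
 by apply/funext => h; rewrite [_ *: 1]mulr1.
split; rewrite /derivable /derive ?E; last exact: cvg_lim c.
by apply/cvg_ex; exists (d *: v).
Qed.

Lemma is_derive_exp_sum l (u : R) :
 is_derive u (1 : R) (exp_sum l) (exp_sum (scale_rates -%R l) u).
rewrite exp_sum_scale; elim: l => [|z l ih].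
 rewrite big_nil; have -> : exp_sum [::] = cst 0 by apply/funext => v; rewrite /exp_sum big_nil.
 exact: is_derive_cst.
have -> : exp_sum (z :: l) = (fun u => expR (- (z.1 * u)) *: z.2) \+ exp_sum l.
 by apply/funext => v; rewrite /exp_sum big_cons.
rewrite big_cons; apply: is_deriveD.
have d1 : is_derive u (1 : R) (fun u => - (z.1 * u)) (- z.1).
 have -> : (fun u => - (z.1 * u)) = (- z.1) \*: (@id R).
  by apply/funext => v; rewrite /= -mulNr.
 by apply: is_derive_eq; rewrite -[RHS]mulr1.
have d2 : is_derive u (1 : R) (expR \o (fun u => - (z.1 * u))) (expR (- (z.1 * u)) * - z.1).
 exact: is_derive1_comp.
rewrite mulrC; exact: is_derive_scalel.
Qed.

Lemma derive1n_exp_sum k l F x0 : (forall u : R, 0 < u -> F u = x0 + exp_sum l u) ->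
 forall u : R, 0 < u -> derive1n k.+1 F u = exp_sum (scale_rates (fun r => (- r) ^+ k.+1) l) u.
move=> FE; elim: k => [|k ih] u u0.
 rewrite derive1nS derive1E derive1n0.
 have -> : 'D_1 F u = 'D_1 (cst x0 \+ exp_sum l) u.
  by apply: near_eq_derive; near=> v; rewrite /= FE//; near: v; exact: lt_nbhsr.
 have d := is_deriveD (is_derive_cst x0 u (1 : R)) (is_derive_exp_sum l u).
 by rewrite (@derive_val _ _ _ _ _ _ _ d) add0r.
rewrite derive1nS derive1E.
have -> : 'D_1 (derive1n k.+1 F) u = 'D_1 (exp_sum (scale_rates (fun r => (- r) ^+ k.+1) l)) u.
 by apply: near_eq_derive; near=> v; rewrite ih//; near: v; exact: lt_nbhsr.
have d := is_derive_exp_sum (scale_rates (fun r => (- r) ^+ k.+1) l) u.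
rewrite (@derive_val _ _ _ _ _ _ _ d) !exp_sum_scale /scale_rates big_map.
by apply: eq_bigr => z _; rewrite /= scalerA; congr (_ *: _); rewrite [in RHS]exprS; ring.
Unshelve. all: by end_near. Qed.

Lemma is_bochner_exp_sum l (s : R) : pos_rates l ->
 is_bochner_integral lebesgue_measure `]s, +oo[
  (fun u : R => (u - s) `^ (b - 1) *: exp_sum l u)
  (Gamma b *: exp_sum (scale_rates (fun r => r `^ (- b)) l) s).
have [b0 b1] := frac_order; have [G0 GE] := Gamma_fin b0 b1.
have mD : measurable (`]s, +oo[%classic : set (measurableTypeR R)) by side.
rewrite exp_sum_scale; elim: l => [_|z l ih /= /andP[z0 hl]].
 rewrite big_nil scaler0.
 have -> : (fun u : R => (u - s) `^ (b - 1) *: exp_sum [::] u) = (fun u => 0 *: (0 : B)).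
  by apply/funext => u; rewrite /exp_sum big_nil !scaler0.
 have m0 : measurable_fun setT (fun _ : measurableTypeR R => 0 : R) by [].
 have := is_bochner_scale mD (0 : B) m0 (integrable0 (@lebesgue_measure R) _).
 by rewrite [X in is_bochner_integral _ _ _ X -> _]scaler0.
pose c u : R := (u - s) `^ (b - 1) * expR (- (z.1 * u)).
have mc : measurable_fun setT c.
 apply: measurable_funM; first side.
 apply: measurableT_comp; first side.
 by apply: measurable_funN; exact: measurable_funM.
have cE : (\int[lebesgue_measure]_(u in `]s, +oo[) (c u)%:E = (Gamma b * (z.1 `^ (- b) * expR (- (z.1 * s))))%:E)%E.
 by rewrite exp_integral// GE -EFinM mulrC.
have ic : lebesgue_measure.-integrable `]s, +oo[ (EFin \o c).
 apply/integrableP; split; first by apply/measurable_EFinP; exact: measurable_funTS.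
 rewrite (_ : (\int[_]_(x in _) _)%E = (\int[lebesgue_measure]_(u in `]s, +oo[) (c u)%:E)%E); last first.
  by apply: eq_integral => u _; rewrite /= ger0_norm// mulr_ge0 ?powR_ge0 ?expR_ge0.
 by rewrite cE ltry.
have h1 := is_bochner_scale mD z.2 mc ic.
have := is_bochner_lin mD 1 h1 (ih hl).
rewrite /Rintegral cE /= scale1r big_cons scalerDr scalerA.
congr is_bochner_integral; apply/funext => u.
by rewrite /exp_sum big_cons scalerDr scale1r /c scalerA.
Qed.

(** On [exp (- r u)] the derivative of order [m] gives [(- r) ^ m] and the fractional integral of
    order [b] gives [r ^ (- b)]; together [(-1) ^ m * r ^ alpha]. *)
Lemma frac_deriv_exp_sum l F x0 (s : R) : pos_rates l -> 0 < s ->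
 (forall u : R, 0 < u -> F u = x0 + exp_sum l u) ->
 is_bochner_integral lebesgue_measure `]s, +oo[
  (fun u : R => (u - s) `^ (b - 1) *: derive1n m F u)
  (Gamma b *: ((-1) ^+ m *: exp_sum (scale_rates (fun r => r `^ alpha) l) s)).
move=> hl s0 FE; have [b0 b1] := frac_order.
have mD : measurable (`]s, +oo[%classic : set (measurableTypeR R)) by side.
have hl' : pos_rates (scale_rates (fun r => (- r) ^+ m) l) by rewrite /pos_rates all_map.
have := is_bochner_exp_sum s hl'; set v := _ *: exp_sum _ _; set v' := _ *: (_ *: _).
have -> : v = v'.
 rewrite /v /v'; congr (_ *: _); rewrite !exp_sum_scale /scale_rates big_map scaler_sumr.
 apply: eq_big_seq => z /(allP hl) z0; rewrite /= !scalerA; congr (_ *: _).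
 rewrite (exprNn z.1) -[z.1 ^+ m]powR_mulrn ?(ltW z0)//.
 have -> : z.1 `^ alpha = z.1 `^ (- b) * z.1 `^ m%:R.
  by rewrite -powRD ?opprB ?subrK// (gt_eqF z0) implybT.
 by ring.
move=> h; apply: (is_bochner_ae mD _ h); apply: aeW => u su.
have {}su : s < u by move: su; rewrite /= in_itv /= andbT.
by rewrite (derive1n_exp_sum _ FE) ?(lt_trans s0).
Qed.

End exponential_sums.

(** [phi] is composed with simple approximations of the identity of the line. *)
Lemma continuous_strongly_measurable (R : realType) (B : normedModType R) (phi : R -> B)
  (D : set (measurableTypeR R)) : (forall u, D u -> {for u, continuous phi}) ->
 strongly_measurable (@lebesgue_measure R) D phi.
move=> cphi; have [s [fs cs]] := meas_smeas (@measurable_id _ (measurableTypeR R) setT).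
exists (fun k u => phi (s k u)); split; first by move=> k; exact: (fsimple_comp phi (fs k)).
by apply: aeW => u Du; apply: (@cvg_comp _ _ _ _ phi _ _ _ (cs u)); exact: cphi.
Qed.

(** * Locality of the fractional derivative *)

Section cutoff.
Context (R : realType) (B : completeNormedModType R) (n : nat) (alpha : R).
Hypothesis a0 : 0 < alpha.
Local Notation T := (Rn R n).
Local Notation m := (Num.truncn alpha).+1.
Local Notation b := (m%:R - alpha).
Implicit Types (f g h : T -> B) (y : T) (s u r M : R).
Local Opaque heat dheat.

Lemma dheat_continuous k f y u : 0 < u -> heat_L1 f ->
 {for u, continuous (fun v => dheat k v f y)}.
move=> u0 hf; have d := is_derive_dheat k y u0 hf.
by apply: differentiable_continuous; apply/derivable1_diffP; exact: ex_derive.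
Qed.

Lemma expR_le_powR_neg (v e : R) : 0 < v -> 0 < e -> e <= 1 -> expR (- v) <= v `^ (- e).
move=> v0 e0 e1; rewrite expRN powRN lef_pV2 ?posrE ?expR_gt0 ?powR_gt0//.
have [v1|v1] := leP v 1.
 apply: (@le_trans _ _ 1); last by rewrite -[leLHS](@expR0 R) ler_expR ltW.
 have h : 1 `^ e = 1 :> R by rewrite powR1.
 by rewrite -[leRHS]h; apply: ge0_ler_powR; rewrite ?nnegrE ?(ltW e0) ?(ltW v0).
apply: (@le_trans _ _ (v `^ 1)); first by apply: ler_powR => //; exact: ltW.
by rewrite powRr1 ?(ltW v0)//; apply: le_trans (expR_ge1Dx _); rewrite lerDr.
Qed.

(** Below [alpha], for the convergence of the beta integral, and at most 1, for
    [expR_le_powR_neg]. *)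
Definition cutoff_order : R := Num.min alpha 1 / 2.

Lemma cutoff_orderP : [/\ 0 < cutoff_order, cutoff_order <= 1 & cutoff_order < alpha].
have m0 : 0 < Num.min alpha 1 by rewrite lt_min a0 ltr01.
rewrite /cutoff_order; split; first side.
 have : Num.min alpha 1 <= 1 by rewrite ge_min lexx orbT.
 by lra.
have : Num.min alpha 1 <= alpha by rewrite ge_min lexx.
by lra.
Qed.
Local Notation e := cutoff_order.

Lemma heat_int_tail : exists2 C : R, 0 < C & forall h M r y u, 0 < r -> 0 < u -> 0 <= M ->
 measurable_fun setT (fun z => `|h z|) ->
 (forall z, `|h z| <= M) -> (forall z, sqd y z < r ^+ 2 -> h z = 0) ->
 (heat_int (2 * u) (fun z => `|h z|%R) y <= (C * M * (u / r ^+ 2) `^ e)%:E)%E.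
have [e0 e1 _] := cutoff_orderP.
exists (2 `^ (n%:R / 2) * 16 `^ e); first side.
move=> h M r y u r0 u0 M0 mh hM hr.
have r20 : 0 < r ^+ 2 by side.
have t2 : 0 < 2 * u by side.
have t4 : 0 < 4 * u by side.
pose k := 2 `^ (n%:R / 2) * (16 * u / r ^+ 2) `^ e * M.
have k0 : 0 <= k by rewrite !mulr_ge0 ?powR_ge0.
apply: (@le_trans _ _ (heat_int (4 * u) (fun=> k) y)); last first.
 rewrite heat_int_cst// lee_fin /k.
 have -> : 16 * u / r ^+ 2 = 16 * (u / r ^+ 2) by rewrite mulrA.
 rewrite (powRM _ _ (ltW (divr_gt0 u0 r20)))//.
 by rewrite le_eqVlt; apply/orP; left; apply/eqP; ring.
apply: le_integralW => // [z _|z _].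
 side.
rewrite lee_fin; have [hz|hz] := ltP (sqd y z) (r ^+ 2).
 by rewrite (hr _ hz) normr0 mulr0 mulr_ge0 ?kernel_ge0.
have d := heat_kernel_damp y z t2 t4.
have K4 : 0 <= heat_kernel (4 * u) y z by side.
have K2 : 0 <= heat_kernel (2 * u) y z by side.
have half0 : 0 < (2 * u / (4 * u)) by side.
have p2 : 2 `^ (n%:R / 2) * (2 * u / (4 * u)) `^ (n%:R / 2) = 1 :> R.
 rewrite -powRM ?(ltW half0)//.
 have -> : 2 * (2 * u / (4 * u)) = 1 by field; rewrite gt_eqF.
 by rewrite powR1.
have -> : heat_kernel (2 * u) y z = 2 `^ (n%:R / 2) * (heat_kernel (4 * u) y z *
  expR (- (sqd y z * ((4 * (2 * u))^-1 - (4 * (4 * u))^-1)))).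
 by rewrite d mulrA p2 mul1r.
rewrite /k [leRHS](_ : _ = 2 `^ (n%:R / 2) * (heat_kernel (4 * u) y z * (16 * u / r ^+ 2) `^ e) * M); last by ring.
apply: ler_pM; [|exact: normr_ge0| |exact: hM].
 side.
rewrite ler_wpM2l ?powR_ge0// ler_wpM2l//.
pose v := r ^+ 2 / (16 * u).
have v0 : 0 < v by rewrite divr_gt0// mulr_gt0.
have -> : (16 * u / r ^+ 2) `^ e = v `^ (- e).
 rewrite -[- e]mulN1r (powRrM v (-1) e) (powR_inv1 (ltW v0)); congr (_ `^ _).
 by rewrite /v invf_div.
apply: le_trans (expR_le_powR_neg v0 e0 e1).
rewrite ler_expR lerN2 /v.
have -> : (4 * (2 * u))^-1 - (4 * (4 * u))^-1 = (16 * u)^-1 by field; rewrite gt_eqF.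
by apply: ler_wpM2r => //; rewrite invr_ge0 mulr_ge0 ?ltW.
Qed.

(** [frac_deriv] is 0 by default when its integral does not exist, so integrability for [g] has to
    be proved. For [f] it is given with its value [v]; for [f - g], which vanishes near [y], the
    tail bound provides it. Subtracting yields the integral for [g] and the estimate. *)
Lemma frac_deriv_cutoff : exists2 C : R, 0 < C & forall f g M r y s v,
 0 < r -> 0 < s -> 0 <= M -> heat_L1 f -> heat_L1 g ->
 (forall z, `|f z - g z| <= M) -> (forall z, sqd y z < r ^+ 2 -> f z = g z) ->
 is_bochner_integral lebesgue_measure `]s, +oo[
  (fun u : R => (u - s) `^ (b - 1) *: derive1n m (fun u => heat u f y) u) v ->
 `|s `^ alpha *: ((Gamma b)^-1 *: v) -
  s `^ alpha *: frac_deriv alpha (fun u => heat u g y) s| <= C * M * (s / r ^+ 2) `^ e.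
have [e0 e1 ea] := cutoff_orderP; have [b0 b1] := frac_order a0.
have [C1 C10 h1] := heat_int_tail.
have [C2 C20 h2] := dheat_norm_le B n m.
have bd : b < m%:R - e by rewrite ltrD2l ltrN2.
have [C3 C30 h3] := integral_beta b0 b1 bd.
pose G := `|(Gamma b)^-1|.
have G0 : 0 <= G by exact: normr_ge0.
exists (G * (C2 * C1 * C3) + 1); first side.
move=> f g M r y s v r0 s0 M0 hf hg fgM fgr fv.
have mD : measurable (`]s, +oo[%classic : set (measurableTypeR R)) by side.
pose h z := f z - g z.
have hh : heat_L1 h by apply: heat_L1D => //; exact: heat_L1N.
have mh := heat_L1_meas hh.
have hr z : sqd y z < r ^+ 2 -> h z = 0 by move=> /fgr e'; rewrite /h e' subrr.
have r20 : 0 < r ^+ 2 by side.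
have dhE u : 0 < u -> dheat m u h y = dheat m u f y - dheat m u g y.
 move=> u0; have := dheat_lin m (-1) y u0 hg hf.
 rewrite scaleN1r addrC => <-; congr dheat; apply/funext => z.
 by rewrite scaleN1r addrC.
pose H u := (u - s) `^ (b - 1) *: dheat m u h y.
pose k := C2 * C1 * M * (r ^+ 2) `^ (- e).
have k0 : 0 <= k by exact: (mulr_ge0 (mulr_ge0 (mulr_ge0 (ltW C20) (ltW C10)) M0) (powR_ge0 _ _)).
have Hle u : s < u -> `|H u| <= k * ((u - s) `^ (b - 1) * u `^ (- (m%:R - e))).
 move=> su; have u0 : 0 < u by exact: lt_trans su.
 rewrite /H normrZ (ger0_norm (powR_ge0 _ _)) mulrCA ler_wpM2l ?powR_ge0// -lee_fin.
 apply: le_trans (h2 u h y u0 hh) _.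
 have w0 : (0 <= (C2 * u ^- m)%:E)%E by side.
 apply: le_trans (lee_wpmul2l w0 (h1 h M r y u r0 u0 M0 mh fgM hr)) _.
 rewrite -EFinM lee_fin (powRM _ (ltW u0)) ?invr_ge0 ?(ltW r20)//.
 rewrite -(powR_inv1 (ltW r20)) -powRrM mulN1r opprB powRD; last by rewrite (gt_eqF u0) implybT.
 rewrite (powRN u m%:R) (powR_mulrn _ (ltW u0)) /k.
 by rewrite le_eqVlt; apply/orP; left; apply/eqP; ring.
have int_le : (\int[lebesgue_measure]_(u in `]s, +oo[) (`|H u|)%:E <=
  (k * (C3 * s `^ (b - (m%:R - e))))%:E)%E.
 apply: (@le_trans _ _ (\int[lebesgue_measure]_(u in `]s, +oo[) (k%:E * ((u - s) `^ (b - 1) * u `^ (- (m%:R - e)))%:E))%E).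
  apply: le_integralW => // u; rewrite /= in_itv /= andbT => su.
  by rewrite -EFinM lee_fin; exact: Hle.
 rewrite ge0_integralZl//.
 - by rewrite [leRHS]EFinM; apply: (lee_wpmul2l _ (h3 s s0)); rewrite lee_fin.
 - apply/measurable_EFinP/measurable_funTS; apply: measurable_funM.
   side.
  side.
 - side.
have sH : strongly_measurable (@lebesgue_measure R) `]s, +oo[ H.
 apply: continuous_strongly_measurable => u; rewrite /= in_itv /= andbT => su.
 have u0 : 0 < u by exact: lt_trans su.
 apply: cvgZ; last exact: dheat_continuous.
 have us0 : 0 < u - s by side.
 have c1 : {for u - s, continuous (@powR R ^~ (b - 1))}.
  apply: differentiable_continuous; apply/derivable1_diffP.
  exact: (@ex_derive _ _ _ _ _ _ _ (is_derive1_powR (b - 1) us0)).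
 apply: (@cvg_comp _ _ _ (fun u : R => u - s) (@powR R ^~ (b - 1)) _ _ _ _ c1).
 by apply: cvgB; [exact: cvg_id|exact: cvg_cst].
have HB := bochner_integralP mD sH (le_lt_trans int_le (ltry _)).
set w := bochner_integral _ _ _ in HB.
have gv : is_bochner_integral lebesgue_measure `]s, +oo[
  (fun u : R => (u - s) `^ (b - 1) *: derive1n m (fun u => heat u g y) u) (v - w).
 have := is_bochner_lin mD (-1) HB fv; rewrite scaleN1r [- w + v]addrC => hb.
 apply: (is_bochner_ae mD _ hb); apply: aeW => u su.
 have {}su : s < u by move: su; rewrite /= in_itv /= andbT.
 have u0 : 0 < u by exact: lt_trans su.
 rewrite !derive1n_heat// /H dhE// scaleN1r -scalerN -scalerDr; congr (_ *: _).
 by rewrite opprB subrK.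
rewrite /frac_deriv (bochner_integral_eq mD gv) -2!scalerBr (subKr v w).
rewrite !normrZ (ger0_norm (powR_ge0 _ _)) -/G.
have wle : `|w| <= k * (C3 * s `^ (b - (m%:R - e))).
 by rewrite -lee_fin; apply: le_trans int_le; exact: bochner_norm_le.
apply: (@le_trans _ _ (s `^ alpha * (G * (k * (C3 * s `^ (b - (m%:R - e))))))).
 by rewrite ler_wpM2l ?powR_ge0// ler_wpM2l.
rewrite [leLHS](_ : _ = G * (C2 * C1 * C3) * (M * (s / r ^+ 2) `^ e)).
 rewrite -[leRHS]mulrA; apply: ler_wpM2r; first side.
 by rewrite lerDl.
rewrite /k (powRM _ (ltW s0)) ?invr_ge0 ?(ltW r20)//.
rewrite -(powR_inv1 (ltW r20)) -powRrM mulN1r.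
have -> : s `^ e = s `^ alpha * s `^ (b - (m%:R - e)).
 by rewrite -powRD ?(gt_eqF s0) ?implybT//; congr (_ `^ _); ring.
by ring.
Qed.

End cutoff.

(** * Boxes and their measure *)

Section boxes.
Context (R : realType).
Local Notation mu n := (lebesgue_Rn R n).

Definition box n (A : 'I_n -> set R) : set (Rn R n) := [set y | forall i, A i (tnth y i)].

Lemma meas_box n (A : 'I_n -> set R) : (forall i, measurable (A i)) -> measurable (box A).
move=> mA; have -> : box A = \bigcap_(i in [set: 'I_n]) ((fun y : Rn R n => tnth y i) @^-1` A i).
 by apply/seteqP; split => y h i; [move=> _; exact: h|exact: h].
apply: fin_bigcap_measurable; first side.
move=> i _; rewrite -[X in measurable X]setTI; exact: (measurable_tnth i measurableT (mA i)).
Qed.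

Lemma lebesgue_Rn_box n (A : 'I_n -> set R) : (forall i, measurable (A i)) ->
 mu n (box A) = (\prod_(i < n) lebesgue_measure (A i))%E.
elim: n A => [|n ih] A mA.
 rewrite big_ord0 /= diracE mem_set//; by case.
rewrite big_ord_recl -ih; last side.
rewrite -product_measure1E; [|exact: mA|by apply: meas_box => i; exact: mA].
rewrite -[LHS]/((lebesgue_measure \x mu n)%E (@rn_cons R n @^-1` box A)).
congr (_ _); apply/seteqP; split => -[a v] /=.
 move=> h; split; first side.
 by move=> i; have := h (lift ord0 i); rewrite tnthS.
by move=> [ha hv] i; case: (unliftP ord0 i) => [j ->|->//]; rewrite tnthS.
Qed.

Lemma lebesgue_itv_le (a b : R) : a <= b -> lebesgue_measure (`[a, b]%classic : set R) = (b - a)%:E.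
rewrite le_eqVlt => /predU1P[->|ab].
 by rewrite subrr lebesgue_measure_itv /= ltxx.
by rewrite lebesgue_measure_itv /= lte_fin ab EFinB.
Qed.

Lemma lebesgue_itv_center (a w : R) : 0 <= w ->
 lebesgue_measure (`[a - w, a + w]%classic : set R) = (2 * w)%:E.
by move=> w0; rewrite lebesgue_itv_le; [congr EFin; ring|lra]. Qed.

Definition translates (N : nat) (E : set R) : set R := \big[setU/set0]_(k < N) ((fun a => a - k%:R) @^-1` E).

Lemma meas_translate (k : R) (E : set R) : measurable E -> measurable ((fun a => a - k) @^-1` E).
move=> mE; rewrite -[X in measurable X]setTI.
have h : measurable_fun setT (fun a : R => a - k) by side.
exact: (h measurableT _ mE).
Qed.

Lemma meas_translates N (E : set R) : measurable E -> measurable (translates N E).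
by move=> mE; apply: bigsetU_measurable => k _; exact: meas_translate. Qed.

Lemma translatesP N E a : translates N E a -> exists2 k, (k < N)%N & E (a - k%:R).
by rewrite /translates -(bigcup_mkord N (fun k : nat => (fun a => a - k%:R) @^-1` E)) => -[k kN Ek]; exists k.
Qed.

Lemma lebesgue_translates N (E : set R) : measurable E -> E `<=` `[0, 1[%classic ->
 lebesgue_measure (translates N E) = (N%:R%:E * lebesgue_measure E)%E.
move=> mE E1; rewrite /translates measure_bigsetU_ord/=; last 2 first.
- by move=> k; exact: meas_translate.
- move=> i j _ _ [a [/E1 /= ai /E1 /= aj]]; apply/val_inj/eqP => /=.
 have h (k l : 'I_N) : a - k%:R < 1 -> 0 <= a - l%:R -> (l <= k)%N.
  by move=> h1 h2; rewrite -ltnS -(ltr_nat R) -natr1; lra.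
 move: ai aj; rewrite !in_itv /= => /andP[? ?] /andP[? ?].
 by rewrite eqn_leq !h.
rewrite (eq_bigr (fun=> lebesgue_measure E)); last first.
 move=> k _; have := lebesgue_measure_affine (- k%:R) ltr01 mE.
 by rewrite invr1 mul1e; under eq_fun do rewrite mul1r.
by rewrite sumr_const card_ord mule_natl.
Qed.

End boxes.

(** * Lower bounds by disjoint sets *)

Section disjoint_lower_bound.
Context d (T : measurableType d) (R : realType) (mu : {measure set T -> \bar R}).

Lemma integral_ge_disjoint (I : eqType) (ts : seq I) (W : I -> set T) (v : I -> R) (D : set T) (J : T -> \bar R) :
 measurable D -> uniq ts ->
 (forall i, i \in ts -> [/\ measurable (W i), W i `<=` D & 0 <= v i]) ->
 (forall i j z, i \in ts -> j \in ts -> W i z -> W j z -> i = j) ->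
 (forall z, D z -> (0 <= J z)%E) ->
 (forall i z, i \in ts -> W i z -> ((v i)%:E <= J z)%E) ->
 (\sum_(i <- ts) (v i)%:E * mu (W i) <= \int[mu]_(z in D) J z)%E.
move=> mD uts hW dW J0 JW.
pose F i z : \bar R := (v i * \1_(W i) z)%:E.
have mW i : i \in ts -> measurable (W i) by move=> /hW[].
have v0 i : i \in ts -> 0 <= v i by move=> /hW[].
have -> : (\sum_(i <- ts) (v i)%:E * mu (W i) = \sum_(i <- ts) \int[mu]_(z in D) F i z)%E.
 apply: eq_big_seq => i its; rewrite /F.
 under eq_integral do rewrite EFinM.
 rewrite ge0_integralZl//; last 2 first.
 - by apply/measurable_EFinP/measurable_funTS/measurable_indic; exact: mW.
 - by rewrite lee_fin v0.
 rewrite integral_indic//; last exact: mW.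
 by congr (_ * mu _)%E; apply/esym/setIidPl; case: (hW i its).
have F0 i z : i \in ts -> (0 <= F i z)%E by move=> its; rewrite lee_fin mulr_ge0// v0.
have -> : (\sum_(i <- ts) \int[mu]_(z in D) F i z = \int[mu]_(z in D) \sum_(i <- ts) F i z)%E.
 have mF i : i \in ts -> measurable_fun D (F i).
  move=> its; apply/measurable_EFinP; apply: measurable_funM => //.
  by apply/measurable_funTS/measurable_indic; exact: mW.
 suff : forall s, {subset s <= ts} -> measurable_fun D (fun z => \sum_(i <- s) F i z)%E /\
   (\sum_(i <- s) \int[mu]_(z in D) F i z = \int[mu]_(z in D) \sum_(i <- s) F i z)%E.
  by move=> /(_ ts (fun _ h => h))[].
 elim=> [_|i s ih sts].
  split; first by under eq_fun do rewrite big_nil; exact: measurable_cst.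
  by rewrite big_nil; under eq_integral do rewrite big_nil; rewrite integral0.
 have its : i \in ts by apply: sts; rewrite mem_head.
 have sts' : {subset s <= ts} by move=> j js; apply: sts; rewrite inE js orbT.
 have [mS eS] := ih sts'.
 split; first by under eq_fun do rewrite big_cons; apply: emeasurable_funD => //; exact: mF.
 rewrite big_cons eS; under [RHS]eq_integral do rewrite big_cons.
 rewrite ge0_integralD//.
 - by move=> z _; exact: F0.
 - exact: mF.
 - by move=> z _; rewrite big_seq; apply: sume_ge0 => j js; apply: F0; exact: sts'.
apply: le_integralW => // z Dz.
 by rewrite big_seq; apply: sume_ge0 => j jts; exact: F0.
have [[i its Wi]|hn] := pselect (exists2 i, i \in ts & W i z).
 rewrite (bigD1_seq i)//= big1_seq ?adde0.
  by rewrite /F indicE mem_set// mulr1; exact: JW.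
 move=> j /andP[ji jts]; rewrite /F indicE memNset ?mulr0// => Wj.
 by move: ji; rewrite (dW _ _ _ jts its Wj Wi) eqxx.
rewrite big1_seq; first exact: J0.
move=> j /andP[_ jts]; rewrite /F indicE memNset ?mulr0// => Wj.
by apply: hn; exists j.
Qed.

End disjoint_lower_bound.

(** * Area integrals of truncated trigonometric polynomials *)

Section trigonometric_polynomials.
Context (R : realType) (B : completeNormedModType R) (c alpha : R).
Hypotheses (c0 : 0 < c) (a0 : 0 < alpha) (cE : forall a : R, 0 < a -> gauss_cos a = expR (- (c * a ^+ 2))).
Implicit Types (l : seq (nat * R * B)) (a t r : R).

(** A triple [(k, ph, v)] stands for the vector [v] times the cosine of frequency [k] and phase
    [ph]; the period is 1. *)
Definition tpoly l a : B := \sum_(z <- l) cos (2 * pi * z.1.1%:R * a + z.1.2) *: z.2.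

(** [lambda ^ alpha * exp (- lambda)] with [lambda = c (2 pi r)^2]: up to sign, the factor by which
    the operator in the area integral, at height [t], multiplies a mode of frequency [k], with
    [r = k t]. *)
Definition profile r : R := (c * (2 * pi * r) ^+ 2) `^ alpha * expR (- (c * (2 * pi * r) ^+ 2)).

(** Up to sign, the vector inside the norm in the area integral, at height [t] and first coordinate
    [a] ([frac_deriv_tfun]). *)
Definition wave l a t : B :=
 \sum_(z <- l) (profile (z.1.1%:R * t) * cos (2 * pi * z.1.1%:R * a + z.1.2)) *: z.2.

Definition pos_freq l := all (fun z : nat * R * B => (0 < z.1.1)%N) l.

Variable n : nat.
Local Notation T := (Rn R n.+1).
Local Notation m := (Num.truncn alpha).+1.
Local Opaque heat.

Definition tfun x0 l (x : T) : B := x0 + tpoly l (tnth x ord0).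

Lemma tpoly_integrable l : smeas (fun x : T => tpoly l (tnth x ord0)) /\
 heat_L1 (fun x : T => tpoly l (tnth x ord0)).
elim: l => [|z l [ih1 ih2]].
 have -> : (fun x : T => tpoly [::] (tnth x ord0)) = (fun=> 0 : B).
  by apply/funext => x; rewrite /tpoly big_nil.
 by split; [exact: smeas_cst|exact: heat_L1_cst].
have -> : (fun x : T => tpoly (z :: l) (tnth x ord0)) =
  (fun x => mode (2 * pi * z.1.1%:R) z.1.2 x *: z.2 + tpoly l (tnth x ord0)).
 by apply/funext => x; rewrite /tpoly big_cons.
split; first by apply: smeasD => //; exact: smeas_mode.
by apply: heat_L1D => //; exact: heat_L1_mode.
Qed.

Definition rates l a : seq (R * B) :=
 [seq (c * (2 * pi * z.1.1%:R) ^+ 2, cos (2 * pi * z.1.1%:R * a + z.1.2) *: z.2) | z <- l].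

Lemma heat_tfun x0 l (x : T) u : pos_freq l -> 0 < u ->
 heat u (tfun x0 l) x = x0 + exp_sum (rates l (tnth x ord0)) u.
move=> hl u0; rewrite (heatD x u0 (heat_L1_cst _ x0) (tpoly_integrable l).2) heat_cst//.
congr (_ + _); elim: l hl => [_|z l ih /= /andP[z0 hl]].
 rewrite /exp_sum big_nil -[RHS](heat_cst (0 : B) x u0); congr heat.
 by apply/funext => y; rewrite /tpoly big_nil.
have -> : (fun y : T => tpoly (z :: l) (tnth y ord0)) =
  (fun y => mode (2 * pi * z.1.1%:R) z.1.2 y *: z.2 + tpoly l (tnth y ord0)).
 by apply/funext => y; rewrite /tpoly big_cons.
rewrite (heatD x u0 (heat_L1_mode n _ _ z.2) (tpoly_integrable l).2) ih//.
rewrite /exp_sum /= big_cons; congr (_ + _); rewrite heat_mode//= scalerA; congr (_ *: _).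
rewrite cE; last by rewrite !mulr_gt0 ?sqrtr_gt0 ?pi_gt0// ltr0n.
by rewrite exprMn sqr_sqrtr ?(ltW u0)// mulrA.
Qed.

Lemma frac_deriv_tfun x0 l (x : T) t : pos_freq l -> 0 < t -> exists v : B,
 is_bochner_integral lebesgue_measure `]t ^+ 2, +oo[
  (fun u : R => (u - t ^+ 2) `^ (m%:R - alpha - 1) *: derive1n m (fun u => heat u (tfun x0 l) x) u) v /\
 `|(t ^+ 2) `^ alpha *: ((Gamma (m%:R - alpha))^-1 *: v)| = `|wave l (tnth x ord0) t|.
move=> hl t0; have t20 : 0 < t ^+ 2 by exact: exprn_gt0.
have hr : pos_rates (rates l (tnth x ord0)).
 rewrite /pos_rates all_map; apply: sub_all hl => z /= z0.
 by rewrite mulr_gt0// exprn_gt0// !mulr_gt0 ?pi_gt0// ltr0n.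
have [b0 b1] := frac_order a0; have [G0 _] := Gamma_fin b0 b1.
eexists; split; first exact: (frac_deriv_exp_sum a0 hr t20 (fun u u0 => heat_tfun x0 x hl u0)).
rewrite [_^-1 *: _]scalerA mulVf ?gt_eqF// scale1r scalerA mulrC -scalerA normrZ normrX normrN1 expr1n mul1r.
congr `|_|; rewrite exp_sum_scale /wave /rates big_map scaler_sumr.
apply: eq_bigr => z _; rewrite /= !scalerA; congr (_ *: _); rewrite /profile.
have -> : c * (2 * pi * (z.1.1%:R * t)) ^+ 2 = c * (2 * pi * z.1.1%:R) ^+ 2 * t ^+ 2 by ring.
rewrite (@powRM _ _ (t ^+ 2)) ?(ltW t20)//; last side.
by ring.
Qed.

Lemma sqd_lt_coord (y z : T) (r : R) (i : 'I_n.+1) : 0 <= r ->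
 r <= `|tnth y i - tnth z i| -> r ^+ 2 <= sqd y z.
move=> r0 h; rewrite /sqd (bigD1 i)//= -[leLHS]addr0; apply: lerD.
 by rewrite -[leRHS]real_normK ?num_real// lerXn2r ?nnegrE.
by apply: sumr_ge0 => j _; exact: sqr_ge0.
Qed.

Definition cube (r : R) : set T := box (fun=> `[- r, r]%classic).

Lemma cubeP r y : cube r y <-> forall i, `|tnth y i| <= r.
by split => h i; have := h i; rewrite /= in_itv /= -ler_norml. Qed.

Lemma meas_cube r : measurable (cube r).
by apply: meas_box => i; exact: measurable_itv. Qed.

Lemma cube_measure r : 0 <= r -> lebesgue_Rn R n.+1 (cube r) = ((2 * r) ^+ n.+1)%:E.
move=> r0; rewrite lebesgue_Rn_box; last side.
rewrite (eq_bigr (fun=> (2 * r)%:E)); last first.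
 move=> i _; rewrite lebesgue_itv_le; last by lra.
 by congr EFin; ring.
by rewrite prodEFin prodr_const card_ord.
Qed.

Definition truncate (r : R) (f : T -> B) (y : T) : B := if y \in cube r then f y else 0.

Lemma truncate_smeas r (f : T -> B) : smeas f -> smeas (truncate r f).
move=> mf; have -> : truncate r f = (fun y => (\1_(cube r) y : R) *: f y).
 apply/funext => y; rewrite /truncate indicE; case: ifP => _; [by rewrite scale1r|by rewrite scale0r].
apply: smeasZ => //; apply: meas_smeas; exact: measurable_indic (meas_cube r).
Qed.

(* On the cube of half the size, truncation changes the fractional derivative by an amount
  which vanishes as the size of the cube increases. *)
Lemma truncate_wave : exists2 C : R, 0 < C & forall x0 l (r t : R) (y : T),
 pos_freq l -> (forall z : T, `|tfun x0 l z| <= 1) -> 0 < r -> 0 < t -> cube (2 * r) y ->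
 `|wave l (tnth y ord0) t| <=
 `|(t ^+ 2) `^ alpha *: frac_deriv alpha (fun u => heat u (truncate (3 * r) (tfun x0 l)) y) (t ^+ 2)|
  + C * (t ^+ 2 / r ^+ 2) `^ (cutoff_order alpha).
have [C C0 hC] := frac_deriv_cutoff B n.+1 a0; exists C => // x0 l r t y hl f1 r0 t0 hy.
have t20 : 0 < t ^+ 2 by side.
have [mf hf] : smeas (tfun x0 l) /\ heat_L1 (tfun x0 l : T -> B).
 have [h1 h2] := tpoly_integrable l; split; first by apply: smeasD => //; exact: smeas_cst.
 by apply: heat_L1D => //; exact: heat_L1_cst.
have hg : heat_L1 (truncate (3 * r) (tfun x0 l)).
 apply: (@bounded_heat_L1 _ _ _ _ 1); first exact: truncate_smeas.
 by move=> z; rewrite /truncate; case: ifP => _ //; rewrite normr0.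
have [v [hv <-]] := frac_deriv_tfun x0 y hl t0.
have := hC (tfun x0 l) (truncate (3 * r) (tfun x0 l)) 1 r y (t ^+ 2) v r0 t20 ler01 hf hg.
rewrite (mulr1 C) => h; rewrite -lerBlDl; apply: (le_trans (lerB_dist _ _)); apply: h => //.
 move=> z; rewrite /truncate; case: ifP => _; last by rewrite subr0.
 by rewrite subrr normr0.
move=> z hz; rewrite /truncate mem_set//; apply/cubeP => i; rewrite leNgt; apply/negP => hi.
move: hz; apply/negP; rewrite -leNgt; apply: (@sqd_lt_coord _ _ _ i); first exact: ltW.
have := (cubeP (2 * r) y).1 hy i; move: hi.
have := ler_normB (tnth y i) (tnth y i - tnth z i); rewrite subKr.
by lra.
Qed.

Lemma cos_period (x : R) (k : nat) : cos (x + 2 * pi * k%:R) = cos x.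
elim: k => [|k ih]; first by rewrite mulr0 addr0.
have -> : x + 2 * pi * k.+1%:R = x + 2 * pi * k%:R + pi + pi by rewrite -natr1; ring.
by rewrite cosDpi cosDpi opprK.
Qed.

Lemma wave_period l a t (k : nat) : wave l (a + k%:R) t = wave l a t.
apply: eq_bigr => z _; congr ((_ * _) *: _); rewrite -[RHS](cos_period _ (z.1.1 * k)).
by congr cos; rewrite natrM; ring.
Qed.

Variables (kappa q p : R).
Hypotheses (k0 : 0 < kappa) (k1 : kappa <= 2^-1) (q0 : 0 < q) (p0 : 0 < p).

(** With [kappa <= 1/2], successive heights in ratio above 2 make the windows between [s] and
    [(1 + kappa) * s] disjoint. *)
Definition separated (ts : seq R) : Prop := [/\ uniq ts, forall t, t \in ts -> 0 < t &
 forall s t, s \in ts -> t \in ts -> s < t -> 2 * s < t].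

(* The boxes may be shifted inside the cone. *)
Definition detects l (ts : seq R) (h o : R -> R) (a : R) : Prop := forall s, s \in ts ->
 [/\ 0 <= h s, `|o s| <= 2^-1 & forall a' t, `|a' - (a + o s * s)| <= kappa * s ->
  s <= t <= (1 + kappa) * s -> h s <= `|wave l a' t|].

Lemma powR_split (h g e : R) : 0 <= h -> 0 <= g -> 0 <= e -> h <= g + e ->
 h `^ q <= 2 `^ q * (g `^ q + e `^ q).
move=> h0 g0 e0 hge.
have key (z : R) : 0 <= z -> h <= 2 * z -> h `^ q <= 2 `^ q * z `^ q.
 move=> z0 hz; rewrite -powRM//; apply: ge0_ler_powR; rewrite ?nnegrE ?(ltW q0)//.
 side.
have [eg|eg] := leP e g.
 apply: (le_trans (key g g0 _)); first by lra.
 by rewrite ler_wpM2l ?powR_ge0// lerDl powR_ge0.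
apply: (le_trans (key e e0 _)); first by lra.
by rewrite ler_wpM2l ?powR_ge0// lerDr powR_ge0.
Qed.

Local Notation mu := (lebesgue_Rn R n.+1).

Definition window_center (o : R) (x : T) (s : R) (i : 'I_n.+1) : R :=
 tnth x i + (if i == ord0 then o * s else 0).

Definition window_base (o : R) (x : T) (s : R) : set T :=
 box (fun i => `[window_center o x s i - kappa * s / n.+2%:R,
         window_center o x s i + kappa * s / n.+2%:R]%classic).

(* Product subsets of the cone with vertex [x], at height between [s] and [(1 + kappa) s]. *)
Definition window (o : R) (x : T) (s : R) : set (T * measurableTypeR R) :=
 window_base o x s `*` (`[s, (1 + kappa) * s]%classic : set (measurableTypeR R)).

Definition window_volume : R := kappa * (2 * kappa / n.+2%:R) ^+ n.+1.

Lemma window_volume_gt0 : 0 < window_volume.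
by rewrite mulr_gt0// exprn_gt0// divr_gt0// mulr_gt0. Qed.

Lemma meas_window o x s : measurable (window o x s).
by apply: measurableX; [apply: meas_box => i|]; exact: measurable_itv. Qed.

Lemma window_measure o x s : 0 < s ->
 ((mu \x lebesgue_measure) (window o x s) = (window_volume * s ^+ n.+2)%:E)%E.
move=> s0; transitivity (mu (window_base o x s) * lebesgue_measure (`[s, ((1 + kappa) * s)%R]%classic : set R))%E.
 apply: product_measure1E; last side.
 by apply: meas_box => i; exact: measurable_itv.
have ks : 0 < kappa * s by side.
have w0 : 0 < kappa * s / n.+2%:R by side.
rewrite lebesgue_Rn_box; last side.
rewrite (eq_bigr (fun=> (2 * kappa / n.+2%:R * s)%:E)); last first.
 by move=> i _; rewrite lebesgue_itv_center ?(ltW w0)//; congr EFin; ring.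
rewrite lebesgue_itv_le; last by lra.
rewrite prodEFin prodr_const card_ord -EFinM; congr EFin.
by rewrite /window_volume exprMn [s ^+ n.+2]exprS; ring.
Qed.

Lemma window_top (s : R) : 0 < s -> (1 + kappa) * s <= 2 * s.
by move=> s0; apply: ler_wpM2r; [exact: ltW|have := k1; lra]. Qed.

Lemma shifted_dist (y0 x0 v w k s : R) : `|y0 - (x0 + v)| <= w -> `|v| <= s / 2 ->
 w <= k / 2 -> k <= s / 2 -> `|y0 - x0| <= 3 / 4 * s.
move=> h1 h2 h3 h4; have := ler_normD (y0 - (x0 + v)) v.
have -> : y0 - (x0 + v) + v = y0 - x0 by ring.
by move=> h; apply: (le_trans h); lra.
Qed.

(** The offset moves the first coordinate by at most [s / 2], and the half-width
    [kappa * s / (n + 2)] is at most [s / 4]. The squared distance to [x] is then at most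
    [9/16 + 1/8 = 11/16] of [s ^ 2], inside the cone. *)
Lemma window_near o x s y t : 0 < s -> `|o| <= 2^-1 -> window o x s (y, t) ->
 [/\ s <= t <= (1 + kappa) * s, `|tnth y ord0 - (tnth x ord0 + o * s)| <= kappa * s,
  forall i, `|tnth y i - tnth x i| <= s & cone x (y, t)].
move=> s0 o1 [/= hy]; rewrite in_itv /= => ht.
pose w := kappa * s / n.+2%:R.
have ks : 0 < kappa * s by side.
have ks2 : kappa * s <= s / 2 by rewrite mulrC ler_pM2l.
have N2 : 2 <= n.+2%:R :> R by rewrite (ler_nat R 2).
have N0 : 0 < n.+2%:R :> R by side.
have w0 : 0 <= w by rewrite divr_ge0// ltW.
have wks : w <= kappa * s / 2 by rewrite /w ler_pM2l// lef_pV2 ?posrE.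
have wN : w * n.+2%:R = kappa * s by rewrite /w divfK// gt_eqF.
have hi i : `|tnth y i - window_center o x s i| <= w.
 by have := hy i; rewrite /= in_itv /= ler_distl.
have h0 : `|tnth y ord0 - (tnth x ord0 + o * s)| <= w by side.
have hj i : i != ord0 -> `|tnth y i - tnth x i| <= w.
 by move=> i0; have := hi i; rewrite /window_center (negbTE i0) addr0.
have os : `|o * s| <= s / 2 by rewrite normrM (gtr0_norm s0) mulrC ler_pM2l.
have h0' : `|tnth y ord0 - tnth x ord0| <= 3 / 4 * s.
 exact: shifted_dist h0 os wks ks2.
have st : s <= t by case/andP: ht.
have t0 : 0 < t by exact: lt_le_trans st.
split => //.
- by apply: (le_trans h0); lra.
- move=> i; have [->|i0] := eqVneq i ord0; first by apply: (le_trans h0'); lra.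
 by apply: (le_trans (hj i i0)); lra.
split => //=; rewrite -(ltr_pXn2r (n := 2))// ?nnegrE ?sqrtr_ge0 ?(ltW t0)// eucl_dist_sqr.
have st2 : s ^+ 2 <= t ^+ 2 by rewrite lerXn2r ?nnegrE ?(ltW s0) ?(ltW t0).
apply: lt_le_trans st2; rewrite /sqd big_ord_recl /=.
have a1 : ((tnth x ord0 : R) - tnth y ord0) ^+ 2 <= (3 / 4 * s) ^+ 2.
 rewrite -[leLHS]real_normK ?num_real// lerXn2r ?nnegrE// ?mulr_ge0 ?(ltW s0)//.
 by rewrite distrC.
have a2 : \sum_(i < n) ((tnth x (lift ord0 i) : R) - tnth y (lift ord0 i)) ^+ 2 <= n%:R * w ^+ 2.
 apply: (@le_trans _ _ (\sum_(i < n) w ^+ 2)); last by rewrite sumr_const card_ord mulr_natl.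
 apply: ler_sum => i _; rewrite -[leLHS]real_normK ?num_real// lerXn2r ?nnegrE//.
 by rewrite distrC; exact: hj.
have a3 : n%:R * w ^+ 2 <= (w * n.+2%:R) * (kappa * s / 2).
 rewrite expr2 mulrA [n%:R * w]mulrC; apply: ler_pM; [exact: (mulr_ge0 w0 (ler0n _ n))|exact: w0| |exact: wks].
 by apply: (ler_wpM2l w0); rewrite ler_nat -addn2 leq_addr.
have a4 : (w * n.+2%:R) * (kappa * s / 2) <= s / 2 * (s / 4).
 by rewrite wN; apply: ler_pM => //; [exact: ltW|rewrite divr_ge0// ltW|lra].
apply: (le_lt_trans (lerD a1 (le_trans a2 (le_trans a3 a4)))).
have s20 : 0 < s ^+ 2 by side.
have -> : (3 / 4 * s) ^+ 2 + s / 2 * (s / 4) = 11 / 16 * s ^+ 2 by field.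
by lra.
Qed.

Definition area_density (g : T -> B) (yt : T * measurableTypeR R) : R :=
 `|((yt.2 : R) ^+ 2) `^ alpha *: frac_deriv alpha (fun u => heat u g yt.1) ((yt.2 : R) ^+ 2)| `^ q
    / (yt.2 : R) ^+ n.+2.

(** The windows are disjoint and their measure is a multiple of [s ^ (n + 2)], which cancels the
    weight of the cone. The error [e] is that of the truncation; by hypothesis all errors together
    cost at most half of the sum. *)
Lemma area_int_ge (g : T -> B) (x : T) (ts : seq R) (h o : R -> R) (e A : R) :
 separated ts -> 0 <= e -> A < \sum_(s <- ts) h s `^ q ->
 (size ts)%:R * e `^ q <= 2 `^ (- q) * A / 2 ->
 (forall s, s \in ts -> `|o s| <= 2^-1) ->
 (forall s yt, s \in ts -> window (o s) x s yt ->
  h s <= `|((yt.2 : R) ^+ 2) `^ alpha *: frac_deriv alpha (fun u => heat u g yt.1) ((yt.2 : R) ^+ 2)| + e) ->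
 (forall s, s \in ts -> 0 <= h s) ->
 ((window_volume / 2 ^+ n.+2 * (2 `^ (- q) * A / 2))%:E <= area_int q alpha g x)%E.
move=> [uts ts0 sep] e0 hA he ho hh h0.
pose v s : R := Num.max 0 (2 `^ (- q) * h s `^ q - e `^ q) / (2 * s) ^+ n.+2.
have mW s : measurable (window (o s) x s) by exact: meas_window.
have s2n s : s \in ts -> 0 < (2 * s) ^+ n.+2.
 by move=> sts; rewrite exprn_gt0// mulr_gt0// ts0.
have J0 (z : T * measurableTypeR R) : cone x z -> (0 <= (area_density g z)%:E)%E.
 by case: z => y t [/= t0 _]; rewrite lee_fin divr_ge0 ?powR_ge0// exprn_ge0// ltW.
apply: (@le_trans _ _ (\sum_(s <- ts) (v s)%:E * (mu \x lebesgue_measure)%E (window (o s) x s))%E); last first.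
 apply: (@integral_ge_disjoint _ _ _ _ _ ts (fun s => window (o s) x s) v (cone x) (fun z => (area_density g z)%:E)) => //.
 - exact: meas_cone.
 - move=> s sts; split => //.
   by move=> [y t] hW; have [] := window_near (ts0 s sts) (ho s sts) hW.
  by rewrite divr_ge0 ?(ltW (s2n s sts))// le_max lexx.
 - move=> s s' [y t] sts sts' hW hW'.
  have [/andP[a1 a2] _ _ _] := window_near (ts0 s sts) (ho s sts) hW.
  have [/andP[b1 b2] _ _ _] := window_near (ts0 s' sts') (ho s' sts') hW'.
  have s0 := ts0 s sts; have s0' := ts0 s' sts'.
  have c1 := window_top s0; have c2 := window_top s0'.
  case: (ltgtP s s') => // ss.
   by have := sep s s' sts sts' ss; lra.
  by have := sep s' s sts' sts ss; lra.
 - move=> s [y t] sts hW; rewrite lee_fin /v /area_density.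
  have s0 := ts0 s sts.
  have [/andP[a1 a2] _ _ _] := window_near s0 (ho s sts) hW.
  have t0 : 0 < t by exact: lt_le_trans a1.
  apply: ler_pM; rewrite ?le_max ?lexx// ?invr_ge0 ?(ltW (s2n s sts))//.
   rewrite ge_max powR_ge0 /= lerBlDr.
   have := powR_split (h0 s sts) (normr_ge0 _) e0 (hh s (y, t) sts hW).
   by move=> hp; rewrite powRN mulrC ler_pdivrMr ?powR_gt0// mulrC.
  rewrite lef_pV2 ?posrE ?(s2n s sts) ?exprn_gt0//.
  rewrite lerXn2r// ?nnegrE ?mulr_ge0 ?(ltW s0) ?(ltW t0)//.
  exact: (le_trans a2 (window_top s0)).
rewrite (eq_big_seq (fun s => (window_volume / 2 ^+ n.+2 * Num.max 0 (2 `^ (- q) * h s `^ q - e `^ q))%:E)); last first.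
 move=> s sts; rewrite window_measure ?ts0// -EFinM; congr EFin; rewrite /v.
 have s0 := ts0 s sts; have sn : s ^+ n.+2 != 0 by rewrite expf_neq0// gt_eqF.
 rewrite exprMn; field; rewrite sn /=.
 side.
rewrite sumEFin lee_fin -mulr_sumr ler_wpM2l ?divr_ge0 ?(ltW window_volume_gt0) ?exprn_ge0//.
apply: (@le_trans _ _ (\sum_(s <- ts) (2 `^ (- q) * h s `^ q - e `^ q))); last first.
 by apply: ler_sum => s _; rewrite le_max lexx orbT.
rewrite sumrB -mulr_sumr big_const_seq count_predT iter_addr_0 -[_ *+ size ts]mulr_natl.
have := ler_wpM2l (powR_ge0 2 (- q)) (ltW hA); lra.
Qed.

Lemma natr_div_succ_le (x : R) (N : nat) : 0 <= x -> N%:R * (x / N.+1%:R) <= x.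
by move=> x0; rewrite mulrA ler_pdivrMr ?ltr0n// mulrC ler_wpM2l// ler_nat.
Qed.

Definition area_bounded (C : R) : Prop := forall f : T -> B, bochner_Lp p f ->
 ('N[mu]_p%:E [area_integral q alpha f] <= C%:E * bochner_norm p f)%E.

Lemma truncate_Lp x0 l (r : R) : 0 <= r -> (forall z : T, `|tfun x0 l z| <= 1) ->
 bochner_Lp p (truncate r (tfun x0 l)) /\
 (\int[mu]_x (`|truncate r (tfun x0 l) x| `^ p)%:E <= ((2 * r) ^+ n.+1)%:E)%E.
move=> r0 f1; have [h1 _] := tpoly_integrable l.
have mf : smeas (tfun x0 l : T -> B) by apply: smeasD => //; exact: smeas_cst.
have le : (\int[mu]_x (`|truncate r (tfun x0 l) x| `^ p)%:E <= ((2 * r) ^+ n.+1)%:E)%E.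
 rewrite -(cube_measure r0) -[cube r]setIT -integral_indic//; last exact: meas_cube.
 apply: le_integralW => // z _.
 rewrite lee_fin indicE /truncate; case: ifP => _; last by rewrite normr0 powR0 ?gt_eqF.
 have e1 : 1 `^ p = 1 :> R by rewrite powR1.
 by rewrite -[leRHS]e1; apply: ge0_ler_powR; rewrite ?nnegrE ?(ltW p0).
split => //; split; first by apply: smeas_strongly_measurable; exact: truncate_smeas.
by rewrite bochner_norm_root//; apply: poweR_lty; exact: le_lt_trans le (ltry _).
Qed.

Lemma tail_small (K x e d : R) : 0 < K -> 0 < e -> 0 < d -> exists N : nat, (0 < N)%N /\
 x <= N%:R /\ forall t, 0 <= t <= x -> K * (t ^+ 2 / N%:R ^+ 2) `^ e <= d.
move=> K0 e0 d0; pose y := `|x| / (d / K) `^ (2 * e)^-1.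
have dK : 0 < (d / K) `^ (2 * e)^-1 by side.
have [N hN] : exists N : nat, Num.max y `|x| < N%:R.
 exists (Num.truncn (Num.max y `|x|)).+1; exact: truncnS_gt.
move: hN; rewrite gt_max => /andP[yN xN].
have N0 : 0 < N%:R :> R by exact: le_lt_trans xN.
exists N; split; first by rewrite -(ltr_nat R).
split; first by apply: le_trans (ltW xN); exact: ler_norm.
move=> t /andP[t0 tx].
have tN : t / N%:R <= (d / K) `^ (2 * e)^-1.
 rewrite ler_pdivrMr// mulrC -ler_pdivrMr//; apply: le_trans (ltW yN).
 rewrite /y ler_pM2r ?invr_gt0//; exact: le_trans (ler_norm _).
rewrite mulrC -ler_pdivlMr// -expr_div_n.
have z0 : 0 <= t / N%:R by side.
rewrite -powR_mulrn// -powRrM.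
apply: (@le_trans _ _ (((d / K) `^ (2 * e)^-1) `^ (2 * e))).
 by apply: ge0_ler_powR; rewrite ?nnegrE ?powR_ge0// mulr_ge0// ltW.
by rewrite -powRrM mulVf ?powRr1 ?gt_eqF ?mulr_gt0// ltW// divr_gt0.
Qed.

(** A weak-type consequence of (b) with no trace of the truncation: if [|x0 + f| <= 1] and the
    square sum exceeds [A] on a set [E] of a period, then [A ^ (p / q)] times the measure of [E] is
    bounded. It holds for every list of modes and every number of heights, since the size [N] of the
    cube is chosen after them. *)
Theorem area_wave (C : R) : 0 < C -> area_bounded C -> exists2 C' : R, 0 < C' &
 forall x0 l (X : R) (S : nat) A (E : set R), pos_freq l -> (forall a, `|x0 + tpoly l a| <= 1) ->
  0 < A -> measurable E -> E `<=` `[0, 1[%classic ->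
  (forall a, E a -> exists ts h o, [/\ separated ts, (size ts <= S)%N,
   forall s, s \in ts -> s <= X, detects l ts h o a & A < \sum_(s <- ts) h s `^ q]) ->
  ((A `^ (p / q))%:E * lebesgue_measure E <= C'%:E)%E.
move=> C0 hC; have [K K0 hK] := truncate_wave.
have [e0 _ _] := cutoff_orderP a0.
pose w := window_volume / 2 ^+ n.+2 * (2 `^ (- q) / 2).
have w0 : 0 < w.
 by rewrite /w mulr_gt0 ?divr_gt0 ?window_volume_gt0 ?powR_gt0 ?exprn_gt0.
exists (C `^ p * 6 ^+ n.+1 / w `^ (p / q)).
 side.
move=> x0 l X S A E hl f1 A0 mE E1 hE.
have f1' (z : T) : `|tfun x0 l z| <= 1 by exact: f1.
pose d := (2 `^ (- q) * A / 2 / S.+1%:R) `^ q^-1.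
have d1 : 0 < 2 `^ (- q) * A / 2 / S.+1%:R by side.
have d0 : 0 < d by exact: powR_gt0.
have dq : S%:R * d `^ q <= 2 `^ (- q) * A / 2.
 rewrite /d -powRrM mulVf ?gt_eqF// powRr1 ?(ltW d1)//.
 by apply: natr_div_succ_le; rewrite divr_ge0 ?mulr_ge0 ?powR_ge0 ?(ltW A0).
have [N [N0 [XN tN]]] := @tail_small K (2 * X) (cutoff_order alpha) d K0 e0 d0.
have NR0 : 0 < N%:R :> R by rewrite ltr0n.
pose g := truncate (3 * N%:R) (tfun x0 l : T -> B).
(* The vertices range over [N] periods of [E] in the first coordinate and over [[- N, N]] in the
   others. The measure of [D] and the [p]-th power of the norm of the truncated function both grow
   like [N ^ (n + 1)], so [N] cancels. *)
pose DA (i : 'I_n.+1) : set R := if i == ord0 then translates N E else `[- N%:R, N%:R]%classic.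
have mDA i : measurable (DA i).
 by rewrite /DA; case: ifP => _; [exact: meas_translates|exact: measurable_itv].
pose D : set T := box DA.
have mD : measurable D by exact: meas_box.
have DN x : D x -> forall i, `|tnth x i| <= N%:R.
 move=> Dx i; have := Dx i; rewrite /DA; case: ifP => _; last by rewrite /= in_itv /= ler_norml.
 move=> /translatesP[k kN /E1]; rewrite /= in_itv /= => /andP[h1 h2].
 have kN' : k%:R + 1 <= N%:R :> R by rewrite natr1 ler_nat.
 have k0' : 0 <= k%:R :> R by side.
 by rewrite ger0_norm; lra.
have muD : mu D = (lebesgue_measure E * (N%:R * (2 * N%:R) ^+ n)%:E)%E.
 rewrite lebesgue_Rn_box// big_ord_recl {1}/DA eqxx lebesgue_translates//.
 rewrite (eq_bigr (fun=> (2 * N%:R)%:E)); last first.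
  by move=> i _; rewrite /DA /= lebesgue_itv_le; [congr EFin; ring|lra].
 rewrite prodEFin prodr_const card_ord EFinM.
 by rewrite [(_ * lebesgue_measure E)%E]muleC -muleA.
have area_ge x : D x -> ((w * A)%:E <= area_int q alpha g x)%E.
 move=> Dx; have := Dx ord0; rewrite /DA eqxx => /translatesP[k kN Ek].
 have [ts [h [off [sep sS sX hd hA]]]] := hE _ Ek; have [_ ts0 _] := sep.
 have -> : w * A = window_volume / 2 ^+ n.+2 * (2 `^ (- q) * A / 2) by rewrite /w; ring.
 have dq' : (size ts)%:R * d `^ q <= 2 `^ (- q) * A / 2.
  by apply: le_trans dq; rewrite ler_wpM2r ?powR_ge0// ler_nat.
 apply: (@area_int_ge g x ts h off d A sep (ltW d0) hA dq').
 - by move=> s sts; case: (hd s sts).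
 - move=> s [y t] sts hW; have s0 := ts0 s sts.
  have [_ os hs] := hd s sts.
  have [st hy0 hy _] := window_near s0 os hW.
  have t0 : 0 < t by case/andP: st => st _; exact: lt_le_trans st.
  have tX : t <= 2 * X.
   case/andP: st => _ tk; apply: (le_trans tk); apply: (le_trans (window_top s0)).
   by rewrite ler_pM2l// sX.
  have ya : h s <= `|wave l (tnth y ord0) t|.
   have -> : wave l (tnth y ord0) t = wave l (tnth y ord0 - k%:R) t.
    by rewrite -(wave_period l (tnth y ord0 - k%:R) t k) subrK.
   apply: hs => //; apply: le_trans hy0; rewrite le_eqVlt; apply/orP; left; apply/eqP.
   by congr `|_|; ring.
  apply: (le_trans ya).
  have cy : cube (2 * N%:R) y.
   apply/cubeP => i; have h1 := hy i; have h2 := DN x Dx i.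
   have h3 : s <= N%:R by have := sX s sts; have := s0; lra.
   have := ler_normD (tnth y i - tnth x i) (tnth x i); rewrite subrK => h4.
   by apply: (le_trans h4); lra.
  apply: (le_trans (hK x0 l N%:R t y hl f1' NR0 t0 cy)).
  by apply: lerD => //; apply: tN; rewrite (ltW t0).
 - by move=> s sts; case: (hd s sts).
have [gL gi] := @truncate_Lp x0 l (3 * N%:R) (mulr_ge0 (ler0n _ 3) (ltW NR0)) f1'.
have wA0 : 0 < w * A by side.
have key : (((w * A) `^ (p / q))%:E * mu D <= (C `^ p * (6 * N%:R) ^+ n.+1)%:E)%E.
 apply: (@le_trans _ _ (\int[mu]_x (area_int q alpha g x `^ (p / q)))%E).
  rewrite -integral_cst// [leLHS]integral_mkcond; apply: le_integralW => // x _.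
   by rewrite patchE; case: ifP => // _; rewrite lee_fin powR_ge0.
  rewrite patchE; case: ifP => [|_]; last side.
  rewrite inE => Dx; rewrite -poweR_EFin; apply: gt0_ler_poweR; last exact: area_ge.
  - side.
  - by rewrite in_itv /= leey andbT lee_fin ltW.
  - by rewrite in_itv /= leey andbT; apply: le_trans (area_ge x Dx); rewrite lee_fin ltW.
 have := hC g gL; rewrite (area_integral_Lnorm _ _ p0 q0) bochner_norm_root//.
 set I := (\int[mu]_x (area_int _ _ _ _ `^ _))%E; set J := (\int[mu]_x _)%E => IJ.
 have I0 : (0 <= I)%E by apply: integral_ge0 => x _; exact: poweR_ge0.
 have J0 : (0 <= J)%E by apply: integral_ge0 => x _; rewrite lee_fin powR_ge0.
 have -> : I = ((I `^ p^-1) `^ p)%E by rewrite -poweRrM mulVf ?gt_eqF// poweRe1.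
 apply: (@le_trans _ _ ((C%:E * J `^ p^-1) `^ p)%E).
  apply: gt0_ler_poweR; last exact: IJ.
  - exact: ltW.
  - by rewrite in_itv /= leey andbT poweR_ge0.
  - by rewrite in_itv /= leey andbT mule_ge0 ?poweR_ge0// lee_fin ltW.
 rewrite poweRM ?poweR_ge0 ?lee_fin ?(ltW C0)// -poweRrM mulVf ?gt_eqF// poweRe1//.
 rewrite poweR_EFin EFinM; apply: lee_wpmul2l; first side.
 by apply: (le_trans gi); rewrite lee_fin mulrA -natrM.
have : ((w `^ (p / q) * (N%:R * (2 * N%:R) ^+ n))%:E * ((A `^ (p / q))%:E * lebesgue_measure E) <=
  (w `^ (p / q) * (N%:R * (2 * N%:R) ^+ n))%:E * (C `^ p * 6 ^+ n.+1 / w `^ (p / q))%:E)%E.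
 rewrite [leLHS](_ : _ = (((w * A) `^ (p / q))%:E * mu D)%E); last first.
  rewrite muD (powRM _ (ltW w0) (ltW A0)); set NN := N%:R * _.
  by rewrite 2!EFinM muleACA [(NN%:E * _)%E]muleC.
 apply: (le_trans key); rewrite -EFinM lee_fin.
 have wq : w `^ (p / q) != 0 by side.
 rewrite [leRHS](_ : _ = C `^ p * (6 ^+ n.+1 * (N%:R * (2 * N%:R) ^+ n))); last by field.
 rewrite ler_wpM2l ?powR_ge0// exprMn ler_wpM2l ?exprn_ge0// exprS ler_wpM2l ?(ltW NR0)//.
 by rewrite lerXn2r ?nnegrE ?mulr_ge0 ?(ltW NR0)//; lra.
rewrite lee_pmul2l// lte_fin mulr_gt0 ?powR_gt0// mulr_gt0// exprn_gt0// mulr_gt0//.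
Qed.

End trigonometric_polynomials.

(** * Size and regularity of the profile *)

Section profile.
Context (R : realType) (c alpha : R).
Hypotheses (c0 : 0 < c) (a0 : 0 < alpha).
Local Notation psi := (profile c alpha).
Local Notation cc := (c * (2 * pi) ^+ 2).
Implicit Types r t d : R.

Lemma powR_expR_bounded (b : R) : 0 < b -> exists2 P : R, 0 < P &
 forall x : R, 0 <= x -> x `^ b * expR (- x) <= P.
move=> b0; exists (b `^ b); first side.
move=> x x0; have [->|x_neq0] := eqVneq x 0; first by rewrite powR0 ?gt_eqF// mul0r powR_ge0.
have xp : 0 < x by rewrite lt_def x_neq0.
have e : x / b <= expR (x / b) by apply: le_trans (expR_ge1Dx _); rewrite lerDr.
have e2 : (x / b) `^ b <= expR x.
 have -> : expR x = expR (x / b) `^ b by rewrite -expRM divfK ?gt_eqF.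
 by apply: ge0_ler_powR; rewrite ?nnegrE ?expR_ge0 ?(ltW b0)//; exact: (divr_ge0 x0 (ltW b0)).
rewrite expRN ler_pdivrMr ?expR_gt0//.
have -> : x `^ b = b `^ b * (x / b) `^ b.
 by rewrite -powRM ?divr_ge0 ?ltW// mulrCA divff ?mulr1 ?gt_eqF.
by rewrite ler_wpM2l ?powR_ge0.
Qed.

Lemma cc_gt0 : 0 < cc.
by rewrite mulr_gt0// exprn_gt0// mulr_gt0// pi_gt0. Qed.

Lemma profileE r : psi r = (cc * r ^+ 2) `^ alpha * expR (- (cc * r ^+ 2)).
by rewrite /profile exprMn mulrA. Qed.

Lemma profile_ge0 r : 0 <= psi r.
by rewrite mulr_ge0 ?powR_ge0 ?expR_ge0. Qed.

Lemma profile_bounded : exists2 P, 0 < P & forall r, psi r <= P.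
have [P P0 hP] := powR_expR_bounded a0; exists P => // r.
by rewrite profileE; apply: hP; rewrite mulr_ge0 ?sqr_ge0 ?(ltW cc_gt0).
Qed.

Lemma profile_decay : exists2 Q, 0 < Q & forall r, 0 < r -> psi r <= Q / r.
have b0 : 0 < alpha + 2^-1 by side.
have [P P0 hP] := powR_expR_bounded b0; have k0 := cc_gt0.
have s0 : 0 < Num.sqrt cc by rewrite sqrtr_gt0.
exists (P / Num.sqrt cc); first side.
move=> r r0; rewrite ler_pdivlMr// ler_pdivlMr//.
have x0 : 0 < cc * r ^+ 2 by side.
have <- : (cc * r ^+ 2) `^ (alpha + 2^-1) * expR (- (cc * r ^+ 2)) = psi r * r * Num.sqrt cc.
 rewrite powRD; last by rewrite (gt_eqF x0) implybT.
 rewrite profileE (powR12_sqrt (ltW x0)) (sqrtrM _ (ltW k0)) sqrtr_sqr (gtr0_norm r0).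
 by ring.
exact/hP/ltW.
Qed.

Lemma profile_small d : 0 < d -> exists2 r0, 0 < r0 & forall r, 0 < r -> r <= r0 -> psi r <= d.
move=> d0; have k0 := cc_gt0; exists (Num.sqrt (d `^ alpha^-1 / cc)).
 by rewrite sqrtr_gt0 divr_gt0// powR_gt0.
move=> r rp hr; have x0 : 0 <= cc * r ^+ 2 by rewrite mulr_ge0 ?sqr_ge0 ?(ltW k0).
rewrite profileE; apply: (@le_trans _ _ ((cc * r ^+ 2) `^ alpha)).
 rewrite -[leRHS]mulr1 ler_wpM2l ?powR_ge0// -[leRHS](@expR0 R) ler_expR.
 by rewrite oppr_le0.
have h : cc * r ^+ 2 <= d `^ alpha^-1.
 have q0 : 0 <= d `^ alpha^-1 / cc by side.
 rewrite mulrC -ler_pdivlMr// -[leRHS](sqr_sqrtr q0).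
 by rewrite lerXn2r ?nnegrE ?(ltW rp) ?sqrtr_ge0.
apply: (@le_trans _ _ ((d `^ alpha^-1) `^ alpha)).
 by apply: ge0_ler_powR; rewrite ?nnegrE ?powR_ge0 ?(ltW a0).
by rewrite -powRrM mulVf ?gt_eqF// powRr1// ltW.
Qed.

Lemma expR_near0 (u : R) : `|u| <= 2^-1 -> `|expR u - 1| <= 2 * `|u|.
move=> hu; have z0 := expR_gt0 u; have h1 := expR_ge1Dx u; have := expR_ge1Dx (- u).
rewrite expRN -[leRHS]mul1r ler_pdivlMr// => h2; move: hu.
by have [u0|u0] := leP 0 u; [rewrite (ger0_norm u0)|rewrite (ltr0_norm u0)]; rewrite ler_norml => hu;
 apply/andP; split; nra.
Qed.

(* [psi r' / psi r] lies between [expR (- K d)] and [expR (K d)] when [r' / r] lies between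
  [1 - d] and [1 + d]. *)
Lemma profile_continuous r1 : 0 < r1 -> exists2 K, 0 < K & forall r r' d, 0 < r -> r <= r1 ->
 0 <= d -> d <= 2^-1 -> K * d <= 2^-1 -> `|r' - r| <= d * r -> `|psi r' - psi r| <= K * d.
move=> r10; have [P P0 hP] := profile_bounded; have k0 := cc_gt0.
pose L := 4 * alpha + 4 * (cc * r1 ^+ 2).
have L0 : 0 < L.
 by apply: addr_gt0; apply: mulr_gt0 => //; apply: mulr_gt0 => //; exact: exprn_gt0.
exists (2 * L * (P + 1)); first side.
move=> r r' d rp rr1 d0 d2 Kd hr.
pose x := r' / r.
have xr : r' = x * r by rewrite /x divfK ?gt_eqF.
have xd : `|x - 1| <= d.
 rewrite -(ler_pM2r rp); apply: le_trans hr.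
 have -> : r' - r = (x - 1) * r by rewrite mulrBl mul1r -xr.
 by rewrite normrM (gtr0_norm rp).
have [x1 x2] : 1 - d <= x /\ x <= 1 + d by move: xd; rewrite ler_norml => /andP[? ?]; split; lra.
have x0 : 0 < x by lra.
have Ld : L * d <= 2^-1.
 apply: le_trans Kd; rewrite ler_wpM2r//.
 have -> : 2 * L * (P + 1) = L + L * (2 * P + 1) by ring.
 by rewrite lerDl mulr_ge0 ?(ltW L0)//; have := P0; lra.
have ry : 0 < r ^+ 2 by side.
pose y := cc * r ^+ 2.
have y0 : 0 < y by exact: mulr_gt0.
have yle : y <= cc * r1 ^+ 2.
 by rewrite ler_pM2l// lerXn2r ?nnegrE ?(ltW rp) ?(ltW r10).
have E : psi r' = psi r * (x `^ (2 * alpha) * expR (- (y * (x ^+ 2 - 1)))).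
 have e : cc * (x * r) ^+ 2 = x ^+ 2 * y by rewrite /y; ring.
 rewrite !profileE xr e -/y.
 rewrite (powRM _ (ltW (exprn_gt0 2 x0)) (ltW y0)) -powR_mulrn ?(ltW x0)// -powRrM.
 have -> : - (x `^ 2%:R * y) = - y + - (y * (x `^ 2%:R - 1)) by ring.
 by rewrite expRD; ring.
have xsq : `|x ^+ 2 - 1| <= 4 * d.
 have -> : x ^+ 2 - 1 = (x - 1) * (x + 1) by ring.
 rewrite normrM mulrC; apply: ler_pM => //.
 by rewrite ger0_norm; lra.
have lnx_up : x <= expR d by apply: (le_trans x2); rewrite addrC; have := expR_ge1Dx d; lra.
have lnx_dn : expR (- (2 * d)) <= x.
 apply: le_trans x1; rewrite expRN.
 have h : 1 + 2 * d <= expR (2 * d) by exact: expR_ge1Dx.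
 have q0 : 0 < 1 - d by lra.
 rewrite -[leRHS]invrK lef_pV2 ?posrE ?expR_gt0 ?invr_gt0//.
 apply: le_trans h; rewrite -[leLHS]mul1r ler_pdivrMr//; nra.
have a2 : 0 <= 2 * alpha by side.
pose u := 2 * alpha * ln x - y * (x ^+ 2 - 1).
have zE : x `^ (2 * alpha) * expR (- (y * (x ^+ 2 - 1))) = expR u by rewrite /powR gt_eqF// -expRD.
have hln : `|ln x| <= 2 * d.
 rewrite ler_norml -[leLHS]expRK -[X in _ && (_ <= X)]expRK !ler_ln ?posrE ?expR_gt0// lnx_dn /=.
 by apply: (le_trans lnx_up); rewrite ler_expR; lra.
have hu : `|u| <= L * d.
 apply: (le_trans (ler_normB _ _)); rewrite normrM (normrM y) (ger0_norm a2) (gtr0_norm y0).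
 have -> : L * d = 2 * alpha * (2 * d) + (cc * r1 ^+ 2) * (4 * d) by rewrite /L; ring.
 by apply: lerD; apply: ler_pM => //; exact: ltW.
rewrite E zE -{2}[psi r]mulr1 -mulrBr normrM (ger0_norm (profile_ge0 r)).
have hz : `|expR u - 1| <= 2 * (L * d).
 by apply: le_trans (expR_near0 (le_trans hu Ld)) _; rewrite ler_pM2l.
have hr' : psi r <= P + 1 by apply: (le_trans (hP r)); lra.
have -> : 2 * L * (P + 1) * d = (P + 1) * (2 * (L * d)) by ring.
by apply: ler_pM => //; exact: profile_ge0.
Qed.

(** For heights between [T] and [2 * T] the factors of all frequencies [k >= 2] are so much smaller
    than that of frequency 1 that the first harmonic of the square wave cannot be cancelled. *)
Lemma profile_dominates : exists2 T, 1 <= T & (exists2 d, 0 < d &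
 forall t, T <= t <= 2 * T -> d <= psi t /\
  forall k : nat, (2 <= k)%N -> psi (k%:R * t) <= 8^-1 ^+ k * psi t).
have k0 := cc_gt0.
(* Ensures [cc * T ^ 2 >= 2 * alpha + 8]; the part [2 * alpha] offsets the growth of
   [k ^ (2 alpha)], the part 8 gives the decay [8 ^ (- k)]. *)
pose T := 1 + (2 * alpha + 8) / cc.
have T1 : 1 <= T by rewrite lerDl; apply: divr_ge0; [have := a0; lra|exact: ltW].
have T0 : 0 < T by lra.
have cT : 2 * alpha + 8 <= cc * T ^+ 2.
 apply: (@le_trans _ _ (cc * T)).
  have -> : cc * T = cc + (2 * alpha + 8) by rewrite /T mulrDr mulr1 [cc * (_ / _)]mulrC divfK ?gt_eqF.
  by rewrite lerDr ltW.
 by rewrite ler_pM2l// expr2 -[leLHS]mul1r ler_pM2r.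
exists T => //; exists ((cc * T ^+ 2) `^ alpha * expR (- (cc * (2 * T) ^+ 2))).
 side.
move=> t /andP[t1 t2]; have t0 : 0 < t by exact: lt_le_trans t1.
have Tt : cc * T ^+ 2 <= cc * t ^+ 2 by rewrite ler_pM2l// lerXn2r ?nnegrE ?(ltW T0) ?(ltW t0).
have tT : cc * t ^+ 2 <= cc * (2 * T) ^+ 2.
 by rewrite ler_pM2l// lerXn2r ?nnegrE ?mulr_ge0 ?(ltW t0) ?(ltW T0).
have T20 : 0 <= cc * T ^+ 2 by side.
split.
 rewrite profileE; apply: ler_pM; rewrite ?powR_ge0 ?expR_ge0//; last by rewrite ler_expR lerN2.
 by apply: ge0_ler_powR; rewrite ?nnegrE ?(ltW a0)//; exact: le_trans Tt.
move=> k k2; rewrite !profileE; set y := cc * t ^+ 2.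
have y0 : 0 < y by rewrite mulr_gt0// exprn_gt0.
have kR : 2 <= k%:R :> R by rewrite (ler_nat R 2).
have k00 : 0 <= k%:R :> R by side.
have -> : cc * (k%:R * t) ^+ 2 = k%:R ^+ 2 * y by rewrite /y; ring.
rewrite (powRM _ (sqr_ge0 _) (ltW y0)) [leLHS]mulrAC.
rewrite [leRHS](_ : _ = 8^-1 ^+ k * expR (- y) * y `^ alpha); last by ring.
rewrite ler_wpM2r ?powR_ge0//.
have kp : (k%:R ^+ 2) `^ alpha <= expR (2 * alpha * k%:R) :> R.
 have h : k%:R ^+ 2 <= expR (2 * k%:R) :> R.
  have -> : expR (2 * k%:R) = expR k%:R ^+ 2 :> R by rewrite expr2 -expRD; congr expR; ring.
  rewrite lerXn2r ?nnegrE ?expR_ge0//.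
  by apply: le_trans (expR_ge1Dx _); rewrite lerDr.
 have -> : 2 * alpha * k%:R = 2 * k%:R * alpha by ring.
 by rewrite expRM; apply: ge0_ler_powR; rewrite ?nnegrE ?expR_ge0 ?sqr_ge0 ?(ltW a0).
apply: (le_trans (ler_wpM2r (expR_ge0 _) kp)); rewrite -expRD.
have e8 : expR (- (8 * k%:R)) <= 8^-1 ^+ k :> R.
 have -> : - (8 * k%:R) = k%:R * (- 8) :> R by ring.
 rewrite expRM_natl lerXn2r ?nnegrE ?expR_ge0 ?invr_ge0// expRN lef_pV2 ?posrE ?expR_gt0//.
 by apply: le_trans (expR_ge1Dx _); rewrite lerDr.
apply: (@le_trans _ _ (expR (- (8 * k%:R)) * expR (- y))); last by rewrite ler_wpM2r ?expR_ge0.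
rewrite -expRD ler_expR.
have yl : 2 * alpha + 8 <= y by exact: le_trans Tt.
have k1 : k%:R <= k%:R ^+ 2 - 1 :> R by nra.
have := ler_pM k00 (ltW (lt_le_trans (addr_gt0 (mulr_gt0 (ltr0Sn _ 1) a0) (ltr0Sn _ 7)) yl)) k1 (lexx y).
have := ler_wpM2l k00 yl.
by lra.
Qed.

End profile.

(** * Smooth square waves with odd frequencies *)

Section square_wave.
Context (R : realType).
Implicit Types (a x y : R) (u : nat -> R) (s : R -> R) (D : nat).

(** Only odd frequencies: this class is stable under products of three factors, which is what the
    odd cubic [steepen] requires. *)
Definition oddcos D u a : R := \sum_(k < D) u k * cos (2 * pi * (k.*2.+1)%:R * a).

Definition odd_cos s : Prop := exists D u, s = oddcos D u.

Lemma odd_cos0 : odd_cos (fun=> 0).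
by exists 0%N, (fun=> 0); apply/funext => a; rewrite /oddcos big_ord0. Qed.

Lemma oddcos_widen D N u : (D <= N)%N ->
 oddcos D u = oddcos N (fun k => if (k < D)%N then u k else 0).
move=> DN; apply/funext => a; rewrite /oddcos (big_ord_widen _ (fun k => u k * cos (2 * pi * (k.*2.+1)%:R * a)) DN).
by rewrite big_mkcond; apply: eq_bigr => k _; case: ifP => // _; rewrite mul0r.
Qed.

Lemma odd_cosD s s' : odd_cos s -> odd_cos s' -> odd_cos (fun a => s a + s' a).
move=> [D [u ->]] [D' [u' ->]]; exists (D + D')%N.
rewrite (oddcos_widen u (leq_addr D' D)) (oddcos_widen u' (leq_addl D D')).
exists (fun k => (if (k < D)%N then u k else 0) + (if (k < D')%N then u' k else 0)); apply/funext => a; rewrite /oddcos -big_split /=.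
by apply: eq_bigr => k _; rewrite [RHS]mulrDl.
Qed.

Lemma odd_cosZ x s : odd_cos s -> odd_cos (fun a => x * s a).
move=> [D [u ->]]; exists D, (fun k => x * u k); apply/funext => a.
by rewrite /oddcos mulr_sumr; apply: eq_bigr => k _; rewrite mulrA.
Qed.

Lemma odd_cos_sum (I : Type) (r : seq I) (F : I -> R -> R) : (forall i, odd_cos (F i)) ->
 odd_cos (fun a => \sum_(i <- r) F i a).
move=> hF; elim: r => [|i r ih]; first by under eq_fun do rewrite big_nil; exact: odd_cos0.
by under eq_fun do rewrite big_cons; exact: odd_cosD.
Qed.

Lemma odd_cos_nat (k : nat) : odd_cos (fun a => cos (2 * pi * (k.*2.+1)%:R * a)).
exists k.+1, (fun j => (j == k)%:R); apply/funext => a.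
rewrite /oddcos big_ord_recr /= eqxx mul1r big1 ?add0r// => j _.
by rewrite (ltn_eqF (ltn_ord j)) mul0r.
Qed.

Lemma natr_odd (k : nat) : (k.*2.+1)%:R = 2 * k%:R + 1 :> R.
by rewrite -muln2 -addn1 natrD natrM mulrC. Qed.

Lemma odd_cos_int (z : int) : odd_cos (fun a => cos (2 * pi * (2 * z%:~R + 1) * a)).
case: z => k.
 have := odd_cos_nat k; congr odd_cos; apply/funext => a; congr (cos (_ * _ * _)).
 exact: natr_odd.
have := odd_cos_nat k; congr odd_cos; apply/funext => a; rewrite -cosN.
by congr cos; rewrite natr_odd NegzE mulrNz -pmulrn -natr1; ring.
Qed.

Lemma cos_mul2 x y : 2 * (cos x * cos y) = cos (x + y) + cos (x - y).
by rewrite cosD cosB; ring. Qed.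

(** The product of three cosines is a combination of cosines of four sums and differences of the
    frequencies, all odd; a negative frequency is folded back by parity of the cosine
    ([odd_cos_int]). *)
Lemma odd_cos_mul3 s1 s2 s3 : odd_cos s1 -> odd_cos s2 -> odd_cos s3 ->
 odd_cos (fun a => s1 a * s2 a * s3 a).
move=> [D1 [u1 ->]] [D2 [u2 ->]] [D3 [u3 ->]].
pose w (k : nat) a := 2 * pi * (k.*2.+1)%:R * a.
have -> : (fun a => oddcos D1 u1 a * oddcos D2 u2 a * oddcos D3 u3 a) =
  (fun a => \sum_(i < D1) \sum_(j < D2) \sum_(k < D3)
   (u1 i * u2 j * u3 k) * (cos (w i a) * cos (w j a) * cos (w k a))).
 apply/funext => a; rewrite /oddcos !mulr_suml; apply: eq_bigr => i _.
 rewrite [X in X * _]mulr_sumr mulr_suml; apply: eq_bigr => j _.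
 by rewrite mulr_sumr; apply: eq_bigr => k _; rewrite /w; ring.
apply: odd_cos_sum => i; apply: odd_cos_sum => j; apply: odd_cos_sum => k; apply: odd_cosZ.
have c (z : int) := odd_cos_int z.
have -> : (fun a => cos (w i a) * cos (w j a) * cos (w k a)) = (fun a => 4^-1 *
  ((cos (2 * pi * (2 * (i + j + k + 1)%N%:Z%:~R + 1) * a) + cos (2 * pi * (2 * ((i + j)%N%:Z - k%:Z)%:~R + 1) * a)) +
  (cos (2 * pi * (2 * ((i + k)%N%:Z - j%:Z)%:~R + 1) * a) + cos (2 * pi * (2 * (i%:Z - (j + k + 1)%N%:Z)%:~R + 1) * a)))).
 apply/funext => a.
 have h1 := cos_mul2 (w i a) (w j a); have h2 := cos_mul2 (w i a + w j a) (w k a).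
 have h3 := cos_mul2 (w i a - w j a) (w k a).
 have -> : 2 * pi * (2 * (i + j + k + 1)%N%:Z%:~R + 1) * a = w i a + w j a + w k a.
  by rewrite /w !natr_odd -pmulrn !natrD; ring.
 have -> : 2 * pi * (2 * ((i + j)%N%:Z - k%:Z)%:~R + 1) * a = w i a + w j a - w k a.
  by rewrite /w !natr_odd intrB -!pmulrn !natrD; ring.
 have -> : 2 * pi * (2 * ((i + k)%N%:Z - j%:Z)%:~R + 1) * a = w i a - w j a + w k a.
  by rewrite /w !natr_odd intrB -!pmulrn !natrD; ring.
 have -> : 2 * pi * (2 * (i%:Z - (j + k + 1)%N%:Z)%:~R + 1) * a = w i a - w j a - w k a.
  by rewrite /w !natr_odd intrB -!pmulrn !natrD; ring.
 have -> : cos (w i a) * cos (w j a) * cos (w k a) =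
   4^-1 * (2 * (2 * (cos (w i a) * cos (w j a)) * cos (w k a))) by field.
 by rewrite h1 [(_ + _) * cos (w k a)]mulrDl [2 * (_ + _)]mulrDr h2 h3.
by apply: odd_cosZ; apply: odd_cosD; apply: odd_cosD; exact: c.
Qed.

(** An odd cubic preserving [[-1, 1]], with attracting fixed points 1 and -1. Iterated on the
    cosine, it tends to the sign and stays a trigonometric polynomial bounded by 1. *)
Definition steepen x : R := (3 * x - x ^+ 3) / 2.

Lemma steepenN x : steepen (- x) = - steepen x.
by rewrite /steepen; ring. Qed.

Lemma steepen_bound x : 0 <= x <= 1 -> x <= steepen x <= 1.
move=> /andP[x0 x1]; rewrite /steepen -subr_ge0 -[X in _ && X]subr_ge0.
have -> : (3 * x - x ^+ 3) / 2 - x = x * ((1 - x) * (1 + x)) / 2 by field.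
have -> : 1 - (3 * x - x ^+ 3) / 2 = (1 - x) ^+ 2 * (2 + x) / 2 by field.
side.
Qed.

Lemma iter_steepenN j x : iter j steepen (- x) = - iter j steepen x.
by elim: j => //= j ->; exact: steepenN. Qed.

Lemma iter_steepen_bound j x : 0 <= x <= 1 -> x <= iter j steepen x <= 1.
move=> /andP[x0 x1]; elim: j => [|j /andP[h1 h2]] /=; first side.
have h3 : 0 <= iter j steepen x by exact: le_trans h1.
have /andP[h4 h5] : iter j steepen x <= steepen (iter j steepen x) <= 1.
 by apply: steepen_bound; rewrite h3.
by rewrite h5 (le_trans h1 h4).
Qed.

Lemma iter_steepen_cvg j x g : 0 < g -> g <= x -> x <= 1 ->
 1 - iter j steepen x <= (1 - g / 2) ^+ j.
move=> g0 gx x1; elim: j => [|j ih]; first by rewrite /= expr0; lra.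
have x01 : 0 <= x <= 1 by apply/andP; split; lra.
have /andP[h1 h2] := iter_steepen_bound j x01.
rewrite /= exprS; set v := iter j steepen x in ih h1 h2 *.
apply: (@le_trans _ _ ((1 - g / 2) * (1 - v))); last by apply: ler_wpM2l => //; lra.
rewrite /steepen; have -> : 1 - (3 * v - v ^+ 3) / 2 = (1 - (v + v ^+ 2) / 2) * (1 - v) by field.
by apply: ler_wpM2r; [lra|nra].
Qed.

Lemma odd_cos_iter j : odd_cos (fun a => iter j steepen (cos (2 * pi * a))).
elim: j => [|j ih].
 have := odd_cos_nat 0; congr odd_cos; apply/funext => a /=.
 by rewrite mulr1.
have -> : (fun a => iter j.+1 steepen (cos (2 * pi * a))) = (fun a =>
  3 / 2 * iter j steepen (cos (2 * pi * a)) + (- 2^-1) * (iter j steepen (cos (2 * pi * a)) *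
   iter j steepen (cos (2 * pi * a)) * iter j steepen (cos (2 * pi * a)))).
 by apply/funext => a; rewrite /= {1}/steepen; field.
by apply: odd_cosD; apply: odd_cosZ => //; exact: odd_cos_mul3.
Qed.

(* Multiplying by [2 * sin (w / 2)] makes the sum telescope. *)
Lemma sum_cos_roots (N m : nat) : (0 < m < N)%N ->
 \sum_(j < N) cos (2 * pi * m%:R * (j%:R / N%:R)) = 0 :> R.
move=> /andP[m0 mN]; have N0 : 0 < N%:R :> R by rewrite ltr0n (ltn_trans m0).
pose w : R := 2 * pi * m%:R / N%:R.
have s0 : sin (w / 2) != 0.
 rewrite gt_eqF// sin_gt0_pi// /w.
 have -> : 2 * pi * m%:R / N%:R / 2 = pi * (m%:R / N%:R) :> R by field; rewrite gt_eqF.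
 apply/andP; split; first by rewrite mulr_gt0 ?pi_gt0// divr_gt0// ltr0n.
 by rewrite -[ltRHS]mulr1 ltr_pM2l ?pi_gt0// ltr_pdivrMr// mul1r ltr_nat.
have tel (n : nat) : 2 * sin (w / 2) * \sum_(j < n) cos (w * j%:R) =
  sin (w * n%:R - w / 2) + sin (w / 2).
 elim: n => [|n ih]; first by rewrite big_ord0 !mulr0 sub0r sinN addNr.
 have e : n.+1%:R = n%:R + 1 :> R by rewrite natr1.
 rewrite big_ord_recr /= mulrDr ih e.
 have -> : w * (n%:R + 1) - w / 2 = w * n%:R + w / 2 by field.
 by rewrite !sinD sinN cosN; ring.
have : 2 * sin (w / 2) * \sum_(j < N) cos (w * j%:R) = 0.
 have e : w * N%:R = 2 * pi * m%:R by rewrite /w divfK// gt_eqF.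
 rewrite tel e; have -> : 2 * pi * m%:R - w / 2 = - (w / 2) + 2 * pi * m%:R by ring.
 have -> : sin (- (w / 2) + 2 * pi * m%:R) = sin (- (w / 2)).
  rewrite !sin_cos_shift -[RHS](cos_period _ m); congr cos; ring.
 by rewrite sinN addNr.
move/eqP; rewrite mulf_eq0 mulf_eq0 (negbTE s0) pnatr_eq0 /= => /eqP e; rewrite -[RHS]e.
by apply: eq_bigr => j _; congr cos; rewrite /w; ring.
Qed.

(** Fourier coefficients read off from samples: at [4 * (D + 1)] equidistant points distinct odd
    frequencies are exactly orthogonal. No integral is involved. *)
Lemma oddcos_coef D u (l : nat) : (l < D)%N ->
 \sum_(j < 4 * D.+1) oddcos D u (j%:R / (4 * D.+1)%:R) * cos (2 * pi * (l.*2.+1)%:R * (j%:R / (4 * D.+1)%:R))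
 = u l * (2 * D.+1%:R).
move=> lD; set N := (4 * D.+1)%N.
have prod (k : nat) : (k < D)%N -> \sum_(j < N) cos (2 * pi * (k.*2.+1)%:R * (j%:R / N%:R)) *
  cos (2 * pi * (l.*2.+1)%:R * (j%:R / N%:R)) = if k == l then 2 * D.+1%:R else 0 :> R.
 move=> kD.
 have -> : \sum_(j < N) cos (2 * pi * (k.*2.+1)%:R * (j%:R / N%:R)) * cos (2 * pi * (l.*2.+1)%:R * (j%:R / N%:R))
   = 2^-1 * (\sum_(j < N) cos (2 * pi * (k + l).+1.*2%:R * (j%:R / N%:R)) +
        \sum_(j < N) cos (2 * pi * (maxn k l - minn k l).*2%:R * (j%:R / N%:R))) :> R.
  rewrite -big_split mulr_sumr; apply: eq_bigr => j _ /=.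
  set t := j%:R / N%:R.
  have h := cos_mul2 (2 * pi * (k.*2.+1)%:R * t) (2 * pi * (l.*2.+1)%:R * t).
  have -> : 2 * pi * (k + l).+1.*2%:R * t = 2 * pi * (k.*2.+1)%:R * t + 2 * pi * (l.*2.+1)%:R * t.
   rewrite -mulrDl -mulrDr -natrD; congr (_ * _%:R * _).
   by rewrite -!muln2; lia.
  have -> : cos (2 * pi * (maxn k l - minn k l).*2%:R * t) =
    cos (2 * pi * (k.*2.+1)%:R * t - 2 * pi * (l.*2.+1)%:R * t) :> R.
   have [lk|kl] := leqP l k.
    congr cos; rewrite -mulrBl -mulrBr -natrB; last by rewrite ltnS leq_double.
    by congr (_ * _%:R * _); rewrite -!muln2; lia.
   rewrite -[RHS]cosN opprB; congr cos; rewrite -mulrBl -mulrBr -natrB; last by rewrite ltnS leq_double ltnW.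
   by congr (_ * _%:R * _); rewrite -!muln2; lia.
  by rewrite -h mulKf.
 rewrite sum_cos_roots ?add0r; last by rewrite /N -!muln2; lia.
 case: eqP => [->|/eqP kl].
  rewrite maxnn minnn subnn (eq_bigr (fun=> 1)); last by move=> j _; rewrite mulr0 mul0r cos0.
  by rewrite sumr_const card_ord /N natrM; field.
 rewrite sum_cos_roots ?mulr0//; rewrite /N -!muln2; apply/andP; split; move: kl; lia.
under eq_bigr do rewrite /oddcos mulr_suml.
rewrite exchange_big /= (bigD1 (Ordinal lD))//= [X in _ + X]big1 ?addr0; last first.
 move=> k kl; under eq_bigr do rewrite -mulrA; rewrite -mulr_sumr prod//.
 by rewrite -val_eqE /= in kl; rewrite (negbTE kl) mulr0.
by under eq_bigr do rewrite -mulrA; rewrite -mulr_sumr prod// eqxx.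
Qed.

(** Steepening keeps the sign and increases the modulus, so the wave times the cosine is at least
    the squared cosine; averaging over samples gives [u 0 >= 1]. The bound by 1 on the wave gives
    [|u k| <= 2]. *)
Lemma square_wave (g e : R) : 0 < g -> 0 < e -> exists D u,
 [/\ (0 < D)%N, 1 <= u 0%N, forall k, (k < D)%N -> `|u k| <= 2,
   forall a, `|oddcos D u a| <= 1 &
   forall a, (g <= cos (2 * pi * a) -> 1 - oddcos D u a <= e) /\
        (cos (2 * pi * a) <= - g -> oddcos D u a + 1 <= e)].
move=> g0 e0.
have [j hj] : exists j : nat, (1 - Num.min g 1 / 2) ^+ j <= e.
 have m0 : 0 < Num.min g 1 by rewrite lt_min g0 ltr01.
 have m1 : Num.min g 1 <= 1 by rewrite ge_min lexx orbT.
 have h : `|1 - Num.min g 1 / 2| < 1 by rewrite ger0_norm; lra.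
 have /cvgrPdist_lt/(_ e e0)[j _ /(_ j (leqnn j)) /=] := cvg_expr h.
 rewrite sub0r normrN => hj; exists j; apply: ltW; apply: le_lt_trans hj; exact: ler_norm.
have [D [u E]] := odd_cos_iter j.
have sE a : oddcos D u a = iter j steepen (cos (2 * pi * a)) by rewrite -E.
have pos a : 0 <= cos (2 * pi * a) -> cos (2 * pi * a) <= oddcos D u a <= 1.
 by move=> h; rewrite sE; apply: iter_steepen_bound; rewrite h cos_le1.
have neg a : cos (2 * pi * a) <= 0 -> -1 <= oddcos D u a <= cos (2 * pi * a).
 move=> h; have /andP[h1 h2] : - cos (2 * pi * a) <= iter j steepen (- cos (2 * pi * a)) <= 1.
  by apply: iter_steepen_bound; rewrite oppr_ge0 h lerNl cos_geN1.
 by move: h1 h2; rewrite iter_steepenN -sE => h1 h2; apply/andP; split; lra.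
have s1 a : `|oddcos D u a| <= 1.
 rewrite ler_norml; have [h|h] := leP 0 (cos (2 * pi * a)).
  by have /andP[? ?] := pos a h; apply/andP; split; lra.
 by have /andP[? ?] := neg a (ltW h); apply/andP; split; lra.
have sc a : cos (2 * pi * a) ^+ 2 <= oddcos D u a * cos (2 * pi * a).
 have [h|h] := leP 0 (cos (2 * pi * a)).
  by have /andP[? ?] := pos a h; rewrite expr2; apply: ler_wpM2r.
 have /andP[? ?] := neg a (ltW h); rewrite expr2 -subr_ge0 -mulrBl.
 by apply: mulr_le0; lra.
have D0 : (0 < D)%N.
 rewrite lt0n; apply/eqP => D0; have := sc 0; rewrite mulr0 cos0 {1}/oddcos D0 big_ord0.
 by rewrite expr1n mul0r; lra.
have N0 : 0 < 2 * D.+1%:R :> R by side.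
exists D, u; split => //.
- rewrite -(ler_pM2r N0) mul1r -oddcos_coef//.
 apply: (@le_trans _ _ (\sum_(j < 4 * D.+1) cos (2 * pi * (j%:R / (4 * D.+1)%:R)) ^+ 2)); last first.
  by apply: ler_sum => i _; rewrite /= mulr1; exact: sc.
 have -> : \sum_(j < 4 * D.+1) cos (2 * pi * (j%:R / (4 * D.+1)%:R)) ^+ 2 =
   2^-1 * (\sum_(j < 4 * D.+1) cos (2 * pi * 2%:R * (j%:R / (4 * D.+1)%:R)) + \sum_(j < 4 * D.+1) 1) :> R.
  rewrite -big_split mulr_sumr; apply: eq_bigr => i _ /=.
  have := cos_mul2 (2 * pi * (i%:R / (4 * D.+1)%:R)) (2 * pi * (i%:R / (4 * D.+1)%:R)).
  rewrite subrr cos0 => h.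
  have -> : 2 * pi * 2 * (i%:R / (4 * D.+1)%:R) = 2 * pi * (i%:R / (4 * D.+1)%:R) + 2 * pi * (i%:R / (4 * D.+1)%:R) :> R by ring.
  by rewrite -h expr2 mulKf.
 rewrite sum_cos_roots; last by lia.
 by rewrite add0r sumr_const card_ord natrM; lra.
- move=> k kD; rewrite -(ler_pM2r N0).
 rewrite -{1}(gtr0_norm N0) -normrM -oddcos_coef//.
 apply: (le_trans (ler_norm_sum _ _ _)); apply: (@le_trans _ _ (\sum_(j < 4 * D.+1) 1)).
  apply: ler_sum => i _; rewrite normrM; apply: mulr_ile1 => //; exact: cos_max.
 by rewrite sumr_const card_ord natrM; lra.
move=> a; split => h.
 have h0 : 0 <= cos (2 * pi * a) by lra.
 rewrite sE; apply: le_trans hj; apply: iter_steepen_cvg; rewrite ?cos_le1// ?lt_min ?g0 ?ltr01//.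
 by rewrite ge_min h.
have -> : oddcos D u a + 1 = 1 - iter j steepen (- cos (2 * pi * a)) by rewrite iter_steepenN -sE; ring.
apply: le_trans hj; apply: iter_steepen_cvg; rewrite ?lt_min ?g0 ?ltr01//.
by rewrite ge_min lerNr h.
Qed.

End square_wave.

(** * Operations on lists of modes *)

Section mode_lists.
Context (R : realType) (B : completeNormedModType R) (c alpha : R).
Implicit Types (l : seq (nat * R * B)) (a t r eta : R) (u : nat -> R) (D M : nat) (y : B).
Local Notation psi := (profile c alpha).
Local Notation wave := (wave c alpha).

Definition total_norm l : R := \sum_(z <- l) `|z.2|.

Lemma total_norm_ge0 l : 0 <= total_norm l.
by apply: sumr_ge0 => z _; exact: normr_ge0. Qed.

Lemma total_norm_cat l1 l2 : total_norm (l1 ++ l2) = total_norm l1 + total_norm l2.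
exact: big_cat. Qed.

Lemma tpoly_cat l1 l2 a : tpoly (l1 ++ l2) a = tpoly l1 a + tpoly l2 a.
exact: big_cat. Qed.

Lemma wave_cat l1 l2 a t : wave (l1 ++ l2) a t = wave l1 a t + wave l2 a t.
exact: big_cat. Qed.

Lemma wave_norm_le l a t eta : (forall z, z \in l -> `|psi (z.1.1%:R * t)| <= eta) ->
 `|wave l a t| <= eta * total_norm l.
move=> h; rewrite /total_norm mulr_sumr; apply: (le_trans (ler_norm_sum _ _ _)).
rewrite big_seq [leRHS]big_seq; apply: ler_sum => z zl.
rewrite normrZ ler_wpM2r// normrM -[leRHS]mulr1; apply: ler_pM => //; [exact: h|exact: cos_max].
Qed.

Definition vscale r l := [seq (z.1, r *: z.2) | z <- l].

Lemma tpoly_vscale r l a : tpoly (vscale r l) a = r *: tpoly l a.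
by rewrite /tpoly big_map scaler_sumr; apply: eq_bigr => z _; rewrite !scalerA mulrC.
Qed.

Lemma wave_vscale r l a t : wave (vscale r l) a t = r *: wave l a t.
by rewrite /wave big_map scaler_sumr; apply: eq_bigr => z _; rewrite !scalerA mulrC.
Qed.

Lemma pos_freq_vscale r l : pos_freq (vscale r l) = pos_freq l.
by rewrite /pos_freq all_map. Qed.

Definition dilate M l : seq (nat * R * B) := [seq ((M * z.1.1)%N, z.1.2, z.2) | z <- l].

Lemma tpoly_dilate M l a : tpoly (dilate M l) a = tpoly l (M%:R * a).
rewrite /tpoly big_map; apply: eq_bigr => z _; congr (cos _ *: _) => /=.
by rewrite natrM; ring.
Qed.

Lemma wave_dilate M l a t : wave (dilate M l) a t = wave l (M%:R * a) (M%:R * t).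
rewrite /wave big_map; apply: eq_bigr => z _ /=; rewrite natrM; congr ((psi _ * cos _) *: _).
 by ring.
by ring.
Qed.

Lemma total_norm_dilate M l : total_norm (dilate M l) = total_norm l.
by rewrite /total_norm big_map. Qed.

Definition oscillation D u y : seq (nat * R * B) :=
 [seq (k.*2.+1, 0, u k *: y) | k <- index_iota 0 D].

Lemma tpoly_oscillation D u y a : tpoly (oscillation D u y) a = oddcos D u a *: y.
rewrite /tpoly big_map big_mkord /oddcos scaler_suml; apply: eq_bigr => k _ /=.
by rewrite addr0 scalerA mulrC.
Qed.

Definition oddwave D u a t : R :=
 \sum_(k < D) u k * (psi ((k.*2.+1)%:R * t) * cos (2 * pi * (k.*2.+1)%:R * a)).

Lemma wave_oscillation D u y a t : wave (oscillation D u y) a t = oddwave D u a t *: y.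
rewrite /wave big_map big_mkord /oddwave scaler_suml; apply: eq_bigr => k _ /=.
by rewrite addr0 scalerA mulrC.
Qed.

Lemma pos_freq_oscillation D u y : pos_freq (oscillation D u y).
by rewrite /pos_freq all_map; apply/allP. Qed.

(* The modes of [oddcos D u a * cos (2 * pi * M * k * a + phi)], by the product formula. *)
Definition modulate1 D u M (z : nat * R * B) : seq (nat * R * B) :=
 [seq ((M * z.1.1 + k.*2.+1)%N, z.1.2, (u k / 2) *: z.2) | k <- index_iota 0 D] ++
 [seq ((M * z.1.1 - k.*2.+1)%N, z.1.2, (u k / 2) *: z.2) | k <- index_iota 0 D].

Definition modulate D u M l := flatten [seq modulate1 D u M z | z <- l].

Lemma modulate_freq D u M l z : pos_freq l -> (2 * D < M)%N -> z \in modulate D u M l ->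
 (M - 2 * D <= z.1.1)%N.
move=> hl DM /flatten_mapP[w wl]; have w0 := allP hl w wl.
have Mw : (M <= M * w.1.1)%N by rewrite leq_pmulr.
move: Mw; rewrite mem_cat => Mw /orP[] /mapP[k]; rewrite mem_index_iota /= => kD -> /=;
 move: Mw; rewrite -muln2; move: (M * w.1.1)%N => q; lia.
Qed.

Lemma modulate_total_norm D u M l :
 total_norm (modulate D u M l) = (\sum_(k < D) `|u k|) * total_norm l.
elim: l => [|z l ih]; first by rewrite /total_norm !big_nil mulr0.
rewrite /modulate /= -/(modulate D u M l) !total_norm_cat ih [total_norm (z :: l)]big_cons.
rewrite mulrDr; congr (_ + _); rewrite /total_norm !big_map !big_mkord -big_split mulr_suml /=.
apply: eq_bigr => k _; rewrite /= normrZ normrM (gtr0_norm (x := 2^-1)) ?invr_gt0//.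
by field.
Qed.

Lemma natr_modulate D M (z : nat * R * B) k : (0 < z.1.1)%N -> (2 * D < M)%N -> (k < D)%N ->
 (M * z.1.1 - k.*2.+1)%:R = M%:R * z.1.1%:R - (k.*2.+1)%:R :> R.
move=> z0 DM kD; have Mw : (M <= M * z.1.1)%N by rewrite leq_pmulr.
by rewrite natrB ?natrM// -muln2; lia.
Qed.

Lemma modulate_phase (m x j a r : R) : [/\ 2 * pi * (m * x + j) * a + r = 2 * pi * (m * x) * a + r + 2 * pi * j * a,
 2 * pi * (m * x - j) * a + r = 2 * pi * (m * x) * a + r - 2 * pi * j * a &
 2 * pi * x * (m * a) + r = 2 * pi * (m * x) * a + r].
by split; ring. Qed.

Lemma tpoly_modulate D u M l a : pos_freq l -> (2 * D < M)%N ->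
 tpoly (modulate D u M l) a = oddcos D u a *: tpoly l (M%:R * a).
move=> hl DM; elim: l hl => [_|z l ih /= /andP[z0 hl]]; first by rewrite /tpoly !big_nil scaler0.
rewrite /modulate /= -/(modulate D u M l) !tpoly_cat ih// [tpoly (z :: l) _]big_cons.
rewrite scalerDr; congr (_ + _); rewrite /tpoly !big_map !big_mkord -big_split scalerA mulr_suml.
rewrite scaler_suml; apply: eq_bigr => k _; rewrite /= !scalerA -scalerDl; congr (_ *: _).
rewrite (natr_modulate z0 DM (ltn_ord k)) natrD natrM.
have := cos_mul2 (2 * pi * (M%:R * z.1.1%:R) * a + z.1.2) (2 * pi * (k.*2.+1)%:R * a).
have [-> -> ->] := modulate_phase M%:R z.1.1%:R (k.*2.+1)%:R a z.1.2.
by move=> h; rewrite -mulrDl -h; field.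
Qed.

(** If the profile hardly changes between the frequencies [M k] and [M k] plus or minus an odd
    number below [2 * D], then multiplication by the slow wave commutes with [wave] up to that
    change. *)
Lemma wave_modulate D u M l a t eta : pos_freq l -> (2 * D < M)%N ->
 (forall z k, z \in l -> (k < D)%N ->
  `|psi ((M * z.1.1 + k.*2.+1)%:R * t) - psi (z.1.1%:R * (M%:R * t))| <= eta /\
  `|psi ((M * z.1.1 - k.*2.+1)%:R * t) - psi (z.1.1%:R * (M%:R * t))| <= eta) ->
 `|wave (modulate D u M l) a t - oddcos D u a *: wave l (M%:R * a) (M%:R * t)| <=
 eta * ((\sum_(k < D) `|u k|) * total_norm l).
move=> hl DM; elim: l hl => [_ _|z l ih /= /andP[z0 hl] hz].
 by rewrite /wave !big_nil scaler0 subrr normr0 /total_norm big_nil !mulr0.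
have wc : wave (z :: l) (M%:R * a) (M%:R * t) =
  (psi (z.1.1%:R * (M%:R * t)) * cos (2 * pi * z.1.1%:R * (M%:R * a) + z.1.2)) *: z.2 +
  wave l (M%:R * a) (M%:R * t) by exact: big_cons.
have sc : total_norm (z :: l) = `|z.2| + total_norm l by exact: big_cons.
rewrite /modulate /= -/(modulate D u M l) !wave_cat wc sc scalerDr.
rewrite (mulrDr _ `|z.2|) (mulrDr eta) opprD addrACA.
apply: (le_trans (ler_normD _ _)); apply: lerD; last first.
 by apply: ih => // w k wl; apply: hz; rewrite inE wl orbT.
rewrite /wave !big_map !big_mkord -big_split /= scalerA mulr_suml scaler_suml -sumrB.
rewrite [leRHS](_ : _ = \sum_(k < D) eta * `|u k| * `|z.2|); last by rewrite mulrA mulr_sumr mulr_suml.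
apply: (le_trans (ler_norm_sum _ _ _)); apply: ler_sum => k _ /=.
have [h1 h2] := hz z k (mem_head _ _) (ltn_ord k).
move: h1 h2; rewrite !scalerA -scalerDl -scalerBl normrZ (natr_modulate z0 DM (ltn_ord k)) natrD natrM.
have := cos_mul2 (2 * pi * (M%:R * z.1.1%:R) * a + z.1.2) (2 * pi * (k.*2.+1)%:R * a).
have [-> -> ->] := modulate_phase M%:R z.1.1%:R (k.*2.+1)%:R a z.1.2.
set A := 2 * pi * _ * a + z.1.2; set J := 2 * pi * _ * a; set p1 := psi _; set p2 := psi _; set p3 := psi _.
move=> h h1 h2; apply: ler_wpM2r => //.
rewrite (_ : _ - _ = u k / 2 * ((p1 - p2) * cos (A + J) + (p3 - p2) * cos (A - J))); last first.
 have -> : u k * cos J * (p2 * cos A) = u k / 2 * p2 * (2 * (cos A * cos J)) by field.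
 by rewrite h; ring.
have e0 : 0 <= eta by exact: le_trans h1.
have k1 : `|(p1 - p2) * cos (A + J)| <= eta.
 by rewrite normrM -[leRHS]mulr1; apply: ler_pM => //; exact: cos_max.
have k2 : `|(p3 - p2) * cos (A - J)| <= eta.
 by rewrite normrM -[leRHS]mulr1; apply: ler_pM => //; exact: cos_max.
rewrite normrM normrM (gtr0_norm (x := 2^-1)) ?invr_gt0//.
have k3 : `|(p1 - p2) * cos (A + J) + (p3 - p2) * cos (A - J)| <= 2 * eta.
 by apply: (le_trans (ler_normD _ _)); lra.
apply: (le_trans (ler_wpM2l _ k3)); first side.
by rewrite le_eqVlt; apply/orP; left; apply/eqP; field.
Qed.

End mode_lists.

(** * Gluing two polynomials along a square wave *)

Section glued_polynomials.
Context (R : realType) (B : completeNormedModType R) (c alpha : R).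
Hypotheses (c0 : 0 < c) (a0 : 0 < alpha).
Implicit Types (l : seq (nat * R * B)) (a t r eta X : R) (u : nat -> R) (D M : nat) (x y : B).
Local Notation psi := (profile c alpha).
Local Notation wave := (wave c alpha).
Local Notation oddwave := (oddwave c alpha).

Lemma geometric_odd_sum N : \sum_(k < N) 8^-1 ^+ (k.+1.*2.+1) <= 8^-1 - 8^-1 ^+ N.+1 :> R.
elim: N => [|N ih]; first by rewrite big_ord0 expr1 subrr.
rewrite big_ord_recr /=; apply: (le_trans (lerD ih (lexx _))).
have h : 8^-1 ^+ (N.+1.*2.+1) <= 8^-1 ^+ N.+2 :> R.
 apply: ler_wiXn2l; rewrite ?invr_ge0// ?invf_le1// ?ler1n//.
 by rewrite -muln2; lia.
have e : 8^-1 ^+ N.+2 = 8^-1 * 8^-1 ^+ N.+1 :> R by side.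
have p0 : 0 <= 8^-1 ^+ N.+1 :> R by side.
by move: h; rewrite e; lra.
Qed.

(** Near a crest the first harmonic contributes at least [psi t / 2]; the others, with coefficients
    at most 2, contribute at most [2 * (1/8)] of [psi t] by the geometric series. *)
Lemma oddwave_lower D u (d t a : R) : 0 <= d -> (0 < D)%N -> 1 <= u 0%N ->
 (forall k, (k < D)%N -> `|u k| <= 2) -> d <= psi t ->
 (forall k : nat, (2 <= k)%N -> psi (k%:R * t) <= 8^-1 ^+ k * psi t) ->
 2^-1 <= `|cos (2 * pi * a)| -> d / 4 <= `|oddwave D u a t|.
move=> d0; case: D => // D _ u0 u2 dt ht ca; have p0 : 0 <= psi t by exact: le_trans dt.
rewrite /oddwave big_ord_recl /= mul1r mulr1.
set S := \sum_(i < D) _.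
have hS : `|S| <= 4^-1 * psi t.
 apply: (le_trans (ler_norm_sum _ _ _)).
 apply: (@le_trans _ _ (\sum_(k < D) 2 * psi t * 8^-1 ^+ (k.+1.*2.+1))).
  apply: ler_sum => k _; rewrite normrM -[leRHS]mulrA; apply: ler_pM => //.
   by apply: u2; rewrite /bump; have := ltn_ord k; lia.
  rewrite normrM -[leRHS]mulr1; apply: ler_pM => //; last exact: cos_max.
  rewrite ger0_norm ?profile_ge0//; rewrite [leRHS]mulrC; exact: ht.
 rewrite -mulr_sumr; have := geometric_odd_sum D.
 have q0 : 0 <= 8^-1 ^+ D.+1 :> R by side.
 move=> h; apply: (@le_trans _ _ (2 * psi t * 8^-1)); last by lra.
 by apply: ler_wpM2l; [rewrite mulr_ge0|lra].
have h1 : 2^-1 * psi t <= `|u 0%N * (psi t * cos (2 * pi * a))|.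
 rewrite normrM normrM (ger0_norm p0) (ger0_norm (le_trans ler01 u0)).
 have -> : u 0%N * (psi t * `|cos (2 * pi * a)|) = (u 0%N * `|cos (2 * pi * a)|) * psi t by ring.
 apply: ler_wpM2r => //; rewrite -[leLHS]mul1r; apply: ler_pM => //.
have := lerB_normD (u 0%N * (psi t * cos (2 * pi * a))) S.
by move=> h; apply: le_trans h; lra.
Qed.

Lemma convex_split (s : R) (v w : B) : v + s *: w = ((1 + s) / 2) *: (v + w) + ((1 - s) / 2) *: (v - w).
by lin v w (0 : B); field. Qed.

Lemma convex_diff (s : R) (v w : B) : 2^-1 *: (v + w) + s *: (2^-1 *: (v + -1 *: w)) =
 ((1 + s) / 2) *: v + ((1 - s) / 2) *: w.
by lin v w (0 : B); field. Qed.

Lemma odd_leq_double (k D : nat) : (k < D)%N -> (k.*2.+1 <= 2 * D)%N.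
by rewrite -muln2; lia. Qed.

Definition glued_rest D u M l1 l2 :=
 dilate M (vscale 2^-1 (l1 ++ l2)) ++
 modulate D u M (vscale 2^-1 (l1 ++ vscale (-1) l2)).

(** With [s] the square wave, [x] plus this polynomial is the convex combination, of weights
    [(1 + s) / 2] and [(1 - s) / 2], of [x + y + f1] and [x - y + f2], where [f1], [f2] are dilated
    by [M] ([tpoly_glued]). The list contains its modes: [s * y], half the sum of [f1] and [f2], and
    [s] times half their difference. *)
Definition glued D u M y l1 l2 := oscillation D u y ++ glued_rest D u M l1 l2.

Lemma pos_freq_pair l1 l2 r : pos_freq l1 -> pos_freq l2 -> pos_freq (vscale r (l1 ++ l2)).
by move=> h1 h2; rewrite pos_freq_vscale /pos_freq all_cat -/(pos_freq l1) h1. Qed.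

Lemma pos_freq_diff l1 l2 r r' : pos_freq l1 -> pos_freq l2 ->
 pos_freq (vscale r (l1 ++ vscale r' l2)).
by move=> h1 h2; apply: pos_freq_pair => //; rewrite pos_freq_vscale. Qed.

Lemma glued_rest_freq D u M l1 l2 z : pos_freq l1 -> pos_freq l2 -> (2 * D < M)%N ->
 z \in glued_rest D u M l1 l2 -> (M - 2 * D <= z.1.1)%N.
move=> h1 h2 DM; rewrite mem_cat => /orP[/mapP[w wl ->] /=|]; last first.
 by apply: modulate_freq => //; exact: pos_freq_diff.
have w0 := allP (pos_freq_pair 2^-1 h1 h2) w wl.
have Mw : (M <= M * w.1.1)%N by rewrite leq_pmulr.
exact: leq_trans (leq_subr _ _) Mw.
Qed.

Lemma pos_freq_glued D u M y l1 l2 : pos_freq l1 -> pos_freq l2 -> (2 * D < M)%N ->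
 pos_freq (glued D u M y l1 l2).
move=> h1 h2 DM; rewrite /pos_freq all_cat -/(pos_freq _) pos_freq_oscillation /=.
apply/allP => z /(glued_rest_freq h1 h2 DM); move: (z.1.1) => w; lia.
Qed.

Lemma tpoly_glued D u M x y l1 l2 a : pos_freq l1 -> pos_freq l2 -> (2 * D < M)%N ->
 x + tpoly (glued D u M y l1 l2) a =
 ((1 + oddcos D u a) / 2) *: (x + y + tpoly l1 (M%:R * a)) +
 ((1 - oddcos D u a) / 2) *: (x - y + tpoly l2 (M%:R * a)).
move=> h1 h2 DM; rewrite /glued !tpoly_cat tpoly_oscillation tpoly_dilate.
rewrite tpoly_modulate//; last exact: pos_freq_diff.
rewrite !tpoly_vscale !tpoly_cat tpoly_vscale.
set s := oddcos _ _ _; set p1 := tpoly l1 _; set p2 := tpoly l2 _.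
by rewrite addrA (convex_split s x y) (convex_diff s p1 p2) addrACA -!scalerDr.
Qed.

Lemma glued_norm_le1 D u M x y l1 l2 a : pos_freq l1 -> pos_freq l2 -> (2 * D < M)%N ->
 `|oddcos D u a| <= 1 -> (forall b, `|x + y + tpoly l1 b| <= 1) ->
 (forall b, `|x - y + tpoly l2 b| <= 1) -> `|x + tpoly (glued D u M y l1 l2) a| <= 1.
move=> h1 h2 DM s1 f1 f2; rewrite tpoly_glued//.
move: s1; rewrite ler_norml => /andP[s1 s2]; set s := oddcos D u a in s1 s2 *.
have w1 : 0 <= (1 + s) / 2 by lra.
have w2 : 0 <= (1 - s) / 2 by lra.
apply: (le_trans (ler_normD _ _)); rewrite (normrZ _ (x + y + _)) (normrZ _ (x - y + _)) (ger0_norm w1) (ger0_norm w2).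
have k1 := ler_wpM2l w1 (f1 (M%:R * a)).
have k2 := ler_wpM2l w2 (f2 (M%:R * a)).
by apply: (le_trans (lerD k1 k2)); lra.
Qed.

Lemma glued_rest_size D u l1 l2 : exists2 W, 0 < W & forall M, total_norm (glued_rest D u M l1 l2) <= W.
exists (total_norm (vscale 2^-1 (l1 ++ l2)) +
 (\sum_(k < D) `|u k|) * total_norm (vscale 2^-1 (l1 ++ vscale (-1) l2)) + 1).
 by rewrite ltr_wpDl// addr_ge0 ?mulr_ge0 ?total_norm_ge0 ?sumr_ge0.
by move=> M; rewrite total_norm_cat total_norm_dilate modulate_total_norm lerDl.
Qed.

(** At heights [t >= 1] only the oscillation is visible: the remaining frequencies are at least
    [M - 2 * D], where the profile is small. *)
Lemma glued_large D u y l1 l2 eta : 0 < eta -> pos_freq l1 -> pos_freq l2 -> exists C : R,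
 forall M t a, C <= M%:R -> (2 * D < M)%N -> 1 <= t ->
 `|wave (glued D u M y l1 l2) a t - oddwave D u a t *: y| <= eta.
move=> e0 h1 h2; have [Q Q0 hQ] := profile_decay c0 a0.
have [W W0 hW] := glued_rest_size D u l1 l2.
exists (2 * D%:R + Q * W / eta) => M t a CM DM t1.
rewrite wave_cat wave_oscillation addrC addKr.
have t0 : 0 < t by side.
apply: (@le_trans _ _ (eta / W * total_norm (glued_rest D u M l1 l2))); last first.
 apply: (le_trans (ler_wpM2l (ltW (divr_gt0 e0 W0)) (hW M))).
 by rewrite divfK// gt_eqF.
apply: wave_norm_le => z /(glued_rest_freq h1 h2 DM) hz.
have hz' : Q * W / eta <= z.1.1%:R.
 apply: (@le_trans _ _ (M - 2 * D)%:R); last by rewrite ler_nat.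
 by rewrite natrB ?(ltnW DM)// natrM; lra.
have z0 : 0 < z.1.1%:R :> R by apply: lt_le_trans hz'; rewrite divr_gt0// mulr_gt0.
rewrite ger0_norm ?profile_ge0//; apply: (le_trans (hQ _ (mulr_gt0 z0 t0))).
rewrite ler_pdivrMr ?mulr_gt0//.
have k1 : Q <= eta / W * z.1.1%:R.
 rewrite mulrAC ler_pdivlMr//; move: hz'; rewrite ler_pdivrMr// mulrC => h; lra.
apply: (le_trans k1); rewrite ler_wpM2l ?(ltW (divr_gt0 e0 W0))//.
by rewrite -[leLHS]mulr1 ler_wpM2l// ltW.
Qed.

(** At heights [t / M] with [t <= X] the oscillation is invisible, its frequencies being low, and
    the square wave behaves as a constant, since [M k] and the modulated frequencies have nearly the
    same profile. *)
Lemma glued_small D u y l1 l2 eta X : 0 < eta -> 0 < X -> pos_freq l1 -> pos_freq l2 ->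
 (forall a, `|oddcos D u a| <= 1) -> exists C : R,
 forall M t a, C <= M%:R -> (2 * D < M)%N -> 0 < t -> t <= X ->
 `|wave (glued D u M y l1 l2) a (t / M%:R) -
  (((1 + oddcos D u a) / 2) *: wave l1 (M%:R * a) t + ((1 - oddcos D u a) / 2) *: wave l2 (M%:R * a) t)| <= eta.
move=> e0 X0 h1 h2 s1.
pose l := vscale 2^-1 (l1 ++ vscale (-1) l2).
have hl : pos_freq l by exact: pos_freq_diff.
pose W1 := total_norm (oscillation D u y) + 1.
have W10 : 0 < W1 by rewrite ltr_wpDl// total_norm_ge0.
pose W2 := (\sum_(k < D) `|u k|) * total_norm l + 1.
have W20 : 0 < W2 by rewrite ltr_wpDl// mulr_ge0 ?sumr_ge0 ?total_norm_ge0.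
have eW1 : 0 < eta / 2 / W1 by side.
have eW2 : 0 < eta / 2 / W2 by side.
have [r0 r00 hr0] := profile_small c0 a0 eW1.
pose r1 := (\sum_(z <- l) z.1.1%:R + 1) * X.
have r10 : 0 < r1 by rewrite mulr_gt0// ltr_wpDl// sumr_ge0.
have [K K0 hK] := profile_continuous c0 a0 r10.
(* [C1] makes the profile small at the frequencies of the oscillation; [C2], [C3] and [C4] bring the
   relative change [2 * D / M] of the modulated frequencies into the range of [profile_continuous]
   and its effect below half of [eta]. *)
pose C1 := 2 * D%:R * X / r0.
pose C2 := 2 * D%:R * K / 2^-1.
pose C3 := 2 * D%:R * K / (eta / 2 / W2).
pose C4 : R := 4 * D%:R.
have C10 : 0 <= C1 by exact: (divr_ge0 (mulr_ge0 (mulr_ge0 (ler0n _ 2) (ler0n _ D)) (ltW X0)) (ltW r00)).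
have DK : 0 <= 2 * D%:R * K by side.
have C20 : 0 <= C2 by rewrite divr_ge0// invr_ge0.
have C30 : 0 <= C3 by exact: (divr_ge0 DK (ltW eW2)).
have C40 : 0 <= C4 by rewrite mulr_ge0.
exists (C1 + C2 + C3 + C4) => M t a CM DM t0 tX.
have M0 : 0 < M%:R :> R by rewrite ltr0n; exact: leq_ltn_trans (leq0n _) DM.
pose d := 2 * D%:R / M%:R : R.
have d0 : 0 <= d by rewrite divr_ge0 ?mulr_ge0 ?ler0n ?ltW.
have dC (x : R) : 0 < x -> 2 * D%:R * K / x <= M%:R -> K * d <= x.
 move=> x0; rewrite ler_pdivrMr// => h; rewrite /d mulrA ler_pdivrMr//.
 by rewrite mulrC [x * _]mulrC.
have Kd2 : K * d <= 2^-1 by apply: dC; rewrite ?invr_gt0// -/C2; lra.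
have Kd3 : K * d <= eta / 2 / W2 by apply: dC => //; rewrite -/C3; lra.
have d2 : d <= 2^-1 by rewrite /d ler_pdivrMr//; rewrite /C4 in CM C40; lra.
have osc : `|wave (oscillation D u y) a (t / M%:R)| <= eta / 2.
 apply: (@le_trans _ _ (eta / 2 / W1 * total_norm (oscillation D u y))); last first.
  rewrite mulrAC ler_pdivrMr//; apply: ler_wpM2l; first side.
  by rewrite lerDl.
 apply: wave_norm_le => z /mapP[k]; rewrite mem_index_iota /= => kD -> /=.
 rewrite ger0_norm ?profile_ge0//; apply: hr0; first side.
 have k2D : (k.*2.+1)%:R <= 2 * D%:R :> R by rewrite -natrM ler_nat odd_leq_double.
 rewrite mulrA ler_pdivrMr//.
 apply: (@le_trans _ _ (2 * D%:R * X)); first by apply: ler_pM => //; rewrite ?ler0n// ltW.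
 have : C1 <= M%:R by lra.
 by rewrite /C1 ler_pdivrMr// [r0 * _]mulrC.
have Mt : M%:R * (t / M%:R) = t by rewrite mulrCA divff ?mulr1// gt_eqF.
have fr z : z \in l -> [/\ (0 < z.1.1)%N, 0 < z.1.1%:R * t & z.1.1%:R * t <= r1].
 move=> zl; have z0 := allP hl z zl; split => //; first by rewrite mulr_gt0// ltr0n.
 apply: ler_pM; rewrite ?ler0n ?(ltW t0)//.
 rewrite (big_rem z zl) /= -addrA lerDl addr_ge0//; exact: sumr_ge0.
have dist z (k : nat) (w : R) : z \in l -> (k < D)%N -> w = (k.*2.+1)%:R \/ w = - (k.*2.+1)%:R ->
  `|psi ((M%:R * z.1.1%:R + w) * (t / M%:R)) - psi (z.1.1%:R * t)| <= eta / 2 / W2.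
 move=> zl kD hw; have [z0 zt0 ztr] := fr z zl.
 apply: le_trans Kd3; apply: hK => //.
 have -> : (M%:R * z.1.1%:R + w) * (t / M%:R) - z.1.1%:R * t = w * (t / M%:R).
  by field; rewrite gt_eqF.
 have wD : `|w| <= 2 * D%:R.
  have -> : `|w| = (k.*2.+1)%:R.
   by case: hw => ->; rewrite ?normrN ger0_norm.
  by rewrite -natrM ler_nat odd_leq_double.
 have tM0 : 0 <= t / M%:R := divr_ge0 (ltW t0) (ltW M0).
 rewrite normrM (ger0_norm tM0).
 have -> : d * (z.1.1%:R * t) = 2 * D%:R * z.1.1%:R * (t / M%:R) by rewrite /d; field; rewrite gt_eqF.
 apply: (ler_wpM2r tM0).
 by apply: (le_trans wD); rewrite -[leLHS]mulr1 ler_wpM2l ?mulr_ge0 ?ler0n// ler1n.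
have md : `|wave (modulate D u M l) a (t / M%:R) - oddcos D u a *: wave l (M%:R * a) t| <= eta / 2.
 rewrite -{2}Mt; apply: (@le_trans _ _ (eta / 2 / W2 * ((\sum_(k < D) `|u k|) * total_norm l))).
  apply: wave_modulate => // z k zl kD; have [z0 _ _] := fr z zl; rewrite Mt; split.
   by rewrite natrD natrM; apply: (dist z k) => //; left.
  by rewrite (natr_modulate z0 DM kD); apply: (dist z k) => //; right.
 rewrite mulrAC ler_pdivrMr//; apply: ler_wpM2l; first side.
 by rewrite lerDl.
rewrite /glued /glued_rest -/l !wave_cat wave_dilate Mt wave_vscale wave_cat.
move: md; rewrite wave_vscale wave_cat wave_vscale.
set s := oddcos D u a; set w1 := wave l1 _ _; set w2 := wave l2 _ _.
set o := wave (oscillation _ _ _) _ _ in osc *; set m := wave (modulate _ _ _ _) _ _ => md.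
have -> : o + (2^-1 *: (w1 + w2) + m) - (((1 + s) / 2) *: w1 + ((1 - s) / 2) *: w2) =
  o + (m - s *: (2^-1 *: (w1 + -1 *: w2))).
 rewrite -addrA; congr (o + _).
 have e : 2^-1 *: (w1 + w2) - (((1 + s) / 2) *: w1 + ((1 - s) / 2) *: w2) =
  - (s *: (2^-1 *: (w1 + -1 *: w2))) by rewrite -convex_diff opprD addrA subrr sub0r.
 by rewrite [_ + m]addrC -addrA e.
by apply: (le_trans (ler_normD _ _)); lra.
Qed.

End glued_polynomials.

(** * Cells of a subdivided period *)

Section cells.
Context (R : realType).
Local Notation mu := (@lebesgue_measure R).

(** For [E] in the unit interval, its copy shrunk by [M] into the [i]-th interval of length
    [1 / M]. *)
Definition cell (M i : nat) (E : set R) : set R := (fun a => M%:R * a - i%:R) @^-1` E.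

Lemma meas_cell M i E : measurable E -> measurable (cell M i E).
move=> mE; rewrite -[X in measurable X]setTI.
exact: (meas_affine M%:R (- i%:R) measurableT mE).
Qed.

Lemma cell_measure M i E : (0 < M)%N -> measurable E -> mu (cell M i E) = (M%:R^-1%:E * mu E)%E.
by move=> M0 mE; apply: lebesgue_measure_affine => //; rewrite ltr0n. Qed.

Lemma cell_bounds M i (E : set R) a : (0 < M)%N -> E `<=` `[0, 1[%classic -> cell M i E a ->
 i%:R / M%:R <= a <= i.+1%:R / M%:R.
move=> M0 E1 /E1; rewrite /= in_itv /= => /andP[h1 h2].
have MR : 0 < M%:R :> R by rewrite ltr0n.
by rewrite ler_pdivrMr// ler_pdivlMr// mulrC -natr1; apply/andP; split; lra.
Qed.

Lemma cos_le_abs (x y : R) : `|x| <= y -> y <= pi -> cos y <= cos x.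
move=> xy y1; have -> : cos x = cos `|x| by case: ger0P => _; rewrite ?cosN.
have y0 : 0 <= y by exact: le_trans xy.
by rewrite leNgt ltr_cos ?in_itv /= ?y0 ?y1 ?normr_ge0 ?(le_trans xy)// -leNgt.
Qed.

(* The arcs where [cos (2 pi a)] is bounded away from 0 are cut into cells of length [1 / (4 K)]. *)
Definition cell_sign (K r i : nat) : option bool :=
 if ((i < K - r) || (3 * K + r <= i))%N then Some true
 else if (K + r <= i < 3 * K - r)%N then Some false else None.

Lemma cell_sign_cos K r i (a : R) : (0 < K)%N -> (r <= K)%N -> (i < 4 * K)%N ->
 i%:R / (4 * K)%:R <= a <= i.+1%:R / (4 * K)%:R ->
 (cell_sign K r i = Some true -> exists m : nat, `|a - m%:R| <= (K - r)%:R / (4 * K)%:R) /\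
 (cell_sign K r i = Some false -> `|a - 2^-1| <= (K - r)%:R / (4 * K)%:R).
move=> K0 rK iK; have KR : 0 < K%:R :> R by rewrite ltr0n.
have K4 : 0 < (4 * K)%:R :> R by rewrite ltr0n muln_gt0.
have e4 : (4 * K)%:R = 4 * K%:R :> R by rewrite natrM.
rewrite ler_pdivrMr// ler_pdivlMr// => /andP[h1 h2].
have key (z : R) (j : nat) : z = j%:R / (4 * K)%:R -> (j <= i + (K - r))%N -> (i < j + (K - r))%N ->
  `|a - z| <= (K - r)%:R / (4 * K)%:R.
 move=> -> j1 j2; rewrite ler_pdivlMr// -[X in _ * X](gtr0_norm K4) -normrM mulrBl divfK ?gt_eqF//.
 have k1 : j%:R <= i%:R + (K - r)%:R :> R by rewrite -natrD ler_nat.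
 have k2 : i.+1%:R <= j%:R + (K - r)%:R :> R by rewrite -natrD ler_nat.
 by rewrite ler_norml; apply/andP; split; lra.
rewrite /cell_sign; case: ifP => [/orP[hi|hi]|hi].
- by split => // _; exists 0%N; apply: (key _ 0%N); rewrite ?mul0r//; lia.
- split => // _; exists 1%N; apply: (key _ (4 * K)%N); rewrite ?divff ?gt_eqF//; lia.
- case: ifP => // /andP[h3 h4]; split => // _; apply: (key _ (2 * K)%N); try lia.
 by rewrite e4 natrM; field; rewrite gt_eqF.
Qed.

Lemma sum_cell_sign K r (e1 e2 : R) : (r <= K)%N -> 0 <= e1 -> 0 <= e2 ->
 \sum_(i < 4 * K) (if cell_sign K r i is Some b then (if b then e1 else e2) else 0) =
 2 * (K - r)%:R * (e1 + e2).
move=> rK e10 e20; pose F i := if cell_sign K r i is Some b then (if b then e1 else e2) else 0.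
rewrite -(big_mkord xpredT F).
have cst (m k : nat) (v : R) : (m <= k)%N -> (forall i, (m <= i < k)%N -> F i = v) ->
  \sum_(m <= i < k) F i = (k - m)%:R * v.
 move=> mk h; rewrite (eq_big_nat _ _ h) big_const_nat iter_addr_0.
 by rewrite mulr_natl.
rewrite (@big_cat_nat _ _ _ (K - r) 0 (4 * K))//=; [|lia].
rewrite (@big_cat_nat _ _ _ (K + r) (K - r) (4 * K))//=; [|lia|lia].
rewrite (@big_cat_nat _ _ _ (3 * K - r) (K + r) (4 * K))//=; [|lia|lia].
rewrite (@big_cat_nat _ _ _ (3 * K + r) (3 * K - r) (4 * K))//=; [|lia|lia].
rewrite (cst _ _ e1)//; last by move=> i hi; rewrite /F /cell_sign ifT//; lia.
rewrite (cst _ _ 0); [|lia|by move=> i hi; rewrite /F /cell_sign ifF ?ifF//; lia].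
rewrite (cst _ _ e2); [|lia|by move=> i hi; rewrite /F /cell_sign ifF ?ifT//; lia].
rewrite (cst _ _ 0); [|lia|by move=> i hi; rewrite /F /cell_sign ifF ?ifF//; lia].
rewrite (cst _ _ e1); [|lia|by move=> i hi; rewrite /F /cell_sign ifT//; lia].
have -> : (3 * K - r - (K + r) = 2 * (K - r))%N by lia.
have -> : (4 * K - (3 * K + r) = K - r)%N by lia.
by rewrite subn0 natrM; ring.
Qed.

End cells.

(** * Distribution of the square sum under gluing *)

Section gluing.
Context (R : realType) (B : completeNormedModType R) (c alpha q T d : R).
Hypotheses (c0 : 0 < c) (a0 : 0 < alpha) (q1 : 1 <= q) (T1 : 1 <= T) (d0 : 0 < d).
Hypothesis hT : forall t, T <= t <= 2 * T -> d <= profile c alpha t /\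
 forall k : nat, (2 <= k)%N -> profile c alpha (k%:R * t) <= 8^-1 ^+ k * profile c alpha t.
Implicit Types (l : seq (nat * R * B)) (a b t eta X : R) (u : nat -> R) (D M : nat) (x y : B).
Local Notation psi := (profile c alpha).
Local Notation wave := (wave c alpha).
Local Notation kappa := ((16 * T)^-1).
Local Notation detects := (detects c alpha kappa).
Local Notation mu := (@lebesgue_measure R).

Ltac keep_lra := clear -B c0 a0 q1 T1 d0 hT; lra.

(** Lowering an amplitude by [eta] costs at most [eta] times the derivative of the power [q] at the
    upper bound [W]. *)
Lemma powR_sub_max (z W eta : R) : 0 <= z -> z <= W -> 0 <= eta ->
 z `^ q <= Num.max 0 (z - eta) `^ q + q * W `^ (q - 1) * eta.
move=> z0 zW e0; pose m := Num.max 0 (z - eta).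
have m0 : 0 <= m by rewrite le_max lexx.
have mz : m <= z by rewrite ge_max z0 /= lerBlDr lerDl.
have zm : z - m <= eta.
 have : z - eta <= m by rewrite le_max lexx orbT.
 by lra.
have q0 : 0 <= q by side.
have h1 := powR_sub_le q1 m0 mz.
have h2 : z `^ (q - 1) <= W `^ (q - 1).
 by apply: ge0_ler_powR; rewrite ?nnegrE ?subr_ge0//; exact: le_trans zW.
have h3 : q * (z - m) * z `^ (q - 1) <= q * eta * W `^ (q - 1).
 by apply: ler_pM; rewrite ?mulr_ge0 ?powR_ge0 ?subr_ge0// ler_wpM2l.
by rewrite -/m; lra.
Qed.

(** The reason for shifted windows: at a zero of the cosine nothing would be detected. Crests are
    [1/2] apart, so one lies within [1/4] of [a], a shift by at most [T / 2]; moving by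
    [kappa * T = 1/16] around it keeps the cosine above [1/2] in modulus. *)
Lemma crest_offset (a : R) : 0 <= a <= 1 -> exists o : R, `|o| <= 2^-1 /\
 forall a', `|a' - (a + o * T)| <= kappa * T -> 2^-1 <= `|cos (2 * pi * a')|.
have T0 : 0 < T by side.
have kT : kappa * T = 16^-1 by field; rewrite gt_eqF.
move=> /andP[ha0 ha1].
have [m hm] : exists m : nat, `|m%:R / 2 - a| <= 4^-1.
 have [h|h] := leP a 4^-1; first by exists 0%N; rewrite ler_norml; apply/andP; split; lra.
 have [h'|h'] := leP a (3 / 4); first by exists 1%N; rewrite ler_norml; apply/andP; split; lra.
 by exists 2%N; rewrite ler_norml; apply/andP; split; lra.
exists ((m%:R / 2 - a) / T); split.
 rewrite normrM normfV (gtr0_norm T0) ler_pdivrMr//.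
 by apply: (le_trans hm); have := T1; lra.
move=> a'; rewrite kT divfK ?gt_eqF// (_ : a + (m%:R / 2 - a) = m%:R / 2); last by ring.
move=> ha'.
have pi4 : pi <= 4 :> R by have := @pihalf_lt2 R; lra.
have pi2 := @pi_ge2 R.
pose z := 2 * pi * (a' - m%:R / 2).
have hz : `|z| <= 2^-1.
 rewrite /z normrM (ger0_norm (x := 2 * pi)); last by rewrite mulr_ge0 ?pi_ge0.
 by apply: (@le_trans _ _ (2 * pi * 16^-1)); [rewrite ler_wpM2l ?mulr_ge0 ?pi_ge0|lra].
have cz : 2^-1 <= cos z.
 have hh : 2^-1 <= cos (2^-1 : R).
  have c1 := @cos1_gt0 R.
  have e : cos (1 : R) = 2 * cos 2^-1 ^+ 2 - 1.
   have := cosD (2^-1 : R) 2^-1; have -> : 2^-1 + 2^-1 = 1 :> R by field.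
   by move=> ->; rewrite -!expr2 sin2cos2; ring.
  have p0 : 0 <= cos (2^-1 : R) by apply: cos_ge0_pihalf; apply/andP; split; lra.
  by nra.
 by apply: (le_trans hh); apply: cos_le_abs => //; lra.
have -> : 2 * pi * a' = z + pi * m%:R by rewrite /z; field.
have cpi (k : nat) : `|cos (z + pi * k%:R)| = `|cos z|.
 elim: k => [|k ih]; first by rewrite mulr0 addr0.
 have -> : z + pi * k.+1%:R = z + pi * k%:R + pi by rewrite -natr1; ring.
 by rewrite cosDpi normrN.
by rewrite cpi; apply: (le_trans cz); exact: ler_norm.
Qed.

(** The heights of [ts], divided by [M], are completed by the height [T]. At [T] the glued
    polynomial looks like the square wave times [y] and contributes [(d / 4 * |y|) ^ q]; at the
    small heights it looks like the polynomial [l'] used in the cell of [a]. All amplitudes are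
    lowered by [eta], whose total cost over at most [S.+1] heights is deducted in advance. The
    condition [2 * X < T * M] keeps the heights separated. *)
Lemma glue_point D u M y l l' ts h off (a b A W eta X : R) (S i : nat) :
 (0 < D)%N -> 1 <= u 0%N -> (forall k, (k < D)%N -> `|u k| <= 2) -> (0 < M)%N ->
 0 < eta -> 0 <= a <= 1 -> 0 <= X -> 2 * X < T * M%:R ->
 (forall a' t, 1 <= t -> `|wave l a' t - oddwave c alpha D u a' t *: y| <= eta) ->
 (forall a' t, `|a' - a| <= X / M%:R -> 0 < t -> t <= 2 * X ->
  `|wave l a' (t / M%:R) - wave l' (M%:R * a') t| <= eta) ->
 (forall a' t, `|wave l' a' t| <= W) -> d / 4 * `|y| <= W ->
 separated ts -> (size ts <= S)%N -> (forall s, s \in ts -> s <= X) ->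
 detects l' ts h off (M%:R * a - i%:R) ->
 A < b + (d / 4 * `|y|) `^ q - S.+1%:R * (q * W `^ (q - 1) * eta) + \sum_(s <- ts) h s `^ q ->
 exists ts' h' off', [/\ separated ts', (size ts' <= S.+1)%N,
  forall s, s \in ts' -> s <= T + X, detects l ts' h' off' a &
  A < b + \sum_(s <- ts') h' s `^ q].
move=> D0 u0 u2 M0 e0 a01 X00 XT hbig hsmall hW yW [uts ts0 sep] sS sX hdet hA.
have T0 : 0 < T by side.
have MR : 0 < M%:R :> R by rewrite ltr0n.
have [oT [oT1 hoT]] := crest_offset a01.
pose g (s : R) := s / M%:R.
have gK s : M%:R * g s = s by rewrite /g mulrCA divff ?mulr1 ?gt_eqF.
have gI : injective g by move=> s s' e; rewrite -[s]gK e gK.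
have gT s : s \in ts -> 2 * g s < T.
 move=> sts; rewrite /g mulrA ltr_pdivrMr//; apply: le_lt_trans XT.
 by rewrite ler_pM2l// sX.
have g0 s : s \in ts -> 0 < g s by move=> sts; rewrite divr_gt0// ts0.
have gnT s : s \in ts -> (g s == T) = false.
 by move=> sts; apply/negbTE/eqP => e; have := gT s sts; have := g0 s sts; lra.
pose h' s := if s == T then Num.max 0 (d / 4 * `|y| - eta) else Num.max 0 (h (M%:R * s) - eta).
pose off' s := if s == T then oT else off (M%:R * s).
have k0 : 0 < kappa by side.
have k1 : kappa <= 2^-1 by rewrite lef_pV2 ?posrE ?mulr_gt0//; have := T1; lra.
have X0 s : s \in ts -> 0 < X by move=> sts; exact: lt_le_trans (ts0 s sts) (sX s sts).
exists (T :: [seq g s | s <- ts]), h', off'; split.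
- split.
 + rewrite /= map_inj_uniq// uts andbT; apply/mapP => -[s sts e].
  by have := gnT s sts; rewrite -e eqxx.
 + by move=> t; rewrite inE => /predU1P[->//|/mapP[s sts ->]]; exact: g0.
 + move=> s t; rewrite !inE => /predU1P[->|/mapP[s' s'ts ->]] /predU1P[->|/mapP[t' t'ts ->]].
  * by rewrite ltxx.
  * by move=> h1; have := gT t' t'ts; have := g0 t' t'ts; lra.
  * by move=> _; exact: gT.
  * rewrite /g ltr_pM2r ?invr_gt0// => h1; rewrite mulrA ltr_pM2r ?invr_gt0//; exact: sep.
- by rewrite /= size_map ltnS.
- move=> s; rewrite inE => /predU1P[->|/mapP[s' s'ts ->]].
  by rewrite lerDl.
 rewrite /g; apply: (@le_trans _ _ X); last by rewrite lerDr ltW.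
 rewrite ler_pdivrMr//; apply: (le_trans (sX s' s'ts)).
 by rewrite -[leLHS]mulr1 ler_wpM2l ?(ltW (X0 s' s'ts))// ler1n.
- move=> s; rewrite inE => /predU1P[->|/mapP[s' s'ts ->]].
  rewrite /h' /off' eqxx; split => //; first by rewrite le_max lexx.
  move=> a' t ha' /andP[t1 t2].
  have t2T : t <= 2 * T.
   by apply: (le_trans t2); apply: ler_wpM2r; [exact: ltW|lra].
  have [dt ht] : d <= psi t /\ forall k : nat, (2 <= k)%N -> psi (k%:R * t) <= 8^-1 ^+ k * psi t.
   by apply: hT; rewrite t1.
  rewrite ge_max normr_ge0 /= lerBlDr.
  have ow := oddwave_lower c0 a0 (ltW d0) D0 u0 u2 dt ht (hoT a' ha').
  have := hbig a' t (le_trans T1 t1); rewrite distrC => hb.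
  have := ler_wpM2r (normr_ge0 y) ow; rewrite -normrZ => hc.
  by move: hb hc (lerB_dist (oddwave c alpha D u a' t *: y) (wave l a' t)); keep_lra.
 rewrite /h' /off' gnT// gK; have [hs os hd] := hdet s' s'ts; split => //.
  by rewrite le_max lexx.
 have s0 := ts0 s' s'ts.
 move=> a' t ha' /andP[t1 t2].
 have t0 : 0 < t by apply: lt_le_trans t1; exact: g0.
 have Ms : M%:R * (kappa * g s') = kappa * s' by rewrite mulrCA gK.
 have ha2 : `|M%:R * a' - i%:R - (M%:R * a - i%:R + off s' * s')| <= kappa * s'.
  have -> : M%:R * a' - i%:R - (M%:R * a - i%:R + off s' * s') = M%:R * (a' - (a + off s' * g s')).
   have -> : off s' * s' = M%:R * (off s' * g s') by rewrite mulrCA gK.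
   by ring.
  by rewrite normrM (gtr0_norm MR) -Ms ler_pM2l.
 have hMt : s' <= M%:R * t <= (1 + kappa) * s'.
  apply/andP; split; first by rewrite -[leLHS]gK ler_pM2l.
  have -> : (1 + kappa) * s' = M%:R * ((1 + kappa) * g s') by rewrite mulrCA gK.
  by rewrite ler_pM2l.
 have h1 := hd _ _ ha2 hMt.
 have -> : wave l a' t = wave l a' (M%:R * t / M%:R) by congr wave; field; rewrite gt_eqF.
 have h2 : wave l' (M%:R * a' - i%:R) (M%:R * t) = wave l' (M%:R * a') (M%:R * t).
  by rewrite -[LHS](wave_period _ _ _ _ _ i) subrK.
 have h3 : `|a' - a| <= X / M%:R.
  have : `|a' - a| <= `|a' - (a + off s' * g s')| + `|off s' * g s'|.
   by have := ler_normD (a' - (a + off s' * g s')) (off s' * g s'); rewrite opprD addrA subrK.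
  have : `|off s' * g s'| <= 2^-1 * g s' by rewrite normrM (gtr0_norm (g0 s' s'ts)) ler_wpM2r ?(ltW (g0 s' s'ts)).
  have : kappa * g s' <= 2^-1 * g s' by rewrite ler_wpM2r ?(ltW (g0 s' s'ts)).
  have : g s' <= X / M%:R by rewrite /g ler_pM2r ?invr_gt0// sX.
  by lra.
 have h4 : M%:R * t <= 2 * X.
  case/andP: hMt => _ hM; apply: (le_trans hM).
  by apply: ler_pM; [move: k0; keep_lra|exact: ltW|move: k1; keep_lra|exact: sX].
 have := hsmall a' (M%:R * t) h3 (mulr_gt0 MR t0) h4; rewrite distrC => h5.
 rewrite ge_max normr_ge0 /= lerBlDr; rewrite h2 in h1.
 by move: h1 h5 (lerB_dist (wave l' (M%:R * a') (M%:R * t)) (wave l a' (M%:R * t / M%:R))); keep_lra.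
apply: (lt_le_trans hA); rewrite -!addrA lerD2l big_cons big_map /h' eqxx.
have e1 := powR_sub_max (mulr_ge0 (ltW (divr_gt0 d0 (ltr0Sn R 3))) (normr_ge0 y)) yW (ltW e0).
have hle s : s \in ts -> 0 <= h s /\ h s <= W.
 move=> sts; have [hs os hd] := hdet s sts; split => //.
 apply: le_trans (hW (M%:R * a - i%:R + off s * s) s); apply: hd.
  by rewrite subrr normr0 mulr_ge0 ?(ltW k0)// ltW// ts0.
 by rewrite lexx /= -[leLHS]mul1r ler_wpM2r ?(ltW (ts0 s sts))// lerDl ltW.
have e2 : \sum_(s <- ts) h s `^ q <= \sum_(s <- ts) h' (g s) `^ q + (size ts)%:R * (q * W `^ (q - 1) * eta).
 rewrite mulr_natl -iter_addr_0 -count_predT -big_const_seq -big_split /=.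
 rewrite big_seq [leRHS]big_seq; apply: ler_sum => s sts.
 have [hs0 hsW] := hle s sts.
 by rewrite /h' gnT// gK; exact: powR_sub_max hs0 hsW (ltW e0).
have Q0 : 0 <= q * W `^ (q - 1) * eta by side.
have e3 : (size ts)%:R * (q * W `^ (q - 1) * eta) <= S%:R * (q * W `^ (q - 1) * eta) by rewrite ler_wpM2r// ler_nat.
have e4 : S.+1%:R * (q * W `^ (q - 1) * eta) = S%:R * (q * W `^ (q - 1) * eta) + q * W `^ (q - 1) * eta.
 by rewrite -natr1; ring.
rewrite e4; move: e1 e2; rewrite /h'; lra.
Qed.

(** A distributional statement: some polynomial has square sum above [A - b] on a set of measure at
    least [v] in a period. The number [b] is the gain already collected at larger scales. *)
Definition attains A x b v : Prop := exists l (E : set R) X S,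
 [/\ pos_freq l, forall a, `|x + tpoly l a| <= 1, measurable E /\ E `<=` `[0, 1[%classic,
  (v%:E <= mu E)%E & forall a, E a -> exists ts h off, [/\ separated ts, (size ts <= S)%N,
   forall s, s \in ts -> s <= X, detects l ts h off a & A < b + \sum_(s <- ts) h s `^ q]].

(** Cells with a sign keep a distance from the zeros of the cosine, so even points at distance up to
    [X] cell lengths see the cosine bounded away from 0 with the right sign. *)
Lemma cell_sign_gap Q K i X a a' : (0 < Q)%N -> (0 < K)%N -> 2 * X <= K%:R -> (i < 4 * (Q * K))%N ->
 i%:R / (4 * (Q * K))%:R <= a <= i.+1%:R / (4 * (Q * K))%:R -> `|a' - a| <= X / (4 * (Q * K))%:R ->
 (cell_sign (Q * K) K i = Some true -> cos (pi / 2 - pi / (4 * Q%:R)) <= cos (2 * pi * a')) /\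
 (cell_sign (Q * K) K i = Some false -> cos (2 * pi * a') <= - cos (pi / 2 - pi / (4 * Q%:R))).
move=> Q0 K0 XK iK ha ha'.
have QR : 0 < Q%:R :> R by rewrite ltr0n.
have KR : 0 < K%:R :> R by rewrite ltr0n.
have QKK : (K <= Q * K)%N by rewrite leq_pmull.
have QK0 : (0 < Q * K)%N by rewrite muln_gt0 Q0.
have [ct cf] := cell_sign_cos QK0 QKK iK ha.
have pi0 := @pi_gt0 R.
have key z : `|a - z| <= (Q * K - K)%:R / (4 * (Q * K))%:R ->
  cos (pi / 2 - pi / (4 * Q%:R)) <= cos (2 * pi * (a' - z)).
 move=> hz; apply: cos_le_abs; last first.
  have : 0 <= pi / (4 * Q%:R) :> R by side.
  by lra.
 rewrite normrM (ger0_norm (x := 2 * pi)); last by rewrite mulr_ge0 ?(ltW pi0).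
 have h1 : `|a' - z| <= X / (4 * (Q * K))%:R + (Q * K - K)%:R / (4 * (Q * K))%:R.
  by apply: le_trans (lerD ha' hz); have := ler_normD (a' - a) (a - z); rewrite addrA subrK.
 have h2 : X / (4 * (Q * K))%:R <= 1 / (8 * Q%:R).
  rewrite !natrM ler_pdivrMr ?mulr_gt0// (_ : 1 / (8 * Q%:R) * (4 * (Q%:R * K%:R)) = K%:R / 2); last first.
   by field; rewrite gt_eqF.
  by lra.
 have h3 : (Q * K - K)%:R / (4 * (Q * K))%:R = 4^-1 - 2 / (8 * Q%:R) :> R.
  by rewrite natrB// !natrM; field; rewrite !gt_eqF.
 have -> : pi / 2 - pi / (4 * Q%:R) = 2 * pi * (4^-1 - 1 / (8 * Q%:R)) :> R by field; rewrite gt_eqF.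
 by apply: ler_wpM2l; [rewrite mulr_ge0 ?(ltW pi0)|lra].
split=> [/ct[m /key]|/cf /key].
 rewrite -(cos_period (2 * pi * (a' - m%:R)) m).
 by have -> : 2 * pi * (a' - m%:R) + 2 * pi * m%:R = 2 * pi * a' by ring.
have -> : 2 * pi * a' = 2 * pi * (a' - 2^-1) + pi by field.
by rewrite cosDpi lerN2.
Qed.

Lemma double_lt_quadruple (m k : nat) : (m < k)%N -> (2 * m < 4 * k)%N.
by lia. Qed.

Lemma weighted_dist (s W e : R) (w1 w2 : B) : `|s| <= 1 -> 1 - s <= e -> `|w1| <= W -> `|w2| <= W ->
 `|((1 + s) / 2) *: w1 + ((1 - s) / 2) *: w2 - w1| <= e * W.
move=> s1 se h1 h2.
have -> : ((1 + s) / 2) *: w1 + ((1 - s) / 2) *: w2 - w1 = ((1 - s) / 2) *: (w2 - w1).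
 by lin w1 w2 (0 : B); field.
move: s1; rewrite ler_norml => /andP[_ s1].
rewrite normrZ ger0_norm; last by lra.
have h3 : `|w2 - w1| <= 2 * W by have := ler_normB w2 w1; lra.
apply: (@le_trans _ _ (e / 2 * (2 * W))); last by rewrite mulrA divfK.
by apply: ler_pM => //; lra.
Qed.

(** The set [E1] is copied into the cells where the square wave is near 1, and [E2] into those where
    it is near -1, so the measures are averaged. One [eps] pays for the cells near zeros of the
    cosine, the other for the lowered amplitudes. *)
Lemma attains_glue A x y b v1 v2 eps : 0 < eps ->
 attains A (x + y) (b + (d / 4 * `|y|) `^ q - eps) v1 ->
 attains A (x - y) (b + (d / 4 * `|y|) `^ q - eps) v2 -> attains A x b ((v1 + v2) / 2 - eps).
move=> eps0 [l1 [E1 [X1 [S1 [f1 n1 [mE1 E11] v1E pt1]]]]] [l2 [E2 [X2 [S2 [f2 n2 [mE2 E21] v2E pt2]]]]].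
pose S := maxn S1 S2; pose X := 1 + `|X1| + `|X2|.
have X0 : 0 < X by rewrite /X -addrA ltr_pwDl// addr_ge0.
have X1X : X1 <= X by rewrite /X; have := ler_norm X1; have := normr_ge0 X2; lra.
have X2X : X2 <= X by rewrite /X; have := ler_norm X2; have := normr_ge0 X1; lra.
have [P P0 hP] := profile_bounded c0 a0.
pose W := P * (total_norm l1 + total_norm l2) + d / 4 * `|y| + 1.
have dy0 : 0 <= d / 4 * `|y| by side.
have [s10 s20] := (total_norm_ge0 l1, total_norm_ge0 l2).
have Ps1 := mulr_ge0 (ltW P0) s10; have Ps2 := mulr_ge0 (ltW P0) s20.
have W0 : 0 < W by rewrite /W mulrDr; lra.
have hW1 a t : `|wave l1 a t| <= W.
 apply: (le_trans (@wave_norm_le _ _ _ _ _ _ _ P _)); last by rewrite /W mulrDr; lra.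
 by move=> z _; rewrite ger0_norm ?profile_ge0.
have hW2 a t : `|wave l2 a t| <= W.
 apply: (le_trans (@wave_norm_le _ _ _ _ _ _ _ P _)); last by rewrite /W mulrDr; lra.
 by move=> z _; rewrite ger0_norm ?profile_ge0.
have yW : d / 4 * `|y| <= W by rewrite /W mulrDr; lra.
pose Z := S.+1%:R * (q * W `^ (q - 1)).
have Z0 : 0 <= Z by rewrite !mulr_ge0 ?powR_ge0//; exact: le_trans q1.
(* Keeps the cost [Z * eta] of all lowered amplitudes below [eps]. *)
pose eta := eps / (Z + 1).
have eta0 : 0 < eta by rewrite divr_gt0// ltr_wpDl.
have hZ : S.+1%:R * (q * W `^ (q - 1) * eta) <= eps.
 rewrite mulrA -/Z /eta mulrCA -[leRHS]mulr1 ler_pM2l// ler_pdivrMr ?ltr_wpDl//; lra.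
have eta20 : 0 < eta / 2 by side.
pose e := eta / 2 / W; have e0 : 0 < e by rewrite divr_gt0.
have eW : e * W = eta / 2 by rewrite divfK// gt_eqF.
(* The proportion of cells left without sign is [1 / Q], at most [eps]. *)
pose Q := (Num.truncn eps^-1).+1.
have QR : 0 < Q%:R :> R by side.
have Qe : Q%:R^-1 <= eps.
 by rewrite -[leRHS]invrK lef_pV2 ?posrE ?invr_gt0// ltW// truncnS_gt.
pose g : R := cos (pi / 2 - pi / (4 * Q%:R)).
have g0 : 0 < g.
 have pi0 := @pi_gt0 R.
 have h1 : 0 < pi / (4 * Q%:R) :> R by side.
 have h2 : pi / (4 * Q%:R) <= pi / 4 :> R.
  by apply: ler_wpM2l; rewrite ?(ltW pi0)// lef_pV2 ?posrE ?mulr_gt0// ler_peMr// ler1n.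
 by apply: cos_gt0_pihalf; apply/andP; split; lra.
have [D [u [D0 u0 u2 s1 sw]]] := square_wave g0 e0.
have [C1 hC1] := glued_large c0 a0 D u y eta0 f1 f2.
have X20 : 0 < 2 * X by side.
have [C2 hC2] := glued_small c0 a0 y eta20 X20 f1 f2 s1.
(* Large enough for both thresholds on [M], for [2 * D < M], and for the margin of [K1] cells around
   the zeros to exceed the displacement [X]. *)
pose K1 := ((Num.truncn (`|C1| + `|C2| + 2 * X)).+1 + D.+1)%N.
have K10 : (0 < K1)%N by [].
have K1X : `|C1| + `|C2| + 2 * X < K1%:R.
 by apply: (lt_le_trans (truncnS_gt _)); rewrite ler_nat leq_addr.
pose K := (Q * K1)%N; pose M := (4 * K)%N.
have KK : (K1 <= K)%N by rewrite leq_pmull.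
have K0 : (0 < K)%N by side.
have M0 : (0 < M)%N by side.
have MR : 0 < M%:R :> R by side.
have KM : (K1 <= M)%N by apply: (leq_trans KK); rewrite leq_pmull.
have KMR : K1%:R <= M%:R :> R by rewrite ler_nat.
have DM : (2 * D < M)%N by apply: (leq_trans (double_lt_quadruple (_ : D < K1)%N)); rewrite ?leq_mul2l// ltn_addl.
have C1M : C1 <= M%:R by move: X0 K1X KMR (ler_norm C1) (normr_ge0 C2); keep_lra.
have C2M : C2 <= M%:R by move: X0 K1X KMR (ler_norm C2) (normr_ge0 C1); keep_lra.
have XK : 2 * X <= K1%:R by move: K1X (normr_ge0 C1) (normr_ge0 C2); keep_lra.
have XTM : 2 * X < T * M%:R.
 apply: (@lt_le_trans _ _ M%:R); last by rewrite ler_peMl// ltW.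
 by move: K1X KMR (normr_ge0 C1) (normr_ge0 C2); keep_lra.
pose sel i : set R := if cell_sign K K1 i is Some s then (if s then E1 else E2) else set0.
have mS i : measurable (sel i) by rewrite /sel; case: cell_sign => [[]|].
have sel1 i : sel i `<=` `[0, 1[%classic by rewrite /sel; case: cell_sign => [[]|].
pose E := \big[setU/set0]_(i < M) cell M i (sel i).
have inE a : E a -> exists2 i, (i < M)%N & cell M i (sel i) a.
 by rewrite /E -(bigcup_mkord M (fun i => cell M i (sel i))) => -[i /= iM h]; exists i.
exists (glued D u M y l1 l2), E, (T + X), S.+1; split.
- exact: (pos_freq_glued c0 a0).
- by move=> a; exact: glued_norm_le1.
- split; first by apply: bigsetU_measurable => i _; exact: meas_cell.
 move=> a /inE[i iM ia]; have /andP[h1 _] := cell_bounds M0 (@sel1 i) ia.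
 move: ia => /sel1; rewrite /= !in_itv /= => /andP[_ h2].
 apply/andP; split; first by apply: le_trans h1; rewrite divr_ge0.
 have : i.+1%:R <= M%:R :> R by rewrite ler_nat.
 by rewrite -natr1 -(ltr_pM2l MR) mulr1; move: h2; keep_lra.
- pose e1 := fine (mu E1); pose e2 := fine (mu E2).
 have fin (F : set R) : measurable F -> F `<=` `[0, 1[%classic -> mu F = (fine (mu F))%:E /\ 0 <= fine (mu F) <= 1.
  move=> mF F1; have h : (mu F <= 1)%E.
   have -> : 1%E = mu `[0%R, 1%R[%classic by rewrite lebesgue_measure_itv /= lte_fin ltr01 oppr0 adde0.
   by apply: le_measure => //; apply/mem_set => //; exact: measurable_itv.
  have ff : mu F \is a fin_num by rewrite ge0_fin_numE// (le_lt_trans h)// ltry.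
  by rewrite fineK//; split => //; rewrite fine_ge0//= -lee_fin fineK.
 have [m1 /andP[e10 e11]] := fin _ mE1 E11; have [m2 /andP[e20 e21]] := fin _ mE2 E21.
 rewrite -/e1 in m1 e10 e11; rewrite -/e2 in m2 e20 e21.
 move: v1E v2E; rewrite m1 m2 !lee_fin => v1e v2e.
 have -> : mu E = \sum_(i < M) mu (cell M i (sel i)).
  rewrite /E measure_bigsetU_ord//=; first by move=> i; exact: meas_cell.
  move=> i j _ _ [a [/sel1 /= ai /sel1 /= aj]]; apply/val_inj/eqP => /=.
  have h (k l : 'I_M) : M%:R * a - k%:R < 1 -> 0 <= M%:R * a - l%:R -> (l <= k)%N.
   by rewrite -ltnS -(ltr_nat R) -natr1; keep_lra.
  move: ai aj; rewrite !in_itv /= => /andP[? ?] /andP[? ?].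
  by rewrite eqn_leq !h.
 rewrite (eq_bigr (fun i : 'I_M => (M%:R^-1 * (if cell_sign K K1 i is Some s then (if s then e1 else e2) else 0))%:E)); last first.
  move=> i _; rewrite cell_measure// EFinM /sel; congr (_ * _)%E.
  by case: cell_sign => [[//|//]|]; exact: measure0.
 rewrite sumEFin -mulr_sumr sum_cell_sign// lee_fin.
 have -> : M%:R^-1 * (2 * (K - K1)%:R * (e1 + e2)) = (e1 + e2) / 2 - Q%:R^-1 * ((e1 + e2) / 2).
  by rewrite natrB// /M /K !natrM; field; rewrite !gt_eqF// ltr0n.
 have : Q%:R^-1 * ((e1 + e2) / 2) <= eps * 1.
  by apply: ler_pM => //; move: e10 e11 e20 e21; keep_lra.
 by move: v1e v2e; keep_lra.
move=> a /inE[i iM ia].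
have ab := cell_bounds M0 (@sel1 i) ia.
have a01 : 0 <= a <= 1.
 case/andP: ab => h1 h2; apply/andP; split; first by apply: le_trans h1; rewrite divr_ge0.
 by apply: (le_trans h2); rewrite ler_pdivrMr// mul1r ler_nat.
pose mix a' t := ((1 + oddcos D u a') / 2) *: wave l1 (M%:R * a') t +
 ((1 - oddcos D u a') / 2) *: wave l2 (M%:R * a') t.
have main l' ts h off : separated ts -> (size ts <= S)%N -> (forall s, s \in ts -> s <= X) ->
  detects l' ts h off (M%:R * a - i%:R) ->
  A < b + (d / 4 * `|y|) `^ q - eps + \sum_(s <- ts) h s `^ q ->
  (forall a' t, `|wave l' a' t| <= W) ->
  (forall a' t, `|a' - a| <= X / M%:R -> `|mix a' t - wave l' (M%:R * a') t| <= e * W) ->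
  exists ts' h' off', [/\ separated ts', (size ts' <= S.+1)%N, forall s, s \in ts' -> s <= T + X,
   detects (glued D u M y l1 l2) ts' h' off' a & A < b + \sum_(s <- ts') h' s `^ q].
 move=> sts hS hX hd hA hW' near; apply: (@glue_point D u M y _ l' ts h off a b A W eta X S i) => //.
 - exact: ltW.
 - by move=> a' t t1; exact: hC1.
 - move=> a' t ha' t0 tX; apply: (le_trans (ler_distD (mix a' t) _ _)).
  move: (near a' t ha') (hC2 M t a' C2M DM t0 tX); rewrite eW -/(mix a' t).
  by keep_lra.
 - by move: hZ hA; keep_lra.
have gap a' := @cell_sign_gap Q K1 i X a a' (ltn0Sn _) K10 XK iM ab.
rewrite /cell /= /sel in ia; case es : cell_sign ia => [[]|] //= ia.
- have [ts [h [off [sts hS hX hd hA]]]] := pt1 _ ia.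
 apply: (main l1 ts h off) => //; first by apply: (leq_trans hS); rewrite leq_maxl.
  by move=> s /hX h1; exact: le_trans X1X.
 by move=> a' t /gap[/(_ es)/(proj1 (sw a')) se _]; exact: weighted_dist.
- have [ts [h [off [sts hS hX hd hA]]]] := pt2 _ ia.
 apply: (main l2 ts h off) => //; first by apply: (leq_trans hS); rewrite leq_maxr.
  by move=> s /hX h1; exact: le_trans X2X.
 move=> a' t /gap[_ /(_ es)/(proj2 (sw a')) se].
 have := @weighted_dist (- oddcos D u a') W e (wave l2 (M%:R * a') t) (wave l1 (M%:R * a') t).
 rewrite normrN opprK [X in `|X - _|]addrC => h'; apply: h' => //.
 by rewrite addrC.
Qed.

(** Once [b] exceeds [A] nothing more has to be detected, and the constant polynomial serves on the
    whole period. This is the stopping rule of [reach_attains]. *)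
Lemma attains_one A x b : `|x| <= 1 -> A < b -> attains A x b 1.
move=> x1 Ab; exists [::], `[0, 1[%classic, 0, 0%N; split => //.
- by move=> a; rewrite /tpoly big_nil addr0.
- by split; [exact: measurable_itv|].
- by rewrite lebesgue_measure_itv /= lte_fin ltr01 oppr0 adde0.
- by move=> a _; exists [::], (fun=> 0), (fun=> 0); split => //; rewrite big_nil addr0.
Qed.

Lemma attains_zero A x b : `|x| <= 1 -> attains A x b 0.
move=> x1; exists [::], set0, 0, 0%N; split => //; first by move=> a; rewrite /tpoly big_nil addr0.
by split; [exact: measurable0|move=> a].
Qed.

End gluing.

(** * Values of iterated gluings *)

Section reachable.
Context (R : realType) (B : completeNormedModType R) (q w : R).
Hypotheses (q1 : 1 <= q) (w0 : 0 < w).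

(* Lower bounds for the square function of nonconstant polynomials [f] with [|x + f| <= 1], built by [j] gluings. *)
Inductive reach : nat -> B -> R -> Prop :=
| reach0 x : `|x| <= 1 -> reach 0 x 0
| reachS j x y v1 v2 : reach j (x + y) v1 -> reach j (x - y) v2 ->
  reach j.+1 x ((w * `|y|) `^ q + (v1 + v2) / 2).

Lemma norm_mid_le (x y : B) : `|x| <= (`|x + y| + `|x - y|) / 2.
have := ler_normD (x + y) (x - y); rewrite addrACA subrr addr0 -mulr2n normrMn -mulr_natr.
by lra.
Qed.

Lemma norm_half_diff_le (x y : B) : `|y| <= (`|x + y| + `|x - y|) / 2.
by rewrite (distrC x y) (addrC x y); exact: norm_mid_le. Qed.

Lemma reach_le1 j x v : reach j x v -> `|x| <= 1.
by elim=> // {}j {}x y v1 v2 _ h1 _ h2; have := norm_mid_le x y; lra. Qed.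

Lemma gain_le j x y v1 v2 : reach j (x + y) v1 -> reach j (x - y) v2 -> (w * `|y|) `^ q <= w `^ q.
move=> /reach_le1 h1 /reach_le1 h2; apply: ge0_ler_powR; rewrite ?nnegrE ?mulr_ge0 ?(ltW w0)//.
 side.
by rewrite -[leRHS]mulr1 ler_pM2l//; have := norm_half_diff_le x y; lra.
Qed.

(** Gluing along [y = 0] gains nothing, so values of different depths can be brought to a common
    depth. *)
Lemma reach_pad k j x v : reach j x v -> reach (k + j) x v.
move=> h; elim: k => // k ih; rewrite addSn.
have q0 : q != 0 by rewrite gt_eqF// (lt_le_trans ltr01).
have -> : v = (w * `|0 : B|) `^ q + (v + v) / 2.
 by rewrite normr0 mulr0 powR0// add0r; field.
by apply: reachS; rewrite ?addr0 ?subr0.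
Qed.

Lemma reach_opp j x v : reach j x v -> reach j (- x) v.
elim=> [{}x x1|{}j {}x y v1 v2 _ h1 _ h2]; first by apply: reach0; rewrite normrN.
rewrite [v1 + v2]addrC; apply: reachS; last by rewrite -opprD.
by rewrite addrC -opprB.
Qed.

Lemma reach_sup (K : R) : (forall j x v, reach j x v -> v <= K) ->
 exists V : B -> R, [/\ forall x, `|x| <= 1 -> 0 <= V x <= K, forall x, V (- x) = V x &
  forall x y, `|x + y| <= 1 -> `|x - y| <= 1 ->
   (w * `|y|) `^ q + (V (x + y) + V (x - y)) / 2 <= V x].
move=> hK; pose S x := [set v : R | exists j, reach j x v].
have ub x : has_ubound (S x) by exists K => v [j /hK].
have ge x j v : reach j x v -> v <= sup (S x) by move=> h; apply: ub_le_sup => //; exists j.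
have sup_le x M : `|x| <= 1 -> (forall j v, reach j x v -> v <= M) -> sup (S x) <= M.
 move=> x1 h; apply: ge_sup; first by exists 0, 0%N; exact: reach0.
 by move=> v [j /h].
exists (fun x => sup (S x)); split.
- by move=> x x1; rewrite (ge x 0%N) ?sup_le//; [move=> j v /hK|exact: reach0].
- move=> x; congr sup; apply/seteqP; split => v [j h]; exists j; last exact: reach_opp.
 by rewrite -[x]opprK; exact: reach_opp.
move=> x y h1 h2; set V := sup (S x).
have k1 j v1 : reach j (x + y) v1 -> forall i v2, reach i (x - y) v2 ->
  v2 <= 2 * (V - (w * `|y|) `^ q) - v1.
 move=> r1 i v2 r2.
 have := ge x _ _ (reachS (reach_pad i r1) (eq_ind _ (fun m => reach m _ _) (reach_pad j r2) _ (addnC j i))).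
 by rewrite -/V; lra.
have k2 : sup (S (x - y)) <= 2 * (V - (w * `|y|) `^ q) - sup (S (x + y)).
 suff : sup (S (x + y)) <= 2 * (V - (w * `|y|) `^ q) - sup (S (x - y)) by lra.
 apply: (sup_le _ _ h1) => j v1 r1.
 suff : sup (S (x - y)) <= 2 * (V - (w * `|y|) `^ q) - v1 by lra.
 by apply: (sup_le _ _ h2) => i v2; exact: (k1 j).
by lra.
Qed.

End reachable.

(** * Uniform bound on the gains by a stopping argument *)

Section reach_bound.
Context (R : realType) (B : completeNormedModType R) (c alpha q p T d : R).
Hypotheses (c0 : 0 < c) (a0 : 0 < alpha) (q1 : 1 <= q) (p0 : 0 < p) (T1 : 1 <= T) (d0 : 0 < d).
Hypothesis hT : forall t, T <= t <= 2 * T -> d <= profile c alpha t /\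
 forall k : nat, (2 <= k)%N -> profile c alpha (k%:R * t) <= 8^-1 ^+ k * profile c alpha t.
Hypothesis cE : forall a : R, 0 < a -> gauss_cos a = expR (- (c * a ^+ 2)).
Local Notation attains := (@attains R B c alpha q T).
Local Notation reach := (@reach R B q (d / 4)).

(** The gluings form a binary tree, and [v] is the mean of the gains along its branches. A branch is
    stopped once the collected gain [b] exceeds [A]. Before stopping it collects at most [A - b]
    plus one overshoot of [(d / 4) ^ q]; afterwards at most [K] on average, on stopped branches of
    total weight [u]. The terms in [eps] pay for the imperfect gluings. *)
Lemma reach_attains (A K eps : R) N : 0 < eps -> 0 <= K ->
 (forall j x v, (j <= N)%N -> reach j x v -> v <= K) ->
 forall j x v, reach j x v -> (j <= N)%N -> forall b, exists2 u, attains A x b u &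
  v <= Num.max (A + (d / 4) `^ q - b) 0 + j%:R * eps + K * (u + j%:R * eps).
move=> e0 K0 hK j x v; elim=> [{}x x1 _ b|{}j {}x y v1 v2 r1 ih1 r2 ih2 jN b].
 by exists 0; [exact: attains_zero|rewrite !mul0r !addr0 mulr0 addr0 le_max lexx orbT].
have r := reachS r1 r2; set gn := _ `^ q in r *.
have gn1 : gn <= (d / 4) `^ q by exact: (gain_le q1 (divr_gt0 d0 (ltr0Sn R 3)) r1 r2).
have m0 : 0 <= j.+1%:R * eps by side.
have [Ab|bA] := ltP A b.
 exists 1; first by apply: attains_one => //; exact: reach_le1 r.
 have vK := hK _ _ _ jN r.
 have : 0 <= Num.max (A + (d / 4) `^ q - b) 0 by rewrite le_max lexx orbT.
 by have := mulr_ge0 K0 m0; lra.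
have [u1 a1 h1] := ih1 (ltnW jN) (b + gn - eps).
have [u2 a2 h2] := ih2 (ltnW jN) (b + gn - eps).
exists ((u1 + u2) / 2 - eps); first exact: (attains_glue c0 a0 q1 T1 d0 hT e0 a1 a2).
have mx : Num.max (A + (d / 4) `^ q - (b + gn - eps)) 0 = A + (d / 4) `^ q - b - gn + eps.
 by rewrite max_l; lra.
rewrite mx in h1 h2; rewrite max_l; last by have := powR_ge0 (d / 4) q; lra.
by rewrite -[j.+1%:R]natr1; lra.
Qed.

(** With [u <= 1/4], a bound [K] up to a given depth improves to [L + K / 4]. No bound is known a
    priori for all depths, hence the induction: one more gluing raises [2 * L] by at most
    [(d / 4) ^ q <= L], and the improvement brings it back below [2 * L]. *)
Lemma reach_bounded (n : nat) (C : R) : 0 < C -> area_bounded B alpha n q p C ->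
 exists2 K : R, 0 < K & forall j x v, reach j x v -> v <= K.
move=> C0 hC; have T0 : 0 < T by exact: lt_le_trans T1.
have q0 : 0 < q by side.
have k0 : 0 < (16 * T)^-1 by side.
have k1 : (16 * T)^-1 <= 2^-1 by rewrite lef_pV2 ?posrE ?mulr_gt0//; have := T1; lra.
have [C' C'0 hC'] := area_wave c0 a0 cE k0 k1 q0 p0 C0 hC.
(* The threshold for which [area_wave] leaves a set of measure at most [1/4]. *)
pose A := (4 * C') `^ (q / p).
have A0 : 0 < A by rewrite powR_gt0// mulr_gt0.
have Ap : A `^ (p / q) = 4 * C'.
 rewrite -powRrM (_ : q / p * (p / q) = 1); last by field; rewrite !gt_eqF.
 by rewrite powRr1// mulr_ge0// ltW.
have small x u : attains A x 0 u -> u <= 4^-1.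
 move=> [l [E [X [S [f n1 [mE E1] uE pt]]]]].
 have pt' a : E a -> exists ts h o, [/\ separated ts, (size ts <= S)%N, forall s, s \in ts -> s <= X,
   detects c alpha (16 * T)^-1 l ts h o a & A < \sum_(s <- ts) h s `^ q].
  by move=> /pt[ts [h [off [? ? ? ? hA]]]]; exists ts, h, off; split => //; rewrite add0r in hA.
 have := hC' x l X S A E f n1 A0 mE E1 pt'; rewrite Ap => h.
 have : (((4 * C') * u)%:E <= C'%:E)%E.
  by rewrite EFinM; apply: le_trans h; apply: lee_wpmul2l => //; rewrite lee_fin mulr_ge0// ltW.
 rewrite lee_fin => h'; rewrite -(ler_pM2l (mulr_gt0 (ltr0Sn R 3) C'0)).
 by rewrite (_ : 4 * C' * 4^-1 = C')//; field.
pose g := (d / 4) `^ q; have g0 : 0 <= g by exact: powR_ge0.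
pose L := A + g + 1; exists (2 * L); first by rewrite /L; lra.
have main N : forall j x v, (j <= N)%N -> reach j x v -> v <= 2 * L.
 have improve m (K : R) : 0 <= K -> (forall j x v, (j <= m)%N -> reach j x v -> v <= K) ->
   forall j x v, (j <= m)%N -> reach j x v -> v <= L + K / 4.
  move=> K0 hK j x v jm r; pose eps := ((m%:R + 1) * (1 + K))^-1.
  have m0 : 0 <= m%:R :> R by [].
  have e0 : 0 < eps by rewrite invr_gt0 mulr_gt0//; lra.
  have [u au hv] := reach_attains A e0 K0 hK r jm 0.
  have u4 := small _ _ au.
  rewrite subr0 max_l in hv; last side.
  have je : j%:R * eps * (1 + K) <= 1.
   apply: (@le_trans _ _ ((m%:R + 1) * eps * (1 + K))).
    by rewrite ler_wpM2r ?addr_ge0// ler_wpM2r ?(ltW e0)// ler_wpDr// ler_nat.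
   by rewrite mulrAC divff// mulf_neq0// gt_eqF//; lra.
  have := ler_wpM2l K0 u4; rewrite -/g in hv; rewrite /L; lra.
 elim: N => [|N ih].
  by move=> j x v; rewrite leqn0 => /eqP -> r; inversion r; rewrite /L; lra.
 have step j x v : (j <= N.+1)%N -> reach j x v -> v <= g + 2 * L.
  move=> jN r; inversion r as [? ? | j' x' y v1 v2 r1 r2]; subst; first by rewrite /L; lra.
  have := gain_le q1 (divr_gt0 d0 (ltr0Sn R 3)) r1 r2; rewrite -/g.
  by have := ih _ _ _ jN r1; have := ih _ _ _ jN r2; lra.
 have gL : 0 <= g + 2 * L by rewrite /L; lra.
 by move=> j x v jN r; have := improve N.+1 _ gL step j x v jN r; rewrite /L; lra.
by move=> j x v; exact: (main j).
Qed.

End reach_bound.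

(** * The equivalent norm as a gauge *)

Section renorming.
Context (R : realType) (B : completeNormedModType R) (q w K : R) (V : B -> R).
Hypotheses (q1 : 1 <= q) (w0 : 0 < w) (K0 : 0 < K).
Hypothesis V_bound : forall x, `|x| <= 1 -> 0 <= V x <= K.
Hypothesis V_even : forall x, V (- x) = V x.
Hypothesis V_mid : forall x y, `|x + y| <= 1 -> `|x - y| <= 1 ->
 (w * `|y|) `^ q + (V (x + y) + V (x - y)) / 2 <= V x.

(** The term [4 * K * |x|], convex, dominates the bounded [V], so sublevel sets of [Psi] are
    comparable with balls; [V] brings the gain at midpoints. The constant [V 0] makes [Psi] vanish
    at 0, and evenness of [V] gives [V x <= V 0] on the unit ball. *)
Let Psi (x : B) := 4 * K * `|x| + V 0 - V x.
Let ball1 (x : B) := `|x| <= 1.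

Lemma Psi_mid x y : ball1 (x + y) -> ball1 (x - y) ->
 Psi x <= (Psi (x + y) + Psi (x - y)) / 2 - (w * `|y|) `^ q.
move=> h1 h2; have := V_mid h1 h2; have := ler_wpM2l (ltW K0) (norm_mid_le x y); rewrite /Psi; lra.
Qed.

Lemma Psi_ge x : ball1 x -> 4 * K * `|x| <= Psi x.
move=> x1; have := @V_mid 0 x; rewrite add0r sub0r V_even normrN => /(_ x1 x1).
by have := powR_ge0 (w * `|x|) q; rewrite /Psi; lra.
Qed.

Lemma Psi_le x : ball1 x -> Psi x <= 4 * K * `|x| + K.
move=> x1; have /andP[v0 _] := V_bound x1.
have z1 : ball1 0 by rewrite /ball1 normr0.
by have /andP[_ vK] := V_bound z1; rewrite /Psi; lra.
Qed.

Lemma PsiN x : Psi (- x) = Psi x. Proof. by rewrite /Psi normrN V_even. Qed.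

Lemma ball1_convex (a b : B) t : 0 <= t <= 1 -> ball1 a -> ball1 b -> ball1 (t *: a + (1 - t) *: b).
move=> /andP[t0 t1] ha hb; apply: (le_trans (ler_normD _ _)).
rewrite (normrZ t a) (normrZ (1 - t) b) (ger0_norm t0) ger0_norm ?subr_ge0//.
have t1' : 0 <= 1 - t by side.
by have := lerD (ler_wpM2l t0 ha) (ler_wpM2l t1' hb); lra.
Qed.

(* Bounded midpoint convex functions are convex: halving the bound on the excess over the chord. *)
Lemma Psi_convex (a b : B) t : 0 <= t <= 1 -> ball1 a -> ball1 b ->
 Psi (t *: a + (1 - t) *: b) <= t * Psi a + (1 - t) * Psi b.
move=> t01 ha hb.
pose G s := Psi (s *: a + (1 - s) *: b) - (s * Psi a + (1 - s) * Psi b).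
have G0 : G 0 = 0 by rewrite /G scale0r add0r subr0 scale1r; ring.
have G1 : G 1 = 0 by rewrite /G subrr scale0r addr0 scale1r; ring.
have mid r s : 0 <= r <= 1 -> 0 <= s <= 1 -> G ((r + s) / 2) <= (G r + G s) / 2.
 move=> r01 s01; pose y := ((r - s) / 2) *: (a - b).
 have e1 : ((r + s) / 2) *: a + (1 - (r + s) / 2) *: b + y = r *: a + (1 - r) *: b.
  by rewrite /y; lin a b (0 : B); field.
 have e2 : ((r + s) / 2) *: a + (1 - (r + s) / 2) *: b - y = s *: a + (1 - s) *: b.
  by rewrite /y; lin a b (0 : B); field.
 have := @Psi_mid (((r + s) / 2) *: a + (1 - (r + s) / 2) *: b) y.
 rewrite e1 e2 => /(_ (ball1_convex r01 ha hb) (ball1_convex s01 ha hb)).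
 by have := powR_ge0 (w * `|y|) q; rewrite /G; lra.
have bound n : forall s, 0 <= s <= 1 -> G s <= 5 * K * 2^-1 ^+ n.
 elim: n => [|n ih] s /andP[s0 s1].
  have s01 : 0 <= s <= 1 by rewrite s0.
  have := Psi_le (ball1_convex s01 ha hb); have := ler_wpM2l (ltW K0) (ball1_convex s01 ha hb).
  have pa := le_trans (mulr_ge0 (mulr_ge0 (ler0n _ 4) (ltW K0)) (normr_ge0 a)) (Psi_ge ha).
  have pb := le_trans (mulr_ge0 (mulr_ge0 (ler0n _ 4) (ltW K0)) (normr_ge0 b)) (Psi_ge hb).
  have s1' : 0 <= 1 - s by side.
  have := mulr_ge0 s0 pa; have := mulr_ge0 s1' pb.
  by rewrite expr0 /G; lra.
 have [h|h] := leP s 2^-1.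
  have i0 : 0 <= (0 : R) <= 1 by side.
  have i2 : 0 <= 2 * s <= 1 by apply/andP; split; lra.
  have := mid _ _ i0 i2; rewrite (_ : (0 + 2 * s) / 2 = s) ?G0; last by field.
  by have := ih _ i2; rewrite exprS; lra.
 have i1 : 0 <= (1 : R) <= 1 by side.
 have i2 : 0 <= 2 * s - 1 <= 1 by apply/andP; split; lra.
 have := mid _ _ i2 i1; rewrite (_ : (2 * s - 1 + 1) / 2 = s) ?G1; last by field.
 by have := ih _ i2; rewrite exprS; lra.
rewrite -subr_le0 -/(G t).
have cv : 5 * K * 2^-1 ^+ n @[n --> \oo] --> (5 * K * 0 : R).
 by apply: cvgM; [exact: cvg_cst|apply: cvg_expr; rewrite ger0_norm ?invr_ge0// invf_lt1// ltr1n].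
rewrite mulr0 in cv; rewrite -(cvg_lim _ cv)//; apply: limr_ge; first exact: cvgP cv.
by near=> n; exact: bound.
Unshelve. all: by end_near. Qed.

(** At the level [2 * K] this set contains the ball of radius [1/4] and is contained in that of
    radius [1/2], so that doubles of its points remain in the unit ball, where [V] is controlled. *)
Let body := [set z : B | ball1 z /\ Psi z <= 2 * K].

Let body_half z : body z -> `|z| <= 2^-1.
move=> [z1 /(le_trans (Psi_ge z1))].
rewrite (_ : 2 * K = 4 * K * 2^-1); last by field.
by rewrite ler_pM2l// mulr_gt0.
Qed.

Let body_quarter z : `|z| <= 4^-1 -> body z.
move=> hz; have z1 : ball1 z by rewrite /ball1; lra.
split => //; apply: (le_trans (Psi_le z1)).
by have := ler_wpM2l (ltW K0) hz; lra.
Qed.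

Let body_convex (a b : B) t : 0 <= t <= 1 -> body a -> body b -> body (t *: a + (1 - t) *: b).
move=> t01 [a1 ha] [b1 hb]; split; first exact: ball1_convex.
apply: (le_trans (Psi_convex t01 a1 b1)); case/andP: t01 => t0 t1.
have t1' : 0 <= 1 - t by side.
by have := lerD (ler_wpM2l t0 ha) (ler_wpM2l t1' hb); lra.
Qed.

Let body0 : body 0. Proof. by apply: body_quarter; rewrite normr0 invr_ge0. Qed.

Let radii x := [set r : R | 0 < r /\ body (r^-1 *: x)].

Definition gauge (x : B) : R := inf (radii x).

Let radii_lb x : has_lbound (radii x).
by exists 0 => r [/ltW]. Qed.

Let radii_big x r : 0 < r -> 4 * `|x| <= r -> radii x r.
move=> r0 h; split => //; apply: body_quarter.
by rewrite normrZ normfV (gtr0_norm r0) mulrC ler_pdivrMr//; lra.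
Qed.

Let radii_neq0 x : radii x !=set0.
by exists (4 * `|x| + 1); apply: radii_big; have := normr_ge0 x; lra. Qed.

Let gauge_le x r : radii x r -> gauge x <= r.
by move=> h; apply: ge_inf. Qed.

Let gauge_lt x r : gauge x < r -> radii x r.
move=> /(inf_lt (radii_neq0 x))[s [s0 hs] sr].
have r0 := lt_trans s0 sr; split => //.
have -> : r^-1 *: x = (s / r) *: (s^-1 *: x) + (1 - s / r) *: 0.
 by rewrite scaler0 addr0 scalerA mulrAC divff ?gt_eqF// mul1r.
apply: body_convex => //; apply/andP; split; first side.
by rewrite ler_pdivrMr// mul1r ltW.
Qed.

Let gauge_ge x : 2 * `|x| <= gauge x.
apply: lb_le_inf => // r [r0 /body_half].
by rewrite normrZ normfV (gtr0_norm r0) mulrC ler_pdivrMr//; lra.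
Qed.

Let gauge_le4 x : gauge x <= 4 * `|x|.
apply/ler_addgt0Pr => e e0; apply: gauge_le; apply: radii_big; last by lra.
by side.
Qed.

Let gauge_triangle x y : gauge (x + y) <= gauge x + gauge y.
apply/ler_addgt0Pr => e e0.
have [|r0 hr] := @gauge_lt x (gauge x + e / 2); first by lra.
have [|s0 hs] := @gauge_lt y (gauge y + e / 2); first by lra.
set r := gauge x + _ in r0 hr *; set s := gauge y + _ in s0 hs *.
have -> : gauge x + gauge y + e = r + s by rewrite /r /s; lra.
apply: gauge_le; split; first side.
have rs : r + s != 0 by side.
have -> : (r + s)^-1 *: (x + y) = (r / (r + s)) *: (r^-1 *: x) + (1 - r / (r + s)) *: (s^-1 *: y).
 by lin x y (0 : B); field; rewrite rs ?gt_eqF.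
apply: body_convex => //; apply/andP; split.
 by side.
by rewrite (ler_pdivrMr _ _ (addr_gt0 r0 s0)) mul1r lerDl ltW.
Qed.

Let gauge_pos_scale (t : R) x : 0 < t -> gauge (t *: x) <= t * gauge x.
move=> t0; apply/ler_addgt0Pr => e e0.
have [|r0 hr] := @gauge_lt x (gauge x + e / t); first by rewrite ltrDl divr_gt0.
have -> : t * gauge x + e = t * (gauge x + e / t) by field; rewrite gt_eqF.
set z := gauge x + e / t in r0 hr *; apply: gauge_le; split; first side.
by rewrite scalerA (_ : (t * z)^-1 * t = z^-1)//; field; rewrite !gt_eqF.
Qed.

Let gaugeN x : gauge (- x) = gauge x.
congr inf; apply/seteqP; split=> r [r0 [h1 h2]]; split => //; split.
- by move: h1; rewrite scalerN /ball1 normrN.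
- by move: h2; rewrite scalerN PsiN.
- by rewrite scalerN /ball1 normrN.
- by rewrite scalerN PsiN.
Qed.

Lemma gauge_is_norm : is_norm gauge.
split; first side.
- have pos (t : R) x : 0 < t -> gauge (t *: x) = t * gauge x.
  move=> t0; apply/eqP; rewrite eq_le gauge_pos_scale//=.
  have t0' : 0 < t^-1 by side.
  have := gauge_pos_scale (t *: x) t0'; rewrite scalerA mulVf ?gt_eqF// scale1r.
  by rewrite mulrC ler_pdivlMr// mulrC.
 move=> t x; have [t0|t0|->] := ltrgt0P t; first exact: pos.
  have -> : t *: x = - ((- t) *: x) by rewrite scaleNr opprK.
  by rewrite gaugeN pos// oppr_gt0.
 rewrite scale0r mul0r; apply/eqP; rewrite eq_le.
 by have := gauge_le4 0; have := gauge_ge 0; rewrite !normr0 !mulr0 => -> ->.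
- move=> x x0; apply/eqP; rewrite -normr_le0.
 by have := gauge_ge x; rewrite x0; lra.
Qed.

Lemma gauge_equivalent : equivalent_norms (fun x : B => `|x|) gauge.
by exists 2, 4; split => // x; rewrite gauge_ge gauge_le4. Qed.

(** The midpoint [m] of [a / r] and [b / r] has [Psi m <= 2 * K - eta]. By convexity
    [(1 + tau) * m], which lies between [m] and [2 * m], is still in the body, since
    [Psi (2 * m) <= 5 * K]; hence the gauge of the midpoint of [a] and [b] is at most
    [r / (1 + tau)]. Taking [r > 1] avoids asking whether the body is closed. *)
Lemma gauge_uniformly_convex : uniformly_convex q gauge.
have q0 : 0 <= q by side.
pose C := (w / 16) `^ q / (10 * K).
have C0 : 0 < C by rewrite divr_gt0 ?powR_gt0 ?divr_gt0 ?mulr_gt0.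
exists C => // e /andP[e0 e2]; apply: le_ereal_inf_tmp => _ [[a b] /= [na nb nab] <-].
(* The half-difference [h] of [a / r] and [b / r] has norm at least [e / 16]: a factor [1/4] from
   [r <= 2], and [1/4] from comparing the gauge with the norm. With [tau = eta / (5 * K)] the
   increase towards [2 * m] is at most the gain [eta]. *)
rewrite lee_fin; pose eta := (w / 16 * e) `^ q; pose tau := eta / (5 * K).
have K5 : 0 < 5 * K by side.
have eta0 : 0 < eta by rewrite powR_gt0// mulr_gt0// divr_gt0.
have tau0 : 0 < tau by rewrite divr_gt0.
have -> : C * e `^ q = tau / 2.
 by rewrite /tau /eta powRM ?(ltW e0) ?(ltW (divr_gt0 w0 _))// /C; field; rewrite gt_eqF.
have abe : e / 4 <= `|a - b| by have := gauge_le4 (a - b); rewrite nab; lra.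
have key r : 1 < r -> r <= 2 -> tau <= 1 /\ gauge (2^-1 *: (a + b)) <= r / (1 + tau).
 move=> r1 r2; have r0 : 0 < r by exact: lt_trans r1.
 have [_ [ha1 ha2]] : radii a r by apply: gauge_lt; rewrite na.
 have [_ [hb1 hb2]] : radii b r by apply: gauge_lt; rewrite nb.
 pose m := (2 * r)^-1 *: (a + b); pose h := (2 * r)^-1 *: (a - b).
 have e1 : m + h = r^-1 *: a by rewrite /m /h; lin a b (0 : B); field; rewrite gt_eqF.
 have e3 : m - h = r^-1 *: b by rewrite /m /h; lin a b (0 : B); field; rewrite gt_eqF.
 have pm : Psi m <= 2 * K - eta.
  have := @Psi_mid m h; rewrite e1 e3 => /(_ ha1 hb1).
  suff : eta <= (w * `|h|) `^ q by lra.
  apply: ge0_ler_powR; rewrite ?nnegrE ?mulr_ge0 ?(ltW w0) ?(ltW e0)//.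
  rewrite -mulrA ler_pM2l// /h normrZ normfV (gtr0_norm (mulr_gt0 _ r0))//.
  apply: (@le_trans _ _ (4^-1 * (e / 4))); first by lra.
  by apply: ler_pM; rewrite ?divr_ge0 ?(ltW e0)// lef_pV2 ?posrE ?mulr_gt0//; lra.
 have m1 : ball1 m.
  rewrite /m (_ : _ *: _ = 2^-1 *: (r^-1 *: a) + (1 - 2^-1) *: (r^-1 *: b)); last first.
   by lin a b (0 : B); field; rewrite gt_eqF.
  by apply: ball1_convex => //; apply/andP; split; lra.
 have p0 : 0 <= Psi m by apply: le_trans (Psi_ge m1); rewrite !mulr_ge0// ltW.
 have tau1 : tau <= 1 by rewrite /tau ler_pdivrMr//; lra.
 have m2 : body m by split => //; lra.
 have mm : `|2 *: m| <= 1 by rewrite normrZ ger0_norm//; have := body_half m2; lra.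
 have p2 : Psi (2 *: m) <= 5 * K.
  by apply: (le_trans (Psi_le mm)); have := ler_wpM2l (ltW K0) mm; lra.
 split => //; apply: gauge_le; split; first side.
 have -> : (r / (1 + tau))^-1 *: (2^-1 *: (a + b)) = tau *: (2 *: m) + (1 - tau) *: m.
  by rewrite /m; lin a b (0 : B); field; rewrite !gt_eqF// ltr_wpDl.
 have t01 : 0 <= tau <= 1 by rewrite ltW.
 split; first exact: ball1_convex.
 apply: (le_trans (Psi_convex t01 mm m1)).
 have k1 := ler_wpM2l (ltW tau0) p2.
 have t1' : 0 <= 1 - tau by side.
 have k2 := ler_wpM2l t1' pm.
 have k3 : tau * (5 * K) = eta by rewrite /tau divfK// gt_eqF.
 have k4 : 0 <= tau * (2 * K - eta) by rewrite mulr_ge0 ?(ltW tau0)//; lra.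
 by lra.
have [tau1 _] := key 2 (ltr1n _ _) (lexx _).
have : gauge (2^-1 *: (a + b)) <= (1 + tau)^-1.
 apply/ler_addgt0Pr => d d0.
 have d1 : 0 < Num.min d 1 by rewrite lt_min d0 ltr01.
 have [||_ h] := key (1 + Num.min d 1); first by rewrite ltrDl.
  by rewrite (_ : 2 = 1 + 1)// lerD2l ge_min lexx orbT.
 apply: (le_trans h); rewrite mulrDl mul1r lerD2l.
 apply: (@le_trans _ _ (Num.min d 1)); last by rewrite ge_min lexx.
 by rewrite ler_pdivrMr ?ltr_wpDl// ler_peMr ?(ltW d1)// lerDl ltW.
suff : (1 + tau)^-1 <= 1 - tau / 2 by lra.
rewrite -[leLHS]mul1r ler_pdivrMr ?ltr_wpDl//; nra.
Qed.

End renorming.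

Theorem theorem1p6 (R : realType) (B : completeNormedModType R) (n : nat)
    (q p alpha : R) (n_gt0 : (0 < n)%N) (q_ge2 : 2 <= q) (p_gt1 : 1 < p)
    (alpha_gt0 : 0 < alpha) :
  (exists N : B -> R,
     [/\ is_norm N, equivalent_norms (fun b : B => `|b|) N &
         uniformly_convex q N])
  <->
  (exists2 C : R, 0 < C &
     forall f : Rn R n -> B, bochner_Lp p f ->
       ('N[lebesgue_Rn R n]_p%:E [area_integral q alpha f]
          <= C%:E * bochner_norm p f)%E).
Proof.
split=> [[N [isn eqn uc]]|[C C0 hC]]; first exact: uniformly_convex_area eqn uc.
(* The test functions oscillate along the first coordinate, so the dimension is written as a
   successor. *)
case: n n_gt0 hC => // n _ hC.
have [c c0 cE] := gauss_cosE R.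
have [T T1 [d d0 hT]] := profile_dominates c0 alpha_gt0.
have q1 : 1 <= q by lra.
have p0 : 0 < p by exact: lt_trans p_gt1.
have [K K0 hK] := reach_bounded c0 alpha_gt0 q1 p0 T1 d0 hT cE C0 hC.
have w0 : 0 < d / 4 by rewrite divr_gt0.
have [V [V1 V2 V3]] := reach_sup q1 hK.
exists (gauge K V); split.
- exact: (gauge_is_norm K0 V1 V2 V3).
- exact: (gauge_equivalent K0 V1 V2 V3).
- exact: (gauge_uniformly_convex q1 w0 K0 V1 V2 V3).
Qed.
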